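(* Let $q \geq 3$ be an integer and let $\chi$ be a real (i.e. real-valued), non-principal Dirichlet character modulo $q$, with Dirichlet $L$-function $L(s,\chi)=\sum_{n\ge1}\chi(n)n^{-s}$ (analytically continued). If $\beta_1$ and $\beta_2$ are two real zeros of $L(s,\chi)$, counted with multiplicity (that is, either $\beta_1 \neq \beta_2$, or $\beta_1 = \beta_2$ is a zero of multiplicity at least $2$), then $$\min(\beta_1,\beta_2) \leq 1 - \frac{1.011}{\log q}.$$ Equivalently, $L(s,\chi)$ has at most one real zero $\beta$, counted with multiplicity, with $1 - 1.011/\log q < \beta < 1$.
   Context: $\log$ denotes the natural logarithm. *)

(* Defs.v *)
(* Stdlib reals with Coquelicot's complex numbers and series. *)
From Stdlib Require Import Reals ZArith.
From Coquelicot Require Import Coquelicot.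

Open Scope R_scope.

Record dirichlet_character (q : Z) (chi : Z -> C) : Prop := {
  dc_periodic : forall n : Z, chi (n + q)%Z = chi n;
  dc_mult : forall m n : Z, chi (m * n)%Z = (chi m * chi n)%C;
  dc_support : forall n : Z, chi n <> RtoC 0 <-> Z.gcd n q = 1%Z
}.

Definition principal (q : Z) (chi : Z -> C) : Prop :=
  forall n : Z, Z.gcd n q = 1%Z -> chi n = RtoC 1.

Definition real_valued (chi : Z -> C) : Prop := forall n : Z, Im (chi n) = 0.

Definition Cexp (z : C) : C := (exp (Re z) * cos (Im z), exp (Re z) * sin (Im z)).

(* [n ^ s] for an integer [n >= 1], with the real logarithm of [n]. *)
Definition nat_Cpower (n : nat) (s : C) : C := Cexp (s * RtoC (ln (INR n)))%C.

(* Coquelicot indexes series from 0: term [k] is the term [n = k + 1] of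
   [sum_(n >= 1) chi(n) n^(-s)]. *)
Definition dirichlet_series (chi : Z -> C) (s l : C) : Prop :=
  @is_series C_AbsRing C_NormedModule
    (fun k : nat => (chi (Z.of_nat (S k)) * nat_Cpower (S k) (- s))%C) l.

Definition power_series_at (f : C -> C) (z0 : C) (a : nat -> C) : Prop :=
  @locally C_UniformSpace z0
    (fun z : C => @is_pseries C_AbsRing C_NormedModule a (z - z0)%C (f z)).

Definition entire (f : C -> C) : Prop :=
  forall z0 : C, exists a : nat -> C, power_series_at f z0 a.

(* For a non-principal [chi] the series converges absolutely for [Re s > 1] and
   continues analytically to the whole plane; such an [L] is unique by the
   identity theorem. *)
Definition is_dirichlet_L (chi : Z -> C) (L : C -> C) : Prop :=
  entire L /\ forall s : C, 1 < Re s -> dirichlet_series chi s (L s).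

Definition zero_multiplicity_ge (f : C -> C) (z0 : C) (m : nat) : Prop :=
  exists a : nat -> C,
    power_series_at f z0 a /\ forall k : nat, (k < m)%nat -> a k = RtoC 0.

(* [b1], [b2] are two real zeros of [f], counted with multiplicity. *)
Definition two_real_zeros (f : C -> C) (b1 b2 : R) : Prop :=
  f (RtoC b1) = RtoC 0 /\ f (RtoC b2) = RtoC 0 /\
  (b1 <> b2 \/ (b1 = b2 /\ zero_multiplicity_ge f (RtoC b1) 2)).

(* Main.v *)
Require Import Defs.
From Stdlib Require Import Reals ZArith.
From Coquelicot Require Import Coquelicot.
From Stdlib Require Import Lra Lia Psatz Znumtheory Classical.

Open Scope list_scope.
Open Scope R_scope.

(* Let chi be primitive of modulus q >= 14 and parity a. The convolution F(L) of the theta functions of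
   zeta and of L(s, chi), in logarithmic variables, is a sum of positive kernels against r = 1 * chi >= 0,
   so F > 0; moreover F(L) divided by exp(a L / 4) exp(- 2 pi e^(L/2) / sqrt q) is nonincreasing.
   With N(s) = int_0^oo F(L) (e^(s L / 2) + eps e^((1 - s) L / 2)) dL, the functional equations show that
   s (1 - s) N(s) / (s + eps (1 - s)) takes one and the same value at all zeros of L(s, chi) in (1/2, 1),
   and that it is stationary at a double zero. But it is strictly decreasing on (1 - 1.011 / log q, 1).
   That decrease amounts to int F(L) (rho - L / 2) omega(L) dL > 0 with rho = (2s - 1) / (s (1 - s)) and
   omega the exponential factor in N(s). By monotonicity (single crossing) F may be replaced by its
   explicit weight, and then log y <= log Y + (y - Y) / Y with y = e^(L/2) leaves log Y < rho for
   Y = 1 + (2 + a/2) sqrt q / (2 pi), a numerical fact.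
   Imprimitive characters reduce to primitive ones by removing Euler factors, which do not vanish for
   s > 0, and for q <= 13 summing by parts twice gives L(s, chi) > 0 on s > 0.
   The theta functional equations are limits of Polya's finite ones, obtained by discrete Fourier
   inversion of the binomial expansion of cos^(2m). L agrees on s > 0 with its conditionally convergent
   Dirichlet series by the identity principle for real power series. *)

(** A single zero only ties [N(s)] to [Vmel 1], a positive multiple of [L(1, chi)], for which no
    useful lower bound is at hand. Two zeros give the same unknown twice, so it cancels and only the
    variation in [s] of a quotient built from [F] matters. This is why the result concerns pairs of
    zeros, and why a double zero enters through a derivative. The theta function of [chi] alone has
    no evident sign. Its convolution with the theta function of zeta does, because [chi] is real,
    and a sign is all that the comparison of weights needs. The sign of the Gauss sum is never
    determined: both root numbers [eps = 1] and [eps = -1] are carried along. Put [t = log q] and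
    [s = 1 - c / t]. Then [rho] is about [t / c], while [log Y] is about [t / 2], so for large [q]
    any [c < 2] would pass the numerical test. The value 1.011 is what the estimates leave at the
    bottom of the analytic range, [t = 2.6 < log 14]. Since [1.011 < log 3], the threshold is
    positive for every [q >= 3], and all work takes place at [s > 0], where the Dirichlet series
    still converges. *)

Ltac eqR := match goal with |- @eq _ ?a ?b => change (@eq R a b) end.

(** * Finite sums with an exclusive upper bound *)

Fixpoint rsum (f : nat -> R) (n : nat) : R :=
  match n with O => 0 | S m => rsum f m + f m end.

Lemma rsum_ext f g n : (forall i, (i < n)%nat -> f i = g i) -> rsum f n = rsum g n.
Proof.
  induction n as [|n IH]; intros H; simpl; auto.
  rewrite IH by (intros; apply H; lia). rewrite H by lia. reflexivity.
Qed.

Lemma rsum_plus f g n : rsum (fun i => f i + g i) n = rsum f n + rsum g n.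
Proof. induction n as [|n IH]; simpl; rewrite ?IH; lra. Qed.

Lemma rsum_minus f g n : rsum (fun i => f i - g i) n = rsum f n - rsum g n.
Proof. induction n as [|n IH]; simpl; rewrite ?IH; lra. Qed.

Lemma rsum_scal c f n : rsum (fun i => c * f i) n = c * rsum f n.
Proof. induction n as [|n IH]; simpl; rewrite ?IH; lra. Qed.

Lemma rsum_scal_r c f n : rsum (fun i => f i * c) n = rsum f n * c.
Proof. induction n as [|n IH]; simpl; rewrite ?IH; lra. Qed.

Lemma rsum_const c n : rsum (fun _ => c) n = INR n * c.
Proof. induction n as [|n IH]; [simpl; lra|]. rewrite S_INR. simpl rsum. rewrite IH. lra. Qed.

Lemma rsum_zero f n : (forall i, (i < n)%nat -> f i = 0) -> rsum f n = 0.
Proof. intros H. rewrite (rsum_ext f (fun _ => 0)) by auto. rewrite rsum_const. lra. Qed.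

Lemma rsum_le f g n : (forall i, (i < n)%nat -> f i <= g i) -> rsum f n <= rsum g n.
Proof.
  induction n as [|n IH]; intros H; simpl; [lra|].
  apply Rplus_le_compat; [apply IH; intros; apply H; lia | apply H; lia].
Qed.

Lemma rsum_nonneg f n : (forall i, (i < n)%nat -> 0 <= f i) -> 0 <= rsum f n.
Proof.
  intros H. apply Rle_trans with (rsum (fun _ => 0) n); [rewrite rsum_const; lra|].
  now apply rsum_le.
Qed.

Lemma rsum_abs f n : Rabs (rsum f n) <= rsum (fun i => Rabs (f i)) n.
Proof.
  induction n as [|n IH]; simpl; [rewrite Rabs_R0; lra|].
  eapply Rle_trans; [apply Rabs_triang|lra].
Qed.

Lemma rsum_swap f n m :
  rsum (fun i => rsum (fun j => f i j) m) n = rsum (fun j => rsum (fun i => f i j) n) m.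
Proof.
  induction n as [|n IH]; simpl.
  - now rewrite rsum_zero.
  - rewrite IH, <- rsum_plus. reflexivity.
Qed.

Lemma rsum_add f n m : rsum f (n + m) = rsum f n + rsum (fun i => f (n + i)%nat) m.
Proof.
  induction m as [|m IH]; simpl; [rewrite Nat.add_0_r; lra|].
  rewrite Nat.add_succ_r. simpl. rewrite IH. lra.
Qed.

Lemma rsum_S_l f n : rsum f (S n) = f O + rsum (fun i => f (S i)) n.
Proof. change (S n) with (1 + n)%nat. rewrite rsum_add. simpl. lra. Qed.

Lemma rsum_rev f n : rsum f n = rsum (fun i => f (n - 1 - i)%nat) n.
Proof.
  revert f. induction n as [|n IH]; intros f; [reflexivity|].
  rewrite rsum_S_l, (IH (fun i => f (S i))). simpl rsum at 2.
  replace (n - 0 - n)%nat with 0%nat by lia.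
  rewrite Rplus_comm. f_equal. apply rsum_ext. intros i Hi. f_equal. lia.
Qed.

Lemma rsum_single f n k : (k < n)%nat -> (forall i, (i < n)%nat -> i <> k -> f i = 0) ->
  rsum f n = f k.
Proof.
  induction n as [|n IH]; intros Hk H; [lia|]. simpl.
  destruct (Nat.eq_dec k n) as [->|Hne].
  - rewrite rsum_zero; [lra|]. intros i Hi; apply H; lia.
  - rewrite IH by (try lia; intros; apply H; lia). rewrite (H n) by lia. lra.
Qed.

Lemma rsum_ext_len f n m : (n <= m)%nat -> (forall i, (n <= i < m)%nat -> f i = 0) ->
  rsum f m = rsum f n.
Proof.
  intros Hle H. replace m with (n + (m - n))%nat by lia. rewrite rsum_add.
  rewrite (rsum_zero (fun i => f (n + i)%nat)); [lra|]. intros i Hi. apply H. lia.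
Qed.

Lemma rsum_le_len f n m : (n <= m)%nat -> (forall i, 0 <= f i) -> rsum f n <= rsum f m.
Proof.
  intros Hle H. replace m with (n + (m - n))%nat by lia. rewrite rsum_add.
  assert (0 <= rsum (fun i => f (n + i)%nat) (m - n)) by (apply rsum_nonneg; auto). lra.
Qed.

(** * Series as limits of finite sums, and dominated convergence *)

Lemma sum_n_rsum (f : nat -> R) n : sum_n f n = rsum f (S n).
Proof.
  induction n as [|n IH].
  - rewrite sum_O. simpl. lra.
  - rewrite sum_Sn, IH. reflexivity.
Qed.

Lemma is_series_rsum (f : nat -> R) (l : R) : is_series f l <-> is_lim_seq (rsum f) l.
Proof.
  split; intros H.
  - apply is_lim_seq_incr_1. apply is_lim_seq_ext with (sum_n f); [apply sum_n_rsum|]. exact H.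
  - apply is_lim_seq_incr_1 in H.
    change (is_lim_seq (sum_n f) l).
    eapply is_lim_seq_ext; [|exact H]. intros n. symmetry. apply sum_n_rsum.
Qed.

Lemma Series_rsum_lim (f : nat -> R) : ex_series f -> is_lim_seq (rsum f) (Series f).
Proof. intros H. apply is_series_rsum. now apply Series_correct. Qed.

Lemma Series_finite (f : nat -> R) n : (forall i, (n <= i)%nat -> f i = 0) ->
  is_series f (rsum f n).
Proof.
  intros H. apply is_series_rsum.
  apply is_lim_seq_ext_loc with (fun _ => rsum f n); [|apply is_lim_seq_const].
  exists n. intros m Hm. symmetry. apply rsum_ext_len; auto. intros; apply H; lia.
Qed.

Lemma ex_series_nonneg_bounded (f : nat -> R) M :
  (forall n, 0 <= f n) -> (forall n, rsum f n <= M) -> ex_series f.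
Proof.
  intros H0 HM.
  destruct (ex_finite_lim_seq_incr (rsum f) M) as [l Hl]; auto.
  - intros n. simpl. specialize (H0 n). lra.
  - exists l. now apply is_series_rsum.
Qed.

Lemma rsum_le_Series (f : nat -> R) n :
  (forall n, 0 <= f n) -> ex_series f -> rsum f n <= Series f.
Proof.
  intros H0 H. apply (is_lim_seq_incr_compare _ _ (Series_rsum_lim f H)).
  intros k. simpl. specialize (H0 k). lra.
Qed.

Lemma ex_series_Rabs_le (a b : nat -> R) :
  (forall n, Rabs (a n) <= b n) -> ex_series b -> ex_series a.
Proof. intros H Hb. apply (ex_series_le (K := R_AbsRing) (V := R_CompleteNormedModule) a b); auto. Qed.

Lemma Series_abs_le (a b : nat -> R) :
  (forall n, Rabs (a n) <= b n) -> ex_series b -> Rabs (Series a) <= Series b.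
Proof.
  intros H Hb.
  assert (Ha : ex_series (fun n => Rabs (a n))).
  { apply ex_series_Rabs_le with b; auto. intros n. rewrite Rabs_Rabsolu. auto. }
  eapply Rle_trans; [apply Series_Rabs; exact Ha|].
  apply Series_le; auto. intros n; split; [apply Rabs_pos|auto].
Qed.

Lemma Series_split (f : nat -> R) n : ex_series f ->
  Series f = rsum f n + Series (fun k => f (n + k)%nat).
Proof.
  intros H. destruct n as [|n].
  - simpl. rewrite Rplus_0_l. apply Series_ext. reflexivity.
  - rewrite (Series_incr_n f (S n)) by (auto; lia). simpl pred.
    now rewrite <- sum_n_rsum, sum_n_Reals.
Qed.

Lemma Series_tail_lim (f : nat -> R) : ex_series f ->
  is_lim_seq (fun n => Series (fun k => f (n + k)%nat)) 0.
Proof.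
  intros H. apply is_lim_seq_ext with (fun n => Series f - rsum f n).
  - intros n. rewrite (Series_split f n H). lra.
  - replace (Finite 0) with (Rbar_minus (Series f) (Series f)) by (simpl; f_equal; lra).
    apply is_lim_seq_minus'; [apply is_lim_seq_const|now apply Series_rsum_lim].
Qed.

Lemma is_lim_seq_rsum (u : nat -> nat -> R) (l : nat -> R) K :
  (forall k, is_lim_seq (fun n => u n k) (l k)) ->
  is_lim_seq (fun n => rsum (u n) K) (rsum l K).
Proof.
  intros H. induction K as [|K IH]; simpl; [apply is_lim_seq_const|].
  apply is_lim_seq_plus'; auto.
Qed.

Lemma is_lim_seq_eps (u : nat -> R) (l : R) :
  is_lim_seq u l <-> forall eps, 0 < eps -> exists N, forall n, (N <= n)%nat -> Rabs (u n - l) < eps.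
Proof.
  split.
  - intros H eps He. apply is_lim_seq_spec in H. apply (H (mkposreal eps He)).
  - intros H. apply is_lim_seq_spec. intros [eps He]. apply (H eps He).
Qed.

(** Dominated convergence for series: the summable majorant makes both tails beyond some [K] small
    at once, and the remaining [K] terms converge one by one. Domination is asked only eventually;
    the limits inherit it. *)
Lemma tannery (u : nat -> nat -> R) (l b : nat -> R) :
  ex_series b ->
  eventually (fun n => forall k, Rabs (u n k) <= b k) ->
  (forall k, is_lim_seq (fun n => u n k) (l k)) ->
  is_lim_seq (fun n => Series (u n)) (Series l).
Proof.
  intros Hb [N0 Hdom] Hlim.
  assert (Hl : forall k, Rabs (l k) <= b k).
  { intros k. apply (is_lim_seq_le_loc (fun n => Rabs (u n k)) (fun _ => b k) (Rabs (l k)) (b k)).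
    - exists N0. intros n Hn. now apply Hdom.
    - apply (is_lim_seq_abs (fun n => u n k) (l k)). apply Hlim.
    - apply is_lim_seq_const. }
  apply is_lim_seq_eps. intros eps He.
  destruct (proj1 (is_lim_seq_eps _ _) (Series_tail_lim b Hb) (eps / 4)) as [K HK]; [lra|].
  specialize (HK K (le_n _)). rewrite Rminus_0_r in HK.
  destruct (proj1 (is_lim_seq_eps _ _) (is_lim_seq_rsum u l K Hlim) (eps / 4)) as [N1 HN1]; [lra|].
  exists (max N0 N1). intros n Hn.
  assert (Hu : ex_series (u n)) by (apply ex_series_Rabs_le with b; auto; apply Hdom; lia).
  assert (Hle : ex_series l) by (apply ex_series_Rabs_le with b; auto).
  rewrite (Series_split (u n) K Hu), (Series_split l K Hle).
  assert (Hbs : ex_series (fun k => b (K + k)%nat)) by (apply (ex_series_incr_n b K); auto).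
  assert (T1 : Rabs (Series (fun k => u n (K + k)%nat)) <= Series (fun k => b (K + k)%nat)).
  { apply Series_abs_le; auto. intros k. apply Hdom. lia. }
  assert (T2 : Rabs (Series (fun k => l (K + k)%nat)) <= Series (fun k => b (K + k)%nat)).
  { apply Series_abs_le; auto. }
  specialize (HN1 n ltac:(lia)).
  apply Rabs_def2 in HK. apply Rabs_def2 in HN1.
  apply Rabs_le_between in T1. apply Rabs_le_between in T2.
  apply Rabs_def1; lra.
Qed.

Lemma ex_series_scal_R (c : R) (f : nat -> R) : ex_series f -> ex_series (fun n => c * f n).
Proof. intros H. apply (ex_series_scal (V := R_NormedModule) c f H). Qed.

Lemma rsum_multiples (f : nat -> R) p n : (1 <= p)%nat ->
  rsum (fun k => if Nat.eqb (S k mod p) 0 then f (S k) else 0) (n * p)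
  = rsum (fun k => f (p * S k)%nat) n.
Proof.
  intros Hp. induction n as [|n IH]; [reflexivity|].
  replace (S n * p)%nat with (n * p + p)%nat by lia. rewrite rsum_add, IH.
  simpl rsum at 3. f_equal.
  (* In a block of [p] consecutive integers that starts just after a multiple of [p], the last one
     is the only multiple. *)
  rewrite (rsum_single _ p (p - 1)) by
    (try lia; intros i Hi Hne;
     replace (S (n * p + i)) with (S i + n * p)%nat by lia;
     rewrite Nat.Div0.mod_add, Nat.mod_small by lia; reflexivity).
  replace (S (n * p + (p - 1))) with (p * S n)%nat by lia.
  rewrite (Nat.mul_comm p), Nat.Div0.mod_mul. reflexivity.
Qed.

(** * Theta identities *)

(* [bw m k = C(2m, m + k) / C(2m, m)]; the finite theta identity is the binomial expansion of
   [(2 cos x)^(2m)], that is [bcos m m x = bP m * cos x ^ (2m)]. *)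
Fixpoint bw (m k : nat) : R :=
  match k with
  | O => 1
  | S i => bw m i * ((INR m - INR i) / (INR m + INR i + 1))
  end.

Lemma bw_step m k : (INR m + INR k + 1) * bw m (S k) = (INR m - INR k) * bw m k.
Proof.
  simpl. pose proof (pos_INR m). pose proof (pos_INR k). field. lra.
Qed.

Lemma bw_zero m k : (m < k)%nat -> bw m k = 0.
Proof.
  induction k as [|k IH]; intros H; [lia|]. simpl.
  destruct (Nat.eq_dec m k) as [->|Hne].
  - unfold Rdiv. rewrite Rminus_diag. ring.
  - rewrite IH by lia. ring.
Qed.

Lemma bw_nonneg m k : 0 <= bw m k.
Proof.
  destruct (le_lt_dec k m) as [H|H]; [|rewrite bw_zero by auto; lra].
  induction k as [|k IH]; simpl; [lra|].
  apply Rmult_le_pos; [apply IH; lia|].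
  pose proof (pos_INR m). pose proof (pos_INR k).
  assert (INR k <= INR m) by (apply le_INR; lia).
  apply Rdiv_le_0_compat; lra.
Qed.

Lemma exp_ge_1_plus x : 1 + x <= exp x.
Proof.
  destruct (Req_dec x 0) as [->|H]; [rewrite exp_0; lra|].
  left. now apply exp_ineq1.
Qed.

(** Each factor is [1 - (2j + 1) / (m + j + 1)], at most [exp (- (2j + 1) / (m + k))] for [j < k],
    and the odd numbers below [2k] sum to [k^2]. The denominator is frozen at its largest value, so
    the induction runs over [j] with [k] fixed. *)
Lemma bw_upper m k : (k <= m)%nat -> bw m k <= exp (- (INR k ^ 2 / (INR m + INR k))).
Proof.
  intros Hk. destruct (Nat.eq_dec k 0) as [->|Hk0].
  { simpl. rewrite Rmult_0_l. unfold Rdiv. rewrite Rmult_0_l, Ropp_0, exp_0. lra. }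
  set (M := INR m + INR k).
  assert (HM : 0 < M).
  { unfold M. assert (0 < INR k) by (apply lt_0_INR; lia). pose proof (pos_INR m). lra. }
  assert (G : forall j, (j <= k)%nat -> bw m j <= exp (- (INR j ^ 2 / M))).
  { induction j as [|j IH]; intros Hj.
    - simpl. rewrite Rmult_0_l. unfold Rdiv. rewrite Rmult_0_l, Ropp_0, exp_0. lra.
    - replace (- (INR (S j) ^ 2 / M)) with (- (INR j ^ 2 / M) + - ((2 * INR j + 1) / M))
        by (rewrite S_INR; field; lra).
      rewrite exp_plus. simpl bw.
      pose proof (pos_INR j) as Pj. pose proof (pos_INR m).
      assert (INR (S j) <= INR k) by (apply le_INR; lia). rewrite S_INR in H0.
      assert (INR (S j) <= INR m) by (apply le_INR; lia). rewrite S_INR in H1.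
      apply Rmult_le_compat.
      + apply bw_nonneg.
      + apply Rdiv_le_0_compat; lra.
      + apply IH; lia.
      + replace ((INR m - INR j) / (INR m + INR j + 1))
          with (1 + - ((2 * INR j + 1) / (INR m + INR j + 1))) by (field; lra).
        eapply Rle_trans; [|apply exp_ge_1_plus].
        apply Rplus_le_compat_l, Ropp_le_contravar.
        unfold Rdiv. apply Rmult_le_compat_l; [lra|].
        apply Rinv_le_contravar; unfold M in *; lra. }
  apply (G k (le_n _)).
Qed.

(** Here each factor is written as [1 / (1 + (2j + 1) / (m - j))] and the denominator is frozen at
    its smallest value [m + 1 - k]. *)
Lemma bw_lower m k : (k <= m)%nat -> exp (- (INR k ^ 2 / (INR m + 1 - INR k))) <= bw m k.
Proof.
  intros Hk.
  set (M := INR m + 1 - INR k).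
  assert (HM : 0 < M).
  { unfold M. assert (INR k <= INR m) by (apply le_INR; lia). lra. }
  assert (G : forall j, (j <= k)%nat -> exp (- (INR j ^ 2 / M)) <= bw m j).
  { induction j as [|j IH]; intros Hj.
    - simpl. rewrite Rmult_0_l. unfold Rdiv. rewrite Rmult_0_l, Ropp_0, exp_0. lra.
    - replace (- (INR (S j) ^ 2 / M)) with (- (INR j ^ 2 / M) + - ((2 * INR j + 1) / M))
        by (rewrite S_INR; field; lra).
      rewrite exp_plus. simpl bw.
      pose proof (pos_INR j) as Pj. pose proof (pos_INR m).
      assert (INR (S j) <= INR k) by (apply le_INR; lia). rewrite S_INR in H0.
      assert (INR (S j) <= INR m) by (apply le_INR; lia). rewrite S_INR in H1.
      apply Rmult_le_compat; try (left; apply exp_pos).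
      + apply IH; lia.
      + assert (Q : 1 + (2 * INR j + 1) / (INR m - INR j) <= exp ((2 * INR j + 1) / M)).
        { eapply Rle_trans; [|apply exp_ge_1_plus].
          apply Rplus_le_compat_l. unfold Rdiv. apply Rmult_le_compat_l; [lra|].
          apply Rinv_le_contravar; unfold M in *; lra. }
        rewrite exp_Ropp.
        replace ((INR m - INR j) / (INR m + INR j + 1))
          with (/ (1 + (2 * INR j + 1) / (INR m - INR j))) by (field; lra).
        apply Rinv_le_contravar; [|exact Q].
        assert (0 <= (2 * INR j + 1) / (INR m - INR j)) by (apply Rdiv_le_0_compat; lra). lra. }
  apply (G k (le_n _)).
Qed.

(** * The cosine polynomial, its sine companion and their closed forms *)

Definition bcos (m K : nat) (x : R) : R :=
  1 + 2 * rsum (fun k => bw m (S k) * cos (2 * INR (S k) * x)) K.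
Definition bsin (m K : nat) (x : R) : R :=
  rsum (fun k => INR (S k) * bw m (S k) * sin (2 * INR (S k) * x)) K.

(** The equation [cos x * y' = - 2 m sin x * y] of [cos ^ (2m)], tested on partial sums. The
    recursion [bw_step] makes everything telescope into one boundary term, which disappears from
    [K = m] on. *)
Lemma bcos_ode_partial m K x :
  cos x * (-4 * bsin m K x) + 2 * INR m * sin x * bcos m K x
  = 2 * (INR m - INR K) * bw m K * sin ((2 * INR K + 1) * x).
Proof.
  induction K as [|K IH].
  - unfold bsin, bcos. simpl. replace ((2 * 0 + 1) * x) with x by ring. ring.
  - unfold bsin, bcos in *. cbn [rsum].
    set (A := rsum (fun k => INR (S k) * bw m (S k) * sin (2 * INR (S k) * x)) K) in *.
    set (B := rsum (fun k => bw m (S k) * cos (2 * INR (S k) * x)) K) in *.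
    pose proof (bw_step m K) as Hs.
    rewrite S_INR. set (k := INR K) in *. set (W := bw m (S K)) in *.
    replace ((2 * (k + 1) + 1) * x) with (2 * (k + 1) * x + x) by ring.
    replace ((2 * k + 1) * x) with (2 * (k + 1) * x - x) in IH by ring.
    rewrite sin_plus. rewrite sin_minus in IH.
    set (c := cos (2 * (k + 1) * x)) in *. set (s := sin (2 * (k + 1) * x)) in *.
    set (cx := cos x) in *. set (sx := sin x) in *.
    assert (E : (INR m - k) * bw m K = (INR m + k + 1) * W) by lra.
    replace (2 * (INR m - k) * bw m K * (s * cx - c * sx))
      with (2 * (s * cx - c * sx) * ((INR m - k) * bw m K)) in IH by ring.
    rewrite E in IH. lra.
Qed.

Lemma bcos_ode m K x : (m <= K)%nat ->
  cos x * (4 * bsin m K x) = 2 * INR m * sin x * bcos m K x.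
Proof.
  intros H. pose proof (bcos_ode_partial m K x) as E.
  assert (Z : (INR m - INR K) * bw m K = 0).
  { destruct (Nat.eq_dec m K) as [->|Hne]; [ring|]. rewrite bw_zero by lia. ring. }
  replace (2 * (INR m - INR K) * bw m K * sin ((2 * INR K + 1) * x))
    with (2 * ((INR m - INR K) * bw m K) * sin ((2 * INR K + 1) * x)) in E by ring.
  rewrite Z in E. lra.
Qed.

Lemma is_derive_bcos m K x : is_derive (bcos m K) x (-4 * bsin m K x).
Proof.
  induction K as [|K IH].
  - unfold bcos, bsin. simpl. auto_derive; auto. ring.
  - apply is_derive_ext with
      (fun y => bcos m K y + 2 * (bw m (S K) * cos (2 * INR (S K) * y))).
    + intros y. eqR. unfold bcos. cbn [rsum]. ring.
    + assert (D : is_derive (fun y => 2 * (bw m (S K) * cos (2 * INR (S K) * y))) x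
                (-4 * (INR (S K) * bw m (S K) * sin (2 * INR (S K) * x)))).
      { generalize (INR (S K)) (bw m (S K)). intros n b. auto_derive; auto. ring. }
      pose proof (is_derive_plus _ _ _ _ _ IH D) as DD.
      replace (-4 * bsin m (S K) x) with
        (-4 * bsin m K x + -4 * (INR (S K) * bw m (S K) * sin (2 * INR (S K) * x)));
        [exact DD|]. unfold bsin. cbn [rsum]. ring.
Qed.

Definition bP (m : nat) : R := bcos m m 0.

Lemma bcos_len m K x : (m <= K)%nat -> bcos m K x = bcos m m x.
Proof.
  intros H. unfold bcos. f_equal. f_equal. apply rsum_ext_len; auto.
  intros i Hi. rewrite bw_zero by lia. ring.
Qed.

Lemma is_derive_zero_const (f : R -> R) a b : a <= b ->
  (forall x, a <= x <= b -> is_derive f x 0) -> f b = f a.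
Proof.
  intros Hab H. destruct (Req_dec a b) as [->|Hne]; auto.
  destruct (MVT_gen f a b (fun _ => 0)) as [c [_ Hc]].
  - rewrite Rmin_left, Rmax_right by lra. intros x Hx. apply H. lra.
  - rewrite Rmin_left, Rmax_right by lra. intros x Hx.
    apply continuity_pt_filterlim. apply (ex_derive_continuous f x).
    exists 0. apply H. lra.
  - lra.
Qed.

(** By [bcos_ode] the quotient by [cos ^ (2m)] has zero derivative, hence keeps its value at 0. The
    interval stops short of [PI / 2], where the divisor vanishes. *)
Lemma bcos_closed m K x : (m <= K)%nat -> 0 <= x < PI / 2 ->
  bcos m K x = bP m * cos x ^ (2 * m).
Proof.
  intros HK Hx.
  assert (Hc : forall y, 0 <= y <= x -> 0 < cos y) by (intros y Hy; apply cos_gt_0; lra).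
  assert (Hpow : forall y n, 0 <= y <= x -> cos y ^ n <> 0).
  { intros y n Hy. apply pow_nonzero. specialize (Hc y Hy). lra. }
  assert (E : bcos m K x / cos x ^ (2 * m) = bcos m K 0 / cos 0 ^ (2 * m)).
  { apply (is_derive_zero_const (fun y => bcos m K y / cos y ^ (2 * m))); [lra|].
    intros y Hy.
    assert (D : is_derive (fun z => cos z ^ (2 * m)) y
                  (INR (2 * m) * (- sin y) * cos y ^ (pred (2 * m)))).
    { apply is_derive_pow. auto_derive; auto. ring. }
    pose proof (is_derive_div (bcos m K) _ y _ _ (is_derive_bcos m K y) D (Hpow y _ Hy)) as DD.
    eapply is_derive_ext_loc in DD; [|apply filter_forall; intros; reflexivity].
    replace 0 with ((-4 * bsin m K y * cos y ^ (2 * m)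
       - bcos m K y * (INR (2 * m) * - sin y * cos y ^ pred (2 * m))) / (cos y ^ (2 * m)) ^ 2).
    - exact DD.
    - pose proof (bcos_ode m K y HK) as O.
      apply Rmult_eq_reg_r with ((cos y ^ (2 * m)) ^ 2); [|apply pow_nonzero, Hpow; auto].
      unfold Rdiv. rewrite Rmult_assoc, Rinv_l by (apply pow_nonzero, Hpow; auto).
      rewrite mult_INR. simpl (INR 2).
      destruct (Nat.eq_dec m 0) as [->|Hm].
      + simpl in O |- *. specialize (Hc y Hy).
        assert (bsin 0 K y = 0) by (apply Rmult_eq_reg_l with (4 * cos y); lra). lra.
      + assert (Ep : cos y ^ (2 * m) = cos y * cos y ^ pred (2 * m)).
        { replace (2 * m)%nat with (S (pred (2 * m))) at 1 by lia. reflexivity. }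
        rewrite Ep. set (X := cos y ^ pred (2 * m)).
        replace (-4 * bsin m K y * (cos y * X) - bcos m K y * ((1 + 1) * INR m * - sin y * X))
          with ((2 * INR m * sin y * bcos m K y - cos y * (4 * bsin m K y)) * X) by ring.
        rewrite O. ring. }
  rewrite cos_0, pow1 in E. rewrite (bcos_len m K 0 HK) in E. fold (bP m) in E.
  apply Rmult_eq_reg_r with (/ cos x ^ (2 * m)).
  - unfold Rdiv in E. rewrite E. rewrite Rmult_assoc, Rinv_r by (apply Hpow; lra). lra.
  - apply Rinv_neq_0_compat, Hpow. lra.
Qed.

Lemma bsin_closed m K x : (1 <= m)%nat -> (m <= K)%nat -> 0 <= x < PI / 2 ->
  2 * bsin m K x = INR m * bP m * (sin x * cos x ^ (2 * m - 1)).
Proof.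
  intros Hm HK Hx. pose proof (bcos_ode m K x HK) as O.
  rewrite (bcos_closed m K x HK Hx) in O.
  assert (0 < cos x) by (apply cos_gt_0; lra).
  apply Rmult_eq_reg_l with (2 * cos x); [|lra].
  replace (cos x ^ (2 * m)) with (cos x * cos x ^ (2 * m - 1)) in O.
  2: { replace (2 * m)%nat with (S (2 * m - 1)) at 2 by lia. reflexivity. }
  lra.
Qed.

(** The endpoint that [bcos_closed] leaves out. It is met at the middle index when the number of
    sample points is even, and follows from the differential equation alone. *)
Lemma bcos_half m K : (1 <= m)%nat -> (m <= K)%nat -> bcos m K (PI / 2) = 0.
Proof.
  intros Hm HK. pose proof (bcos_ode m K (PI / 2) HK) as O.
  rewrite cos_PI2, sin_PI2 in O.
  assert (0 < INR m) by (apply lt_0_INR; lia).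
  apply Rmult_eq_reg_l with (2 * INR m); lra.
Qed.

Lemma cos_nat_period n y : cos (2 * INR n * PI - y) = cos y.
Proof.
  rewrite <- (cos_neg y). replace (2 * INR n * PI - y) with (- y + 2 * INR n * PI) by ring.
  apply cos_period.
Qed.

Lemma sin_nat_period n y : sin (2 * INR n * PI - y) = - sin y.
Proof.
  rewrite <- (sin_neg y). replace (2 * INR n * PI - y) with (- y + 2 * INR n * PI) by ring.
  apply sin_period.
Qed.

Lemma bcos_reflect m K x : bcos m K (PI - x) = bcos m K x.
Proof.
  unfold bcos. f_equal. f_equal. apply rsum_ext. intros i _. f_equal.
  replace (2 * INR (S i) * (PI - x)) with (2 * INR (S i) * PI - 2 * INR (S i) * x) by ring.
  apply cos_nat_period.
Qed.

Lemma bsin_reflect m K x : bsin m K (PI - x) = - bsin m K x.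
Proof.
  unfold bsin. replace (- rsum (fun k : nat => INR (S k) * bw m (S k) * sin (2 * INR (S k) * x)) K)
   with (-1 * rsum (fun k : nat => INR (S k) * bw m (S k) * sin (2 * INR (S k) * x)) K) by ring.
  rewrite <- rsum_scal. apply rsum_ext. intros i _.
  replace (2 * INR (S i) * (PI - x)) with (2 * INR (S i) * PI - 2 * INR (S i) * x) by ring.
  rewrite sin_nat_period. ring.
Qed.

(** * Residue classes, inversion of finite trigonometric sums, and the finite theta identities *)

Definition zind (q : nat) (z : Z) : R := if Z.eqb (z mod Z.of_nat q) 0 then 1 else 0.

Definition zperiodic (q : nat) (c : Z -> R) : Prop := forall n, c (n + Z.of_nat q)%Z = c n.

Lemma zperiodic_mult q c : zperiodic q c -> forall n k, c (n + k * Z.of_nat q)%Z = c n.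
Proof.
  intros H n k.
  assert (P : forall j n, c (n + Z.of_nat j * Z.of_nat q)%Z = c n).
  { induction j as [|j IH]; intros x; [f_equal; lia|].
    replace (x + Z.of_nat (S j) * Z.of_nat q)%Z with ((x + Z.of_nat j * Z.of_nat q) + Z.of_nat q)%Z by lia.
    rewrite H. apply IH. }
  destruct (Z_le_gt_dec 0 k) as [Hk|Hk].
  - rewrite <- (P (Z.to_nat k) n). f_equal. lia.
  - rewrite <- (P (Z.to_nat (- k)) (n + k * Z.of_nat q)%Z). f_equal. lia.
Qed.

Lemma zperiodic_mod q c : (1 <= q)%nat -> zperiodic q c ->
  forall n, c (n mod Z.of_nat q)%Z = c n.
Proof.
  intros Hq H n. rewrite <- (zperiodic_mult q c H (n mod Z.of_nat q) (n / Z.of_nat q)).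
  f_equal. pose proof (Z.div_mod n (Z.of_nat q)). lia.
Qed.

Lemma zind_1 q z : (1 <= q)%nat -> (Z.of_nat q | z)%Z -> zind q z = 1.
Proof.
  intros Hq H. unfold zind. rewrite (proj2 (Z.eqb_eq _ _)); auto.
  apply Z.mod_divide; auto; lia.
Qed.

Lemma zind_0 q z : (1 <= q)%nat -> ~ (Z.of_nat q | z)%Z -> zind q z = 0.
Proof.
  intros Hq H. unfold zind. rewrite (proj2 (Z.eqb_neq _ _)); auto.
  intros E. apply H. apply Z.mod_divide; auto; lia.
Qed.

Lemma zind_cases q z : (1 <= q)%nat ->
  ((Z.of_nat q | z)%Z /\ zind q z = 1) \/ (~ (Z.of_nat q | z)%Z /\ zind q z = 0).
Proof.
  intros Hq. destruct (Znumtheory.Zdivide_dec (Z.of_nat q) z) as [H|H]; [left|right]; split; auto.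
  - now apply zind_1.
  - now apply zind_0.
Qed.

Lemma zind_ext q q' z z' : (1 <= q)%nat -> (1 <= q')%nat ->
  ((Z.of_nat q | z)%Z <-> (Z.of_nat q' | z')%Z) -> zind q z = zind q' z'.
Proof.
  intros Hq Hq' H.
  destruct (zind_cases q z Hq) as [[D ->]|[D ->]]; destruct (zind_cases q' z' Hq') as [[D' ->]|[D' ->]];
    tauto || reflexivity.
Qed.

(** Exactly one residue [b < q] is congruent to [n]. With this reproducing property a change of
    variable modulo [q] becomes an exchange of two finite sums. *)
Lemma rsum_residue q f n : (1 <= q)%nat -> zperiodic q f ->
  rsum (fun b => f (Z.of_nat b) * zind q (Z.of_nat b - n)) q = f n.
Proof.
  intros Hq Hf.
  assert (Hm : (0 <= n mod Z.of_nat q < Z.of_nat q)%Z) by (apply Z.mod_pos_bound; lia).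
  pose proof (Z.div_mod n (Z.of_nat q) ltac:(lia)) as Hdm.
  rewrite (rsum_single _ q (Z.to_nat (n mod Z.of_nat q))).
  - rewrite Z2Nat.id by lia. rewrite (zperiodic_mod q f Hq Hf), zind_1; auto; [ring|].
    exists (- (n / Z.of_nat q))%Z. lia.
  - lia.
  - intros i Hi Hne. rewrite zind_0; auto; [ring|].
    intros [k Hk]. apply Hne.
    assert (n / Z.of_nat q = - k)%Z by nia. nia.
Qed.

Lemma cos_period_Z y k : cos (y + 2 * IZR k * PI) = cos y.
Proof.
  destruct (Z_le_gt_dec 0 k) as [H|H].
  - replace (IZR k) with (INR (Z.to_nat k)); [apply cos_period|].
    rewrite INR_IZR_INZ. f_equal. lia.
  - rewrite <- (cos_period _ (Z.to_nat (- k))). f_equal.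
    rewrite INR_IZR_INZ, Z2Nat.id by lia. rewrite opp_IZR. ring.
Qed.

Lemma sin_period_Z y k : sin (y + 2 * IZR k * PI) = sin y.
Proof.
  destruct (Z_le_gt_dec 0 k) as [H|H].
  - replace (IZR k) with (INR (Z.to_nat k)); [apply sin_period|].
    rewrite INR_IZR_INZ. f_equal. lia.
  - rewrite <- (sin_period _ (Z.to_nat (- k))). f_equal.
    rewrite INR_IZR_INZ, Z2Nat.id by lia. rewrite opp_IZR. ring.
Qed.

Lemma cos_sum_telescope x n :
  2 * sin (x / 2) * rsum (fun i => cos (INR i * x)) n = sin ((INR n - 1 / 2) * x) + sin (x / 2).
Proof.
  induction n as [|n IH].
  - simpl. replace ((0 - 1 / 2) * x) with (- (x / 2)) by field. rewrite sin_neg. ring.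
  - cbn [rsum]. rewrite Rmult_plus_distr_l, IH, S_INR.
    replace ((INR n + 1 - 1 / 2) * x) with (INR n * x + x / 2) by field.
    replace ((INR n - 1 / 2) * x) with (INR n * x - x / 2) by field.
    rewrite sin_plus, sin_minus. ring.
Qed.

(** Orthogonality of additive characters in real form. If [l] does not divide [k], the telescoped
    side is zero by periodicity, and [sin (PI k / l)] is nonzero and can be cancelled. *)
Lemma cos_sum l k : (1 <= l)%nat ->
  rsum (fun i => cos (2 * PI * INR i * IZR k / INR l)) l = INR l * zind l k.
Proof.
  intros Hl. assert (Hl0 : INR l <> 0) by (apply not_0_INR; lia).
  destruct (zind_cases l k Hl) as [[[j Hj] ->]|[Hnd ->]].
  - rewrite (rsum_ext _ (fun _ => 1)).
    + rewrite rsum_const. ring.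
    + intros i _. rewrite Hj, mult_IZR, <- INR_IZR_INZ.
      replace (2 * PI * INR i * (IZR j * INR l) / INR l)
        with (0 + 2 * IZR (Z.of_nat i * j) * PI)
        by (rewrite mult_IZR, <- INR_IZR_INZ; field; auto).
      now rewrite cos_period_Z, cos_0.
  - rewrite Rmult_0_r.
    set (x := 2 * PI * IZR k / INR l).
    rewrite (rsum_ext _ (fun i => cos (INR i * x))).
    2: { intros i _. f_equal. unfold x. field. auto. }
    pose proof (cos_sum_telescope x l) as T.
    replace ((INR l - 1 / 2) * x) with (- (x / 2) + 2 * IZR k * PI) in T
      by (unfold x; field; auto).
    rewrite sin_period_Z, sin_neg in T.
    assert (Hs : sin (x / 2) <> 0).
    { intros E. destruct (sin_eq_0_0 _ E) as [j Hj]. apply Hnd. exists j.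
      apply eq_IZR. rewrite mult_IZR, <- INR_IZR_INZ.
      pose proof PI_RGT_0.
      apply Rmult_eq_reg_r with PI; [|lra]. unfold x in Hj.
      replace (IZR j * INR l * PI) with ((IZR j * PI) * INR l) by ring. rewrite <- Hj.
      field. auto. }
    apply Rmult_eq_reg_l with (2 * sin (x / 2)); [|lra]. rewrite T. ring.
Qed.

Definition cosT (c : Z -> R) (q i : nat) : R :=
  rsum (fun b => c (Z.of_nat b) * cos (2 * PI * INR i * INR b / INR q)) q.
Definition sinT (c : Z -> R) (q i : nat) : R :=
  rsum (fun b => c (Z.of_nat b) * sin (2 * PI * INR i * INR b / INR q)) q.

(** The stretched sequence that appears when a transform of period [q] is inverted modulo [q * N].
    The stretching makes the weights [bw m] be sampled at distance [N], which is the scale on which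
    they look Gaussian when [m] is of order [N^2]. *)
Definition spread (c : Z -> R) (N k : nat) : R :=
  if Nat.eqb (k mod N) 0 then c (Z.of_nat (k / N)) else 0.

Lemma spread_sum q N c k (sg : Z) : (1 <= q)%nat -> (1 <= N)%nat -> zperiodic q c ->
  (sg = 1 \/ sg = -1)%Z ->
  rsum (fun b => c (Z.of_nat b) * zind (q * N) (Z.of_nat k - sg * Z.of_nat (b * N))) q
  = if Nat.eqb (k mod N) 0 then c (sg * Z.of_nat (k / N))%Z else 0.
Proof.
  intros Hq HN Hc Hsg.
  destruct (Nat.eqb_spec (k mod N) 0) as [E|E].
  - assert (Hk : k = (N * (k / N))%nat) by (apply Nat.Div0.div_exact; auto).
    set (n := (k / N)%nat) in *.
    rewrite <- (rsum_residue q c (sg * Z.of_nat n)) by auto.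
    apply rsum_ext. intros b _. f_equal.
    apply zind_ext; auto; [nia|]. rewrite Hk.
    split; intros [j Hj]; exists (- sg * j)%Z; destruct Hsg; subst sg; nia.
  - apply rsum_zero. intros b _. rewrite zind_0; [ring|nia|].
    intros [j Hj]. apply E.
    assert (Hd : (Z.of_nat N | Z.of_nat k)%Z)
      by (exists (j * Z.of_nat q + sg * Z.of_nat b)%Z; nia).
    destruct Hd as [t Ht]. apply Nat.Div0.mod_divides.
    exists (Z.to_nat t). nia.
Qed.

(** Product-to-sum formulas turn the double sum into two orthogonality relations, at the frequencies
    [k - bN] and [k + bN]; evenness of [c] makes their contributions equal. *)
Lemma cosT_inversion q N c k : (1 <= q)%nat -> (1 <= N)%nat -> zperiodic q c ->
  (forall n, c (- n)%Z = c n) ->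
  rsum (fun i => cosT c q i * cos (2 * INR k * (PI * INR i / INR (q * N)))) (q * N)
  = INR (q * N) * spread c N k.
Proof.
  intros Hq HN Hc He.
  assert (Hq0 : INR q <> 0) by (apply not_0_INR; lia).
  assert (HN0 : INR N <> 0) by (apply not_0_INR; lia).
  transitivity (rsum (fun b => c (Z.of_nat b) / 2 *
     (rsum (fun i => cos (2 * PI * INR i * IZR (Z.of_nat k - 1 * Z.of_nat (b * N)) / INR (q * N))) (q * N)
     + rsum (fun i => cos (2 * PI * INR i * IZR (Z.of_nat k - -1 * Z.of_nat (b * N)) / INR (q * N))) (q * N))) q).
  { unfold cosT.
    rewrite (rsum_ext _ (fun i => rsum (fun b => c (Z.of_nat b) / 2 *
       (cos (2 * PI * INR i * IZR (Z.of_nat k - 1 * Z.of_nat (b * N)) / INR (q * N))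
       + cos (2 * PI * INR i * IZR (Z.of_nat k - -1 * Z.of_nat (b * N)) / INR (q * N)))) q)).
    - rewrite rsum_swap. apply rsum_ext. intros b _. now rewrite rsum_scal, rsum_plus.
    - intros i _. rewrite <- rsum_scal_r. apply rsum_ext. intros b _.
      rewrite !minus_IZR, !mult_IZR, <- !INR_IZR_INZ, !mult_INR.
      set (A := 2 * PI * INR i * INR b / INR q).
      set (B := 2 * INR k * (PI * INR i / (INR q * INR N))).
      replace (2 * PI * INR i * (INR k - 1 * (INR b * INR N)) / (INR q * INR N)) with (B - A)
        by (unfold A, B; field; auto).
      replace (2 * PI * INR i * (INR k - -1 * (INR b * INR N)) / (INR q * INR N)) with (B + A)
        by (unfold A, B; field; auto).
      rewrite cos_minus, cos_plus. field. }
  transitivity (INR (q * N) / 2 *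
    (rsum (fun b => c (Z.of_nat b) * zind (q * N) (Z.of_nat k - 1 * Z.of_nat (b * N))) q +
     rsum (fun b => c (Z.of_nat b) * zind (q * N) (Z.of_nat k - -1 * Z.of_nat (b * N))) q)).
  { rewrite <- rsum_plus, <- rsum_scal. apply rsum_ext. intros b _.
    rewrite !cos_sum by nia. field. }
  rewrite !spread_sum by (auto; lia). unfold spread.
  destruct (Nat.eqb (k mod N) 0); [|lra].
  rewrite Z.mul_1_l. replace (-1 * Z.of_nat (k / N))%Z with (- Z.of_nat (k / N))%Z by lia.
  rewrite He. field.
Qed.

Lemma sinT_inversion q N c k : (1 <= q)%nat -> (1 <= N)%nat -> zperiodic q c ->
  (forall n, c (- n)%Z = - c n) ->
  rsum (fun i => sinT c q i * sin (2 * INR k * (PI * INR i / INR (q * N)))) (q * N)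
  = INR (q * N) * spread c N k.
Proof.
  intros Hq HN Hc He.
  assert (Hq0 : INR q <> 0) by (apply not_0_INR; lia).
  assert (HN0 : INR N <> 0) by (apply not_0_INR; lia).
  transitivity (rsum (fun b => c (Z.of_nat b) / 2 *
     (rsum (fun i => cos (2 * PI * INR i * IZR (Z.of_nat k - 1 * Z.of_nat (b * N)) / INR (q * N))) (q * N)
     - rsum (fun i => cos (2 * PI * INR i * IZR (Z.of_nat k - -1 * Z.of_nat (b * N)) / INR (q * N))) (q * N))) q).
  { unfold sinT.
    rewrite (rsum_ext _ (fun i => rsum (fun b => c (Z.of_nat b) / 2 *
       (cos (2 * PI * INR i * IZR (Z.of_nat k - 1 * Z.of_nat (b * N)) / INR (q * N))
       - cos (2 * PI * INR i * IZR (Z.of_nat k - -1 * Z.of_nat (b * N)) / INR (q * N)))) q)).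
    - rewrite rsum_swap. apply rsum_ext. intros b _. now rewrite rsum_scal, rsum_minus.
    - intros i _. rewrite <- rsum_scal_r. apply rsum_ext. intros b _.
      rewrite !minus_IZR, !mult_IZR, <- !INR_IZR_INZ, !mult_INR.
      set (A := 2 * PI * INR i * INR b / INR q).
      set (B := 2 * INR k * (PI * INR i / (INR q * INR N))).
      replace (2 * PI * INR i * (INR k - 1 * (INR b * INR N)) / (INR q * INR N)) with (B - A)
        by (unfold A, B; field; auto).
      replace (2 * PI * INR i * (INR k - -1 * (INR b * INR N)) / (INR q * INR N)) with (B + A)
        by (unfold A, B; field; auto).
      rewrite cos_minus, cos_plus. field. }
  transitivity (INR (q * N) / 2 *
    (rsum (fun b => c (Z.of_nat b) * zind (q * N) (Z.of_nat k - 1 * Z.of_nat (b * N))) q -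
     rsum (fun b => c (Z.of_nat b) * zind (q * N) (Z.of_nat k - -1 * Z.of_nat (b * N))) q)).
  { rewrite <- rsum_minus, <- rsum_scal. apply rsum_ext. intros b _.
    rewrite !cos_sum by nia. field. }
  rewrite !spread_sum by (auto; lia). unfold spread.
  destruct (Nat.eqb (k mod N) 0); [|lra].
  rewrite Z.mul_1_l. replace (-1 * Z.of_nat (k / N))%Z with (- Z.of_nat (k / N))%Z by lia.
  rewrite He. field.
Qed.

(** Pairing [i] with [l - i] leaves the index 0 alone and restricts the others to [2 i < l]. The
    angles [PI i / l] then lie in the interval where the closed forms hold. *)
Lemma rsum_fold (f : nat -> R) l : (1 <= l)%nat ->
  (forall i, (1 <= i < l)%nat -> f (l - i)%nat = f i) ->
  (forall i, (2 * i = l)%nat -> f i = 0) ->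
  rsum f l = f O + 2 * rsum (fun i => if Nat.ltb (2 * S i) l then f (S i) else 0) (l - 1).
Proof.
  intros Hl Hr Hh.
  replace (rsum f l) with (rsum f (S (l - 1))) by (f_equal; lia).
  rewrite rsum_S_l. f_equal.
  set (g := fun i => if Nat.ltb (2 * S i) l then f (S i) else 0).
  rewrite (rsum_ext _ (fun i => g i + g (l - 1 - 1 - i)%nat)).
  - rewrite rsum_plus, <- (rsum_rev g). lra.
  - intros i Hi. unfold g.
    destruct (Nat.ltb_spec (2 * S i) l); destruct (Nat.ltb_spec (2 * S (l - 1 - 1 - i)) l); try lia.
    + lra.
    + replace (S (l - 1 - 1 - i)) with (l - S i)%nat by lia. rewrite Hr by lia. lra.
    + rewrite Hh by lia. lra.
Qed.

Lemma cosT_reflect c q N i : (1 <= q)%nat -> (i <= q * N)%nat -> cosT c q (q * N - i) = cosT c q i.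
Proof.
  intros Hq Hi. assert (Hq0 : INR q <> 0) by (apply not_0_INR; lia).
  apply rsum_ext. intros b _. f_equal. rewrite minus_INR, mult_INR by auto.
  replace (2 * PI * (INR q * INR N - INR i) * INR b / INR q)
    with (2 * INR (N * b) * PI - 2 * PI * INR i * INR b / INR q)
    by (rewrite mult_INR; field; auto).
  apply cos_nat_period.
Qed.

Lemma sinT_reflect c q N i : (1 <= q)%nat -> (i <= q * N)%nat -> sinT c q (q * N - i) = - sinT c q i.
Proof.
  intros Hq Hi. assert (Hq0 : INR q <> 0) by (apply not_0_INR; lia).
  transitivity (-1 * sinT c q i); [|ring]. unfold sinT. rewrite <- rsum_scal.
  apply rsum_ext. intros b _. rewrite minus_INR, mult_INR by auto.
  replace (2 * PI * (INR q * INR N - INR i) * INR b / INR q)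
    with (2 * INR (N * b) * PI - 2 * PI * INR i * INR b / INR q)
    by (rewrite mult_INR; field; auto).
  rewrite sin_nat_period. ring.
Qed.

Lemma angle_range l i : (2 * i < l)%nat -> 0 <= PI * INR i / INR l < PI / 2.
Proof.
  intros H. pose proof PI_RGT_0.
  assert (Hl : 0 < INR l) by (apply lt_0_INR; lia).
  assert (Hi : 2 * INR i < INR l).
  { replace 2 with (INR 2) by reflexivity. rewrite <- mult_INR. apply lt_INR; lia. }
  pose proof (pos_INR i).
  split.
  - apply Rdiv_le_0_compat; auto. apply Rmult_le_pos; lra.
  - apply Rmult_lt_reg_r with (INR l); auto. unfold Rdiv at 1.
    rewrite Rmult_assoc, Rinv_l by lra. nra.
Qed.

Definition theta_dual_even (c : Z -> R) (q m l i : nat) : R :=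
  if Nat.ltb (2 * S i) l then cosT c q (S i) * cos (PI * INR (S i) / INR l) ^ (2 * m) else 0.
Definition theta_dual_odd (c : Z -> R) (q m l i : nat) : R :=
  if Nat.ltb (2 * S i) l then
    sinT c q (S i) * (sin (PI * INR (S i) / INR l) * cos (PI * INR (S i) / INR l) ^ (2 * m - 1)) else 0.

(** The sum over [i < q N] of [cosT c q i * bcos (PI i / (q N))] is computed twice: expanding [bcos]
    and inverting the transform gives the left side, inserting the closed form gives the right
    side. *)
Lemma theta_finite_even q N m c : (1 <= q)%nat -> (1 <= N)%nat -> (1 <= m)%nat ->
  zperiodic q c -> (forall n, c (- n)%Z = c n) ->
  c 0%Z + 2 * rsum (fun n => c (Z.of_nat (S n)) * bw m (N * S n)) m
  = bP m / INR (q * N) * (cosT c q 0 + 2 * rsum (theta_dual_even c q m (q * N)) (q * N - 1)).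
Proof.
  intros Hq HN Hm Hc He.
  set (l := (q * N)%nat). assert (Hl : (1 <= l)%nat) by (unfold l; nia).
  assert (Hl0 : INR l <> 0) by (apply not_0_INR; lia).
  (* Taken larger than [m] so that the frequencies [1, ..., K] form [m] whole blocks of length [N];
     the weights beyond [m] vanish. *)
  set (K := (m * N)%nat). assert (HK : (m <= K)%nat) by (unfold K; nia).
  set (x := fun i => PI * INR i / INR l).
  assert (E : rsum (fun i => cosT c q i * bcos m K (x i)) l
     = INR l * (c 0%Z + 2 * rsum (fun n => c (Z.of_nat (S n)) * bw m (N * S n)) m)).
  { rewrite (rsum_ext _ (fun i => cosT c q i * cos (2 * INR 0 * x i)
       + rsum (fun k => 2 * bw m (S k) * (cosT c q i * cos (2 * INR (S k) * x i))) K)).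
    - rewrite rsum_plus, rsum_swap.
      unfold x, l. rewrite cosT_inversion by auto.
      rewrite (rsum_ext _ (fun k => 2 * INR (q * N) * (if Nat.eqb (S k mod N) 0
              then (fun k => bw m k * c (Z.of_nat (k / N))) (S k) else 0))).
      + rewrite rsum_scal. unfold K. rewrite (rsum_multiples (fun k => bw m k * c (Z.of_nat (k / N)))) by auto.
        unfold spread. rewrite Nat.Div0.mod_0_l, Nat.Div0.div_0_l. simpl Nat.eqb. cbv iota.
        rewrite (rsum_ext (fun k => bw m (N * S k) * _) (fun n => c (Z.of_nat (S n)) * bw m (N * S n))).
        * simpl Z.of_nat at 1. ring.
        * intros i _. rewrite Rmult_comm. f_equal. f_equal. f_equal.
          rewrite Nat.mul_comm. apply Nat.div_mul. lia.
      + intros k _. rewrite rsum_scal, cosT_inversion by auto. unfold spread.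
        destruct (Nat.eqb (S k mod N) 0); ring.
    - intros i _. unfold bcos.
      replace (rsum (fun k => 2 * bw m (S k) * (cosT c q i * cos (2 * INR (S k) * x i))) K)
        with (2 * cosT c q i * rsum (fun k => bw m (S k) * cos (2 * INR (S k) * x i)) K)
        by (rewrite <- rsum_scal; apply rsum_ext; intros; ring).
      simpl (INR 0). rewrite Rmult_0_r, Rmult_0_l, cos_0. ring. }
  apply Rmult_eq_reg_l with (INR l); auto. rewrite <- E.
  replace (INR l * (bP m / INR l * (cosT c q 0 + 2 * rsum (theta_dual_even c q m l) (l - 1))))
    with (cosT c q 0 * bP m + 2 * (bP m * rsum (theta_dual_even c q m l) (l - 1))) by (field; auto).
  rewrite rsum_fold; auto.
  - f_equal.
    + unfold x. simpl (INR 0). unfold Rdiv. rewrite Rmult_0_r, Rmult_0_l.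
      now rewrite (bcos_len m K 0 HK).
    + f_equal. rewrite <- rsum_scal. apply rsum_ext. intros i _. unfold theta_dual_even.
      destruct (Nat.ltb_spec (2 * S i) l) as [Hlt|]; [|ring].
      rewrite bcos_closed by (auto; apply angle_range; auto). unfold x. ring.
  - intros i Hi. unfold l at 1. rewrite cosT_reflect by (auto; unfold l in Hi; lia). f_equal.
    unfold x. rewrite minus_INR by lia.
    replace (PI * (INR l - INR i) / INR l) with (PI - PI * INR i / INR l) by (field; auto).
    apply bcos_reflect.
  - intros i Hi. unfold x.
    replace (PI * INR i / INR l) with (PI / 2).
    + rewrite bcos_half by auto. ring.
    + rewrite <- Hi, mult_INR. simpl (INR 2). field. intros E0. apply Hl0. rewrite <- Hi, mult_INR, E0. ring.
Qed.

(** The same double evaluation with [bsin]. An odd [c] pairs with sines only, and sines come from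
    differentiating [bcos], hence the extra weight [N (n + 1)]. *)
Lemma theta_finite_odd q N m c : (1 <= q)%nat -> (1 <= N)%nat -> (1 <= m)%nat ->
  zperiodic q c -> (forall n, c (- n)%Z = - c n) ->
  rsum (fun n => INR (N * S n) * (c (Z.of_nat (S n)) * bw m (N * S n))) m
  = INR m * bP m / INR (q * N) * rsum (theta_dual_odd c q m (q * N)) (q * N - 1).
Proof.
  intros Hq HN Hm Hc He.
  set (l := (q * N)%nat). assert (Hl : (1 <= l)%nat) by (unfold l; nia).
  assert (Hl0 : INR l <> 0) by (apply not_0_INR; lia).
  set (K := (m * N)%nat). assert (HK : (m <= K)%nat) by (unfold K; nia).
  set (x := fun i => PI * INR i / INR l).
  assert (E : rsum (fun i => sinT c q i * bsin m K (x i)) l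
     = INR l * rsum (fun n => INR (N * S n) * (c (Z.of_nat (S n)) * bw m (N * S n))) m).
  { rewrite (rsum_ext _ (fun i =>
       rsum (fun k => INR (S k) * bw m (S k) * (sinT c q i * sin (2 * INR (S k) * x i))) K)).
    - rewrite rsum_swap. unfold x, l.
      rewrite (rsum_ext _ (fun k => INR (q * N) * (if Nat.eqb (S k mod N) 0
              then (fun k => INR k * bw m k * c (Z.of_nat (k / N))) (S k) else 0))).
      + rewrite rsum_scal. unfold K.
        rewrite (rsum_multiples (fun k => INR k * bw m k * c (Z.of_nat (k / N)))) by auto. f_equal.
        apply rsum_ext. intros i _. rewrite (Nat.mul_comm N (S i)), Nat.div_mul by lia. ring.
      + intros k _. rewrite rsum_scal, sinT_inversion by auto. unfold spread.
        destruct (Nat.eqb (S k mod N) 0); ring.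
    - intros i _. unfold bsin. rewrite <- rsum_scal. apply rsum_ext. intros; ring. }
  apply Rmult_eq_reg_l with (2 * INR l); [|lra]. rewrite Rmult_assoc, <- E.
  replace (2 * INR l * (INR m * bP m / INR l * rsum (theta_dual_odd c q m l) (l - 1)))
    with (2 * (INR m * bP m * rsum (theta_dual_odd c q m l) (l - 1))) by (field; auto).
  rewrite rsum_fold; auto.
  - assert (Z0 : bsin m K (x 0%nat) = 0).
    { unfold x, bsin. apply rsum_zero. intros k _. simpl (INR 0). unfold Rdiv.
      rewrite Rmult_0_r, Rmult_0_l, Rmult_0_r, sin_0. ring. }
    rewrite Z0, Rmult_0_r, Rplus_0_l. f_equal. rewrite <- !rsum_scal. apply rsum_ext.
    intros i _. unfold theta_dual_odd.
    destruct (Nat.ltb_spec (2 * S i) l) as [Hlt|]; [|ring].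
    replace (2 * (sinT c q (S i) * bsin m K (x (S i))))
      with (sinT c q (S i) * (2 * bsin m K (x (S i)))) by ring.
    rewrite bsin_closed by (auto; apply angle_range; auto). unfold x. ring.
  - intros i Hi. unfold l at 1. rewrite sinT_reflect by (auto; unfold l in Hi; lia).
    unfold x. rewrite minus_INR by lia.
    replace (PI * (INR l - INR i) / INR l) with (PI - PI * INR i / INR l) by (field; auto).
    rewrite bsin_reflect. ring.
  - intros i Hi. unfold x.
    replace (PI * INR i / INR l) with (PI / 2).
    + assert (S0 : sinT c q i = 0).
      { pose proof (sinT_reflect c q N i Hq ltac:(unfold l in Hi; lia)) as R0.
        replace (q * N - i)%nat with i in R0 by (unfold l in Hi; lia). lra. }
      rewrite S0. ring.
    + rewrite <- Hi, mult_INR. simpl (INR 2). field. intros E0. apply Hl0. rewrite <- Hi, mult_INR, E0. ring.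
Qed.

(** * Elementary bounds for exponentials and cosines *)

Lemma exp_nat_mult n x : exp (INR n * x) = exp x ^ n.
Proof.
  induction n as [|n IH]; [simpl; now rewrite Rmult_0_l, exp_0|].
  rewrite S_INR, Rmult_plus_distr_r, Rmult_1_l, exp_plus, IH. simpl. ring.
Qed.

Lemma exp_le_mono x y : x <= y -> exp x <= exp y.
Proof. intros [H| ->]; [left; now apply exp_increasing|lra]. Qed.

(** The [k]-th power of [x / k <= exp (x / k)], inverted. It supplies the polynomial majorants of
    Gaussian and exponential terms. *)
Lemma exp_neg_le_pow k x : 0 < x -> exp (- x) <= INR k ^ k / x ^ k.
Proof.
  intros Hx. destruct k as [|k].
  - simpl. rewrite Rdiv_1_r. rewrite <- exp_0. apply exp_le_mono. lra.
  - assert (Hk : 0 < INR (S k)) by (apply lt_0_INR; lia).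
    rewrite exp_Ropp. unfold Rdiv.
    replace x with (INR (S k) * (x / INR (S k))) at 1 by (field; lra).
    rewrite exp_nat_mult.
    assert (Hq : 0 < x / INR (S k)) by (apply Rdiv_lt_0_compat; auto).
    assert (P : (x / INR (S k)) ^ S k <= exp (x / INR (S k)) ^ S k).
    { apply pow_incr. pose proof (exp_ge_1_plus (x / INR (S k))). lra. }
    replace (INR (S k) ^ S k * / x ^ S k) with (/ ((x / INR (S k)) ^ S k)).
    + apply Rinv_le_contravar; auto. now apply pow_lt.
    + unfold Rdiv. rewrite Rpow_mult_distr, pow_inv, Rinv_mult, Rinv_inv. ring.
Qed.

Lemma ex_series_inv_sq : ex_series (fun n => / INR (S n) ^ 2).
Proof.
  apply ex_series_nonneg_bounded with 2.
  - intros n. left. apply Rinv_0_lt_compat, pow_lt, lt_0_INR. lia.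
  - intros n. destruct n as [|n]; [simpl; lra|].
    apply Rle_trans with (2 - / INR (S n)).
    + induction n as [|n IH]; [simpl; lra|].
      change (rsum (fun n => / INR (S n) ^ 2) (S (S n)))
        with (rsum (fun n => / INR (S n) ^ 2) (S n) + / INR (S (S n)) ^ 2).
      eapply Rle_trans; [apply Rplus_le_compat_r, IH|].
      rewrite (S_INR (S n)). set (x := INR (S n)).
      assert (Hx : 1 <= x) by (unfold x; rewrite S_INR; pose proof (pos_INR n); lra).
      assert (/ (x + 1) ^ 2 <= / (x * (x + 1))) by (apply Rinv_le_contravar; nra).
      assert (/ (x * (x + 1)) = / x - / (x + 1)) by (field; lra). lra.
    + assert (0 < / INR (S n)) by (apply Rinv_0_lt_compat, lt_0_INR; lia). lra.
Qed.

Lemma cos_le_exp x : 0 <= x <= PI / 2 -> cos x <= exp (- x ^ 2 / 2 + x ^ 4 / 24).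
Proof.
  intros Hx. eapply Rle_trans; [|apply exp_ge_1_plus].
  (* [pre_cos_bound] asks for an argument in [[-2, 2]], which [PI <= 4] provides on the quarter
     period. *)
  pose proof PI_4 as P4.
  destruct (pre_cos_bound x 0 ltac:(lra) ltac:(lra)) as [_ H].
  unfold cos_approx, cos_term in H. simpl in H. lra.
Qed.

Lemma cos_ge_exp x : 0 <= x <= PI / 2 -> x ^ 2 < 2 ->
  exp (- (x ^ 2 / 2 / (1 - x ^ 2 / 2))) <= cos x.
Proof.
  intros Hx Hx2. set (y := x ^ 2 / 2). assert (Hy : y < 1) by (unfold y; lra).
  apply Rle_trans with (1 - y).
  - rewrite exp_Ropp. apply Rle_trans with (/ (1 + y / (1 - y))); [|right; field; lra].
    apply Rinv_le_contravar; [|apply exp_ge_1_plus].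
    replace (1 + y / (1 - y)) with (/ (1 - y)) by (field; lra).
    apply Rinv_0_lt_compat. lra.
  - pose proof PI_4 as P4.
    destruct (pre_cos_bound x 0 ltac:(lra) ltac:(lra)) as [H _].
    unfold cos_approx, cos_term in H. simpl in H. unfold y. lra.
Qed.

Lemma cos_le_exp_simple x : 0 <= x <= PI / 2 -> cos x <= exp (- (x ^ 2 / 3)).
Proof.
  intros Hx. eapply Rle_trans; [apply cos_le_exp; auto|]. apply exp_le_mono.
  pose proof PI_4. assert (x ^ 2 <= 4) by nra. nra.
Qed.

Lemma is_lim_seq_exp u (l : R) : is_lim_seq u l -> is_lim_seq (fun n => exp (u n)) (exp l).
Proof.
  intros H. apply is_lim_seq_continuous; auto.
  apply derivable_continuous_pt, derivable_pt_exp.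
Qed.

Lemma is_lim_seq_inv' u (l : R) : l <> 0 -> is_lim_seq u l -> is_lim_seq (fun n => / u n) (/ l).
Proof.
  intros Hl H. apply (is_lim_seq_inv u l H). intros E. injection E. auto.
Qed.

Lemma is_lim_seq_scal' u (a l : R) : is_lim_seq u l -> is_lim_seq (fun n => a * u n) (a * l).
Proof. intros H. apply (is_lim_seq_scal_l u a l H). Qed.

Lemma is_lim_seq_opp' u (l : R) : is_lim_seq u l -> is_lim_seq (fun n => - u n) (- l).
Proof. intros H. now apply (is_lim_seq_opp u l). Qed.

Lemma is_lim_seq_eq u (l l' : R) : is_lim_seq u l -> l = l' -> is_lim_seq u l'.
Proof. now intros H <-. Qed.

Lemma is_lim_seq_ev_between (u : nat -> R) (l a b : R) : a < l < b -> is_lim_seq u l ->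
  eventually (fun n => a < u n < b).
Proof.
  intros H Hu. apply is_lim_seq_spec in Hu.
  assert (He : 0 < Rmin (l - a) (b - l)) by (apply Rmin_glb_lt; lra).
  destruct (Hu (mkposreal _ He)) as [N HN]. exists N. intros n Hn. specialize (HN n Hn).
  simpl in HN. apply Rabs_def2 in HN.
  pose proof (Rmin_l (l - a) (b - l)). pose proof (Rmin_r (l - a) (b - l)). lra.
Qed.

(* The regime [m ~ tau N^2], in which [bw m (N k)] tends to [exp (- k^2 / tau)]. *)
Record scaling (N m : nat -> nat) (tau : R) : Prop := {
  sc_N : forall j, (1 <= N j)%nat;
  sc_m : forall j, (1 <= m j)%nat;
  sc_tau : 0 < tau;
  sc_N_lim : is_lim_seq (fun j => / INR (N j)) 0;
  sc_mu_lim : is_lim_seq (fun j => INR (m j) / INR (N j) ^ 2) tau }.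

(** * Limits of both sides of the finite identities in the scaling regime *)

Lemma sc_N_pos N m tau : scaling N m tau -> forall j, 0 < INR (N j).
Proof. intros H j. apply lt_0_INR. pose proof (sc_N _ _ _ H j). lia. Qed.

Lemma sc_ev_mu N m tau : scaling N m tau ->
  eventually (fun j => tau / 2 < INR (m j) / INR (N j) ^ 2 < 2 * tau).
Proof.
  intros H. pose proof (sc_tau _ _ _ H).
  apply (is_lim_seq_ev_between _ tau); [lra|]. apply (sc_mu_lim _ _ _ H).
Qed.

Lemma sc_ev_N N m tau x : scaling N m tau -> eventually (fun j => x < INR (N j)).
Proof.
  intros H. assert (Hp : 0 < / (Rabs x + 1)).
  { apply Rinv_0_lt_compat. pose proof (Rabs_pos x). lra. }
  destruct (is_lim_seq_ev_between _ 0 (-1) (/ (Rabs x + 1)) ltac:(lra) (sc_N_lim _ _ _ H)) as [J HJ].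
  exists J. intros j Hj. destruct (HJ j Hj) as [_ H2].
  apply Rinv_lt_cancel in H2; [|apply (sc_N_pos _ _ _ H)].
  pose proof (Rle_abs x). lra.
Qed.

Lemma sc_ev_le N m tau n : scaling N m tau -> eventually (fun j => (N j * n <= m j)%nat).
Proof.
  intros H. pose proof (sc_tau _ _ _ H) as Ht.
  generalize (filter_and _ _ (sc_ev_mu _ _ _ H) (sc_ev_N _ _ _ (2 * INR n / tau) H)).
  apply filter_imp. intros j [[H1 _] H2].
  pose proof (sc_N_pos _ _ _ H j) as Hp.
  apply INR_le. rewrite mult_INR.
  assert (A1 : tau / 2 * INR (N j) ^ 2 < INR (m j)).
  { apply (Rmult_lt_compat_r (INR (N j) ^ 2)) in H1; [|apply pow_lt; auto].
    unfold Rdiv at 2 in H1. rewrite Rmult_assoc, Rinv_l, Rmult_1_r in H1; auto.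
    apply pow_nonzero; lra. }
  assert (A2 : INR n < tau / 2 * INR (N j)).
  { apply (Rmult_lt_compat_l (tau / 2)) in H2; [|lra].
    replace (tau / 2 * (2 * INR n / tau)) with (INR n) in H2 by (field; lra). auto. }
  nra.
Qed.

(** At [k = N n] the exponents [k^2 / (m + k)] and [k^2 / (m + 1 - k)] of the two bounds have the
    common limit [n^2 / tau] after division by [N^2]. *)
Lemma bw_lim N m tau n : scaling N m tau ->
  is_lim_seq (fun j => bw (m j) (N j * n)) (exp (- (INR n ^ 2 / tau))).
Proof.
  intros H. pose proof (sc_tau _ _ _ H) as Ht.
  set (nu := fun j => / INR (N j)). set (mu := fun j => INR (m j) / INR (N j) ^ 2).
  assert (Lnu : is_lim_seq nu 0) by apply (sc_N_lim _ _ _ H).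
  assert (Lmu : is_lim_seq mu tau) by apply (sc_mu_lim _ _ _ H).
  apply is_lim_seq_le_le_loc with
    (u := fun j => exp (- (INR n ^ 2 * / (mu j + nu j * nu j - INR n * nu j))))
    (w := fun j => exp (- (INR n ^ 2 * / (mu j + INR n * nu j)))).
  - generalize (sc_ev_le _ _ _ n H). apply filter_imp. intros j Hj.
    pose proof (sc_N_pos _ _ _ H j) as Hp.
    assert (Hm : 0 < INR (m j)) by (apply lt_0_INR; pose proof (sc_m _ _ _ H j); lia).
    assert (Hle : INR (N j) * INR n <= INR (m j)) by (rewrite <- mult_INR; apply le_INR; auto).
    pose proof (pos_INR n).
    assert (0 <= INR (N j) * INR n) by (apply Rmult_le_pos; lra).
    split.
    + eapply Rle_trans; [|apply bw_lower; auto]. right. f_equal. f_equal.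
      rewrite mult_INR. unfold mu, nu. field. split; lra.
    + eapply Rle_trans; [apply bw_upper; auto|]. right. f_equal. f_equal.
      rewrite mult_INR. unfold mu, nu. field. split; lra.
  - apply is_lim_seq_exp. eapply is_lim_seq_eq.
    + apply (is_lim_seq_opp' _ (INR n ^ 2 * / (tau + 0 * 0 - INR n * 0))).
      apply is_lim_seq_scal', is_lim_seq_inv'; [lra|].
      apply is_lim_seq_minus'; [apply is_lim_seq_plus'; [auto|now apply is_lim_seq_mult']|].
      now apply is_lim_seq_scal'.
    + field. lra.
  - apply is_lim_seq_exp. eapply is_lim_seq_eq.
    + apply (is_lim_seq_opp' _ (INR n ^ 2 * / (tau + INR n * 0))).
      apply is_lim_seq_scal', is_lim_seq_inv'; [lra|].
      apply is_lim_seq_plus'; auto. now apply is_lim_seq_scal'.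
    + field. lra.
Qed.

(** Where the weight is nonzero, [N n <= m < 2 tau N^2], so the denominator [m + N n] of the upper
    bound is below [4 tau N^2]. *)
Lemma bw_dominated N m tau : scaling N m tau ->
  eventually (fun j => forall n, bw (m j) (N j * n) <= exp (- (INR n ^ 2 / (4 * tau)))).
Proof.
  intros H. pose proof (sc_tau _ _ _ H) as Ht.
  generalize (sc_ev_mu _ _ _ H). apply filter_imp. intros j [_ Hmu] n.
  pose proof (sc_N_pos _ _ _ H j) as Hp.
  destruct (le_lt_dec (N j * n) (m j)) as [Hle|Hlt].
  - eapply Rle_trans; [apply bw_upper; auto|]. apply exp_le_mono, Ropp_le_contravar.
    assert (Hm : 0 < INR (m j)) by (apply lt_0_INR; pose proof (sc_m _ _ _ H j); lia).
    assert (Hm2 : INR (m j) < 2 * tau * INR (N j) ^ 2).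
    { apply (Rmult_lt_compat_r (INR (N j) ^ 2)) in Hmu; [|apply pow_lt; auto].
      unfold Rdiv in Hmu. rewrite Rmult_assoc, Rinv_l, Rmult_1_r in Hmu; auto.
      apply pow_nonzero; lra. }
    apply le_INR in Hle. rewrite mult_INR in *. pose proof (pos_INR n).
    assert (0 <= INR (N j) * INR n) by (apply Rmult_le_pos; lra).
    replace (INR n ^ 2 / (4 * tau))
      with ((INR (N j) * INR n) ^ 2 / (4 * tau * INR (N j) ^ 2)) by (field; lra).
    unfold Rdiv. apply Rmult_le_compat_l; [apply pow2_ge_0|].
    apply Rinv_le_contravar; lra.
  - rewrite bw_zero by auto. left. apply exp_pos.
Qed.

Lemma angle_lim N m tau q i : scaling N m tau -> (1 <= q)%nat ->
  is_lim_seq (fun j => PI * INR i / INR (q * N j)) 0.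
Proof.
  intros H Hq. assert (Hq0 : 0 < INR q) by (apply lt_0_INR; lia).
  apply is_lim_seq_ext with (fun j => PI * INR i / INR q * / INR (N j)).
  - intros j. rewrite mult_INR. pose proof (sc_N_pos _ _ _ H j). field. lra.
  - eapply is_lim_seq_eq; [apply is_lim_seq_scal', (sc_N_lim _ _ _ H)|ring].
Qed.

Lemma angle_sq_lim N m tau q i : scaling N m tau -> (1 <= q)%nat ->
  is_lim_seq (fun j => INR (m j) * (PI * INR i / INR (q * N j)) ^ 2)
    ((PI * INR i / INR q) ^ 2 * tau).
Proof.
  intros H Hq. assert (Hq0 : 0 < INR q) by (apply lt_0_INR; lia).
  apply is_lim_seq_ext with (fun j => (PI * INR i / INR q) ^ 2 * (INR (m j) / INR (N j) ^ 2)).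
  - intros j. rewrite mult_INR. pose proof (sc_N_pos _ _ _ H j). field. lra.
  - apply is_lim_seq_scal', (sc_mu_lim _ _ _ H).
Qed.

Lemma sc_ev_index N m tau q i : scaling N m tau -> (1 <= q)%nat ->
  eventually (fun j => (2 * i < q * N j)%nat).
Proof.
  intros H Hq. generalize (sc_ev_N _ _ _ (INR (2 * i)) H). apply filter_imp.
  intros j Hj. apply INR_lt in Hj. nia.
Qed.

(** A power of order [N^2] amplifies errors in the cosine, so it is squeezed between exponentials
    that agree to second order in the angle; the relative corrections are of the size of the squared
    angle and vanish. *)
Lemma cos_pow_lim N m tau q i : scaling N m tau -> (1 <= q)%nat ->
  is_lim_seq (fun j => cos (PI * INR i / INR (q * N j)) ^ (2 * m j))
    (exp (- ((PI * INR i / INR q) ^ 2 * tau))).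
Proof.
  intros H Hq. pose proof PI_4 as P4.
  set (x := fun j => PI * INR i / INR (q * N j)).
  assert (Lx : is_lim_seq x 0) by (apply (angle_lim _ _ _ _ _ H Hq)).
  assert (Lx2 : is_lim_seq (fun j => x j ^ 2) 0).
  { simpl. eapply is_lim_seq_eq; [apply is_lim_seq_mult'; [exact Lx|apply is_lim_seq_mult'; [exact Lx|apply is_lim_seq_const]]|ring]. }
  assert (Ly : is_lim_seq (fun j => INR (m j) * x j ^ 2) ((PI * INR i / INR q) ^ 2 * tau))
    by (apply (angle_sq_lim _ _ _ _ _ H Hq)).
  apply is_lim_seq_le_le_loc with
    (u := fun j => exp (- ((INR (m j) * x j ^ 2) * / (1 - x j ^ 2 * / 2))))
    (w := fun j => exp (- ((INR (m j) * x j ^ 2) * (1 - x j ^ 2 * / 12)))).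
  - generalize (filter_and _ _ (sc_ev_index _ _ _ q i H Hq)
      (is_lim_seq_ev_between _ 0 (-1) 2 ltac:(lra) Lx2)).
    apply filter_imp. intros j [Hj [_ Hx2]].
    destruct (angle_range _ _ Hj) as [X1 X2]. fold (x j) in X1, X2 |- *.
    assert (C0 : 0 < cos (x j)) by (apply cos_gt_0; lra).
    split.
    + replace (- (INR (m j) * x j ^ 2 * / (1 - x j ^ 2 * / 2)))
        with (INR (2 * m j) * (- (x j ^ 2 / 2 / (1 - x j ^ 2 / 2))))
        by (rewrite mult_INR; simpl (INR 2); field; lra).
      rewrite exp_nat_mult. apply pow_incr. split; [left; apply exp_pos|].
      apply cos_ge_exp; lra.
    + replace (- (INR (m j) * x j ^ 2 * (1 - x j ^ 2 * / 12)))
        with (INR (2 * m j) * (- x j ^ 2 / 2 + x j ^ 4 / 24))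
        by (rewrite mult_INR; simpl (INR 2); field).
      rewrite exp_nat_mult. apply pow_incr. split; [lra|].
      apply cos_le_exp; lra.
  - apply is_lim_seq_exp. eapply is_lim_seq_eq.
    + apply (is_lim_seq_opp' _ ((PI * INR i / INR q) ^ 2 * tau * / (1 - 0 * / 2))).
      apply is_lim_seq_mult'; auto. apply is_lim_seq_inv'; [lra|].
      apply is_lim_seq_minus'; [apply is_lim_seq_const|].
      apply is_lim_seq_mult'; [auto|apply is_lim_seq_const].
    + f_equal. rewrite Rmult_0_l, Rminus_0_r, Rinv_1. ring.
  - apply is_lim_seq_exp. eapply is_lim_seq_eq.
    + apply (is_lim_seq_opp' _ ((PI * INR i / INR q) ^ 2 * tau * (1 - 0 * / 12))).
      apply is_lim_seq_mult'; auto.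
      apply is_lim_seq_minus'; [apply is_lim_seq_const|].
      apply is_lim_seq_mult'; [auto|apply is_lim_seq_const].
    + f_equal. rewrite Rmult_0_l, Rminus_0_r. ring.
Qed.

(** Uniform in every exponent [k >= m], in order to serve both [2m] and [2m - 1]. The 6 combines
    [cos x <= exp (- x^2 / 3)] with [m > tau N^2 / 2]. *)
Lemma cos_pow_dominated N m tau q : scaling N m tau -> (1 <= q)%nat ->
  eventually (fun j => forall i k, (2 * i < q * N j)%nat -> (m j <= k)%nat ->
    0 <= cos (PI * INR i / INR (q * N j)) ^ k <= exp (- ((PI * INR i / INR q) ^ 2 * tau / 6))).
Proof.
  intros H Hq. pose proof (sc_tau _ _ _ H) as Ht.
  assert (Hq0 : 0 < INR q) by (apply lt_0_INR; lia).
  generalize (sc_ev_mu _ _ _ H). apply filter_imp. intros j [Hmu _] i k Hi Hk.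
  destruct (angle_range _ _ Hi) as [X1 X2].
  pose proof (sc_N_pos _ _ _ H j) as Hp.
  set (x := PI * INR i / INR (q * N j)) in *.
  assert (C0 : 0 < cos x) by (apply cos_gt_0; lra).
  split; [apply pow_le; lra|].
  apply Rle_trans with (exp (- (x ^ 2 / 3)) ^ k).
  { apply pow_incr. split; [lra|]. apply cos_le_exp_simple. lra. }
  rewrite <- exp_nat_mult. apply exp_le_mono.
  assert (Hm : INR (m j) <= INR k) by (apply le_INR; auto).
  assert (E : x ^ 2 = (PI * INR i / INR q) ^ 2 / INR (N j) ^ 2).
  { unfold x. rewrite mult_INR. field. lra. }
  assert (S1 : 0 <= (PI * INR i / INR q) ^ 2) by apply pow2_ge_0.
  assert (S2 : tau / 2 * x ^ 2 * INR (N j) ^ 2 <= INR k * x ^ 2).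
  { assert (A1 : tau / 2 * INR (N j) ^ 2 < INR (m j)).
    { apply (Rmult_lt_compat_r (INR (N j) ^ 2)) in Hmu; [|apply pow_lt; auto].
      unfold Rdiv at 2 in Hmu. rewrite Rmult_assoc, Rinv_l, Rmult_1_r in Hmu; auto.
      apply pow_nonzero; lra. }
    pose proof (pow2_ge_0 x). nra. }
  replace ((PI * INR i / INR q) ^ 2 * tau / 6) with (tau / 2 * x ^ 2 * INR (N j) ^ 2 / 3)
    by (rewrite E; field; lra).
  lra.
Qed.

Lemma INR_S_ge_1 n : 1 <= INR (S n).
Proof. rewrite S_INR. pose proof (pos_INR n). lra. Qed.

Lemma gauss_bound eta n : 0 < eta ->
  INR (S n) * exp (- (eta * INR (S n) ^ 2)) <= 4 / eta ^ 2 * / INR (S n) ^ 2.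
Proof.
  intros He. pose proof (INR_S_ge_1 n) as H1. set (x := INR (S n)) in *.
  assert (Hx : 0 < eta * x ^ 2) by (apply Rmult_lt_0_compat; [|apply pow_lt]; lra).
  pose proof (exp_neg_le_pow 2 _ Hx) as E. simpl (INR 2) in E.
  apply Rle_trans with (x * ((1 + 1) ^ 2 / (eta * x ^ 2) ^ 2)); [apply Rmult_le_compat_l; lra|].
  replace (x * ((1 + 1) ^ 2 / (eta * x ^ 2) ^ 2)) with (4 / eta ^ 2 * / x ^ 2 * / x)
    by (field; lra).
  assert (/ x <= 1) by (rewrite <- Rinv_1; apply Rinv_le_contravar; lra).
  assert (0 <= 4 / eta ^ 2 * / x ^ 2).
  { apply Rmult_le_pos; [apply Rdiv_le_0_compat; [lra|apply pow_lt; lra]|].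
    left. apply Rinv_0_lt_compat, pow_lt. lra. }
  rewrite <- (Rmult_1_r (4 / eta ^ 2 * / x ^ 2)) at 2. apply Rmult_le_compat_l; lra.
Qed.

Lemma gauss_bound_0 eta n : 0 < eta ->
  exp (- (eta * INR (S n) ^ 2)) <= 4 / eta ^ 2 * / INR (S n) ^ 2.
Proof.
  intros He. eapply Rle_trans; [|apply gauss_bound; auto].
  pose proof (INR_S_ge_1 n). pose proof (exp_pos (- (eta * INR (S n) ^ 2))). nra.
Qed.

Lemma ex_series_inv_sq_scal C : ex_series (fun n => C * / INR (S n) ^ 2).
Proof. apply ex_series_scal_R, ex_series_inv_sq. Qed.

Lemma zperiodic_bounded q c : (1 <= q)%nat -> zperiodic q c ->
  forall z, Rabs (c z) <= rsum (fun b => Rabs (c (Z.of_nat b))) q.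
Proof.
  intros Hq Hc z. rewrite <- (zperiodic_mod q c Hq Hc z).
  assert (Hm : (0 <= z mod Z.of_nat q < Z.of_nat q)%Z) by (apply Z.mod_pos_bound; lia).
  rewrite <- (Z2Nat.id (z mod Z.of_nat q)) by lia.
  set (k := Z.to_nat (z mod Z.of_nat q)). assert (Hk : (k < q)%nat) by lia.
  clearbody k. clear Hm. revert Hk. generalize q. intros n. induction n as [|n IH]; intros Hk; [lia|].
  cbn [rsum]. pose proof (Rabs_pos (c (Z.of_nat n))).
  destruct (Nat.eq_dec k n) as [->|Hne].
  - assert (0 <= rsum (fun b => Rabs (c (Z.of_nat b))) n) by (apply rsum_nonneg; intros; apply Rabs_pos).
    lra.
  - specialize (IH ltac:(lia)). lra.
Qed.

Lemma cosT_bounded q c i : Rabs (cosT c q i) <= rsum (fun b => Rabs (c (Z.of_nat b))) q.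
Proof.
  eapply Rle_trans; [apply rsum_abs|]. apply rsum_le. intros b _.
  rewrite Rabs_mult. pose proof (Rabs_pos (c (Z.of_nat b))).
  pose proof (COS_bound (2 * PI * INR i * INR b / INR q)) as [].
  assert (Rabs (cos (2 * PI * INR i * INR b / INR q)) <= 1) by (apply Rabs_le; lra). nra.
Qed.

Lemma sinT_bounded q c i : Rabs (sinT c q i) <= rsum (fun b => Rabs (c (Z.of_nat b))) q.
Proof.
  eapply Rle_trans; [apply rsum_abs|]. apply rsum_le. intros b _.
  rewrite Rabs_mult. pose proof (Rabs_pos (c (Z.of_nat b))).
  pose proof (SIN_bound (2 * PI * INR i * INR b / INR q)) as [].
  assert (Rabs (sin (2 * PI * INR i * INR b / INR q)) <= 1) by (apply Rabs_le; lra). nra.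
Qed.

Lemma Series_of_finite f n : (forall i, (n <= i)%nat -> f i = 0) -> rsum f n = Series f.
Proof. intros H. symmetry. apply is_series_unique. now apply Series_finite. Qed.

Definition gauss_even (c : Z -> R) (x : R) : R :=
  Series (fun n => c (Z.of_nat (S n)) * exp (- (x * INR (S n) ^ 2))).
Definition gauss_odd (c : Z -> R) (x : R) : R :=
  Series (fun n => INR (S n) * (c (Z.of_nat (S n)) * exp (- (x * INR (S n) ^ 2)))).

Lemma primal_even_lim N m tau q c : scaling N m tau -> (1 <= q)%nat -> zperiodic q c ->
  is_lim_seq (fun j => rsum (fun n => c (Z.of_nat (S n)) * bw (m j) (N j * S n)) (m j))
    (gauss_even c (/ tau)).
Proof.
  intros H Hq Hc. pose proof (sc_tau _ _ _ H) as Ht.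
  set (B := rsum (fun b => Rabs (c (Z.of_nat b))) q).
  assert (HB : forall z, Rabs (c z) <= B) by (apply zperiodic_bounded; auto).
  apply is_lim_seq_ext with
    (fun j => Series (fun n => c (Z.of_nat (S n)) * bw (m j) (N j * S n))).
  { intros j. symmetry. apply Series_of_finite. intros i Hi.
    pose proof (sc_N _ _ _ H j). rewrite bw_zero by nia. ring. }
  apply tannery with (fun n => B * (4 / (/ (4 * tau)) ^ 2 * / INR (S n) ^ 2)).
  - apply ex_series_scal_R, ex_series_inv_sq_scal.
  - generalize (bw_dominated _ _ _ H). apply filter_imp. intros j Hj n.
    rewrite Rabs_mult. pose proof (bw_nonneg (m j) (N j * S n)).
    rewrite (Rabs_pos_eq (bw _ _)) by auto.
    apply Rmult_le_compat; auto using Rabs_pos.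
    eapply Rle_trans; [apply Hj|].
    replace (INR (S n) ^ 2 / (4 * tau)) with (/ (4 * tau) * INR (S n) ^ 2) by (field; lra).
    apply gauss_bound_0. apply Rinv_0_lt_compat. lra.
  - intros n. apply is_lim_seq_scal'.
    eapply is_lim_seq_eq; [apply bw_lim; eauto|]. f_equal. field. lra.
Qed.

Lemma primal_odd_lim N m tau q c : scaling N m tau -> (1 <= q)%nat -> zperiodic q c ->
  is_lim_seq (fun j => rsum (fun n => INR (S n) * (c (Z.of_nat (S n)) * bw (m j) (N j * S n))) (m j))
    (gauss_odd c (/ tau)).
Proof.
  intros H Hq Hc. pose proof (sc_tau _ _ _ H) as Ht.
  set (B := rsum (fun b => Rabs (c (Z.of_nat b))) q).
  assert (HB : forall z, Rabs (c z) <= B) by (apply zperiodic_bounded; auto).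
  apply is_lim_seq_ext with
    (fun j => Series (fun n => INR (S n) * (c (Z.of_nat (S n)) * bw (m j) (N j * S n)))).
  { intros j. symmetry. apply Series_of_finite. intros i Hi.
    pose proof (sc_N _ _ _ H j). rewrite bw_zero by nia. ring. }
  apply tannery with (fun n => B * (4 / (/ (4 * tau)) ^ 2 * / INR (S n) ^ 2)).
  - apply ex_series_scal_R, ex_series_inv_sq_scal.
  - generalize (bw_dominated _ _ _ H). apply filter_imp. intros j Hj n.
    rewrite !Rabs_mult. pose proof (bw_nonneg (m j) (N j * S n)). pose proof (INR_S_ge_1 n).
    rewrite (Rabs_pos_eq (bw _ _)) by auto. rewrite (Rabs_pos_eq (INR (S n))) by lra.
    replace (INR (S n) * (Rabs (c (Z.of_nat (S n))) * bw (m j) (N j * S n)))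
      with (Rabs (c (Z.of_nat (S n))) * (INR (S n) * bw (m j) (N j * S n))) by ring.
    apply Rmult_le_compat; auto using Rabs_pos; [apply Rmult_le_pos; lra|].
    eapply Rle_trans; [apply Rmult_le_compat_l; [lra|apply Hj]|].
    replace (INR (S n) ^ 2 / (4 * tau)) with (/ (4 * tau) * INR (S n) ^ 2) by (field; lra).
    apply gauss_bound. apply Rinv_0_lt_compat. lra.
  - intros n. apply is_lim_seq_scal', is_lim_seq_scal'.
    eapply is_lim_seq_eq; [apply bw_lim; eauto|]. f_equal. field. lra.
Qed.

(** The transform is indexed by naturals, whereas [gauss_even] expects a function on [Z] and reads
    it at positive integers. Negative arguments fall to index 0 and are not sampled. *)
Definition cosTz (c : Z -> R) (q : nat) (z : Z) : R := cosT c q (Z.to_nat z).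
Definition sinTz (c : Z -> R) (q : nat) (z : Z) : R := sinT c q (Z.to_nat z).

Lemma dual_even_lim N m tau q c : scaling N m tau -> (1 <= q)%nat ->
  is_lim_seq (fun j => rsum (theta_dual_even c q (m j) (q * N j)) (q * N j - 1))
    (gauss_even (cosTz c q) (PI ^ 2 * tau / INR q ^ 2)).
Proof.
  intros H Hq. pose proof (sc_tau _ _ _ H) as Ht. pose proof PI_RGT_0 as Hpi.
  assert (Hq0 : 0 < INR q) by (apply lt_0_INR; lia).
  set (B := rsum (fun b => Rabs (c (Z.of_nat b))) q).
  assert (HB : forall i, Rabs (cosT c q i) <= B) by (intros; apply cosT_bounded; auto).
  set (eta := PI ^ 2 * tau / INR q ^ 2 / 6).
  assert (He : 0 < eta).
  { unfold eta. apply Rdiv_lt_0_compat; [|lra]. apply Rdiv_lt_0_compat; [|apply pow_lt; auto].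
    apply Rmult_lt_0_compat; auto. apply pow_lt; auto. }
  assert (HB0 : 0 <= B) by (eapply Rle_trans; [apply Rabs_pos|apply (HB O)]).
  apply is_lim_seq_ext with (fun j => Series (theta_dual_even c q (m j) (q * N j))).
  { intros j. symmetry. apply Series_of_finite. intros i Hi.
    unfold theta_dual_even. destruct (Nat.ltb_spec (2 * S i) (q * N j)); [lia|reflexivity]. }
  apply tannery with (fun n => B * (4 / eta ^ 2 * / INR (S n) ^ 2)).
  - apply ex_series_scal_R, ex_series_inv_sq_scal.
  - generalize (cos_pow_dominated _ _ _ _ H Hq). apply filter_imp. intros j Hj n.
    unfold theta_dual_even. destruct (Nat.ltb_spec (2 * S n) (q * N j)) as [Hlt|_].
    + destruct (Hj (S n) (2 * m j)%nat Hlt ltac:(lia)) as [G1 G2].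
      rewrite Rabs_mult. rewrite (Rabs_pos_eq (cos _ ^ _)) by auto.
      apply Rmult_le_compat; auto using Rabs_pos.
      eapply Rle_trans; [apply G2|].
      replace ((PI * INR (S n) / INR q) ^ 2 * tau / 6) with (eta * INR (S n) ^ 2)
        by (unfold eta; field; lra).
      apply gauss_bound_0; auto.
    + rewrite Rabs_R0. apply Rmult_le_pos; auto. apply Rmult_le_pos.
      * apply Rdiv_le_0_compat; [lra|apply pow_lt; auto].
      * left. apply Rinv_0_lt_compat, pow_lt. pose proof (INR_S_ge_1 n). lra.
  - intros n. apply is_lim_seq_ext_loc with
      (fun j => cosT c q (S n) * cos (PI * INR (S n) / INR (q * N j)) ^ (2 * m j)).
    + generalize (sc_ev_index _ _ _ q (S n) H Hq). apply filter_imp. intros j Hj.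
      unfold theta_dual_even. destruct (Nat.ltb_spec (2 * S n) (q * N j)); [reflexivity|lia].
    + unfold cosTz. rewrite Nat2Z.id. apply is_lim_seq_scal'.
      eapply is_lim_seq_eq; [apply (cos_pow_lim _ _ _ q (S n) H Hq)|].
      f_equal. field. lra.
Qed.

Lemma sin_over_angle_lim N m tau q i : scaling N m tau -> (1 <= q)%nat ->
  is_lim_seq (fun j => INR (N j) * sin (PI * INR (S i) / INR (q * N j))) (PI * INR (S i) / INR q).
Proof.
  intros H Hq. assert (Hq0 : 0 < INR q) by (apply lt_0_INR; lia). pose proof PI_RGT_0 as Hpi.
  pose proof (INR_S_ge_1 i) as Hi.
  set (x := fun j => PI * INR (S i) / INR (q * N j)).
  assert (Hx : forall j, x j <> 0).
  { intros j. unfold x. rewrite mult_INR. pose proof (sc_N_pos _ _ _ H j).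
    apply Rgt_not_eq. apply Rdiv_lt_0_compat; apply Rmult_lt_0_compat; lra. }
  apply is_lim_seq_ext with (fun j => PI * INR (S i) / INR q * (sin (x j) / x j)).
  - intros j. unfold x. rewrite mult_INR. pose proof (sc_N_pos _ _ _ H j).
    field. repeat split; lra.
  - eapply is_lim_seq_eq; [apply is_lim_seq_scal'|].
    + apply (is_lim_comp_seq (fun y => sin y / y) x 0 1 is_lim_sinc_0).
      * exists O. intros j _. specialize (Hx j). intros E. injection E. auto.
      * apply (angle_lim _ _ _ _ _ H Hq).
    + ring.
Qed.

Lemma cos_pow_pred_lim N m tau q i : scaling N m tau -> (1 <= q)%nat ->
  is_lim_seq (fun j => cos (PI * INR i / INR (q * N j)) ^ (2 * m j - 1))
    (exp (- ((PI * INR i / INR q) ^ 2 * tau))).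
Proof.
  intros H Hq.
  apply is_lim_seq_ext_loc with
    (fun j => cos (PI * INR i / INR (q * N j)) ^ (2 * m j) / cos (PI * INR i / INR (q * N j))).
  - generalize (sc_ev_index _ _ _ q i H Hq). apply filter_imp. intros j Hj.
    destruct (angle_range _ _ Hj) as [X1 X2].
    assert (C0 : 0 < cos (PI * INR i / INR (q * N j))) by (apply cos_gt_0; lra).
    pose proof (sc_m _ _ _ H j).
    replace (2 * m j)%nat with (S (2 * m j - 1)) at 1 by lia. simpl pow. field. lra.
  - eapply is_lim_seq_eq; [apply is_lim_seq_div'|].
    + apply (cos_pow_lim _ _ _ q i H Hq).
    + apply (is_lim_seq_continuous cos _ 0); [apply continuity_cos|].
      apply (angle_lim _ _ _ _ _ H Hq).
    + rewrite cos_0. lra.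
    + rewrite cos_0. field.
Qed.

(** The factor [N] compensates [sin (PI i / (q N))], and [N sin x <= N x = PI i / q] provides the
    majorant. *)
Lemma dual_odd_lim N m tau q c : scaling N m tau -> (1 <= q)%nat ->
  is_lim_seq (fun j => INR (N j) * rsum (theta_dual_odd c q (m j) (q * N j)) (q * N j - 1))
    (PI / INR q * gauss_odd (sinTz c q) (PI ^ 2 * tau / INR q ^ 2)).
Proof.
  intros H Hq. pose proof (sc_tau _ _ _ H) as Ht. pose proof PI_RGT_0 as Hpi.
  assert (Hq0 : 0 < INR q) by (apply lt_0_INR; lia).
  set (B := rsum (fun b => Rabs (c (Z.of_nat b))) q).
  assert (HB : forall i, Rabs (sinT c q i) <= B) by (intros; apply sinT_bounded; auto).
  set (eta := PI ^ 2 * tau / INR q ^ 2 / 6).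
  assert (He : 0 < eta).
  { unfold eta. apply Rdiv_lt_0_compat; [|lra]. apply Rdiv_lt_0_compat; [|apply pow_lt; auto].
    apply Rmult_lt_0_compat; auto. apply pow_lt; auto. }
  assert (HB0 : 0 <= B) by (eapply Rle_trans; [apply Rabs_pos|apply (HB O)]).
  unfold gauss_odd. rewrite <- Series_scal_l.
  apply is_lim_seq_ext with (fun j => Series (fun i => INR (N j) * theta_dual_odd c q (m j) (q * N j) i)).
  { intros j. rewrite Series_scal_l. f_equal. symmetry. apply Series_of_finite. intros i Hi.
    unfold theta_dual_odd. destruct (Nat.ltb_spec (2 * S i) (q * N j)); [lia|reflexivity]. }
  apply tannery with (fun n => B * (PI / INR q * (4 / eta ^ 2 * / INR (S n) ^ 2))).
  - apply ex_series_scal_R, ex_series_scal_R, ex_series_inv_sq_scal.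
  - generalize (cos_pow_dominated _ _ _ _ H Hq). apply filter_imp. intros j Hj n.
    pose proof (sc_N_pos _ _ _ H j) as Hp. pose proof (INR_S_ge_1 n) as Hn.
    assert (Hpq : 0 < PI / INR q) by (apply Rdiv_lt_0_compat; auto).
    unfold theta_dual_odd. destruct (Nat.ltb_spec (2 * S n) (q * N j)) as [Hlt|_].
    + destruct (Hj (S n) (2 * m j - 1)%nat Hlt) as [G1 G2].
      { pose proof (sc_m _ _ _ H j). lia. }
      destruct (angle_range _ _ Hlt) as [X1 X2].
      set (x := PI * INR (S n) / INR (q * N j)) in *.
      assert (Hs : 0 <= sin x <= x).
      { split; [apply sin_ge_0; lra|]. destruct X1 as [X1|<-]; [left; now apply sin_lt_x|rewrite sin_0; lra]. }
      assert (HNx : INR (N j) * x = PI / INR q * INR (S n)).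
      { unfold x. rewrite mult_INR. field. lra. }
      rewrite !Rabs_mult. rewrite (Rabs_pos_eq (cos _ ^ _)) by auto.
      rewrite (Rabs_pos_eq (sin x)) by lra. rewrite (Rabs_pos_eq (INR (N j))) by lra.
      replace (INR (N j) * (Rabs (sinT c q (S n)) * (sin x * cos x ^ (2 * m j - 1))))
        with (Rabs (sinT c q (S n)) * (INR (N j) * sin x * cos x ^ (2 * m j - 1))) by ring.
      apply Rmult_le_compat; auto using Rabs_pos.
      { apply Rmult_le_pos; auto. apply Rmult_le_pos; lra. }
      apply Rle_trans with (PI / INR q * INR (S n) * exp (- (eta * INR (S n) ^ 2))).
      * apply Rmult_le_compat; auto; [apply Rmult_le_pos; lra| |].
        -- rewrite <- HNx. apply Rmult_le_compat_l; lra.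
        -- eapply Rle_trans; [apply G2|]. right. f_equal. unfold eta. field. lra.
      * rewrite Rmult_assoc. apply Rmult_le_compat_l; [lra|]. now apply gauss_bound.
    + rewrite Rmult_0_r, Rabs_R0. apply Rmult_le_pos; auto. apply Rmult_le_pos; [lra|].
      apply Rmult_le_pos.
      * apply Rdiv_le_0_compat; [lra|apply pow_lt; auto].
      * left. apply Rinv_0_lt_compat, pow_lt. lra.
  - intros n. apply is_lim_seq_ext_loc with
      (fun j => sinT c q (S n) * ((INR (N j) * sin (PI * INR (S n) / INR (q * N j)))
         * cos (PI * INR (S n) / INR (q * N j)) ^ (2 * m j - 1))).
    + generalize (sc_ev_index _ _ _ q (S n) H Hq). apply filter_imp. intros j Hj.
      unfold theta_dual_odd. destruct (Nat.ltb_spec (2 * S n) (q * N j)); [ring|lia].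
    + unfold sinTz. rewrite Nat2Z.id. eapply is_lim_seq_eq.
      * apply is_lim_seq_scal', is_lim_seq_mult'.
        -- apply (sin_over_angle_lim _ _ _ _ _ H Hq).
        -- apply (cos_pow_pred_lim _ _ _ q (S n) H Hq).
      * replace ((PI * INR (S n) / INR q) ^ 2 * tau) with (PI ^ 2 * tau / INR q ^ 2 * INR (S n) ^ 2)
          by (field; lra). field. lra.
Qed.

(** * The normalising constant [bP] and the limiting theta identities *)

Definition nat_up (x : R) : nat := Z.to_nat (up x).

Lemma nat_up_bounds x : 0 <= x -> x < INR (nat_up x) <= x + 1.
Proof.
  intros Hx. destruct (archimed x) as [H1 H2]. unfold nat_up.
  assert (0 < up x)%Z by (apply lt_IZR; lra).
  rewrite INR_IZR_INZ, Z2Nat.id by lia. lra.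
Qed.

Lemma nat_up_ge_1 x : 0 <= x -> (1 <= nat_up x)%nat.
Proof.
  intros Hx. destruct (nat_up_bounds x Hx) as [H _].
  assert (0 < INR (nat_up x)) by lra.
  destruct (nat_up x); [simpl in *; lra|lia].
Qed.

Lemma inv_INR_S_lim : is_lim_seq (fun n => / INR (S n)) 0.
Proof.
  apply (is_lim_seq_incr_1 (fun n => / INR n)).
  replace (Finite 0) with (Rbar_inv p_infty) by reflexivity.
  apply is_lim_seq_inv; [apply is_lim_seq_INR|discriminate].
Qed.

Lemma cosT_trivial i : cosT (fun _ => 1) 1 i = 1.
Proof. unfold cosT. simpl. unfold Rdiv. rewrite Rmult_0_r, Rmult_0_l, cos_0. ring. Qed.

Definition gauss (x : R) : R := gauss_even (fun _ => 1) x.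

Lemma ex_series_gauss_even q c x : (1 <= q)%nat -> zperiodic q c -> 0 < x ->
  ex_series (fun n => c (Z.of_nat (S n)) * exp (- (x * INR (S n) ^ 2))).
Proof.
  intros Hq Hc Hx. apply ex_series_Rabs_le with
    (fun n => rsum (fun b => Rabs (c (Z.of_nat b))) q * (4 / x ^ 2 * / INR (S n) ^ 2)).
  - intros n. rewrite Rabs_mult, (Rabs_pos_eq (exp _)) by (left; apply exp_pos).
    apply Rmult_le_compat; [apply Rabs_pos|left; apply exp_pos|apply zperiodic_bounded; auto|].
    now apply gauss_bound_0.
  - apply ex_series_scal_R, ex_series_inv_sq_scal.
Qed.

Lemma zperiodic_one : zperiodic 1 (fun _ => 1).
Proof. intros n. reflexivity. Qed.

Lemma gauss_nonneg x : 0 < x -> 0 <= gauss x.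
Proof.
  intros Hx. unfold gauss, gauss_even.
  apply Rle_trans with (rsum (fun n => 1 * exp (- (x * INR (S n) ^ 2))) 0); [simpl; lra|].
  apply rsum_le_Series.
  - intros n. rewrite Rmult_1_l. left. apply exp_pos.
  - apply (ex_series_gauss_even 1 (fun _ => 1)); auto using zperiodic_one.
Qed.

(** The finite identity for [q = 1] and [c = 1] can be solved for [bP m / N]. The limit is a
    quotient of two theta values, which becomes explicit at the self-dual point. *)
Lemma bP_ratio_lim N m tau : scaling N m tau ->
  is_lim_seq (fun j => bP (m j) / INR (N j)) ((1 + 2 * gauss (/ tau)) / (1 + 2 * gauss (PI ^ 2 * tau))).
Proof.
  intros H. pose proof (sc_tau _ _ _ H) as Ht. pose proof PI_RGT_0 as Hpi.
  assert (Hz : cosTz (fun _ => 1) 1 = fun _ => 1) by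
    (apply FunctionalExtensionality.functional_extensionality; intros z; apply cosT_trivial).
  pose proof (primal_even_lim _ _ _ 1 (fun _ => 1) H (le_n _) zperiodic_one) as L1.
  pose proof (dual_even_lim _ _ _ 1 (fun _ => 1) H (le_n _)) as L2.
  rewrite Hz in L2. simpl (INR 1) in L2. rewrite pow1, Rdiv_1_r in L2.
  fold (gauss (/ tau)) in L1. fold (gauss (PI ^ 2 * tau)) in L2.
  assert (G2 : 0 <= gauss (PI ^ 2 * tau)).
  { apply gauss_nonneg, Rmult_lt_0_compat; auto. now apply pow_lt. }
  set (X := fun j => rsum (fun n => 1 * bw (m j) (N j * S n)) (m j)) in *.
  set (Y := fun j => rsum (theta_dual_even (fun _ => 1) 1 (m j) (1 * N j)) (1 * N j - 1)) in *.
  assert (L2' : is_lim_seq (fun j => 1 + 2 * Y j) (1 + 2 * gauss (PI ^ 2 * tau))).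
  { apply is_lim_seq_plus'; [apply is_lim_seq_const|]. now apply is_lim_seq_scal'. }
  apply is_lim_seq_ext_loc with (fun j => (1 + 2 * X j) / (1 + 2 * Y j)).
  - generalize (is_lim_seq_ev_between _ (1 + 2 * gauss (PI ^ 2 * tau)) 0 (2 + 2 * gauss (PI ^ 2 * tau)) ltac:(lra) L2').
    apply filter_imp. intros j [Hj _].
    pose proof (theta_finite_even 1 (N j) (m j) (fun _ => 1) (le_n _) (sc_N _ _ _ H j) (sc_m _ _ _ H j)
      zperiodic_one (fun _ => eq_refl)) as E.
    rewrite cosT_trivial in E. fold (X j) (Y j) in E. rewrite E, Nat.mul_1_l.
    pose proof (sc_N_pos _ _ _ H j). field. lra.
  - apply is_lim_seq_div'; auto; [|lra].
    apply is_lim_seq_plus'; [apply is_lim_seq_const|]. now apply is_lim_seq_scal'.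
Qed.

Lemma inv_sqrt_lim : is_lim_seq (fun m => / sqrt (PI * INR (S m))) 0.
Proof.
  pose proof PI_RGT_0.
  apply is_lim_seq_ext with (fun m => sqrt (/ PI * / INR (S m))).
  - intros m. rewrite <- Rinv_mult. apply sqrt_inv.
  - eapply is_lim_seq_eq; [apply (is_lim_seq_continuous sqrt _ 0)|apply sqrt_0].
    + apply continuity_pt_sqrt. lra.
    + eapply is_lim_seq_eq; [apply is_lim_seq_scal', inv_INR_S_lim|ring].
Qed.

(* Self-duality of the case [q = 1], [tau = 1 / pi] replaces Stirling's formula. *)
Lemma bP_asymptotic : is_lim_seq (fun m => bP (S m) / sqrt (INR (S m))) (sqrt PI).
Proof.
  pose proof PI_RGT_0 as Hpi.
  set (x := fun m => sqrt (PI * INR (S m))).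
  assert (Hx : forall m, 0 < x m).
  { intros m. apply sqrt_lt_R0, Rmult_lt_0_compat; auto. apply lt_0_INR. lia. }
  (* With [N] close to [sqrt (PI m)] the ratio [m / N^2] tends to [1 / PI], the self-dual
     parameter. *)
  set (N := fun m => nat_up (x m)).
  assert (HN : forall m, x m < INR (N m) <= x m + 1).
  { intros m. apply nat_up_bounds. left. apply Hx. }
  assert (Lx : is_lim_seq (fun m => / x m) 0) by apply inv_sqrt_lim.
  assert (Lr : is_lim_seq (fun m => INR (N m) / x m) 1).
  { apply is_lim_seq_le_le with (u := fun _ => 1) (w := fun m => 1 + / x m).
    - intros m. specialize (Hx m). specialize (HN m). split.
      + apply Rmult_le_reg_r with (x m); auto. unfold Rdiv. rewrite Rmult_assoc, Rinv_l by lra. lra.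
      + apply Rmult_le_reg_r with (x m); auto. unfold Rdiv.
        rewrite Rmult_plus_distr_r, Rmult_assoc, Rinv_l by lra. lra.
    - apply is_lim_seq_const.
    - eapply is_lim_seq_eq; [apply is_lim_seq_plus'; [apply is_lim_seq_const|exact Lx]|ring]. }
  assert (Lr' : is_lim_seq (fun m => x m / INR (N m)) 1).
  { apply is_lim_seq_ext with (fun m => / (INR (N m) / x m)).
    - intros m. specialize (Hx m). specialize (HN m). field. lra.
    - eapply is_lim_seq_eq; [apply is_lim_seq_inv'; [|exact Lr]; lra|apply Rinv_1]. }
  assert (Hsc : scaling N S (/ PI)).
  { split.
    - intros m. apply nat_up_ge_1. left. apply Hx.
    - intros m. lia.
    - now apply Rinv_0_lt_compat.
    - apply is_lim_seq_ext with (fun m => x m / INR (N m) * / x m).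
      + intros m. specialize (Hx m). specialize (HN m). field. lra.
      + eapply is_lim_seq_eq; [apply is_lim_seq_mult'; [exact Lr'|exact Lx]|ring].
    - apply is_lim_seq_ext with (fun m => / PI * (x m / INR (N m)) ^ 2).
      + intros m. specialize (Hx m). specialize (HN m).
        assert (E : x m ^ 2 = PI * INR (S m)).
        { unfold x. rewrite pow2_sqrt; auto. apply Rmult_le_pos; [lra|apply pos_INR]. }
        unfold Rdiv at 1. rewrite Rpow_mult_distr, E, pow_inv. field. lra.
      + eapply is_lim_seq_eq; [apply is_lim_seq_scal'|].
        * simpl. apply is_lim_seq_mult'; [exact Lr'|].
          apply is_lim_seq_mult'; [exact Lr'|apply is_lim_seq_const].
        * ring. }
  pose proof (bP_ratio_lim _ _ _ Hsc) as L.
  replace (PI ^ 2 * / PI) with PI in L by (field; lra). rewrite Rinv_inv in L.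
  (* At [tau = 1 / PI] both theta values are taken at [PI], so the quotient is 1. *)
  replace ((1 + 2 * gauss PI) / (1 + 2 * gauss PI)) with 1 in L.
  2: { pose proof (gauss_nonneg PI Hpi). field. lra. }
  apply is_lim_seq_ext with (fun m => bP (S m) / INR (N m) * (INR (N m) / x m) * sqrt PI).
  - intros m. specialize (Hx m). specialize (HN m).
    assert (Hs : 0 < sqrt PI) by (apply sqrt_lt_R0; auto).
    assert (Hs2 : 0 < sqrt (INR (S m))) by (apply sqrt_lt_R0, lt_0_INR; lia).
    assert (E : x m = sqrt PI * sqrt (INR (S m))).
    { unfold x. apply sqrt_mult; [lra|apply pos_INR]. }
    rewrite E. field. repeat split; lra.
  - eapply is_lim_seq_eq.
    + apply is_lim_seq_mult'; [apply is_lim_seq_mult'; [exact L|exact Lr]|apply is_lim_seq_const].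
    + ring.
Qed.

Definition scale_m (tau : R) (j : nat) : nat := nat_up (tau * INR (S j) ^ 2).

Lemma scaling_exists tau : 0 < tau -> scaling S (scale_m tau) tau.
Proof.
  intros Ht.
  assert (Hp : forall j, 0 <= tau * INR (S j) ^ 2).
  { intros j. apply Rmult_le_pos; [lra|apply pow2_ge_0]. }
  split; auto.
  - intros; lia.
  - intros j. now apply nat_up_ge_1.
  - apply inv_INR_S_lim.
  - apply is_lim_seq_le_le with (u := fun _ => tau) (w := fun j => tau + / INR (S j) * / INR (S j)).
    + intros j. destruct (nat_up_bounds _ (Hp j)) as [H1 H2]. fold (scale_m tau j) in H1, H2.
      pose proof (INR_S_ge_1 j). set (y := INR (S j)) in *.
      assert (Hy : 0 < y ^ 2) by (apply pow_lt; lra).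
      split; apply Rmult_le_reg_r with (y ^ 2); auto; unfold Rdiv;
        rewrite ?Rmult_plus_distr_r, Rmult_assoc.
      * rewrite Rinv_l by lra. lra.
      * rewrite Rinv_l by lra. replace (/ y * / y * y ^ 2) with 1 by (field; lra). lra.
    + apply is_lim_seq_const.
    + eapply is_lim_seq_eq.
      * apply is_lim_seq_plus'; [apply is_lim_seq_const|].
        apply is_lim_seq_mult'; apply inv_INR_S_lim.
      * ring.
Qed.

(** Combines [bP m ~ sqrt (PI m)] with [m ~ tau N^2]. The predecessor appears because the
    asymptotics are stated along [S m]. *)
Lemma bP_scale_lim tau : 0 < tau ->
  is_lim_seq (fun j => bP (scale_m tau j) / INR (S j)) (sqrt (PI * tau)).
Proof.
  intros Ht. pose proof PI_RGT_0 as Hpi. pose proof (scaling_exists tau Ht) as H.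
  apply is_lim_seq_ext with (fun j =>
    bP (S (pred (scale_m tau j))) / sqrt (INR (S (pred (scale_m tau j))))
    * sqrt (INR (scale_m tau j) / INR (S j) ^ 2)).
  - intros j. pose proof (sc_m _ _ _ H j) as Hm.
    replace (S (pred (scale_m tau j))) with (scale_m tau j) by lia.
    pose proof (INR_S_ge_1 j). set (y := INR (S j)) in *.
    assert (Hs : 0 < INR (scale_m tau j)) by (apply lt_0_INR; lia).
    rewrite sqrt_div by (try (apply pow_lt); lra). rewrite sqrt_pow2 by lra.
    assert (0 < sqrt (INR (scale_m tau j))) by (apply sqrt_lt_R0; auto).
    field. lra.
  - rewrite sqrt_mult by lra. apply is_lim_seq_mult'.
    + apply (is_lim_seq_subseq (fun m => bP (S m) / sqrt (INR (S m))) (sqrt PI)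
               (fun j => pred (scale_m tau j))); [|apply bP_asymptotic].
      intros P [K HK].
      generalize (sc_ev_le _ _ _ (S K) H). intros [J HJ].
      exists J. intros j Hj. apply HK. specialize (HJ j Hj). nia.
    + apply (is_lim_seq_continuous sqrt _ tau); [apply continuity_pt_sqrt; lra|].
      apply (sc_mu_lim _ _ _ H).
Qed.

(** Both sides of [theta_finite_even] converge along one scaling sequence, so their limits agree.
    For [q = 1] and [c = 1] this is Jacobi's inversion formula. *)
Theorem theta_identity_even q c tau : (1 <= q)%nat -> zperiodic q c ->
  (forall n, c (- n)%Z = c n) -> 0 < tau ->
  c 0%Z + 2 * gauss_even c (/ tau)
  = sqrt (PI * tau) / INR q * (cosT c q 0 + 2 * gauss_even (cosTz c q) (PI ^ 2 * tau / INR q ^ 2)).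
Proof.
  intros Hq Hc He Ht. pose proof (scaling_exists tau Ht) as H.
  assert (Hq0 : 0 < INR q) by (apply lt_0_INR; lia).
  assert (L1 : is_lim_seq (fun j => c 0%Z + 2 * rsum (fun n => c (Z.of_nat (S n)) * bw (scale_m tau j) (S j * S n)) (scale_m tau j))
     (c 0%Z + 2 * gauss_even c (/ tau))).
  { apply is_lim_seq_plus'; [apply is_lim_seq_const|]. apply is_lim_seq_scal'.
    apply (primal_even_lim _ _ _ q c H Hq Hc). }
  assert (L2 : is_lim_seq (fun j => c 0%Z + 2 * rsum (fun n => c (Z.of_nat (S n)) * bw (scale_m tau j) (S j * S n)) (scale_m tau j))
     (sqrt (PI * tau) * / INR q * (cosT c q 0 + 2 * gauss_even (cosTz c q) (PI ^ 2 * tau / INR q ^ 2)))).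
  { apply is_lim_seq_ext with (fun j => bP (scale_m tau j) / INR (S j) * / INR q *
      (cosT c q 0 + 2 * rsum (theta_dual_even c q (scale_m tau j) (q * S j)) (q * S j - 1))).
    - intros j. rewrite theta_finite_even with (q := q)
        by (auto; try lia; apply (sc_m _ _ _ H)).
      rewrite mult_INR. f_equal. pose proof (INR_S_ge_1 j). field. lra.
    - apply is_lim_seq_mult'.
      + apply is_lim_seq_mult'; [now apply bP_scale_lim|apply is_lim_seq_const].
      + apply is_lim_seq_plus'; [apply is_lim_seq_const|]. apply is_lim_seq_scal'.
        apply (dual_even_lim _ _ _ q c H Hq). }
  apply is_lim_seq_unique in L1. apply is_lim_seq_unique in L2.
  rewrite L1 in L2. now apply Rbar_finite_eq in L2.
Qed.

Theorem theta_identity_odd q c tau : (1 <= q)%nat -> zperiodic q c ->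
  (forall n, c (- n)%Z = - c n) -> 0 < tau ->
  gauss_odd c (/ tau)
  = tau * sqrt (PI * tau) * PI / INR q ^ 2 * gauss_odd (sinTz c q) (PI ^ 2 * tau / INR q ^ 2).
Proof.
  intros Hq Hc He Ht. pose proof (scaling_exists tau Ht) as H.
  assert (Hq0 : 0 < INR q) by (apply lt_0_INR; lia).
  pose proof (primal_odd_lim _ _ _ q c H Hq Hc) as L1.
  assert (L2 : is_lim_seq (fun j => rsum (fun n => INR (S n) * (c (Z.of_nat (S n)) * bw (scale_m tau j) (S j * S n))) (scale_m tau j))
     (tau * (sqrt (PI * tau) * / INR q * (PI / INR q * gauss_odd (sinTz c q) (PI ^ 2 * tau / INR q ^ 2))))).
  { apply is_lim_seq_ext with (fun j => INR (scale_m tau j) / INR (S j) ^ 2 * (bP (scale_m tau j) / INR (S j) * / INR q *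
      (INR (S j) * rsum (theta_dual_odd c q (scale_m tau j) (q * S j)) (q * S j - 1)))).
    - intros j. pose proof (INR_S_ge_1 j) as Hj.
      pose proof (theta_finite_odd q (S j) (scale_m tau j) c Hq ltac:(lia) (sc_m _ _ _ H j) Hc He) as E.
      rewrite (rsum_ext _ (fun n => INR (S j) * (INR (S n) * (c (Z.of_nat (S n)) * bw (scale_m tau j) (S j * S n))))) in E.
      2: { intros i _. rewrite mult_INR. ring. }
      rewrite rsum_scal in E. apply Rmult_eq_reg_l with (INR (S j)); [|lra]. rewrite E.
      rewrite mult_INR. field. lra.
    - apply is_lim_seq_mult'; [apply (sc_mu_lim _ _ _ H)|]. apply is_lim_seq_mult'.
      + apply is_lim_seq_mult'; [now apply bP_scale_lim|apply is_lim_seq_const].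
      + apply (dual_odd_lim _ _ _ q c H Hq). }
  apply is_lim_seq_unique in L1. apply is_lim_seq_unique in L2.
  rewrite L1 in L2. apply Rbar_finite_eq in L2. rewrite L2. field. lra.
Qed.

(** * Integrals over a half line *)

Definition cont (f : R -> R) : Prop := forall x, continuous f x.

Lemma cont_ex_RInt f a b : cont f -> ex_RInt f a b.
Proof. intros H. apply (ex_RInt_continuous (V := R_CompleteNormedModule)). intros; apply H. Qed.

Lemma cont_const c : cont (fun _ => c).
Proof. intros x. apply continuous_const. Qed.
Lemma cont_id : cont (fun x => x).
Proof. intros x. apply continuous_id. Qed.
Lemma cont_plus f g : cont f -> cont g -> cont (fun x => f x + g x).
Proof. intros Hf Hg x. apply (continuous_plus f g); auto. Qed.
Lemma cont_minus f g : cont f -> cont g -> cont (fun x => f x - g x).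
Proof. intros Hf Hg x. apply (continuous_minus f g); auto. Qed.
Lemma cont_mult f g : cont f -> cont g -> cont (fun x => f x * g x).
Proof. intros Hf Hg x. apply (continuous_mult f g); auto. Qed.
Lemma cont_comp f g : cont f -> cont g -> cont (fun x => g (f x)).
Proof. intros Hf Hg x. apply (continuous_comp f g); auto. Qed.
Lemma cont_exp : cont exp.
Proof. intros x. apply continuous_exp. Qed.
Lemma cont_opp : cont (fun x => - x).
Proof. intros x. apply (ex_derive_continuous (fun x => - x)). auto_derive. auto. Qed.
Lemma cont_Rabs : cont Rabs.
Proof. intros x. apply continuous_Rabs. Qed.

Lemma cont_ext f g : (forall x, f x = g x) -> cont f -> cont g.
Proof. intros E H x. apply continuous_ext with f; auto. Qed.

Create HintDb cont.
#[export] Hint Resolve cont_const cont_id cont_plus cont_minus cont_mult cont_exp cont_opp cont_Rabs : cont.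

Lemma cont_exp_lin a : cont (fun x => exp (a * x)).
Proof. apply (cont_comp (fun x => a * x) exp); auto with cont. Qed.
#[export] Hint Resolve cont_exp_lin : cont.

(** Continuity with exponential decay is a class stable under the operations used below: shifts,
    convolution, multiplication by small exponentials or by the variable. It also gives explicit
    tails, so improper integrals become limits along the integers. *)
Definition hbound (eta C : R) (f : R -> R) : Prop :=
  forall x, 0 <= x -> Rabs (f x) <= C * exp (- eta * x).
Definition ibound (eta C : R) (f : R -> R) : Prop :=
  forall x, Rabs (f x) <= C * exp (- eta * Rabs x).
Definition hgood f := cont f /\ exists eta C, 0 < eta /\ hbound eta C f.
Definition igood f := cont f /\ exists eta C, 0 < eta /\ ibound eta C f.

Lemma hbound_nonneg eta C f : hbound eta C f -> 0 <= C.
Proof.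
  intros H. specialize (H 0 (Rle_refl 0)). rewrite Rmult_0_r, exp_0 in H.
  pose proof (Rabs_pos (f 0)). lra.
Qed.

Lemma ibound_nonneg eta C f : ibound eta C f -> 0 <= C.
Proof.
  intros H. specialize (H 0). rewrite Rabs_R0, Rmult_0_r, exp_0 in H.
  pose proof (Rabs_pos (f 0)). lra.
Qed.

Lemma ibound_hbound eta C f : ibound eta C f -> hbound eta C f.
Proof. intros H x Hx. rewrite <- (Rabs_pos_eq x Hx) at 2. apply H. Qed.

Lemma ibound_opp eta C f : ibound eta C f -> ibound eta C (fun x => f (- x)).
Proof. intros H x. rewrite <- (Rabs_Ropp x). apply H. Qed.

Lemma igood_hgood f : igood f -> hgood f.
Proof. intros [H [e [C [He HC]]]]. split; auto. exists e, C. split; auto using ibound_hbound. Qed.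

Lemma igood_opp f : igood f -> igood (fun x => f (- x)).
Proof.
  intros [H [e [C [He HC]]]]. split.
  - apply (cont_comp (fun x => - x) f); auto with cont.
  - exists e, C. split; auto using ibound_opp.
Qed.

Lemma RInt_exp_neg eta a b : eta <> 0 ->
  RInt (fun x => exp (- eta * x)) a b = (exp (- eta * a) - exp (- eta * b)) / eta.
Proof.
  intros He. apply is_RInt_unique.
  replace ((exp (- eta * a) - exp (- eta * b)) / eta)
    with (minus (- exp (- eta * b) / eta) (- exp (- eta * a) / eta))
    by (unfold minus, plus, opp; simpl; field; auto).
  apply (is_RInt_derive (fun x => - exp (- eta * x) / eta) (fun x => exp (- eta * x))).
  - intros x _. auto_derive; auto. field. auto.
  - intros x _. apply cont_exp_lin.
Qed.

Lemma RInt_tail eta C f a b : cont f -> 0 < eta -> hbound eta C f -> 0 <= a <= b ->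
  Rabs (RInt f a b) <= C / eta * exp (- eta * a).
Proof.
  intros Hf He HC Hab. pose proof (hbound_nonneg _ _ _ HC) as HC0.
  apply Rle_trans with (RInt (fun x => C * exp (- eta * x)) a b).
  - eapply Rle_trans; [apply abs_RInt_le; [lra|now apply cont_ex_RInt]|].
    apply RInt_le; [lra| | |].
    + apply cont_ex_RInt. apply (cont_comp f Rabs); auto with cont.
    + apply cont_ex_RInt. auto with cont.
    + intros x Hx. apply HC. lra.
  - rewrite (RInt_scal (V := R_CompleteNormedModule)) by (apply cont_ex_RInt; auto with cont).
    unfold scal; simpl; unfold mult; simpl.
    rewrite RInt_exp_neg by lra. unfold Rdiv. rewrite Rmult_assoc. apply Rmult_le_compat_l; auto.
    rewrite Rmult_comm. apply Rmult_le_compat_l; [left; now apply Rinv_0_lt_compat|].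
    pose proof (exp_pos (- eta * b)). lra.
Qed.

(* Meaningful on [hgood], respectively [igood], functions only: [Lim_seq] and [real] are total. *)
Definition Hint (f : R -> R) : R := real (Lim_seq (fun n => RInt f 0 (INR n))).
Definition Int (f : R -> R) : R := Hint f + Hint (fun x => f (- x)).

Lemma RInt_Chasles_cont f a b c : cont f -> RInt f a b + RInt f b c = RInt f a c.
Proof. intros H. apply (RInt_Chasles f a b c); now apply cont_ex_RInt. Qed.

Lemma RInt_diff_cont f a b c : cont f -> RInt f a c - RInt f a b = RInt f b c.
Proof.
  intros H. rewrite <- (RInt_Chasles_cont f a b c H).
  generalize (RInt f a b) (RInt f b c). intros u v. change (u + v - u = v :> R). ring.
Qed.

Lemma exp_decay_lim eta : 0 < eta -> is_lim_seq (fun n => exp (- eta * INR n)) 0.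
Proof.
  intros He. apply is_lim_seq_le_le_loc with (u := fun _ => 0) (w := fun n => / eta * / INR n).
  - exists 1%nat. intros n Hn. split; [left; apply exp_pos|].
    assert (Hx : 0 < eta * INR n) by (apply Rmult_lt_0_compat; auto; apply lt_0_INR; lia).
    pose proof (exp_neg_le_pow 1 _ Hx) as E. simpl in E.
    replace (- eta * INR n) with (- (eta * INR n)) by ring.
    eapply Rle_trans; [apply E|]. right. field. split; nra.
  - apply is_lim_seq_const.
  - eapply is_lim_seq_eq; [apply is_lim_seq_scal'|].
    + apply is_lim_seq_incr_1. apply inv_INR_S_lim.
    + ring.
Qed.

Lemma Hint_lim f : hgood f -> is_lim_seq (fun n => RInt f 0 (INR n)) (Hint f).
Proof.
  intros [Hf [e [C [He HC]]]].
  apply Lim_seq_correct'. apply ex_lim_seq_cauchy_corr.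
  intros eps. pose proof (hbound_nonneg _ _ _ HC) as HC0.
  assert (L : is_lim_seq (fun n => C / e * exp (- e * INR n)) 0).
  { eapply is_lim_seq_eq; [apply is_lim_seq_scal', exp_decay_lim; auto|ring]. }
  destruct (proj1 (is_lim_seq_eps _ _) L (eps / 2)) as [N HN]; [destruct eps; simpl; lra|].
  assert (G : forall n, (N <= n)%nat -> Rabs (RInt f 0 (INR n) - RInt f 0 (INR N)) < eps / 2).
  { intros n Hn. rewrite RInt_diff_cont by auto.
    eapply Rle_lt_trans; [apply (RInt_tail e C); auto|].
    - split; [apply pos_INR|now apply le_INR].
    - specialize (HN N (le_n _)). rewrite Rminus_0_r in HN.
      eapply Rle_lt_trans; [apply Rle_abs|exact HN]. }
  exists N. intros n m Hn Hm.
  pose proof (G n Hn) as G1. pose proof (G m Hm) as G2.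
  apply Rabs_def2 in G1. apply Rabs_def2 in G2. apply Rabs_def1; lra.
Qed.

Lemma Hint_unique f (l : R) : is_lim_seq (fun n => RInt f 0 (INR n)) l -> Hint f = l.
Proof. intros H. unfold Hint. now rewrite (is_lim_seq_unique _ _ H). Qed.

Lemma Hint_tail eta C f X : cont f -> 0 < eta -> hbound eta C f -> 0 <= X ->
  Rabs (Hint f - RInt f 0 X) <= C / eta * exp (- eta * X).
Proof.
  intros Hf He HC HX.
  assert (Hg : hgood f) by (split; auto; exists eta, C; auto).
  assert (L : is_lim_seq (fun n => Rabs (RInt f 0 (INR n) - RInt f 0 X)) (Rabs (Hint f - RInt f 0 X))).
  { apply (is_lim_seq_abs (fun n => RInt f 0 (INR n) - RInt f 0 X) (Hint f - RInt f 0 X)).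
    apply is_lim_seq_minus'; [now apply Hint_lim|apply is_lim_seq_const]. }
  apply (is_lim_seq_le_loc _ (fun _ => C / eta * exp (- eta * X)) _
    (C / eta * exp (- eta * X))) in L; [exact L| |apply is_lim_seq_const].
  exists (nat_up X). intros n Hn.
  rewrite RInt_diff_cont by auto.
  apply RInt_tail; auto. split; auto.
  destruct (nat_up_bounds X HX) as [H _]. apply le_INR in Hn. lra.
Qed.

Lemma Hint_abs_le eta C f : cont f -> 0 < eta -> hbound eta C f -> Rabs (Hint f) <= C / eta.
Proof.
  intros Hf He HC. pose proof (Hint_tail eta C f 0 Hf He HC (Rle_refl 0)) as H.
  rewrite RInt_point, Rmult_0_r, exp_0 in H. unfold zero in H; simpl in H.
  rewrite Rminus_0_r, Rmult_1_r in H. exact H.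
Qed.

Lemma hgood_plus f g : hgood f -> hgood g -> hgood (fun x => f x + g x).
Proof.
  intros [Hf [e [C [He HC]]]] [Hg [e' [C' [He' HC']]]]. split; auto with cont.
  pose proof (hbound_nonneg _ _ _ HC). pose proof (hbound_nonneg _ _ _ HC').
  exists (Rmin e e'), (C + C'). split; [now apply Rmin_glb_lt|].
  intros x Hx. eapply Rle_trans; [apply Rabs_triang|].
  rewrite Rmult_plus_distr_r. pose proof (Rmin_l e e'). pose proof (Rmin_r e e').
  apply Rplus_le_compat.
  - eapply Rle_trans; [now apply HC|]. apply Rmult_le_compat_l; auto. apply exp_le_mono. nra.
  - eapply Rle_trans; [now apply HC'|]. apply Rmult_le_compat_l; auto. apply exp_le_mono. nra.
Qed.

Lemma hgood_scal c f : hgood f -> hgood (fun x => c * f x).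
Proof.
  intros [Hf [e [C [He HC]]]]. split; auto with cont.
  exists e, (Rabs c * C). split; auto. intros x Hx. rewrite Rabs_mult, Rmult_assoc.
  apply Rmult_le_compat_l; [apply Rabs_pos|now apply HC].
Qed.

Lemma hgood_le f g : cont f -> hgood g -> (forall x, 0 <= x -> Rabs (f x) <= g x) -> hgood f.
Proof.
  intros Hf [_ [e [C [He HC]]]] H. split; auto. exists e, C. split; auto.
  intros x Hx. eapply Rle_trans; [now apply H|]. eapply Rle_trans; [apply Rle_abs|now apply HC].
Qed.

Lemma hgood_exp e : 0 < e -> hgood (fun x => exp (- e * x)).
Proof.
  intros He. split; [apply cont_exp_lin|]. exists e, 1. split; auto.
  intros x _. rewrite Rabs_pos_eq by (left; apply exp_pos). lra.
Qed.

Lemma Hint_plus f g : hgood f -> hgood g -> Hint (fun x => f x + g x) = Hint f + Hint g.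
Proof.
  intros Hf Hg. apply Hint_unique.
  apply is_lim_seq_ext with (fun n => RInt f 0 (INR n) + RInt g 0 (INR n)).
  - intros n. symmetry. apply (RInt_plus f g); apply cont_ex_RInt; [apply Hf|apply Hg].
  - apply is_lim_seq_plus'; now apply Hint_lim.
Qed.

Lemma Hint_scal c f : hgood f -> Hint (fun x => c * f x) = c * Hint f.
Proof.
  intros Hf. apply Hint_unique.
  apply is_lim_seq_ext with (fun n => c * RInt f 0 (INR n)).
  - intros n. symmetry. apply (RInt_scal f 0 (INR n) c). apply cont_ex_RInt, Hf.
  - apply is_lim_seq_scal'. now apply Hint_lim.
Qed.

Lemma Hint_minus f g : hgood f -> hgood g -> Hint (fun x => f x - g x) = Hint f - Hint g.
Proof.
  intros Hf Hg. apply Hint_unique.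
  apply is_lim_seq_ext with (fun n => RInt f 0 (INR n) - RInt g 0 (INR n)).
  - intros n. symmetry. apply (RInt_minus f g); apply cont_ex_RInt; [apply Hf|apply Hg].
  - apply is_lim_seq_minus'; now apply Hint_lim.
Qed.

Lemma Hint_ext f g : (forall x, 0 <= x -> f x = g x) -> Hint f = Hint g.
Proof.
  intros H. unfold Hint. f_equal. apply Lim_seq_ext. intros n.
  apply RInt_ext. rewrite Rmin_left by apply pos_INR. intros x Hx. apply H. lra.
Qed.

Lemma Hint_le f g : hgood f -> hgood g -> (forall x, 0 <= x -> f x <= g x) -> Hint f <= Hint g.
Proof.
  intros Hf Hg H.
  apply (is_lim_seq_le _ _ (Hint f) (Hint g) (fun n => RInt_le f g 0 (INR n) (pos_INR n)
     (cont_ex_RInt _ _ _ (proj1 Hf)) (cont_ex_RInt _ _ _ (proj1 Hg)) (fun x Hx => H x (Rlt_le _ _ (proj1 Hx)))));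
   now apply Hint_lim.
Qed.

Lemma Hint_zero : Hint (fun _ => 0) = 0.
Proof.
  apply Hint_unique. apply is_lim_seq_ext with (fun _ => 0); [|apply is_lim_seq_const].
  intros n. rewrite RInt_const. unfold scal; simpl; unfold mult; simpl. ring.
Qed.

Lemma hgood_zero : hgood (fun _ => 0).
Proof.
  split; auto with cont. exists 1, 0. split; [lra|]. intros x _. rewrite Rabs_R0. lra.
Qed.

Lemma Hint_nonneg f : hgood f -> (forall x, 0 <= x -> 0 <= f x) -> 0 <= Hint f.
Proof. intros Hf H. rewrite <- Hint_zero. apply Hint_le; auto using hgood_zero. Qed.

Lemma Hint_pos f : hgood f -> (forall x, 0 < x -> 0 < f x) -> 0 < Hint f.
Proof.
  intros Hf H.
  assert (H1 : 0 < RInt f 0 1).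
  { apply RInt_gt_0; [lra|intros x Hx; apply H; lra|intros x _; apply Hf]. }
  apply Rlt_le_trans with (RInt f 0 1); auto.
  apply (is_lim_seq_le_loc (fun _ => RInt f 0 1) (fun n => RInt f 0 (INR n)) (RInt f 0 1) (Hint f));
    [|apply is_lim_seq_const|now apply Hint_lim].
  exists 1%nat. intros n Hn. rewrite <- (RInt_Chasles_cont f 0 1 (INR n)) by apply Hf.
  assert (0 <= RInt f 1 (INR n)).
  { apply RInt_ge_0; [apply (le_INR 1); auto|apply cont_ex_RInt, Hf|].
    intros x Hx. left. apply H. lra. }
  lra.
Qed.

Lemma Hint_derive f df eta C : (forall x, is_derive f x (df x)) -> hgood df ->
  0 < eta -> hbound eta C f -> Hint df = - f 0.
Proof.
  intros Hd Hg He HC. apply Hint_unique.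
  apply is_lim_seq_ext with (fun n => f (INR n) - f 0).
  - intros n. symmetry. apply is_RInt_unique. apply (is_RInt_derive f df).
    + intros x _. apply Hd.
    + intros x _. apply Hg.
  - eapply is_lim_seq_eq; [apply is_lim_seq_minus'; [|apply is_lim_seq_const]|].
    + apply is_lim_seq_abs_0.
      apply is_lim_seq_le_le with (u := fun _ => 0) (w := fun n => C * exp (- eta * INR n)).
      * intros n. split; [apply Rabs_pos|apply HC, pos_INR].
      * apply is_lim_seq_const.
      * eapply is_lim_seq_eq; [apply is_lim_seq_scal', exp_decay_lim; auto|ring].
    + ring.
Qed.

(** * Integrals over the whole line *)

Lemma igood_plus f g : igood f -> igood g -> igood (fun x => f x + g x).
Proof.
  intros [Hf [e [C [He HC]]]] [Hg [e' [C' [He' HC']]]]. split; auto with cont.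
  pose proof (ibound_nonneg _ _ _ HC). pose proof (ibound_nonneg _ _ _ HC').
  exists (Rmin e e'), (C + C'). split; [now apply Rmin_glb_lt|].
  intros x. eapply Rle_trans; [apply Rabs_triang|].
  rewrite Rmult_plus_distr_r. pose proof (Rmin_l e e'). pose proof (Rmin_r e e').
  pose proof (Rabs_pos x).
  apply Rplus_le_compat.
  - eapply Rle_trans; [now apply HC|]. apply Rmult_le_compat_l; auto. apply exp_le_mono. nra.
  - eapply Rle_trans; [now apply HC'|]. apply Rmult_le_compat_l; auto. apply exp_le_mono. nra.
Qed.

Lemma igood_scal c f : igood f -> igood (fun x => c * f x).
Proof.
  intros [Hf [e [C [He HC]]]]. split; auto with cont.
  exists e, (Rabs c * C). split; auto. intros x. rewrite Rabs_mult, Rmult_assoc.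
  apply Rmult_le_compat_l; [apply Rabs_pos|now apply HC].
Qed.

Lemma igood_ext f g : (forall x, f x = g x) -> igood f -> igood g.
Proof.
  intros E [Hf [e [C [He HC]]]]. split; [now apply cont_ext with f|].
  exists e, C. split; auto. intros x. rewrite <- E. apply HC.
Qed.

Lemma igood_minus f g : igood f -> igood g -> igood (fun x => f x - g x).
Proof.
  intros Hf Hg. apply igood_ext with (fun x => f x + -1 * g x); [intros; ring|].
  apply igood_plus; auto. now apply igood_scal.
Qed.

Lemma Int_ext f g : (forall x, f x = g x) -> Int f = Int g.
Proof. intros H. unfold Int. f_equal; apply Hint_ext; auto. Qed.

Lemma Int_opp f : Int (fun x => f (- x)) = Int f.
Proof.
  unfold Int. rewrite Rplus_comm. f_equal. apply Hint_ext. intros x _. now rewrite Ropp_involutive.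
Qed.

Lemma Int_plus f g : igood f -> igood g -> Int (fun x => f x + g x) = Int f + Int g.
Proof.
  intros Hf Hg. unfold Int.
  rewrite Hint_plus by (now apply igood_hgood).
  rewrite (Hint_plus (fun x => f (- x)) (fun x => g (- x)))
    by (apply igood_hgood; now apply igood_opp). ring.
Qed.

Lemma Int_scal c f : igood f -> Int (fun x => c * f x) = c * Int f.
Proof.
  intros Hf. unfold Int.
  rewrite Hint_scal by (now apply igood_hgood).
  rewrite (Hint_scal c (fun x => f (- x))) by (apply igood_hgood; now apply igood_opp). ring.
Qed.

Lemma Int_minus f g : igood f -> igood g -> Int (fun x => f x - g x) = Int f - Int g.
Proof.
  intros Hf Hg. unfold Int.
  rewrite Hint_minus by (now apply igood_hgood).
  rewrite (Hint_minus (fun x => f (- x)) (fun x => g (- x)))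
    by (apply igood_hgood; now apply igood_opp). ring.
Qed.

Lemma Int_le f g : igood f -> igood g -> (forall x, f x <= g x) -> Int f <= Int g.
Proof.
  intros Hf Hg H. unfold Int. apply Rplus_le_compat; apply Hint_le; auto using igood_hgood, igood_opp.
Qed.

Lemma Int_abs_le f g : igood f -> igood g -> (forall x, Rabs (f x) <= g x) -> Rabs (Int f) <= Int g.
Proof.
  intros Hf Hg H. apply Rabs_le. split.
  - replace (- Int g) with (Int (fun x => -1 * g x)) by (rewrite Int_scal; auto; ring).
    apply Int_le; auto using igood_scal. intros x. specialize (H x).
    apply Rabs_le_between in H. lra.
  - apply Int_le; auto. intros x. specialize (H x). apply Rabs_le_between in H. lra.
Qed.

Lemma Int_pos f : igood f -> (forall x, 0 < f x) -> 0 < Int f.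
Proof.
  intros Hf H. unfold Int.
  assert (0 < Hint f) by (apply Hint_pos; auto using igood_hgood).
  assert (0 < Hint (fun x => f (- x))) by (apply Hint_pos; auto using igood_hgood, igood_opp).
  lra.
Qed.

Lemma Int_abs_bound eta C f : cont f -> 0 < eta -> ibound eta C f -> Rabs (Int f) <= 2 * C / eta.
Proof.
  intros Hf He HC. unfold Int. eapply Rle_trans; [apply Rabs_triang|].
  replace (2 * C / eta) with (C / eta + C / eta) by (field; lra).
  apply Rplus_le_compat; apply Hint_abs_le; auto using ibound_hbound, ibound_opp.
  apply (cont_comp (fun x => - x) f); auto with cont.
Qed.

Lemma RInt_reflect f a : cont f -> RInt (fun x => f (- x)) 0 a = RInt f (- a) 0.
Proof.
  intros Hf.
  pose proof (RInt_comp_lin f (-1) 0 0 a) as E.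
  rewrite Rmult_0_r, Rplus_0_l in E.
  specialize (E (cont_ex_RInt _ _ _ Hf)).
  rewrite (RInt_ext _ (fun y => scal (-1) (f (- y)))) in E.
  2: { intros x _. do 2 f_equal. ring. }
  rewrite (RInt_scal (V := R_CompleteNormedModule)) in E.
  2: { apply cont_ex_RInt. apply (cont_comp (fun x => - x) f); auto with cont. }
  unfold scal in E; simpl in E; unfold mult in E; simpl in E.
  replace (-1 * a + 0) with (- a) in E by ring.
  rewrite <- (opp_RInt_swap f) by now apply cont_ex_RInt. unfold opp; simpl. lra.
Qed.

Lemma Int_tail eta C f X Y : cont f -> 0 < eta -> ibound eta C f -> X <= 0 <= Y ->
  Rabs (Int f - RInt f X Y) <= C / eta * (exp (eta * X) + exp (- eta * Y)).
Proof.
  intros Hf He HC HXY. unfold Int.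
  pose proof (Hint_tail eta C f Y Hf He (ibound_hbound _ _ _ HC) ltac:(lra)) as H1.
  assert (Hf' : cont (fun x => f (- x))) by (apply (cont_comp (fun x => - x) f); auto with cont).
  pose proof (Hint_tail eta C (fun x => f (- x)) (- X) Hf' He
    (ibound_hbound _ _ _ (ibound_opp _ _ _ HC)) ltac:(lra)) as H2.
  rewrite RInt_reflect, Ropp_involutive in H2 by auto.
  replace (- eta * - X) with (eta * X) in H2 by ring.
  rewrite <- (RInt_Chasles_cont f X 0 Y) by auto.
  replace (Hint f + Hint (fun x => f (- x)) - (RInt f X 0 + RInt f 0 Y))
    with ((Hint f - RInt f 0 Y) + (Hint (fun x => f (- x)) - RInt f X 0)) by ring.
  eapply Rle_trans; [apply Rabs_triang|]. lra.
Qed.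

Lemma Int_lim f : igood f -> is_lim_seq (fun n => RInt f (- INR n) (INR n)) (Int f).
Proof.
  intros [Hf [e [C [He HC]]]].
  replace (Finite (Int f)) with (Finite (Int f - 0)) by (f_equal; ring).
  apply is_lim_seq_ext with (fun n => Int f - (Int f - RInt f (- INR n) (INR n))); [intros; ring|].
  apply is_lim_seq_minus'; [apply is_lim_seq_const|].
  apply is_lim_seq_abs_0.
  apply is_lim_seq_le_le with (u := fun _ => 0) (w := fun n => 2 * (C / e) * exp (- e * INR n)).
  - intros n. pose proof (pos_INR n). split; [apply Rabs_pos|].
    eapply Rle_trans; [apply (Int_tail e C); auto; lra|].
    replace (e * - INR n) with (- e * INR n) by ring. lra.
  - apply is_lim_seq_const.
  - eapply is_lim_seq_eq; [apply is_lim_seq_scal', exp_decay_lim; auto|ring].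
Qed.

Lemma Int_unique f (l : R) : igood f -> is_lim_seq (fun n => RInt f (- INR n) (INR n)) l -> Int f = l.
Proof.
  intros Hf H. apply Int_lim in Hf. apply is_lim_seq_unique in H. apply is_lim_seq_unique in Hf.
  rewrite H in Hf. now apply Rbar_finite_eq in Hf.
Qed.

Lemma Rabs_shift_exp eta x c : 0 < eta -> exp (- eta * Rabs (x + c)) <= exp (eta * Rabs c) * exp (- eta * Rabs x).
Proof.
  intros He. rewrite <- exp_plus. apply exp_le_mono.
  assert (Rabs x <= Rabs (x + c) + Rabs c).
  { replace x with ((x + c) + - c) at 1 by ring. rewrite <- (Rabs_Ropp c). apply Rabs_triang. }
  nra.
Qed.

Lemma igood_shift f c : igood f -> igood (fun x => f (x + c)).
Proof.
  intros [Hf [e [C [He HC]]]]. pose proof (ibound_nonneg _ _ _ HC). split.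
  - apply (cont_comp (fun x => x + c) f); auto with cont.
  - exists e, (C * exp (e * Rabs c)). split; auto. intros x.
    eapply Rle_trans; [apply HC|]. rewrite Rmult_assoc. apply Rmult_le_compat_l; auto.
    now apply Rabs_shift_exp.
Qed.

Lemma Int_shift f c : igood f -> Int (fun x => f (x + c)) = Int f.
Proof.
  intros Hg. apply Int_unique; [now apply igood_shift|].
  destruct Hg as [Hf [e [C [He HC]]]].
  replace (Finite (Int f)) with (Finite (Int f - 0)) by (f_equal; ring).
  apply is_lim_seq_ext with (fun n => Int f - (Int f - RInt f (- INR n + c) (INR n + c))).
  { intros n. pose proof (RInt_comp_lin f 1 c (- INR n) (INR n) (cont_ex_RInt _ _ _ Hf)) as E.
    rewrite !Rmult_1_l in E. rewrite <- E.
    rewrite (RInt_ext _ (fun x => f (x + c))); [ring|].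
    intros x _. unfold scal; simpl; unfold mult; simpl. now rewrite !Rmult_1_l. }
  apply is_lim_seq_minus'; [apply is_lim_seq_const|].
  apply is_lim_seq_abs_0.
  apply is_lim_seq_le_le_loc with (u := fun _ => 0)
    (w := fun n => C / e * (exp (e * c) + exp (- e * c)) * exp (- e * INR n)).
  - exists (nat_up (Rabs c)). intros n Hn. split; [apply Rabs_pos|].
    destruct (nat_up_bounds (Rabs c) (Rabs_pos c)) as [Hb _]. apply le_INR in Hn.
    pose proof (Rle_abs c). pose proof (Rle_abs (- c)). rewrite Rabs_Ropp in H0.
    eapply Rle_trans; [apply (Int_tail e C); auto; lra|]. right.
    replace (e * (- INR n + c)) with (e * c + - e * INR n) by ring.
    replace (- e * (INR n + c)) with (- e * c + - e * INR n) by ring.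
    rewrite !exp_plus. ring.
  - apply is_lim_seq_const.
  - eapply is_lim_seq_eq; [apply is_lim_seq_scal', exp_decay_lim; auto|ring].
Qed.

(** A substitute for dominated convergence: the error is uniformly small against one fixed
    integrable weight, so a numerical factor tending to 0 can be pulled out of the integral. *)
Lemma Int_weighted_lim (f : nat -> R -> R) g w (eps : nat -> R) :
  (forall n, igood (f n)) -> igood g -> igood w -> is_lim_seq eps 0 ->
  (eventually (fun n => forall x, Rabs (f n x - g x) <= eps n * w x)) ->
  is_lim_seq (fun n => Int (f n)) (Int g).
Proof.
  intros Hf Hg Hw He H.
  replace (Finite (Int g)) with (Finite (0 + Int g)) by (f_equal; ring).
  apply is_lim_seq_ext with (fun n => (Int (f n) - Int g) + Int g); [intros; ring|].
  apply is_lim_seq_plus'; [|apply is_lim_seq_const].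
  apply is_lim_seq_abs_0.
  apply is_lim_seq_le_le_loc with (u := fun _ => 0) (w := fun n => eps n * Int w).
  - revert H. apply filter_imp. intros n Hn. split; [apply Rabs_pos|].
    rewrite <- Int_minus, <- Int_scal by auto.
    apply Int_abs_le; auto using igood_minus, igood_scal.
  - apply is_lim_seq_const.
  - eapply is_lim_seq_eq; [apply is_lim_seq_mult'; [exact He|apply is_lim_seq_const]|ring].
Qed.

(** * Parametric integrals and exchange of the order of integration *)

Definition cont2 (f : R -> R -> R) : Prop := forall x y, continuity_2d_pt f x y.

Lemma cont2_swap f : cont2 f -> cont2 (fun y x => f x y).
Proof.
  intros H y x eps. destruct (H x y eps) as [d Hd]. exists d. intros u v Hu Hv. now apply Hd.
Qed.

Lemma cont2_fst f : cont2 f -> forall y, cont (fun x => f x y).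
Proof.
  intros H y x. apply continuity_pt_filterlim. intros eps He.
  destruct (H x y (mkposreal eps He)) as [d Hd]. exists d. split; [apply cond_pos|].
  intros u [_ Hu]. apply Hd; auto. rewrite Rminus_diag, Rabs_R0. apply cond_pos.
Qed.

Lemma cont2_snd f : cont2 f -> forall x, cont (f x).
Proof. intros H x. apply (cont2_fst _ (cont2_swap _ H)). Qed.

Lemma cont_param_RInt_le f a b : a <= b -> cont2 f -> cont (fun x => RInt (f x) a b).
Proof.
  intros Hab H x. apply continuity_pt_filterlim. intros eps He.
  assert (He' : 0 < eps / (b - a + 1)) by (apply Rdiv_lt_0_compat; lra).
  destruct (uniform_continuity_2d_1d' f a b x (fun t _ => H x t) (mkposreal _ He')) as [d Hd].
  exists d. split; [apply cond_pos|]. intros u [_ Hu].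
  simpl in Hu. unfold R_dist in Hu. simpl. unfold R_dist.
  rewrite <- (RInt_minus (f u) (f x)) by (apply cont_ex_RInt, cont2_snd; auto).
  unfold minus, plus, opp; simpl.
  eapply Rle_lt_trans; [apply (abs_RInt_le_const _ a b (eps / (b - a + 1))); auto|].
  - apply (ex_RInt_minus (f u) (f x)); apply cont_ex_RInt, cont2_snd; auto.
  - intros t Ht. left. apply (Hd t x t u); auto.
    + pose proof (cond_pos d). lra.
    + apply Rabs_def2 in Hu. lra.
    + rewrite Rminus_diag, Rabs_R0. apply cond_pos.
  - apply Rlt_le_trans with ((b - a + 1) * (eps / (b - a + 1))).
    + apply Rmult_lt_compat_r; lra.
    + right. field. lra.
Qed.

Lemma cont_param_RInt f a b : cont2 f -> cont (fun x => RInt (f x) a b).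
Proof.
  intros H. destruct (Rle_lt_dec a b) as [Hab|Hab]; [now apply cont_param_RInt_le|].
  apply cont_ext with (fun x => -1 * RInt (f x) b a).
  - intros x. rewrite <- (opp_RInt_swap (f x)) by (apply cont_ex_RInt; now apply cont2_snd).
    unfold opp; simpl. ring.
  - apply cont_mult; [apply cont_const|]. apply cont_param_RInt_le; auto. lra.
Qed.

Lemma is_derive_RInt_cont f a x : cont f -> is_derive (fun z => RInt f a z) x (f x).
Proof.
  intros H. apply (is_derive_RInt f _ a); [|apply H].
  apply filter_forall. intros z. apply (RInt_correct (V := R_CompleteNormedModule)).
  now apply cont_ex_RInt.
Qed.

(** As functions of the upper limit [b] both sides have the same derivative, by differentiation
    under the integral sign, and both vanish at [b = a]. *)
Lemma RInt_swap_rect f a b c d : a <= b -> cont2 f ->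
  RInt (fun x => RInt (f x) c d) a b = RInt (fun y => RInt (fun x => f x y) a b) c d.
Proof.
  intros Hab H.
  assert (Hp : cont (fun x => RInt (f x) c d)) by now apply cont_param_RInt.
  assert (Dinner : forall y x, is_derive (fun z => RInt (fun u => f u y) a z) x (f x y)).
  { intros y x. apply (is_derive_RInt_cont (fun u => f u y)). now apply cont2_fst. }
  assert (D2 : forall x,
    is_derive (fun x => RInt (fun y => RInt (fun u => f u y) a x) c d) x (RInt (f x) c d)).
  { intros x.
    pose proof (is_derive_RInt_param (fun x y => RInt (fun u => f u y) a x) c d x) as D.
    rewrite (RInt_ext (fun t => Derive (fun u => RInt (fun u0 => f u0 t) a u) x) (f x)) in D.
    2: { intros t _. apply is_derive_unique, Dinner. }
    apply D; clear D.
    - apply filter_forall. intros z t _. exists (f z t). apply Dinner.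
    - intros t _. apply continuity_2d_pt_ext with f; [|apply H].
      intros u v. symmetry. apply is_derive_unique, Dinner.
    - apply filter_forall. intros z. apply cont_ex_RInt.
      apply (cont_param_RInt (fun y u => f u y)). now apply cont2_swap. }
  assert (E : RInt (fun x => RInt (f x) c d) a b - RInt (fun y => RInt (fun u => f u y) a b) c d
     = RInt (fun x => RInt (f x) c d) a a - RInt (fun y => RInt (fun u => f u y) a a) c d).
  { apply (is_derive_zero_const (fun x => RInt (fun x => RInt (f x) c d) a x
       - RInt (fun y => RInt (fun u => f u y) a x) c d) a b Hab).
    intros x _.
    pose proof (is_derive_minus (V := R_NormedModule) _ _ x _ _
      (is_derive_RInt_cont (fun x => RInt (f x) c d) a x Hp) (D2 x)) as DD.
    rewrite minus_eq_zero in DD. exact DD. }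
  rewrite RInt_point in E. rewrite (RInt_ext (fun y => RInt (fun u => f u y) a a) (fun _ => zero)) in E
    by (intros; apply RInt_point).
  rewrite RInt_const in E. unfold scal, zero in E; simpl in E; unfold mult in E; simpl in E.
  lra.
Qed.

Lemma cont_param_Int f eta C : cont2 f -> 0 < eta -> (forall x, ibound eta C (f x)) ->
  cont (fun x => Int (f x)).
Proof.
  intros H He HC x. apply continuity_pt_filterlim. intros eps Heps.
  assert (L : is_lim_seq (fun n => 2 * (C / eta) * exp (- eta * INR n)) 0).
  { eapply is_lim_seq_eq; [apply is_lim_seq_scal', exp_decay_lim; auto|ring]. }
  destruct (proj1 (is_lim_seq_eps _ _) L (eps / 3) ltac:(lra)) as [n Hn].
  specialize (Hn n (le_n _)). rewrite Rminus_0_r in Hn.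
  assert (T : forall y, Rabs (Int (f y) - RInt (f y) (- INR n) (INR n)) < eps / 3).
  { intros y. pose proof (pos_INR n).
    eapply Rle_lt_trans; [apply (Int_tail eta C); auto; [now apply cont2_snd|lra]|].
    replace (eta * - INR n) with (- eta * INR n) by ring.
    eapply Rle_lt_trans; [|exact Hn]. eapply Rle_trans; [|apply Rle_abs]. right. ring. }
  pose proof (cont_param_RInt f (- INR n) (INR n) H x) as Hc.
  apply continuity_pt_filterlim in Hc.
  destruct (Hc (eps / 3) ltac:(lra)) as [d [Hd Hd']].
  exists d. split; auto. intros y Hy. specialize (Hd' y Hy).
  simpl in *. unfold R_dist in *.
  pose proof (T x) as Tx. pose proof (T y) as Ty.
  apply Rabs_def2 in Hd'. apply Rabs_def2 in Tx. apply Rabs_def2 in Ty.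
  apply Rabs_def1; lra.
Qed.

Lemma poly_exp_lim eta : 0 < eta -> is_lim_seq (fun n => INR n * exp (- eta * INR n)) 0.
Proof.
  intros He. apply is_lim_seq_le_le with (u := fun _ => 0)
    (w := fun n => 2 / eta * exp (- (eta / 2) * INR n)).
  - intros n. pose proof (pos_INR n). split; [apply Rmult_le_pos; [auto|left; apply exp_pos]|].
    replace (- eta * INR n) with (- (eta / 2) * INR n + - (eta / 2) * INR n) by field.
    rewrite exp_plus, <- Rmult_assoc. apply Rmult_le_compat_r; [left; apply exp_pos|].
    pose proof (exp_ge_1_plus (eta / 2 * INR n)) as E.
    replace (- (eta / 2) * INR n) with (- (eta / 2 * INR n)) by ring. rewrite exp_Ropp.
    pose proof (exp_pos (eta / 2 * INR n)).
    apply Rmult_le_reg_r with (exp (eta / 2 * INR n)); auto.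
    rewrite Rmult_assoc, Rinv_l, Rmult_1_r by lra.
    apply Rmult_le_reg_l with (eta / 2); [lra|].
    replace (eta / 2 * (2 / eta * exp (eta / 2 * INR n))) with (exp (eta / 2 * INR n)) by (field; lra).
    lra.
  - apply is_lim_seq_const.
  - eapply is_lim_seq_eq; [apply is_lim_seq_scal', exp_decay_lim; lra|ring].
Qed.

Lemma Int_param_ibound f eta C : cont2 f -> 0 < eta ->
  (forall x y, Rabs (f x y) <= C * exp (- eta * Rabs x) * exp (- eta * Rabs y)) ->
  ibound eta (2 * C / eta) (fun x => Int (f x)).
Proof.
  intros H He HC x.
  replace (2 * C / eta * exp (- eta * Rabs x)) with (2 * (C * exp (- eta * Rabs x)) / eta)
    by (field; lra).
  apply Int_abs_bound; auto; [now apply cont2_snd|]. intros y. apply HC.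
Qed.

(** Cutting to a square loses an inner tail of size [exp (- eta n)] for every [x] in a window of
    length [2 n]; the product still tends to 0. The square is symmetric in the two variables, which
    is what [Int_swap] exploits. *)
Lemma Int_square_lim f eta C : cont2 f -> 0 < eta ->
  (forall x y, Rabs (f x y) <= C * exp (- eta * Rabs x) * exp (- eta * Rabs y)) ->
  is_lim_seq (fun n => RInt (fun x => RInt (f x) (- INR n) (INR n)) (- INR n) (INR n))
    (Int (fun x => Int (f x))).
Proof.
  intros H He HC.
  assert (HC0 : 0 <= C).
  { specialize (HC 0 0). rewrite Rabs_R0, !Rmult_0_r, exp_0 in HC. pose proof (Rabs_pos (f 0 0)). lra. }
  assert (Hrow : forall x, ibound eta C (f x)).
  { intros x y. eapply Rle_trans; [apply HC|]. apply Rmult_le_compat_r; [left; apply exp_pos|].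
    rewrite <- (Rmult_1_r C) at 2. apply Rmult_le_compat_l; auto.
    rewrite <- exp_0. apply exp_le_mono. pose proof (Rabs_pos x). nra. }
  assert (Hcont : cont (fun x => Int (f x))) by (apply (cont_param_Int f eta C); auto).
  assert (Hg : igood (fun x => Int (f x))).
  { split; auto. exists eta, (2 * C / eta). split; auto. now apply Int_param_ibound. }
  replace (Finite (Int (fun x => Int (f x)))) with (Finite (Int (fun x => Int (f x)) - 0)) by (f_equal; ring).
  apply is_lim_seq_ext with (fun n => RInt (fun x => Int (f x)) (- INR n) (INR n)
     - (RInt (fun x => Int (f x)) (- INR n) (INR n)
        - RInt (fun x => RInt (f x) (- INR n) (INR n)) (- INR n) (INR n))).
  { intros n. generalize (RInt (fun x => Int (f x)) (- INR n) (INR n))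
      (RInt (fun x => RInt (f x) (- INR n) (INR n)) (- INR n) (INR n)).
    intros u v. change (u - (u - v) = v :> R). ring. }
  apply is_lim_seq_minus'; [now apply Int_lim|].
  apply is_lim_seq_abs_0.
  apply is_lim_seq_le_le with (u := fun _ => 0)
    (w := fun n => 4 * (C / eta) * (INR n * exp (- eta * INR n))).
  - intros n. pose proof (pos_INR n) as Hn. split; [apply Rabs_pos|].
    rewrite <- (RInt_minus (fun x => Int (f x)) (fun x => RInt (f x) (- INR n) (INR n)))
      by (apply cont_ex_RInt; auto; now apply cont_param_RInt).
    eapply Rle_trans; [apply (abs_RInt_le_const _ _ _ (2 * (C / eta) * exp (- eta * INR n))); [lra| |]|].
    + apply cont_ex_RInt. apply (cont_minus (fun x => Int (f x)) (fun x => RInt (f x) (- INR n) (INR n))); auto.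
      now apply cont_param_RInt.
    + intros x _. eapply Rle_trans; [apply (Int_tail eta C); auto; [now apply cont2_snd|lra]|].
      replace (eta * - INR n) with (- eta * INR n) by ring. right. ring.
    + right. ring.
  - apply is_lim_seq_const.
  - eapply is_lim_seq_eq; [apply is_lim_seq_scal', poly_exp_lim; auto|ring].
Qed.

Lemma Int_swap f eta C : cont2 f -> 0 < eta ->
  (forall x y, Rabs (f x y) <= C * exp (- eta * Rabs x) * exp (- eta * Rabs y)) ->
  Int (fun x => Int (f x)) = Int (fun y => Int (fun x => f x y)).
Proof.
  intros H He HC.
  pose proof (Int_square_lim f eta C H He HC) as L1.
  assert (L2 := Int_square_lim (fun y x => f x y) eta C (cont2_swap f H) He).
  assert (HC' : forall y x, Rabs (f x y) <= C * exp (- eta * Rabs y) * exp (- eta * Rabs x)).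
  { intros y x. eapply Rle_trans; [apply HC|]. right. ring. }
  specialize (L2 HC').
  eapply is_lim_seq_ext in L2.
  2: { intros n. symmetry. apply RInt_swap_rect; auto. pose proof (pos_INR n). lra. }
  apply is_lim_seq_unique in L1. apply is_lim_seq_unique in L2.
  rewrite L1 in L2. now apply Rbar_finite_eq in L2.
Qed.

(** * Convolution on the line *)

Definition conv (f g : R -> R) (x : R) : R := Int (fun y => f (x - y) * g y).

Lemma cont2_conv f g : cont f -> cont g -> cont2 (fun x y => f (x - y) * g y).
Proof.
  intros Hf Hg x y. apply continuity_2d_pt_mult.
  - apply (continuity_1d_2d_pt_comp f (fun x y => x - y)).
    + apply continuity_pt_filterlim, Hf.
    + apply continuity_2d_pt_minus; [apply continuity_2d_pt_id1|apply continuity_2d_pt_id2].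
  - apply (continuity_1d_2d_pt_comp g (fun x y => y)).
    + apply continuity_pt_filterlim, Hg.
    + apply continuity_2d_pt_id2.
Qed.

(** The factor [g] decays twice as fast as needed: since [|x| <= |x - y| + |y|], half of its rate
    completes the decay in [x] and the other half remains as decay in [y]. *)
Lemma conv_bound f g eta C D : ibound eta C f -> ibound (2 * eta) D g -> 0 < eta ->
  forall x y, Rabs (f (x - y) * g y) <= C * D * exp (- eta * Rabs x) * exp (- eta * Rabs y).
Proof.
  intros Hf Hg He x y. pose proof (ibound_nonneg _ _ _ Hf) as HC. pose proof (ibound_nonneg _ _ _ Hg) as HD.
  rewrite Rabs_mult.
  apply Rle_trans with (C * exp (- eta * Rabs (x - y)) * (D * exp (- (2 * eta) * Rabs y))).
  - apply Rmult_le_compat; auto using Rabs_pos.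
  - replace (C * exp (- eta * Rabs (x - y)) * (D * exp (- (2 * eta) * Rabs y)))
      with (C * D * exp (- eta * Rabs (x - y) + - (2 * eta) * Rabs y)) by (rewrite exp_plus; ring).
    rewrite (Rmult_assoc (C * D) (exp (- eta * Rabs x))), <- exp_plus.
    apply Rmult_le_compat_l; [now apply Rmult_le_pos|].
    apply exp_le_mono.
    assert (Rabs x <= Rabs (x - y) + Rabs y).
    { replace x with ((x - y) + y) at 1 by ring. apply Rabs_triang. }
    nra.
Qed.

Lemma cont_conv f g eta C D : cont f -> cont g -> 0 < eta -> ibound eta C f -> ibound (2 * eta) D g ->
  cont (conv f g).
Proof.
  intros Hf Hg He HC HD.
  apply (cont_param_Int (fun x y => f (x - y) * g y) eta (C * D)); auto.
  - now apply cont2_conv.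
  - intros x y. eapply Rle_trans; [apply (conv_bound f g eta C D); auto|].
    apply Rmult_le_compat_r; [left; apply exp_pos|].
    rewrite <- (Rmult_1_r (C * D)) at 2. apply Rmult_le_compat_l.
    + apply Rmult_le_pos; [apply (ibound_nonneg _ _ _ HC)|apply (ibound_nonneg _ _ _ HD)].
    + rewrite <- exp_0. apply exp_le_mono. pose proof (Rabs_pos x). nra.
Qed.

Lemma igood_conv f g eta C D : cont f -> cont g -> 0 < eta -> ibound eta C f -> ibound (2 * eta) D g ->
  igood (conv f g).
Proof.
  intros Hf Hg He HC HD. split; [now apply (cont_conv f g eta C D)|].
  exists eta, (2 * (C * D) / eta). split; auto.
  apply (Int_param_ibound (fun x y => f (x - y) * g y)); auto.
  - now apply cont2_conv.
  - now apply conv_bound.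
Qed.

(** After the exchange of integrals the inner one is a translate of [Int f]. *)
Lemma Int_conv f g eta C D : cont f -> cont g -> 0 < eta -> ibound eta C f -> ibound (2 * eta) D g ->
  Int (conv f g) = Int f * Int g.
Proof.
  intros Hf Hg He HC HD. unfold conv.
  rewrite (Int_swap (fun x y => f (x - y) * g y) eta (C * D)); auto.
  2: now apply cont2_conv.
  2: now apply conv_bound.
  assert (Gf : igood f) by (split; auto; exists eta, C; auto).
  assert (Gg : igood g) by (split; auto; exists (2 * eta), D; split; [lra|auto]).
  rewrite <- Int_scal by auto. apply Int_ext. intros y.
  rewrite Rmult_comm, <- (Int_shift f (- y)) by auto.
  rewrite <- Int_scal by now apply igood_shift.
  apply Int_ext. intros x. unfold Rminus. ring.
Qed.

(** * Differentiation of exponential moments *)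

Lemma exp_taylor_2 t : Rabs (exp t - 1 - t) <= t ^ 2 * exp (Rabs t).
Proof.
  pose proof (exp_ge_1_plus t) as H1. rewrite Rabs_pos_eq by lra.
  destruct (Rle_lt_dec 0 t) as [Ht|Ht].
  - rewrite Rabs_pos_eq by auto.
    pose proof (exp_ge_1_plus (- t)) as H2. rewrite exp_Ropp in H2.
    pose proof (exp_pos t) as Hp.
    assert (E : (1 + - t) * exp t <= 1).
    { apply (Rmult_le_compat_r (exp t)) in H2; [|lra]. rewrite Rinv_l in H2 by lra. exact H2. }
    nra.
  - rewrite Rabs_left by auto.
    pose proof (exp_ge_1_plus (- t)) as H2.
    assert (E : exp t <= / (1 + - t)).
    { rewrite <- (Ropp_involutive t) at 1. rewrite exp_Ropp. apply Rinv_le_contravar; lra. }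
    assert (E2 : / (1 + - t) <= 1 + t + t ^ 2).
    { apply Rmult_le_reg_r with (1 + - t); [lra|]. rewrite Rinv_l by lra. nra. }
    nra.
Qed.

Lemma sq_le_exp a x : 0 < a -> 0 <= x -> x ^ 2 <= (2 / a) ^ 2 * exp (a * x).
Proof.
  intros Ha Hx.
  replace (a * x) with (INR 2 * (a * x / 2)) by (simpl; field). rewrite exp_nat_mult.
  rewrite <- Rpow_mult_distr. apply pow_incr. split; auto.
  pose proof (exp_ge_1_plus (a * x / 2)).
  apply Rmult_le_reg_l with (a / 2); [lra|].
  replace (a / 2 * (2 / a * exp (a * x / 2))) with (exp (a * x / 2)) by (field; lra). lra.
Qed.

(** Used twice: to differentiate exponential moments, and to turn the quadratic bound at a double
    zero into a vanishing derivative. *)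
Lemma is_derive_quadratic f x d K r : 0 < r ->
  (forall h, Rabs h < r -> Rabs (f (x + h) - f x - h * d) <= K * h ^ 2) -> is_derive f x d.
Proof.
  intros Hr H. apply is_derive_Reals. intros eps He.
  assert (HK : 0 <= Rabs K) by apply Rabs_pos.
  assert (Hd : 0 < Rmin r (eps / (Rabs K + 1))).
  { apply Rmin_glb_lt; auto. apply Rdiv_lt_0_compat; lra. }
  exists (mkposreal _ Hd). intros h Hh Hlt. simpl in Hlt.
  pose proof (Rmin_l r (eps / (Rabs K + 1))). pose proof (Rmin_r r (eps / (Rabs K + 1))).
  specialize (H h ltac:(lra)).
  replace ((f (x + h) - f x) / h - d) with ((f (x + h) - f x - h * d) / h) by (field; auto).
  assert (Hp : 0 < Rabs h) by now apply Rabs_pos_lt.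
  unfold Rdiv. rewrite Rabs_mult, Rabs_inv.
  apply Rmult_lt_reg_r with (Rabs h); auto. rewrite Rmult_assoc, Rinv_l, Rmult_1_r by lra.
  eapply Rle_lt_trans; [exact H|].
  rewrite <- (pow2_abs h). pose proof (Rle_abs K).
  assert (A1 : Rabs h * (Rabs K + 1) < eps).
  { apply Rlt_le_trans with (eps / (Rabs K + 1) * (Rabs K + 1)); [|right; field; lra].
    apply Rmult_lt_compat_r; lra. }
  nra.
Qed.

Lemma hgood_moment F kappa C s : cont F -> hbound kappa C F -> s < kappa ->
  hgood (fun x => F x * exp (s * x)).
Proof.
  intros HF HC Hs. split; [auto with cont|]. exists (kappa - s), C. split; [lra|].
  intros x Hx. rewrite Rabs_mult, (Rabs_pos_eq (exp _)) by (left; apply exp_pos).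
  replace (- (kappa - s) * x) with (- kappa * x + s * x) by ring. rewrite exp_plus, <- Rmult_assoc.
  apply Rmult_le_compat_r; [left; apply exp_pos|now apply HC].
Qed.

Lemma hbound_mul_id F kappa C eta : 0 < eta -> hbound kappa C F ->
  hbound (kappa - eta) (C / eta) (fun x => x * F x).
Proof.
  intros He HC x Hx. rewrite Rabs_mult, Rabs_pos_eq by auto.
  pose proof (hbound_nonneg _ _ _ HC).
  apply Rle_trans with (x * (C * exp (- kappa * x))); [apply Rmult_le_compat_l; auto|].
  replace (- (kappa - eta) * x) with (- kappa * x + eta * x) by ring. rewrite exp_plus.
  pose proof (exp_ge_1_plus (eta * x)) as E. pose proof (exp_pos (- kappa * x)).
  replace (C / eta * (exp (- kappa * x) * exp (eta * x)))
    with (C * exp (- kappa * x) * (exp (eta * x) / eta)) by (field; lra).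
  replace (x * (C * exp (- kappa * x))) with (C * exp (- kappa * x) * x) by ring.
  apply Rmult_le_compat_l; [apply Rmult_le_pos; lra|].
  apply Rmult_le_reg_r with eta; auto. unfold Rdiv. rewrite Rmult_assoc, Rinv_l by lra. lra.
Qed.

Lemma hgood_moment1 F kappa C s : cont F -> hbound kappa C F -> s < kappa ->
  hgood (fun x => x * F x * exp (s * x)).
Proof.
  intros HF HC Hs.
  apply (hgood_moment (fun x => x * F x) (kappa - (kappa - s) / 2) (C / ((kappa - s) / 2))); [auto with cont| |lra].
  apply hbound_mul_id; auto. lra.
Qed.

Lemma is_derive_moment F kappa C s : cont F -> hbound kappa C F -> s < kappa ->
  is_derive (fun s => Hint (fun x => F x * exp (s * x))) s (Hint (fun x => x * F x * exp (s * x))).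
Proof.
  (* The spare decay [kappa - s] is cut into four parts: one absorbs [x^2], one absorbs
     [exp (|h| x)] for [|h| < a], and two are left, more than the rate [a] claimed below. *)
  intros HF HC Hs. set (a := (kappa - s) / 4). assert (Ha : 0 < a) by (unfold a; lra).
  pose proof (hbound_nonneg _ _ _ HC) as HC0.
  apply (is_derive_quadratic _ s _ (C * (2 / a) ^ 2 / a) a Ha).
  intros h Hh.
  assert (G0 : hgood (fun x => F x * exp (s * x))) by (apply (hgood_moment F kappa C); auto).
  assert (G1 : hgood (fun x => x * F x * exp (s * x))) by (apply (hgood_moment1 F kappa C); auto).
  assert (G2 : hgood (fun x => F x * exp ((s + h) * x))).
  { apply (hgood_moment F kappa C); auto. apply Rabs_def2 in Hh. unfold a in Hh. lra. }
  rewrite <- Hint_minus, <- Hint_scal by auto.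
  rewrite <- (Hint_minus (fun x => F x * exp ((s + h) * x) - F x * exp (s * x))).
  2: { eapply (hgood_le _ (fun x => Rabs (F x * exp ((s + h) * x)) + Rabs (F x * exp (s * x)))).
       - auto with cont.
       - apply hgood_plus.
         + destruct G2 as [c2 [e2 [D2 [He2 HD2]]]]. split; [apply (cont_comp _ Rabs); auto with cont|].
           exists e2, D2. split; auto. intros x Hx. rewrite Rabs_Rabsolu. now apply HD2.
         + destruct G0 as [c2 [e2 [D2 [He2 HD2]]]]. split; [apply (cont_comp _ Rabs); auto with cont|].
           exists e2, D2. split; auto. intros x Hx. rewrite Rabs_Rabsolu. now apply HD2.
       - intros x _. unfold Rminus. eapply Rle_trans; [apply Rabs_triang|]. rewrite Rabs_Ropp. lra. }
  2: now apply hgood_scal.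
  replace (C * (2 / a) ^ 2 / a * h ^ 2) with ((C * (2 / a) ^ 2 * h ^ 2) / a) by (field; lra).
  apply Hint_abs_le; auto with cont.
  intros x Hx.
  replace (F x * exp ((s + h) * x) - F x * exp (s * x) - h * (x * F x * exp (s * x)))
    with (F x * (exp (s * x) * (exp (h * x) - 1 - h * x)))
    by (rewrite Rmult_plus_distr_r, exp_plus; ring).
  rewrite !Rabs_mult, (Rabs_pos_eq (exp (s * x))) by (left; apply exp_pos).
  pose proof (exp_taylor_2 (h * x)) as T.
  assert (T2 : (h * x) ^ 2 * exp (Rabs (h * x)) <= h ^ 2 * ((2 / a) ^ 2 * exp (a * x)) * exp (a * x)).
  { rewrite Rpow_mult_distr. apply Rmult_le_compat.
    - apply Rmult_le_pos; apply pow2_ge_0.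
    - left; apply exp_pos.
    - apply Rmult_le_compat_l; [apply pow2_ge_0|]. now apply sq_le_exp.
    - apply exp_le_mono. rewrite Rabs_mult, (Rabs_pos_eq x) by auto. apply Rmult_le_compat_r; lra. }
  apply Rle_trans with (C * exp (- kappa * x) * (exp (s * x) * (h ^ 2 * ((2 / a) ^ 2 * exp (a * x)) * exp (a * x)))).
  - apply Rmult_le_compat; auto using Rabs_pos.
    + apply Rmult_le_pos; [left; apply exp_pos|apply Rabs_pos].
    + apply Rmult_le_compat_l; [left; apply exp_pos|]. lra.
  - apply Rle_trans with (C * (2 / a) ^ 2 * h ^ 2 * exp (- (2 * a) * x)).
    + right. replace (- (2 * a) * x) with (- kappa * x + s * x + a * x + a * x)
        by (unfold a; field). rewrite !exp_plus. ring.
    + apply Rmult_le_compat_l.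
      * apply Rmult_le_pos; [apply Rmult_le_pos; [auto|apply pow2_ge_0]|apply pow2_ge_0].
      * apply exp_le_mono. nra.
Qed.

(** * Decay of the Gaussian profile, and continuity of function series *)

Lemma poly_gauss_bounded k eta : 0 < eta -> exists C, 0 <= C /\
  forall x, 0 <= x -> (1 + x) ^ (2 * k) * exp (- (eta * x ^ 2)) <= C.
Proof.
  intros He. exists (exp eta * (2 ^ k * (INR k ^ k / eta ^ k))). split.
  - pose proof (pow_le _ k (pos_INR k)).
    apply Rmult_le_pos; [left; apply exp_pos|]. apply Rmult_le_pos; [apply pow_le; lra|].
    apply Rdiv_le_0_compat; [auto|apply pow_lt; auto].
  - intros x Hx.
    replace (- (eta * x ^ 2)) with (eta + - (eta * (1 + x ^ 2))) by ring.
    rewrite exp_plus.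
    assert (Hy : 0 < 1 + x ^ 2) by (pose proof (pow2_ge_0 x); lra).
    assert (P1 : (1 + x) ^ (2 * k) <= 2 ^ k * (1 + x ^ 2) ^ k).
    { rewrite pow_mult, <- Rpow_mult_distr. apply pow_incr.
      split; [apply pow2_ge_0|]. pose proof (pow2_ge_0 (1 - x)). simpl in *. lra. }
    assert (P2 : exp (- (eta * (1 + x ^ 2))) <= INR k ^ k / (eta * (1 + x ^ 2)) ^ k).
    { apply exp_neg_le_pow. now apply Rmult_lt_0_compat. }
    apply Rle_trans with (2 ^ k * (1 + x ^ 2) ^ k * (exp eta * (INR k ^ k / (eta * (1 + x ^ 2)) ^ k))).
    + apply Rmult_le_compat; auto.
      * apply pow_le; lra.
      * apply Rmult_le_pos; left; apply exp_pos.
      * apply Rmult_le_compat_l; [left; apply exp_pos|auto].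
    + right. rewrite Rpow_mult_distr. field. split; apply pow_nonzero; lra.
Qed.

Definition phi (a : nat) (eta x : R) : R := x ^ a * exp (- (eta * x ^ 2)).
Definition dphi (a : nat) (eta x : R) : R :=
  (INR a - 2 * eta * x ^ (1 + a)) * exp (- (eta * x ^ 2)).

Lemma is_derive_phi a eta x : (a <= 1)%nat -> is_derive (phi a eta) x (dphi a eta x).
Proof.
  intros Ha. destruct a as [|[|a]]; [| |lia]; unfold phi, dphi; simpl;
    auto_derive; auto; simpl; ring.
Qed.

Lemma phi_decay a eta : (a <= 1)%nat -> 0 < eta -> exists C, 0 <= C /\
  forall x, 0 <= x -> Rabs (phi a eta x) <= C / (1 + x) ^ 8 /\ Rabs (dphi a eta x) <= C / (1 + x) ^ 8.
Proof.
  (* Ten powers of [1 + x], of which the polynomial factors of [phi] and [dphi] use at most two;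
     eight remain. *)
  intros Ha He. destruct (poly_gauss_bounded 5 eta He) as [C [HC0 HC]].
  exists ((1 + 2 * eta) * C). split; [nra|].
  intros x Hx. specialize (HC x Hx). change (2 * 5)%nat with 10%nat in HC.
  set (E := exp (- (eta * x ^ 2))) in *. assert (HE : 0 < E) by apply exp_pos.
  assert (H8 : 0 < (1 + x) ^ 8) by (apply pow_lt; lra).
  assert (G : forall y, Rabs y <= (1 + 2 * eta) * (1 + x) ^ 2 ->
     Rabs (y * E) <= (1 + 2 * eta) * C / (1 + x) ^ 8).
  { intros y Hy. rewrite Rabs_mult, (Rabs_pos_eq E) by lra.
    apply Rmult_le_reg_r with ((1 + x) ^ 8); auto.
    unfold Rdiv. rewrite !Rmult_assoc, Rinv_l, Rmult_1_r by lra.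
    apply Rle_trans with ((1 + 2 * eta) * (1 + x) ^ 2 * (E * (1 + x) ^ 8)).
    - apply Rmult_le_compat_r; [apply Rmult_le_pos; lra|auto].
    - replace ((1 + 2 * eta) * (1 + x) ^ 2 * (E * (1 + x) ^ 8))
        with ((1 + 2 * eta) * ((1 + x) ^ 10 * E)) by ring.
      apply Rmult_le_compat_l; lra. }
  unfold phi, dphi. fold E. split; apply G; apply Rabs_le; destruct a as [|[|a]]; try lia; simpl; nra.
Qed.

Lemma cont_phi a eta : (a <= 1)%nat -> cont (phi a eta).
Proof.
  intros Ha x. apply (ex_derive_continuous (phi a eta)). exists (dphi a eta x). now apply is_derive_phi.
Qed.

Lemma continuous_Series (f : nat -> R -> R) (M : nat -> R) x0 :
  (forall n, continuous (f n) x0) -> ex_series M ->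
  locally x0 (fun x => forall n, Rabs (f n x) <= M n) ->
  continuous (fun x => Series (fun n => f n x)) x0.
Proof.
  intros Hf HM [d Hd].
  assert (Hc : forall K, continuous (fun x => rsum (fun n => f n x) K) x0).
  { induction K as [|K IH]; simpl; [apply continuous_const|].
    apply (continuous_plus (fun x => rsum (fun n => f n x) K) (f K)); auto. }
  apply continuity_pt_filterlim. intros eps He.
  destruct (proj1 (is_lim_seq_eps _ _) (Series_tail_lim M HM) (eps / 3) ltac:(lra)) as [K HK].
  specialize (HK K (le_n _)). rewrite Rminus_0_r in HK.
  pose proof (Hc K) as HcK. apply continuity_pt_filterlim in HcK.
  destruct (HcK (eps / 3) ltac:(lra)) as [d' [Hd' Hd'']].
  exists (Rmin d d'). split; [apply Rmin_glb_lt; auto; apply cond_pos|].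
  intros y [Dy Hy]. simpl in Hy. unfold R_dist in Hy. simpl. unfold R_dist.
  pose proof (Rmin_l d d'). pose proof (Rmin_r d d').
  assert (T : forall z, Rabs (z - x0) < d ->
     Rabs (Series (fun n => f n z) - rsum (fun n => f n z) K) < eps / 3).
  { intros z Hz. assert (Bz : forall n, Rabs (f n z) <= M n) by (apply Hd; exact Hz).
    rewrite (Series_split (fun n => f n z) K) by (apply ex_series_Rabs_le with M; auto).
    replace (rsum (fun n => f n z) K + Series (fun k => f (K + k)%nat z) - rsum (fun n => f n z) K)
      with (Series (fun k => f (K + k)%nat z)) by ring.
    eapply Rle_lt_trans; [apply (Series_abs_le _ (fun k => M (K + k)%nat)); auto|].
    - now apply (ex_series_incr_n M K).
    - eapply Rle_lt_trans; [apply Rle_abs|exact HK]. }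
  assert (T1 := T x0). rewrite Rminus_diag, Rabs_R0 in T1. specialize (T1 (cond_pos d)).
  assert (T2 := T y ltac:(lra)).
  assert (T3 : Rabs (rsum (fun n => f n y) K - rsum (fun n => f n x0) K) < eps / 3).
  { destruct (Req_dec x0 y) as [<-|Hne]; [rewrite Rminus_diag, Rabs_R0; lra|].
    apply Hd''. split; [split; auto; exact I|simpl; unfold R_dist; lra]. }
  apply Rabs_def2 in T1. apply Rabs_def2 in T2. apply Rabs_def2 in T3. apply Rabs_def1; lra.
Qed.

(** * The two theta functions in the logarithmic variable *)

Definition uterm (m : nat) (t : R) : R := exp (- (PI * exp t * INR (S m) ^ 2)).
Definition ufun (t : R) : R := Series (fun m => uterm m t).
Definition ucut (X : nat) (t : R) : R := rsum (fun m => uterm m t) X.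

(** Used with [eta = PI / q]. The power [a] in [phi] contributes a factor [exp (a x / 2)], which
    gives both parities the same reflection factor [exp (x / 2)]. *)
Definition vterm (c : Z -> R) (a : nat) (eta : R) (d : nat) (x : R) : R :=
  c (Z.of_nat (S d)) * phi a eta (INR (S d) * exp (x / 2)).
Definition vfun c a eta (x : R) : R := Series (fun d => vterm c a eta d x).
Definition vcut c a eta (X : nat) (x : R) : R := rsum (fun d => vterm c a eta d x) X.

Lemma uterm_bound k m t : (1 <= k)%nat ->
  uterm m t <= INR k ^ k / PI ^ k * exp (- INR k * t) * / INR (S m) ^ 2.
Proof.
  intros Hk. unfold uterm. pose proof PI_RGT_0 as Hpi. pose proof (exp_pos t) as Ht.
  pose proof (INR_S_ge_1 m) as Hm. set (n := INR (S m)) in *.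
  assert (Hn2 : 1 <= n ^ 2) by nra.
  eapply Rle_trans; [apply (exp_neg_le_pow k)|].
  - apply Rmult_lt_0_compat; [apply Rmult_lt_0_compat; lra|lra].
  - rewrite !Rpow_mult_distr.
    replace (- INR k * t) with (- (INR k * t)) by ring. rewrite exp_Ropp, exp_nat_mult.
    assert (Hkk : 0 <= INR k ^ k) by (apply pow_le, pos_INR).
    assert (P : 0 < PI ^ k) by (apply pow_lt; lra). assert (Q : 0 < exp t ^ k) by (apply pow_lt; lra).
    assert (E : n ^ 2 <= (n ^ 2) ^ k).
    { rewrite <- (pow_1 (n ^ 2)) at 1. apply Rle_pow; auto. }
    replace (INR k ^ k / (PI ^ k * exp t ^ k * (n ^ 2) ^ k))
      with (INR k ^ k / PI ^ k * / exp t ^ k * / (n ^ 2) ^ k) by (field; repeat split; lra).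
    apply Rmult_le_compat_l.
    + apply Rmult_le_pos; [apply Rdiv_le_0_compat; auto|left; now apply Rinv_0_lt_compat].
    + apply Rinv_le_contravar; lra.
Qed.

Lemma uterm_pos m t : 0 < uterm m t.
Proof. apply exp_pos. Qed.

Lemma cont_uterm m : cont (uterm m).
Proof.
  intros t. apply (ex_derive_continuous (uterm m)). unfold uterm. auto_derive. auto.
Qed.

Lemma ex_series_uterm t : ex_series (fun m => uterm m t).
Proof.
  apply ex_series_Rabs_le with (fun m => INR 1 ^ 1 / PI ^ 1 * exp (- INR 1 * t) * / INR (S m) ^ 2).
  - intros m. rewrite Rabs_pos_eq by (left; apply uterm_pos). apply uterm_bound. lia.
  - apply ex_series_inv_sq_scal.
Qed.

Definition zeta2 : R := Series (fun n => / INR (S n) ^ 2).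

Lemma inv_sq_nonneg n : 0 <= / INR (S n) ^ 2.
Proof. left. apply Rinv_0_lt_compat, pow_lt. pose proof (INR_S_ge_1 n). lra. Qed.

Lemma zeta2_nonneg : 0 <= zeta2.
Proof.
  apply (Rle_trans _ (rsum (fun n => / INR (S n) ^ 2) 0)); [simpl; lra|].
  apply rsum_le_Series; [apply inv_sq_nonneg|apply ex_series_inv_sq].
Qed.

Definition tail2 (X : nat) : R := Series (fun n => / INR (S (X + n)) ^ 2).

Lemma tail2_lim : is_lim_seq tail2 0.
Proof. apply (Series_tail_lim _ ex_series_inv_sq). Qed.

Lemma tail2_ex X : ex_series (fun n => / INR (S (X + n)) ^ 2).
Proof. apply (ex_series_incr_n (fun n => / INR (S n) ^ 2) X), ex_series_inv_sq. Qed.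

(** The exponent [k] is free because a Gaussian beats every power. The case [k = 2] makes the
    convolution decay like [exp (- 2 L)], so that its moments exist for [s < 4]. *)
Lemma ufun_cut_bound k X t : (1 <= k)%nat ->
  0 <= ufun t - ucut X t <= INR k ^ k / PI ^ k * exp (- INR k * t) * tail2 X.
Proof.
  intros Hk. unfold ufun, ucut. rewrite (Series_split _ X (ex_series_uterm t)).
  replace (rsum (fun m => uterm m t) X + Series (fun k0 => uterm (X + k0) t) - rsum (fun m => uterm m t) X)
    with (Series (fun k0 => uterm (X + k0) t)) by ring.
  assert (Hex : ex_series (fun k0 => uterm (X + k0) t))
    by (apply (ex_series_incr_n (fun m => uterm m t) X), ex_series_uterm).
  split.
  - apply (Rle_trans _ (rsum (fun k0 => uterm (X + k0) t) 0)); [simpl; lra|].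
    apply rsum_le_Series; auto. intros n. left. apply uterm_pos.
  - unfold tail2. rewrite <- Series_scal_l. apply Series_le.
    + intros n. split; [left; apply uterm_pos|now apply uterm_bound].
    + apply ex_series_scal_R, tail2_ex.
Qed.

Lemma ufun_bound k t : (1 <= k)%nat ->
  0 <= ufun t <= INR k ^ k / PI ^ k * zeta2 * exp (- INR k * t).
Proof.
  intros Hk. pose proof (ufun_cut_bound k 0 t Hk) as H. unfold ucut in H. simpl rsum in H.
  unfold tail2 in H. rewrite (Series_ext _ (fun n => / INR (S n) ^ 2)) in H by reflexivity.
  fold zeta2 in H. lra.
Qed.

Lemma cont_ufun : cont ufun.
Proof.
  intros t. unfold ufun.
  apply (continuous_Series uterm (fun m => INR 1 ^ 1 / PI ^ 1 * exp (- INR 1 * (t - 1)) * / INR (S m) ^ 2)).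
  - intros n. apply cont_uterm.
  - apply ex_series_inv_sq_scal.
  - exists (mkposreal 1 Rlt_0_1). intros x Hx n.
    unfold ball in Hx; simpl in Hx. unfold AbsRing_ball, abs, minus, plus, opp in Hx; simpl in Hx.
    apply Rabs_def2 in Hx.
    rewrite Rabs_pos_eq by (left; apply uterm_pos). eapply Rle_trans; [apply (uterm_bound 1); lia|].
    apply Rmult_le_compat_r; [apply inv_sq_nonneg|]. apply Rmult_le_compat_l.
    + apply Rdiv_le_0_compat; [apply pow_le; simpl; lra|apply pow_lt, PI_RGT_0].
    + apply exp_le_mono. simpl. lra.
Qed.

Lemma cont_ucut X : cont (ucut X).
Proof.
  induction X as [|X IH]; [apply (cont_const 0)|].
  apply (cont_plus (ucut X) (uterm X)); auto. apply cont_uterm.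
Qed.

(** At least two powers of [n e^(x/2)] are spent, so that [1 / n^2] makes the series converge, and
    at most the eight that [phi_decay] offers. *)
Lemma vterm_bound c a eta : (a <= 1)%nat -> 0 < eta -> (forall n, Rabs (c n) <= 1) ->
  exists C, 0 <= C /\ forall k d x, (2 <= k <= 8)%nat ->
    Rabs (vterm c a eta d x) <= C * exp (- (INR k / 2) * x) * / INR (S d) ^ 2.
Proof.
  intros Ha He Hc. destruct (phi_decay a eta Ha He) as [C [HC0 HC]].
  exists C. split; auto. intros k d x Hk. unfold vterm.
  pose proof (INR_S_ge_1 d) as Hd. set (n := INR (S d)) in *.
  set (y := exp (x / 2)). assert (Hy : 0 < y) by apply exp_pos.
  assert (Hny : 0 < n * y) by (apply Rmult_lt_0_compat; lra).
  destruct (HC (n * y) ltac:(lra)) as [H1 _].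
  rewrite Rabs_mult.
  apply Rle_trans with (1 * (C / (1 + n * y) ^ 8)).
  { apply Rmult_le_compat; auto using Rabs_pos. }
  rewrite Rmult_1_l. unfold Rdiv at 1. rewrite Rmult_assoc. apply Rmult_le_compat_l; auto.
  replace (- (INR k / 2) * x) with (- (INR k * (x / 2))) by field.
  rewrite exp_Ropp, exp_nat_mult, <- Rinv_mult. fold y.
  apply Rinv_le_contravar.
  - apply Rmult_lt_0_compat; [apply pow_lt; auto|apply pow_lt; lra].
  - apply Rle_trans with ((n * y) ^ k).
    + rewrite Rpow_mult_distr, Rmult_comm. apply Rmult_le_compat_r; [apply pow_le; lra|].
      apply Rle_pow; [lra|lia].
    + apply Rle_trans with ((1 + n * y) ^ k); [apply pow_incr; lra|].
      apply Rle_pow; [lra|lia].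
Qed.

Lemma cont_vterm c a eta d : (a <= 1)%nat -> cont (vterm c a eta d).
Proof.
  intros Ha. unfold vterm. apply cont_mult; [apply cont_const|].
  apply (cont_comp (fun x => INR (S d) * exp (x / 2)) (phi a eta)); [|now apply cont_phi].
  apply cont_mult; [apply cont_const|].
  apply (cont_ext (fun x => exp (/ 2 * x))); [intros; f_equal; field|apply cont_exp_lin].
Qed.

Lemma cont_vcut c a eta X : (a <= 1)%nat -> cont (vcut c a eta X).
Proof.
  intros Ha. induction X as [|X IH]; [apply (cont_const 0)|].
  apply (cont_plus (vcut c a eta X) (vterm c a eta X)); auto. now apply cont_vterm.
Qed.

Lemma ex_series_vterm c a eta x : (a <= 1)%nat -> 0 < eta -> (forall n, Rabs (c n) <= 1) ->
  ex_series (fun d => vterm c a eta d x).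
Proof.
  intros Ha He Hc. destruct (vterm_bound c a eta Ha He Hc) as [C [HC0 HC]].
  apply ex_series_Rabs_le with (fun d => C * exp (- (INR 2 / 2) * x) * / INR (S d) ^ 2).
  - intros d. apply HC. lia.
  - apply ex_series_inv_sq_scal.
Qed.

Lemma vfun_cut_bound c a eta : (a <= 1)%nat -> 0 < eta -> (forall n, Rabs (c n) <= 1) ->
  exists C, 0 <= C /\ forall k X x, (2 <= k <= 8)%nat ->
    Rabs (vfun c a eta x - vcut c a eta X x) <= C * exp (- (INR k / 2) * x) * tail2 X.
Proof.
  intros Ha He Hc. destruct (vterm_bound c a eta Ha He Hc) as [C [HC0 HC]].
  exists C. split; auto. intros k X x Hk. unfold vfun, vcut.
  rewrite (Series_split _ X (ex_series_vterm c a eta x Ha He Hc)).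
  replace (rsum (fun d => vterm c a eta d x) X + Series (fun j => vterm c a eta (X + j) x)
     - rsum (fun d => vterm c a eta d x) X) with (Series (fun j => vterm c a eta (X + j) x)) by ring.
  unfold tail2. rewrite <- Series_scal_l. apply Series_abs_le.
  - intros n. apply HC. auto.
  - apply ex_series_scal_R, tail2_ex.
Qed.

Lemma tail2_0 : tail2 0 = zeta2.
Proof. reflexivity. Qed.

Lemma vfun_bound c a eta : (a <= 1)%nat -> 0 < eta -> (forall n, Rabs (c n) <= 1) ->
  exists C, 0 <= C /\ forall k x, (2 <= k <= 8)%nat -> Rabs (vfun c a eta x) <= C * exp (- (INR k / 2) * x).
Proof.
  intros Ha He Hc. destruct (vfun_cut_bound c a eta Ha He Hc) as [C [HC0 HC]].
  exists (C * zeta2). split; [apply Rmult_le_pos; auto using zeta2_nonneg|].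
  intros k x Hk. specialize (HC k O x Hk). unfold vcut in HC. simpl rsum in HC.
  rewrite Rminus_0_r, tail2_0 in HC. lra.
Qed.

Lemma cont_vfun c a eta : (a <= 1)%nat -> 0 < eta -> (forall n, Rabs (c n) <= 1) -> cont (vfun c a eta).
Proof.
  intros Ha He Hc x0. destruct (vterm_bound c a eta Ha He Hc) as [C [HC0 HC]].
  apply (continuous_Series (fun d => vterm c a eta d)
    (fun d => C * exp (- (INR 2 / 2) * (x0 - 1)) * / INR (S d) ^ 2)).
  - intros n. now apply cont_vterm.
  - apply ex_series_inv_sq_scal.
  - exists (mkposreal 1 Rlt_0_1). intros x Hx n.
    unfold ball in Hx; simpl in Hx. unfold AbsRing_ball, abs, minus, plus, opp in Hx; simpl in Hx.
    apply Rabs_def2 in Hx.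
    eapply Rle_trans; [apply (HC 2%nat); lia|].
    apply Rmult_le_compat_r; [apply inv_sq_nonneg|]. apply Rmult_le_compat_l; auto.
    apply exp_le_mono. simpl. lra.
Qed.

(** * Functional equations *)

(* Removing the growth at [-oo] leaves an exact reflection formula, at the price of a slower decay at [+oo]. *)
Definition ureg (t : R) : R := ufun t - / 2 * exp (- (t / 2)).

Lemma ufun_gauss t : ufun t = gauss (PI * exp t).
Proof. apply Series_ext. intros n. unfold uterm. now rewrite Rmult_1_l. Qed.

Lemma sqrt_exp x : sqrt (exp x) = exp (x / 2).
Proof.
  rewrite <- (sqrt_Rsqr (exp (x / 2))) by (left; apply exp_pos). f_equal.
  unfold Rsqr. rewrite <- exp_plus. f_equal. field.
Qed.

Lemma exp_half_sq t : exp (- (t / 2)) * exp (t / 2) = 1.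
Proof. rewrite <- exp_plus, <- exp_0. f_equal. ring. Qed.

(** At [tau = e^t / PI] the theta identity reads [1 + 2 u(-t) = e^(t/2) (1 + 2 u(t))]; subtracting
    half of [e^(-t/2)] from [u(t)] absorbs the constant term. *)
Lemma ureg_reflect t : ureg (- t) = exp (t / 2) * ureg t.
Proof.
  pose proof PI_RGT_0 as Hpi. unfold ureg. rewrite !ufun_gauss.
  assert (Ht : 0 < exp t / PI) by (apply Rdiv_lt_0_compat; [apply exp_pos|auto]).
  pose proof (theta_identity_even 1 (fun _ => 1) _ (le_n _) zperiodic_one (fun _ => eq_refl) Ht) as E.
  rewrite cosT_trivial in E.
  assert (Hz : cosTz (fun _ => 1) 1 = fun _ => 1) by
    (apply FunctionalExtensionality.functional_extensionality; intros z; apply cosT_trivial).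
  rewrite Hz in E. fold (gauss (/ (exp t / PI))) in E.
  replace (PI ^ 2 * (exp t / PI) / INR 1 ^ 2) with (PI * exp t) in E by (simpl; field; lra).
  fold (gauss (PI * exp t)) in E.
  replace (PI * (exp t / PI)) with (exp t) in E by (field; lra).
  replace (/ (exp t / PI)) with (PI * exp (- t)) in E
    by (pose proof (exp_pos t); rewrite exp_Ropp; field; lra).
  rewrite sqrt_exp in E. simpl (INR 1) in E.
  replace (- (- t / 2)) with (t / 2) by field.
  pose proof (exp_half_sq t). nra.
Qed.

Lemma vfun_even c q x : (1 <= q)%nat ->
  vfun c 0 (PI / INR q) x = gauss_even c (PI * exp x / INR q).
Proof.
  intros Hq. apply Series_ext. intros d. unfold vterm, phi. rewrite pow_O, Rmult_1_l.
  do 3 f_equal. rewrite Rpow_mult_distr.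
  replace (exp (x / 2) ^ 2) with (exp x) by (simpl; rewrite Rmult_1_r, <- exp_plus; f_equal; field).
  unfold Rdiv. ring.
Qed.

Lemma vfun_odd c q x : (1 <= q)%nat ->
  vfun c 1 (PI / INR q) x = exp (x / 2) * gauss_odd c (PI * exp x / INR q).
Proof.
  intros Hq. unfold gauss_odd. rewrite <- Series_scal_l. apply Series_ext. intros d.
  unfold vterm, phi. rewrite pow_1.
  replace (- (PI / INR q * (INR (S d) * exp (x / 2)) ^ 2)) with (- (PI * exp x / INR q * INR (S d) ^ 2)).
  - ring.
  - rewrite Rpow_mult_distr.
    replace (exp (x / 2) ^ 2) with (exp x) by (simpl; rewrite Rmult_1_r, <- exp_plus; f_equal; field).
    unfold Rdiv. ring.
Qed.

Lemma gauss_even_scal c T x : gauss_even (fun z => T * c z) x = T * gauss_even c x.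
Proof. unfold gauss_even. rewrite <- Series_scal_l. apply Series_ext. intros n. ring. Qed.

Lemma gauss_even_ext c c' x : (forall n : nat, c (Z.of_nat (S n)) = c' (Z.of_nat (S n))) ->
  gauss_even c x = gauss_even c' x.
Proof. intros H. apply Series_ext. intros n. now rewrite H. Qed.

Lemma gauss_odd_ext c T c' x : (forall n : nat, c (Z.of_nat (S n)) = T * c' (Z.of_nat (S n))) ->
  gauss_odd c x = T * gauss_odd c' x.
Proof. intros H. unfold gauss_odd. rewrite <- Series_scal_l. apply Series_ext. intros n. rewrite H. ring. Qed.

(** The hypothesis on [cosT] says that [c] is an eigenvector of the finite cosine transform, with
    the Gauss sum [T] as eigenvalue. As [c 0 = 0], no constant terms survive in the theta identity
    and no regularisation is required. *)
Lemma vfun_reflect_even c q T x : (1 <= q)%nat -> zperiodic q c -> (forall n, c (- n)%Z = c n) ->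
  (forall j, cosT c q j = T * c (Z.of_nat j)) -> c 0%Z = 0 ->
  vfun c 0 (PI / INR q) (- x) = T / sqrt (INR q) * exp (x / 2) * vfun c 0 (PI / INR q) x.
Proof.
  intros Hq Hp He HT H0. pose proof PI_RGT_0 as Hpi.
  assert (Hq0 : 0 < INR q) by (apply lt_0_INR; lia).
  assert (Hsq : 0 < sqrt (INR q)) by now apply sqrt_lt_R0.
  rewrite !vfun_even by auto.
  assert (Ht : 0 < INR q * exp x / PI).
  { apply Rdiv_lt_0_compat; auto. apply Rmult_lt_0_compat; auto. apply exp_pos. }
  pose proof (theta_identity_even q c _ Hq Hp He Ht) as E.
  rewrite H0, HT in E. simpl Z.of_nat in E. rewrite H0, Rmult_0_r in E.
  rewrite (gauss_even_ext (cosTz c q) (fun z => T * c z)) in E.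
  2: { intros n. unfold cosTz. rewrite Nat2Z.id. apply HT. }
  rewrite gauss_even_scal in E.
  replace (PI ^ 2 * (INR q * exp x / PI) / INR q ^ 2) with (PI * exp x / INR q) in E by (field; lra).
  replace (PI * (INR q * exp x / PI)) with (INR q * exp x) in E by (field; lra).
  replace (/ (INR q * exp x / PI)) with (PI * exp (- x) / INR q) in E
    by (pose proof (exp_pos x); rewrite exp_Ropp; field; repeat split; lra).
  rewrite sqrt_mult, sqrt_exp in E by (try lra; left; apply exp_pos).
  assert (Eq : sqrt (INR q) / INR q = / sqrt (INR q)).
  { rewrite <- (sqrt_sqrt (INR q)) at 2 by lra. field. lra. }
  replace (sqrt (INR q) * exp (x / 2) / INR q) with (sqrt (INR q) / INR q * exp (x / 2)) in E by (field; lra).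
  rewrite Eq in E. unfold Rdiv at 2. nra.
Qed.

Lemma vfun_reflect_odd c q T x : (1 <= q)%nat -> zperiodic q c -> (forall n, c (- n)%Z = - c n) ->
  (forall j, sinT c q j = T * c (Z.of_nat j)) ->
  vfun c 1 (PI / INR q) (- x) = T / sqrt (INR q) * exp (x / 2) * vfun c 1 (PI / INR q) x.
Proof.
  intros Hq Hp He HT. pose proof PI_RGT_0 as Hpi.
  assert (Hq0 : 0 < INR q) by (apply lt_0_INR; lia).
  assert (Hsq : 0 < sqrt (INR q)) by now apply sqrt_lt_R0.
  rewrite !vfun_odd by auto.
  assert (Ht : 0 < INR q * exp x / PI).
  { apply Rdiv_lt_0_compat; auto. apply Rmult_lt_0_compat; auto. apply exp_pos. }
  pose proof (theta_identity_odd q c _ Hq Hp He Ht) as E.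
  rewrite (gauss_odd_ext (sinTz c q) T c) in E.
  2: { intros n. unfold sinTz. rewrite Nat2Z.id. apply HT. }
  replace (PI ^ 2 * (INR q * exp x / PI) / INR q ^ 2) with (PI * exp x / INR q) in E by (field; lra).
  replace (PI * (INR q * exp x / PI)) with (INR q * exp x) in E by (field; lra).
  replace (/ (INR q * exp x / PI)) with (PI * exp (- x) / INR q) in E
    by (pose proof (exp_pos x); rewrite exp_Ropp; field; repeat split; lra).
  rewrite sqrt_mult, sqrt_exp in E by (try lra; left; apply exp_pos).
  rewrite E.
  assert (Eq : sqrt (INR q) / INR q = / sqrt (INR q)).
  { rewrite <- (sqrt_sqrt (INR q)) at 2 by lra. field. lra. }
  replace (INR q * exp x / PI * (sqrt (INR q) * exp (x / 2)) * PI / INR q ^ 2)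
    with (sqrt (INR q) / INR q * (exp x * exp (x / 2))) by (field; lra).
  rewrite Eq. replace (- x / 2) with (- (x / 2)) by field.
  assert (Ex : exp x = exp (x / 2) * exp (x / 2)) by (rewrite <- exp_plus; f_equal; field).
  rewrite Ex. pose proof (exp_half_sq x) as Eh.
  replace (exp (- (x / 2)) * (/ sqrt (INR q) * (exp (x / 2) * exp (x / 2) * exp (x / 2)) *
     (T * gauss_odd c (PI * (exp (x / 2) * exp (x / 2)) / INR q))))
   with ((exp (- (x / 2)) * exp (x / 2)) * (/ sqrt (INR q) * (exp (x / 2) * exp (x / 2)) *
     (T * gauss_odd c (PI * (exp (x / 2) * exp (x / 2)) / INR q)))) by ring.
  rewrite Eh. unfold Rdiv. ring.
Qed.

(** * Tails of the twisted theta series, uniformly near [-oo] *)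

Lemma abel_sum (f b : nat -> R) n :
  rsum (fun i => f i * b i) n = rsum f n * b n + rsum (fun i => rsum f (S i) * (b i - b (S i))) n.
Proof.
  induction n as [|n IH]; [simpl; ring|]. cbn [rsum]. rewrite IH. cbn [rsum]. ring.
Qed.

Lemma abel_sum_bound (f b : nat -> R) B n : (forall k, Rabs (rsum f k) <= B) ->
  Rabs (rsum (fun i => f i * b i) n) <= B * (Rabs (b n) + rsum (fun i => Rabs (b i - b (S i))) n).
Proof.
  intros HB.
  rewrite abel_sum. eapply Rle_trans; [apply Rabs_triang|].
  rewrite Rmult_plus_distr_l. apply Rplus_le_compat.
  - rewrite Rabs_mult. apply Rmult_le_compat_r; auto using Rabs_pos.
  - eapply Rle_trans; [apply rsum_abs|]. rewrite <- rsum_scal. apply rsum_le. intros i _.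
    rewrite Rabs_mult. apply Rmult_le_compat_r; auto using Rabs_pos.
Qed.

Lemma phi_increment a eta C z y : (a <= 1)%nat -> 0 <= z -> 0 < y ->
  (forall x, 0 <= x -> Rabs (dphi a eta x) <= C / (1 + x) ^ 8) -> 0 <= C ->
  Rabs (phi a eta z - phi a eta (z + y)) <= C * (y / (1 + z) ^ 8).
Proof.
  intros Ha Hz Hy HC HC0.
  destruct (MVT_gen (phi a eta) z (z + y) (dphi a eta)) as [x [Hx E]].
  - intros x _. now apply is_derive_phi.
  - intros x _. apply continuity_pt_filterlim. now apply cont_phi.
  - rewrite Rmin_left, Rmax_right in Hx by lra.
    rewrite Rabs_minus_sym, E. replace (z + y - z) with y by ring.
    rewrite Rabs_mult, (Rabs_pos_eq y) by lra.
    replace (C * (y / (1 + z) ^ 8)) with (C / (1 + z) ^ 8 * y) by (unfold Rdiv; ring).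
    apply Rmult_le_compat_r; [lra|]. eapply Rle_trans; [apply HC; lra|].
    unfold Rdiv. apply Rmult_le_compat_l; auto.
    apply Rinv_le_contravar; [apply pow_lt; lra|apply pow_incr; lra].
Qed.

(** Six of the eight powers are estimated at the starting point [w]; the remaining two dominate a
    telescoping difference of reciprocals. *)
Lemma increment_telescope w z y : 0 <= w -> w + y <= z -> 0 < y ->
  y / (1 + z) ^ 8 <= / (1 + w) ^ 6 * (/ (1 + (z - y)) - / (1 + z)).
Proof.
  intros Hw Hz Hy.
  assert (A1 : 0 < (1 + w) ^ 6) by (apply pow_lt; lra).
  assert (A2 : (1 + w) ^ 6 <= (1 + z) ^ 6) by (apply pow_incr; lra).
  replace (y / (1 + z) ^ 8) with (/ (1 + z) ^ 6 * (y / (1 + z) ^ 2)) by (field; lra).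
  apply Rmult_le_compat.
  - left. apply Rinv_0_lt_compat, pow_lt. lra.
  - apply Rdiv_le_0_compat; [lra|apply pow_lt; lra].
  - apply Rinv_le_contravar; auto.
  - replace (/ (1 + (z - y)) - / (1 + z)) with (y * / ((1 + (z - y)) * (1 + z))) by (field; lra).
    unfold Rdiv. apply Rmult_le_compat_l; [lra|].
    apply Rinv_le_contravar; [apply Rmult_lt_0_compat; lra|].
    simpl. rewrite Rmult_1_r. apply Rmult_le_compat_r; lra.
Qed.

(** Near [x = -oo] the terms vary slowly, and absolute values would cost a factor [e^(-x/2)].
    Summation by parts against the bounded sums of [c] leaves the total variation of [phi] beyond
    [N e^(x/2)], which does not depend on the step length. *)
Lemma vfun_tail_bound c a eta B : (a <= 1)%nat -> 0 < eta -> (forall n, Rabs (c n) <= 1) ->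
  (forall n, Rabs (rsum (fun i => c (Z.of_nat (S i))) n) <= B) ->
  exists K, 0 <= K /\ forall N x,
    Rabs (vcut c a eta N x - vfun c a eta x) <= K / (1 + INR N * exp (x / 2)) ^ 7.
Proof.
  intros Ha He Hc HB. destruct (phi_decay a eta Ha He) as [C [HC0 HC]].
  assert (HB0 : 0 <= B) by (eapply Rle_trans; [apply Rabs_pos|apply (HB O)]).
  exists (4 * B * C). split; [apply Rmult_le_pos; [lra|auto]|].
  intros N x. set (y := exp (x / 2)). assert (Hy : 0 < y) by apply exp_pos.
  set (w := INR N * y). assert (Hw : 0 <= w) by (apply Rmult_le_pos; [apply pos_INR|lra]).
  rewrite Rabs_minus_sym. unfold vfun, vcut.
  rewrite (Series_split _ N (ex_series_vterm c a eta x Ha He Hc)).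
  replace (rsum (fun d => vterm c a eta d x) N + Series (fun j => vterm c a eta (N + j) x)
     - rsum (fun d => vterm c a eta d x) N) with (Series (fun j => vterm c a eta (N + j) x)) by ring.
  assert (Hex : ex_series (fun j => vterm c a eta (N + j) x)).
  { apply (ex_series_incr_n (fun d => vterm c a eta d x) N). now apply ex_series_vterm. }
  apply (is_lim_seq_le (fun n => Rabs (rsum (fun j => vterm c a eta (N + j) x) n))
           (fun _ => 4 * B * C / (1 + w) ^ 7)
           (Rabs (Series (fun j => vterm c a eta (N + j) x))) (4 * B * C / (1 + w) ^ 7)).
  2: { apply (is_lim_seq_abs _ (Series (fun j => vterm c a eta (N + j) x))).
       now apply Series_rsum_lim. }
  2: apply is_lim_seq_const.
  intros n.
  set (z := fun i => w + INR (S i) * y).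
  assert (Hz : forall i, w + y <= z i).
  { intros i. unfold z. pose proof (INR_S_ge_1 i). nra. }
  rewrite (rsum_ext _ (fun i => c (Z.of_nat (S (N + i))) * phi a eta (z i))).
  2: { intros i _. unfold vterm. do 2 f_equal. unfold z, w. fold y.
       rewrite <- Nat.add_succ_r, plus_INR. ring. }
  (* Partial sums that start after [N] are differences of two initial ones, hence [2 B]. *)
  eapply Rle_trans; [apply (abel_sum_bound _ _ (2 * B))|].
  { intros k. replace (rsum (fun i => c (Z.of_nat (S (N + i)))) k)
      with (rsum (fun i => c (Z.of_nat (S i))) (N + k) - rsum (fun i => c (Z.of_nat (S i))) N)
      by (rewrite rsum_add; ring).
    pose proof (HB (N + k)%nat) as H1. pose proof (HB N) as H2.
    apply Rabs_le_between in H1. apply Rabs_le_between in H2. apply Rabs_le. lra. }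
  assert (P6 : 0 < (1 + w) ^ 6) by (apply pow_lt; lra).
  assert (P7 : 0 < (1 + w) ^ 7) by (apply pow_lt; lra).
  assert (T1 : Rabs (phi a eta (z n)) <= C / (1 + w) ^ 7).
  { eapply Rle_trans; [apply HC; specialize (Hz n); lra|].
    unfold Rdiv. apply Rmult_le_compat_l; auto. apply Rinv_le_contravar; auto.
    apply Rle_trans with ((1 + z n) ^ 7).
    - apply pow_incr. specialize (Hz n). lra.
    - apply Rle_pow; [specialize (Hz n); lra|lia]. }
  assert (T2 : rsum (fun i => Rabs (phi a eta (z i) - phi a eta (z (S i)))) n
     <= C * (/ (1 + w) ^ 6 * (/ (1 + w) - / (1 + (w + INR n * y))))).
  { apply Rle_trans with (rsum (fun i => C * (/ (1 + w) ^ 6 * (/ (1 + (z i - y)) - / (1 + z i)))) n).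
    - apply rsum_le. intros i _.
      replace (z (S i)) with (z i + y) by (unfold z; rewrite (S_INR (S i)); ring).
      eapply Rle_trans; [apply (phi_increment a eta C); auto; [specialize (Hz i); lra|]|].
      + intros u Hu. now apply HC.
      + apply Rmult_le_compat_l; auto. apply increment_telescope; auto.
    - rewrite rsum_scal, rsum_scal. right. do 2 f_equal.
      assert (Tel : forall k, rsum (fun i => / (1 + (z i - y)) - / (1 + z i)) k
         = / (1 + w) - / (1 + (w + INR k * y))).
      { induction k as [|k IH]; [simpl; replace (w + 0 * y) with w by ring; ring|].
        cbn [rsum]. rewrite IH. unfold z.
        replace (w + INR (S k) * y - y) with (w + INR k * y) by (rewrite S_INR; ring). ring. }
      apply Tel. }
  assert (T3 : C * (/ (1 + w) ^ 6 * (/ (1 + w) - / (1 + (w + INR n * y)))) <= C / (1 + w) ^ 7).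
  { unfold Rdiv. apply Rmult_le_compat_l; auto.
    apply Rle_trans with (/ (1 + w) ^ 6 * / (1 + w)); [|right; field; lra].
    apply Rmult_le_compat_l; [left; now apply Rinv_0_lt_compat|].
    assert (0 < / (1 + (w + INR n * y))).
    { apply Rinv_0_lt_compat. assert (0 <= INR n * y) by (apply Rmult_le_pos; [apply pos_INR|lra]). lra. }
    lra. }
  replace (4 * B * C / (1 + w) ^ 7) with (2 * B * (C / (1 + w) ^ 7 + C / (1 + w) ^ 7)) by (field; lra).
  apply Rmult_le_compat_l; lra.
Qed.

Lemma inv_1p_le_exp t e : 0 <= e <= 1 -> / (1 + exp t) <= exp (- e * t).
Proof.
  intros He. replace (- e * t) with (- (e * t)) by ring. rewrite exp_Ropp.
  apply Rinv_le_contravar; [apply exp_pos|].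
  destruct (Rle_lt_dec 0 t) as [Ht|Ht].
  - apply Rle_trans with (exp t); [apply exp_le_mono; nra|lra].
  - apply Rle_trans with 1; [rewrite <- exp_0; apply exp_le_mono; nra|].
    pose proof (exp_pos t). lra.
Qed.

(** * Mellin transforms and Dirichlet series *)

Definition halfexp (s x : R) : R := exp (s / 2 * x).
Lemma cont_halfexp s : cont (halfexp s).
Proof. apply cont_exp_lin. Qed.

Lemma cont_exp_half : cont (fun x => exp (x / 2)).
Proof. apply (cont_ext (fun x => exp (/ 2 * x))); [intros; f_equal; field|apply cont_exp_lin]. Qed.

Lemma ibound_of_sides eta C f :
  (forall x, 0 <= x -> Rabs (f x) <= C * exp (- eta * x)) ->
  (forall x, x <= 0 -> Rabs (f x) <= C * exp (eta * x)) -> ibound eta C f.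
Proof.
  intros H1 H2 x. destruct (Rle_lt_dec 0 x) as [Hx|Hx].
  - rewrite (Rabs_pos_eq x) by auto. now apply H1.
  - rewrite (Rabs_left x) by auto. replace (- eta * - x) with (eta * x) by ring. apply H2. lra.
Qed.

Lemma phi_exp_ibound a eta : (a <= 1)%nat -> 0 < eta -> exists C, 0 <= C /\ forall s, 0 < s <= 2 ->
  ibound (s / 2) C (fun x => phi a eta (exp (x / 2)) * halfexp s x).
Proof.
  intros Ha He. destruct (phi_decay a eta Ha He) as [C [HC0 HC]].
  exists C. split; auto. intros s Hs.
  assert (G : forall x, Rabs (phi a eta (exp (x / 2)) * halfexp s x) <= C / (1 + exp (x / 2)) ^ 8 * halfexp s x).
  { intros x. rewrite Rabs_mult, (Rabs_pos_eq (halfexp s x)) by (left; apply exp_pos).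
    apply Rmult_le_compat_r; [left; apply exp_pos|]. apply HC. left; apply exp_pos. }
  assert (D8 : forall x, 1 <= (1 + exp (x / 2)) ^ 8).
  { intros x. apply pow_R1_Rle. pose proof (exp_pos (x / 2)). lra. }
  apply ibound_of_sides; intros x Hx; (eapply Rle_trans; [apply G|]);
    specialize (D8 x); unfold Rdiv at 1; rewrite Rmult_assoc; apply Rmult_le_compat_l; auto.
  - apply Rle_trans with (/ exp (x / 2) ^ 8 * halfexp s x).
    + apply Rmult_le_compat_r; [left; apply exp_pos|]. pose proof (exp_pos (x / 2)).
      apply Rinv_le_contravar; [apply pow_lt; auto|apply pow_incr; lra].
    + rewrite <- exp_nat_mult, <- exp_Ropp. unfold halfexp. rewrite <- exp_plus.
      apply exp_le_mono. simpl. nra.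
  - unfold halfexp. rewrite <- (Rmult_1_l (exp (s / 2 * x))) at 2.
    apply Rmult_le_compat_r; [left; apply exp_pos|].
    rewrite <- Rinv_1. apply Rinv_le_contravar; lra.
Qed.

Lemma cont_phi_exp a eta s : (a <= 1)%nat -> cont (fun x => phi a eta (exp (x / 2)) * halfexp s x).
Proof.
  intros Ha. apply cont_mult; [|apply cont_halfexp].
  apply (cont_comp (fun x => exp (x / 2)) (phi a eta)); [apply cont_exp_half|now apply cont_phi].
Qed.

Lemma phi_exp_igood a eta s : (a <= 1)%nat -> 0 < eta -> 0 < s <= 2 ->
  igood (fun x => phi a eta (exp (x / 2)) * halfexp s x).
Proof.
  intros Ha He Hs. destruct (phi_exp_ibound a eta Ha He) as [C [_ HC]].
  split; [now apply cont_phi_exp|]. exists (s / 2), C. split; [lra|auto].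
Qed.

(** The archimedean factor: with [w = e^x] it is [eta ^ (- (s + a) / 2) * Gamma ((s + a) / 2)]. *)
Definition gam (a : nat) (eta s : R) : R := Int (fun x => phi a eta (exp (x / 2)) * halfexp s x).
Lemma gam_bounded a eta : (a <= 1)%nat -> 0 < eta -> exists C, 0 <= C /\
  forall s, 1 / 2 <= s <= 2 -> Rabs (gam a eta s) <= C.
Proof.
  intros Ha He. destruct (phi_exp_ibound a eta Ha He) as [C [HC0 HC]].
  exists (8 * C). split; [lra|]. intros s Hs.
  eapply Rle_trans; [apply (Int_abs_bound (s / 2) C); [now apply cont_phi_exp|lra|apply HC; lra]|].
  apply Rmult_le_reg_r with (s / 2); [lra|]. unfold Rdiv at 1. rewrite Rmult_assoc, Rinv_l by lra. nra.
Qed.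

Definition dterm (c : Z -> R) (s : R) (n : nat) : R := c (Z.of_nat (S n)) * exp (- s * ln (INR (S n))).

(** In the logarithmic variable, rescaling by [n] is the translation by [2 ln n]; compensating the
    weight [e^(s x / 2)] produces [n^(-s)]. *)
Lemma vterm_shift c a eta s d x :
  vterm c a eta d x * halfexp s x
  = dterm c s d * ((fun x => phi a eta (exp (x / 2)) * halfexp s x) (x + 2 * ln (INR (S d)))).
Proof.
  unfold vterm, dterm, halfexp. pose proof (INR_S_ge_1 d) as Hd.
  replace ((x + 2 * ln (INR (S d))) / 2) with (ln (INR (S d)) + x / 2) by field.
  rewrite exp_plus, exp_ln by lra.
  replace (s / 2 * (x + 2 * ln (INR (S d)))) with (s / 2 * x + s * ln (INR (S d))) by field.
  rewrite (exp_plus (s / 2 * x)).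
  replace (- s * ln (INR (S d))) with (- (s * ln (INR (S d)))) by ring. rewrite exp_Ropp.
  pose proof (exp_pos (s * ln (INR (S d)))). field. lra.
Qed.

Lemma vterm_igood c a eta s d : (a <= 1)%nat -> 0 < eta -> 0 < s <= 2 ->
  igood (fun x => vterm c a eta d x * halfexp s x).
Proof.
  intros Ha He Hs.
  apply igood_ext with (fun x => dterm c s d *
    ((fun x => phi a eta (exp (x / 2)) * halfexp s x) (x + 2 * ln (INR (S d))))).
  { intros x. symmetry. apply vterm_shift. }
  apply igood_scal. apply (igood_shift (fun x => phi a eta (exp (x / 2)) * halfexp s x)).
  now apply phi_exp_igood.
Qed.

Lemma vcut_igood_Int c a eta s N : (a <= 1)%nat -> 0 < eta -> 0 < s <= 2 ->
  igood (fun x => vcut c a eta N x * halfexp s x) /\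
  Int (fun x => vcut c a eta N x * halfexp s x) = gam a eta s * rsum (dterm c s) N.
Proof.
  intros Ha He Hs. induction N as [|N [IH1 IH2]].
  - split.
    + apply igood_ext with (fun x => 0 * (phi a eta (exp (x / 2)) * halfexp s x)).
      * intros x. unfold vcut. simpl. ring.
      * apply igood_scal. now apply phi_exp_igood.
    + rewrite (Int_ext _ (fun x => 0 * (phi a eta (exp (x / 2)) * halfexp s x))).
      2: { intros x. unfold vcut. simpl. ring. }
      rewrite Int_scal by now apply phi_exp_igood. simpl. ring.
  - pose proof (vterm_igood c a eta s N Ha He Hs) as G.
    assert (E : forall x, vcut c a eta N x * halfexp s x + vterm c a eta N x * halfexp s x
       = vcut c a eta (S N) x * halfexp s x) by (intros x; unfold vcut; cbn [rsum]; ring).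
    split.
    + apply (igood_ext _ _ E). now apply igood_plus.
    + rewrite <- (Int_ext _ _ E), Int_plus, IH2 by auto. cbn [rsum].
      rewrite Rmult_plus_distr_l. f_equal.
      rewrite (Int_ext _ _ (vterm_shift c a eta s N)).
      rewrite Int_scal by (apply (igood_shift (fun x => phi a eta (exp (x / 2)) * halfexp s x)); now apply phi_exp_igood).
      rewrite (Int_shift (fun x => phi a eta (exp (x / 2)) * halfexp s x)) by now apply phi_exp_igood.
      unfold gam. ring.
Qed.

Lemma Rabs_le_mult_compat x y k : 0 <= k -> Rabs x <= y -> Rabs (x * k) <= y * k.
Proof. intros Hk H. rewrite Rabs_mult, (Rabs_pos_eq k) by auto. now apply Rmult_le_compat_r. Qed.

(** Valid also for [s <= 1], where the Dirichlet series converges only conditionally: the uniform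
    tail bound permits integrating the partial sums term by term and then passing to the limit. *)
Lemma mellin_dirichlet c a eta B s : (a <= 1)%nat -> 0 < eta -> (forall n, Rabs (c n) <= 1) ->
  (forall n, Rabs (rsum (fun i => c (Z.of_nat (S i))) n) <= B) -> 0 < s <= 2 ->
  igood (fun x => vfun c a eta x * halfexp s x) ->
  is_lim_seq (fun N => gam a eta s * rsum (dterm c s) N) (Int (fun x => vfun c a eta x * halfexp s x)).
Proof.
  intros Ha He Hc HB Hs HV.
  destruct (vfun_tail_bound c a eta B Ha He Hc HB) as [K [HK0 HK]].
  apply is_lim_seq_ext with (fun N => Int (fun x => vcut c a eta N x * halfexp s x)).
  { intros N. now apply vcut_igood_Int. }
  (* Of the seven powers in the tail bound, six make the weight integrable at [+oo]. The seventh is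
     interpolated as [1 / (1 + N y) <= (N y)^(- s/2)], where [y = e^(x/2)]: it yields the small
     factor [N^(- s/2)] and uses up half of the weight [e^(s x / 2)]. *)
  set (w := fun x => halfexp (s / 2) x * / (1 + exp (x / 2)) ^ 6).
  assert (HP : forall x, 0 < 1 + exp (x / 2)) by (intros x; pose proof (exp_pos (x / 2)); lra).
  apply (Int_weighted_lim _ _ w (fun N => K * exp (- (s / 2) * ln (INR N)))).
  - intros N. now apply vcut_igood_Int.
  - auto.
  - split.
    + apply cont_mult; [apply cont_halfexp|]. intros x.
      apply (ex_derive_continuous (fun x => / (1 + exp (x / 2)) ^ 6)).
      auto_derive. apply Rgt_not_eq. pose proof (HP x). apply (pow_lt _ 6). auto.
    + exists (s / 4), 1. split; [lra|].
      assert (G : forall x, 0 <= w x) by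
        (intros x; apply Rmult_le_pos; [left; apply exp_pos|left; apply Rinv_0_lt_compat, pow_lt; auto]).
      apply ibound_of_sides; intros x Hx; rewrite (Rabs_pos_eq _ (G x)), Rmult_1_l; unfold w.
      * apply Rle_trans with (halfexp (s / 2) x * / exp (x / 2) ^ 6).
        -- apply Rmult_le_compat_l; [left; apply exp_pos|]. pose proof (exp_pos (x / 2)).
           apply Rinv_le_contravar; [apply pow_lt; auto|apply pow_incr; lra].
        -- rewrite <- exp_nat_mult, <- exp_Ropp. unfold halfexp. rewrite <- exp_plus.
           apply exp_le_mono. simpl. nra.
      * replace (exp (s / 4 * x)) with (halfexp (s / 2) x * / 1)
          by (unfold halfexp; rewrite Rinv_1, Rmult_1_r; f_equal; field).
        apply Rmult_le_compat_l; [left; apply exp_pos|].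
        apply Rinv_le_contravar; [lra|]. apply pow_R1_Rle. pose proof (exp_pos (x / 2)). lra.
  - eapply is_lim_seq_eq; [apply is_lim_seq_scal'|].
    + apply is_lim_seq_spec. intros [e He']. simpl.
      set (L := Rmax 1 (- (2 / s) * ln e + 1)).
      exists (nat_up (exp L)). intros n Hn.
      destruct (nat_up_bounds (exp L)) as [H1 _]; [left; apply exp_pos|].
      apply le_INR in Hn. rewrite Rminus_0_r, Rabs_pos_eq by (left; apply exp_pos).
      assert (HL : L < ln (INR n)).
      { rewrite <- (ln_exp L). apply ln_increasing; [apply exp_pos|lra]. }
      rewrite <- (exp_ln e) by auto. apply exp_increasing.
      pose proof (Rmax_r 1 (- (2 / s) * ln e + 1)) as HM. fold L in HM.
      apply Rmult_lt_reg_l with (2 / s); [apply Rdiv_lt_0_compat; lra|].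
      replace (2 / s * (- (s / 2) * ln (INR n))) with (- ln (INR n)) by (field; lra).
      replace (- (2 / s) * ln e) with (- (2 / s * ln e)) in HM by ring. lra.
    + ring.
  - exists 1%nat. intros N HN x.
    replace (vcut c a eta N x * halfexp s x - vfun c a eta x * halfexp s x)
      with ((vcut c a eta N x - vfun c a eta x) * halfexp s x) by ring.
    eapply Rle_trans; [apply Rabs_le_mult_compat; [left; apply exp_pos|apply HK]|].
    assert (HN1 : 1 <= INR N) by (apply (le_INR 1); auto).
    set (y := exp (x / 2)). assert (Hy : 0 < y) by apply exp_pos.
    assert (HNy : y <= INR N * y) by nra.
    replace (K / (1 + INR N * y) ^ 7) with (K * (/ (1 + INR N * y) * / (1 + INR N * y) ^ 6))
      by (field; lra).
    rewrite !Rmult_assoc. apply Rmult_le_compat_l; auto.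
    replace (halfexp s x) with (exp (s / 4 * x) * halfexp (s / 2) x)
      by (unfold halfexp; rewrite <- exp_plus; f_equal; field).
    unfold w. fold y.
    replace (exp (- (s / 2) * ln (INR N)) * (halfexp (s / 2) x * / (1 + y) ^ 6))
      with ((exp (- (s / 2) * ln (INR N)) * / (1 + y) ^ 6) * halfexp (s / 2) x) by ring.
    replace (/ (1 + INR N * y) * (/ (1 + INR N * y) ^ 6 * (exp (s / 4 * x) * halfexp (s / 2) x)))
      with ((/ (1 + INR N * y) * exp (s / 4 * x)) * / (1 + INR N * y) ^ 6 * halfexp (s / 2) x) by ring.
    apply Rmult_le_compat_r; [left; apply exp_pos|].
    apply Rmult_le_compat.
    + apply Rmult_le_pos; [left; apply Rinv_0_lt_compat; lra|left; apply exp_pos].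
    + left. apply Rinv_0_lt_compat, pow_lt. lra.
    + replace (INR N * y) with (exp (ln (INR N) + x / 2)) by (rewrite exp_plus, exp_ln by lra; reflexivity).
      eapply Rle_trans; [apply Rmult_le_compat_r; [left; apply exp_pos|apply (inv_1p_le_exp _ (s / 2)); lra]|].
      right. rewrite <- exp_plus. f_equal. field.
    + apply Rinv_le_contravar; [apply pow_lt; lra|apply pow_incr; lra].
Qed.

(** * Convolution of the two theta functions *)

(* [eps] is the root number; its value is never needed, only [eps^2 = 1]. *)
Record theta_data (c : Z -> R) (a : nat) (eta eps : R) : Prop := {
  td_a : (a <= 1)%nat;
  td_eta : 0 < eta;
  td_c : forall n, Rabs (c n) <= 1;
  td_eps : eps = 1 \/ eps = -1;
  td_refl : forall x, vfun c a eta (- x) = eps * exp (x / 2) * vfun c a eta x }.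

Lemma td_cont c a eta eps : theta_data c a eta eps -> cont (vfun c a eta).
Proof. intros H. apply cont_vfun; apply H. Qed.

(** The reflection formula converts decay at [+oo] into decay at [-oo], losing only [1/2] in the
    rate. Rate 3 is enough to absorb a factor [e^(2x)] from [ufun] and still leave an integrable
    function. *)
Lemma td_ibound c a eta eps : theta_data c a eta eps -> exists C, ibound 3 C (vfun c a eta).
Proof.
  intros H. destruct (vfun_bound c a eta (td_a _ _ _ _ H) (td_eta _ _ _ _ H) (td_c _ _ _ _ H)) as [C [HC0 HC]].
  exists C. apply ibound_of_sides; intros x Hx.
  - eapply Rle_trans; [apply (HC 8%nat); lia|]. apply Rmult_le_compat_l; auto.
    apply exp_le_mono. simpl. lra.
  - rewrite <- (Ropp_involutive x), (td_refl _ _ _ _ H), !Rabs_mult, (Rabs_pos_eq (exp _)) by (left; apply exp_pos).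
    assert (Ee : Rabs eps = 1).
    { destruct (td_eps _ _ _ _ H) as [-> | ->]; [apply Rabs_R1|]. rewrite Rabs_left; lra. }
    rewrite Ee, Rmult_1_l.
    apply Rle_trans with (exp (- x / 2) * (C * exp (- (INR 8 / 2) * (- x)))).
    + apply Rmult_le_compat_l; [left; apply exp_pos|]. apply HC. lia.
    + replace (exp (- x / 2) * (C * exp (- (INR 8 / 2) * - x)))
        with (C * exp (- x / 2 + - (INR 8 / 2) * - x)) by (rewrite exp_plus; ring).
      apply Rmult_le_compat_l; auto. apply exp_le_mono. simpl. lra.
Qed.

Lemma halfexp_le s x : 0 <= s -> halfexp s x <= exp (s / 2 * Rabs x).
Proof. intros Hs. apply exp_le_mono. pose proof (Rle_abs x). apply Rmult_le_compat_l; lra. Qed.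

Lemma ibound_halfexp f C eta s : 0 <= s -> ibound eta C f -> ibound (eta - s / 2) C (fun x => f x * halfexp s x).
Proof.
  intros Hs HC x. rewrite Rabs_mult, (Rabs_pos_eq (halfexp s x)) by (left; apply exp_pos).
  replace (- (eta - s / 2) * Rabs x) with (- eta * Rabs x + s / 2 * Rabs x) by ring.
  rewrite exp_plus, <- Rmult_assoc.
  apply Rmult_le_compat; auto using Rabs_pos; [left; apply exp_pos|now apply halfexp_le].
Qed.

Lemma ibound_weaken eta eta' C f : eta' <= eta -> ibound eta C f -> ibound eta' C f.
Proof.
  intros Hle HC x. eapply Rle_trans; [apply HC|]. apply Rmult_le_compat_l; [apply (ibound_nonneg _ _ _ HC)|].
  apply exp_le_mono. pose proof (Rabs_pos x). nra.
Qed.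

Lemma td_igood c a eta eps s : theta_data c a eta eps -> 0 <= s <= 2 ->
  igood (fun x => vfun c a eta x * halfexp s x).
Proof.
  intros H Hs. destruct (td_ibound _ _ _ _ H) as [C HC]. split.
  - apply cont_mult; [apply (td_cont _ _ _ _ H)|apply cont_halfexp].
  - exists (3 - s / 2), C. split; [lra|]. apply ibound_halfexp; auto; lra.
Qed.

Lemma ureg_bounds : exists C, 0 <= C /\
  (forall t, 0 <= t -> Rabs (ureg t) <= C * exp (- (t / 2))) /\ (forall t, t <= 0 -> Rabs (ureg t) <= C).
Proof.
  set (K := INR 1 ^ 1 / PI ^ 1 * zeta2).
  assert (HK : 0 <= K).
  { unfold K. apply Rmult_le_pos; [|apply zeta2_nonneg].
    apply Rdiv_le_0_compat; [simpl; lra|]. apply pow_lt, PI_RGT_0. }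
  assert (G : forall t, 0 <= t -> Rabs (ureg t) <= (K + / 2) * exp (- (t / 2))).
  { intros t Ht. destruct (ufun_bound 1 t (le_n _)) as [U0 U1]. fold K in U1.
    assert (exp (- INR 1 * t) <= exp (- (t / 2))) by (apply exp_le_mono; simpl; lra).
    pose proof (exp_pos (- (t / 2))).
    assert (ufun t <= K * exp (- (t / 2))) by (eapply Rle_trans; [exact U1|now apply Rmult_le_compat_l]).
    unfold ureg. apply Rabs_le. split; nra. }
  exists (K + / 2). split; [lra|]. split; auto.
  intros t Ht. rewrite <- (Ropp_involutive t), ureg_reflect, Rabs_mult, (Rabs_pos_eq (exp _)) by (left; apply exp_pos).
  eapply Rle_trans; [apply Rmult_le_compat_l; [left; apply exp_pos|apply G; lra]|].
  right. pose proof (exp_half_sq (- t)). nra.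
Qed.

Lemma cont_ureg : cont ureg.
Proof.
  apply cont_minus; [apply cont_ufun|]. apply cont_mult; [apply cont_const|].
  apply (cont_ext (fun t => exp (- / 2 * t))); [intros; f_equal; field|apply cont_exp_lin].
Qed.

(** For [0 < s < 1] its integral is the completed zeta function [PI^(-s/2) Gamma (s/2) zeta (s)]:
    removing [e^(-t/2) / 2] moves the Mellin transform from [s > 1] into the critical strip. *)
Definition ureg_s (s t : R) : R := ureg t * halfexp s t.

Lemma cont_ureg_s s : cont (ureg_s s).
Proof. apply cont_mult; [apply cont_ureg|apply cont_halfexp]. Qed.

(** [ureg] is bounded at [-oo] and of size [e^(-t/2)] at [+oo]. The weight therefore leaves the
    rates [s / 2] and [(1 - s) / 2], and this restricts [s] to the strip. *)
Lemma ureg_s_ibound : exists C, 0 <= C /\ forall s, 0 < s < 1 -> ibound (Rmin s (1 - s) / 2) C (ureg_s s).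
Proof.
  destruct ureg_bounds as [C [HC0 [H1 H2]]]. exists C. split; auto. intros s Hs.
  pose proof (Rmin_l s (1 - s)). pose proof (Rmin_r s (1 - s)).
  apply ibound_of_sides; intros t Ht; unfold ureg_s;
    rewrite Rabs_mult, (Rabs_pos_eq (halfexp s t)) by (left; apply exp_pos).
  - apply Rle_trans with (C * exp (- (t / 2)) * halfexp s t).
    + apply Rmult_le_compat_r; [left; apply exp_pos|auto].
    + rewrite Rmult_assoc. apply Rmult_le_compat_l; auto. unfold halfexp. rewrite <- exp_plus.
      apply exp_le_mono. nra.
  - apply Rmult_le_compat; auto using Rabs_pos; [left; apply exp_pos|].
    apply exp_le_mono. nra.
Qed.

(* Exponential moments of these convolutions are products of a completed zeta function and a completed
   L-function; [Freg] is the one with the exact functional equation. *)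
Definition Ffun c a eta (L : R) : R := Int (fun x => ufun (L - x) * vfun c a eta x).
Definition Freg c a eta (L : R) : R := Int (fun x => ureg (L - x) * vfun c a eta x).
Definition Vmel c a eta (s : R) : R := Int (fun x => vfun c a eta x * halfexp s x).

(** The bound of [ufun] at order [k] splits as [e^(-k L) e^(k x)]: the first factor gives the decay
    in [L], the second is paid for by the rate 3 of [vfun]. *)
Lemma Fint_ibound c a eta eps k : theta_data c a eta eps -> (1 <= k <= 2)%nat -> exists C, 0 <= C /\
  forall L, ibound (3 - INR k) (C * exp (- INR k * L)) (fun x => ufun (L - x) * vfun c a eta x).
Proof.
  intros H Hk. destruct (td_ibound _ _ _ _ H) as [C HC].
  pose proof (ibound_nonneg _ _ _ HC) as HC0.
  set (K := INR k ^ k / PI ^ k * zeta2).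
  assert (HK : 0 <= K).
  { unfold K. apply Rmult_le_pos; [|apply zeta2_nonneg].
    apply Rdiv_le_0_compat; [apply pow_le, pos_INR|]. apply pow_lt, PI_RGT_0. }
  exists (K * C). split; [now apply Rmult_le_pos|]. intros L x.
  destruct (ufun_bound k (L - x) ltac:(lia)) as [U0 U1]. fold K in U1.
  rewrite Rabs_mult, (Rabs_pos_eq (ufun _)) by auto.
  apply Rle_trans with (K * exp (- INR k * (L - x)) * (C * exp (- 3 * Rabs x))).
  - apply Rmult_le_compat; auto using Rabs_pos.
  - replace (K * exp (- INR k * (L - x)) * (C * exp (-3 * Rabs x)))
      with (K * C * exp (- INR k * (L - x) + -3 * Rabs x)) by (rewrite exp_plus; ring).
    rewrite (Rmult_assoc (K * C)), <- exp_plus. apply Rmult_le_compat_l; [now apply Rmult_le_pos|].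
    apply exp_le_mono. pose proof (Rle_abs x). pose proof (pos_INR k). nra.
Qed.

Lemma cont_shift_arg f L : cont f -> cont (fun x => f (L - x)).
Proof. intros Hf. apply (cont_comp (fun x => L - x) f); auto with cont. Qed.

Lemma Fint_igood c a eta eps L : theta_data c a eta eps -> igood (fun x => ufun (L - x) * vfun c a eta x).
Proof.
  intros H. destruct (Fint_ibound _ _ _ _ 1 H ltac:(lia)) as [C [HC0 HC]]. split.
  - apply cont_mult; [apply cont_shift_arg, cont_ufun|apply (td_cont _ _ _ _ H)].
  - exists (3 - INR 1), (C * exp (- INR 1 * L)). split; [simpl; lra|apply HC].
Qed.

(** The subtracted exponential [e^(-(L - x)/2)] factors in [L] and [x], so its convolution with
    [vfun] is a multiple of the Mellin transform at [s = 1]. This is how [L(1, chi)] enters. *)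
Lemma Freg_F c a eta eps L : theta_data c a eta eps ->
  Freg c a eta L = Ffun c a eta L - Vmel c a eta 1 / 2 * exp (- (L / 2)).
Proof.
  intros H. unfold Freg, Ffun, Vmel.
  assert (G : igood (fun x => vfun c a eta x * halfexp 1 x)) by (apply (td_igood _ _ _ _ _ H); lra).
  rewrite (Int_ext _ (fun x => ufun (L - x) * vfun c a eta x
     - (/ 2 * exp (- (L / 2))) * (vfun c a eta x * halfexp 1 x))).
  - rewrite Int_minus, Int_scal; auto.
    + field.
    + apply (Fint_igood _ _ _ _ _ H).
    + now apply igood_scal.
  - intros x. unfold ureg, halfexp.
    replace (- ((L - x) / 2)) with (- (L / 2) + 1 / 2 * x) by field. rewrite exp_plus. ring.
Qed.

(** The two reflection factors [e^((L - x)/2)] and [e^(x/2)] multiply to [e^(L/2)], free of the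
    integration variable. *)
Lemma Freg_reflect c a eta eps L : theta_data c a eta eps ->
  Freg c a eta (- L) = eps * (exp (L / 2) * Freg c a eta L).
Proof.
  intros H. unfold Freg. rewrite <- Int_opp.
  rewrite (Int_ext _ (fun x => (eps * exp (L / 2)) * (ureg (L - x) * vfun c a eta x))).
  - rewrite Int_scal; [ring|].
    apply igood_ext with (fun x => ufun (L - x) * vfun c a eta x
     - (/ 2 * exp (- (L / 2))) * (vfun c a eta x * halfexp 1 x)).
    + intros x. unfold ureg, halfexp.
      replace (- ((L - x) / 2)) with (- (L / 2) + 1 / 2 * x) by field. rewrite exp_plus. ring.
    + apply igood_minus; [apply (Fint_igood _ _ _ _ _ H)|]. apply igood_scal.
      apply (td_igood _ _ _ _ _ H); lra.
  - intros x. replace (- L - - x) with (- (L - x)) by ring.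
    rewrite ureg_reflect, (td_refl _ _ _ _ H).
    replace (L / 2) with ((L - x) / 2 + x / 2) by field. rewrite exp_plus. ring.
Qed.

Lemma Freg_conv c a eta s L :
  theta_data c a eta 1 \/ theta_data c a eta (-1) -> 0 < s < 1 ->
  conv (ureg_s s) (fun x => vfun c a eta x * halfexp s x) L = halfexp s L * Freg c a eta L.
Proof.
  intros H Hs. unfold conv, Freg.
  assert (G : igood (fun x => ureg (L - x) * vfun c a eta x)).
  { assert (H' : exists eps, theta_data c a eta eps) by (destruct H; eauto). destruct H' as [eps H'].
    apply igood_ext with (fun x => ufun (L - x) * vfun c a eta x
     - (/ 2 * exp (- (L / 2))) * (vfun c a eta x * halfexp 1 x)).
    + intros x. unfold ureg, halfexp.
      replace (- ((L - x) / 2)) with (- (L / 2) + 1 / 2 * x) by field. rewrite exp_plus. ring.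
    + apply igood_minus; [apply (Fint_igood _ _ _ _ _ H')|]. apply igood_scal.
      apply (td_igood _ _ _ _ _ H'); lra. }
  rewrite <- Int_scal by auto. apply Int_ext. intros x. unfold ureg_s, halfexp.
  replace (s / 2 * L) with (s / 2 * (L - x) + s / 2 * x) by ring. rewrite exp_plus. ring.
Qed.

Lemma td_or c a eta eps : theta_data c a eta eps -> theta_data c a eta 1 \/ theta_data c a eta (-1).
Proof. intros H. destruct (td_eps _ _ _ _ H) as [E|E]; rewrite E in H; auto. Qed.

Lemma conv_hyps c a eta eps s : theta_data c a eta eps -> 0 < s < 1 -> exists C D,
  0 < Rmin s (1 - s) / 2 /\ ibound (Rmin s (1 - s) / 2) C (ureg_s s) /\
  ibound (2 * (Rmin s (1 - s) / 2)) D (fun x => vfun c a eta x * halfexp s x).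
Proof.
  intros H Hs. destruct ureg_s_ibound as [C [_ HC]]. destruct (td_ibound _ _ _ _ H) as [D HD].
  pose proof (Rmin_l s (1 - s)). exists C, D. repeat split; auto.
  - assert (0 < Rmin s (1 - s)) by (apply Rmin_glb_lt; lra). lra.
  - apply ibound_weaken with (3 - s / 2); [lra|]. apply ibound_halfexp; auto; lra.
Qed.

(** The weight [e^(s L / 2)] splits over [L - x] and [x], so the weighted [Freg] is itself a
    convolution, and its integral is a product. *)
Lemma Freg_moment c a eta eps s : theta_data c a eta eps -> 0 < s < 1 ->
  igood (fun L => halfexp s L * Freg c a eta L) /\
  Int (fun L => halfexp s L * Freg c a eta L) = Int (ureg_s s) * Vmel c a eta s.
Proof.
  intros H Hs. destruct (conv_hyps _ _ _ _ s H Hs) as [C [D [He [HC HD]]]].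
  pose proof (td_or _ _ _ _ H) as Ho.
  assert (HV : cont (fun x => vfun c a eta x * halfexp s x))
    by (apply cont_mult; [apply (td_cont _ _ _ _ H)|apply cont_halfexp]).
  split.
  - apply (igood_ext _ _ (fun L => Freg_conv c a eta s L Ho Hs)).
    apply (igood_conv _ _ (Rmin s (1 - s) / 2) C D); auto. apply cont_ureg_s.
  - rewrite <- (Int_ext _ _ (fun L => Freg_conv c a eta s L Ho Hs)).
    apply (Int_conv _ _ (Rmin s (1 - s) / 2) C D); auto. apply cont_ureg_s.
Qed.

Lemma cont_Ffun c a eta eps : theta_data c a eta eps -> cont (Ffun c a eta).
Proof.
  (* Continuity is read off from the convolution at [s = 1/2], by undoing its weight and adding back
     the removed exponential. *)
  intros H. destruct (Freg_moment _ _ _ _ (1 / 2) H ltac:(lra)) as [[Hc _] _].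
  apply cont_ext with (fun L => halfexp (- (1 / 2)) L * (halfexp (1 / 2) L * Freg c a eta L)
     + Vmel c a eta 1 / 2 * halfexp (-1) L).
  - intros L. rewrite (Freg_F _ _ _ _ _ H), <- Rmult_assoc. unfold halfexp. rewrite <- exp_plus.
    replace (- (1 / 2) / 2 * L + 1 / 2 / 2 * L) with 0 by field.
    replace (-1 / 2 * L) with (- (L / 2)) by field. rewrite exp_0. ring.
  - apply cont_plus; apply cont_mult; auto using cont_halfexp, cont_const.
Qed.

Lemma Ffun_hbound c a eta eps : theta_data c a eta eps -> exists C, hbound 2 C (Ffun c a eta).
Proof.
  intros H. destruct (Fint_ibound _ _ _ _ 2 H ltac:(lia)) as [C [HC0 HC]].
  exists (2 * C). intros L _. unfold Ffun.
  eapply Rle_trans; [apply (Int_abs_bound (3 - INR 2) (C * exp (- INR 2 * L)))|].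
  - apply (Fint_igood _ _ _ _ _ H).
  - simpl; lra.
  - apply HC.
  - right. change (INR 2) with (1 + 1). replace (1 + 1) with 2 by ring. field.
Qed.

Definition Nmom c a eta (s : R) : R := Hint (fun L => Ffun c a eta L * halfexp s L).

Lemma Nmom_hgood c a eta eps s : theta_data c a eta eps -> s < 4 ->
  hgood (fun L => Ffun c a eta L * halfexp s L).
Proof.
  intros H Hs. destruct (Ffun_hbound _ _ _ _ H) as [C HC].
  apply (hgood_moment (Ffun c a eta) 2 C (s / 2)); auto; [apply (cont_Ffun _ _ _ _ H)|lra].
Qed.

Lemma Hint_exp e : 0 < e -> Hint (fun x => exp (- e * x)) = / e.
Proof.
  intros He.
  transitivity (- (- / e * exp (- e * 0))); [|rewrite Rmult_0_r, exp_0; ring].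
  apply (Hint_derive (fun x => - / e * exp (- e * x)) (fun x => exp (- e * x)) e (/ e)).
  - intros x. auto_derive; auto. field. lra.
  - now apply hgood_exp.
  - auto.
  - intros x _. rewrite Rabs_mult, Rabs_Ropp, (Rabs_pos_eq (/ e)), (Rabs_pos_eq (exp _));
      [lra|left; apply exp_pos|left; now apply Rinv_0_lt_compat].
Qed.

Lemma Freg_half c a eta eps s : theta_data c a eta eps -> 0 < s < 1 ->
  Hint (fun L => halfexp s L * Freg c a eta L) = Nmom c a eta s - Vmel c a eta 1 / (1 - s) /\
  hgood (fun L => halfexp s L * Freg c a eta L).
Proof.
  intros H Hs.
  assert (E : forall L, halfexp s L * Freg c a eta L
     = Ffun c a eta L * halfexp s L - Vmel c a eta 1 / 2 * exp (- ((1 - s) / 2) * L)).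
  { intros L. rewrite (Freg_F _ _ _ _ _ H). unfold halfexp.
    replace (- ((1 - s) / 2) * L) with (- (L / 2) + s / 2 * L) by field. rewrite exp_plus. ring. }
  assert (G1 : hgood (fun L => Ffun c a eta L * halfexp s L)) by (apply (Nmom_hgood _ _ _ _ _ H); lra).
  assert (G2 : hgood (fun L => exp (- ((1 - s) / 2) * L))) by (apply hgood_exp; lra).
  split.
  - rewrite (Hint_ext _ _ (fun L _ => E L)), Hint_minus, Hint_scal, Hint_exp by (auto using hgood_scal; lra).
    unfold Nmom. field. lra.
  - destruct (Freg_moment _ _ _ _ s H Hs) as [G _]. now apply igood_hgood.
Qed.

(** The half line [L <= 0] of the moment at [s] is [eps] times the half line [L >= 0] of the moment
    at [1 - s], by reflection. On each half [Freg] is replaced by [Ffun], at the cost of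
    [Vmel 1 / (1 - s)] and [eps * Vmel 1 / s]. *)
Theorem completed_identity c a eta eps s : theta_data c a eta eps -> 0 < s < 1 ->
  Int (ureg_s s) * Vmel c a eta s
  = Nmom c a eta s + eps * Nmom c a eta (1 - s) - Vmel c a eta 1 * (/ (1 - s) + eps / s).
Proof.
  intros H Hs. destruct (Freg_moment _ _ _ _ s H Hs) as [G <-]. unfold Int.
  destruct (Freg_half _ _ _ _ s H Hs) as [-> _].
  destruct (Freg_half _ _ _ _ (1 - s) H ltac:(lra)) as [E2 G2].
  rewrite (Hint_ext _ (fun L => eps * (halfexp (1 - s) L * Freg c a eta L))).
  - rewrite Hint_scal, E2 by auto. field. lra.
  - intros L _. rewrite (Freg_reflect _ _ _ _ _ H). unfold halfexp.
    replace ((1 - s) / 2 * L) with (s / 2 * - L + L / 2) by field. rewrite exp_plus. ring.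
Qed.

Lemma ureg_s_Int_bound : exists C, 0 <= C /\ forall s, 0 < s < 1 -> Rabs (Int (ureg_s s)) <= C / Rmin s (1 - s).
Proof.
  destruct ureg_s_ibound as [C [HC0 HC]]. exists (4 * C). split; [lra|]. intros s Hs.
  assert (0 < Rmin s (1 - s)) by (apply Rmin_glb_lt; lra).
  eapply Rle_trans; [apply (Int_abs_bound (Rmin s (1 - s) / 2) C)|].
  - apply cont_ureg_s.
  - lra.
  - now apply HC.
  - right. field. lra.
Qed.

(** * Nonnegativity of [1 * chi] *)

Record cmult (f : nat -> R) : Prop := {
  cm_1 : f 1%nat = 1;
  cm_mul : forall m n, f (m * n)%nat = f m * f n;
  cm_val : forall n, f n = 1 \/ f n = 0 \/ f n = -1 }.

Definition divides (d n : nat) : bool := Nat.eqb (n mod d) 0.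

Lemma divides_iff d n : divides d n = true <-> Nat.divide d n.
Proof. unfold divides. rewrite Nat.eqb_eq. apply Nat.Lcm0.mod_divide. Qed.

Definition dsum (f : nat -> R) (n : nat) : R :=
  rsum (fun i => if divides (S i) n then f (S i) else 0) n.

Lemma dsum_len f n X : (1 <= n)%nat -> (n <= X)%nat ->
  rsum (fun i => if divides (S i) n then f (S i) else 0) X = dsum f n.
Proof.
  intros Hn HX. apply rsum_ext_len; auto. intros i Hi.
  destruct (divides (S i) n) eqn:E; auto.
  apply divides_iff, Nat.divide_pos_le in E; lia.
Qed.

Definition nprime (p : nat) : Prop := (1 < p)%nat /\ forall d, Nat.divide d p -> d = 1%nat \/ d = p.

Lemma nprime_divisor n : (1 < n)%nat -> exists p, nprime p /\ Nat.divide p n.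
Proof.
  induction n as [n IH] using lt_wf_ind. intros Hn.
  destruct (Classical_Prop.classic (exists d, Nat.divide d n /\ d <> 1%nat /\ d <> n)) as [[d [Hd [H1 H2]]]|Hno].
  - assert (Hd0 : (0 < d)%nat).
    { destruct d; [|lia]. apply Nat.divide_0_l in Hd. lia. }
    pose proof (Nat.divide_pos_le d n ltac:(lia) Hd).
    destruct (IH d ltac:(lia) ltac:(lia)) as [p [Hp Hpd]].
    exists p. split; auto. now apply Nat.divide_trans with d.
  - exists n. split; [|apply Nat.divide_refl]. split; auto.
    intros d Hd. destruct (Nat.eq_dec d 1); auto. destruct (Nat.eq_dec d n); auto.
    exfalso. apply Hno. eauto.
Qed.

Lemma nprime_gcd p d : nprime p -> ~ Nat.divide p d -> Nat.gcd p d = 1%nat.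
Proof.
  intros [Hp1 Hp] Hd. destruct (Hp (Nat.gcd p d) (Nat.gcd_divide_l p d)) as [E|E]; auto.
  exfalso. apply Hd. rewrite <- E. apply Nat.gcd_divide_r.
Qed.

Lemma nprime_mult p a b : nprime p -> Nat.divide p (a * b) -> Nat.divide p a \/ Nat.divide p b.
Proof.
  intros Hp H. destruct (Classical_Prop.classic (Nat.divide p a)) as [Ha|Ha]; auto.
  right. apply Nat.gauss with a; auto. now apply nprime_gcd.
Qed.

Definition twist (f : nat -> R) (p n : nat) : R := if divides p n then 0 else f n.

Lemma twist_cmult f p : nprime p -> cmult f -> cmult (twist f p).
Proof.
  intros Hp Hf. split.
  - unfold twist. destruct (divides p 1) eqn:E; [|apply Hf].
    apply divides_iff in E. apply Nat.divide_1_r in E. destruct Hp. lia.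
  - intros m n. unfold twist.
    destruct (divides p (m * n)) eqn:E.
    + apply divides_iff in E. destruct (nprime_mult _ _ _ Hp E) as [D|D]; apply divides_iff in D; rewrite D; ring.
    + destruct (divides p m) eqn:Em.
      { apply divides_iff in Em. assert (divides p (m * n) = true); [|congruence].
        apply divides_iff. now apply Nat.divide_mul_l. }
      destruct (divides p n) eqn:En.
      { apply divides_iff in En. assert (divides p (m * n) = true); [|congruence].
        apply divides_iff. now apply Nat.divide_mul_r. }
      apply Hf.
  - intros n. unfold twist. destruct (divides p n); auto. apply Hf.
Qed.

(** The divisors of [p n] are split into multiples [p d] with [d] dividing [n], and those prime to
    [p], which also divide [n] by Gauss's lemma. *)
Lemma dsum_prime f p n : cmult f -> nprime p -> (1 <= n)%nat ->
  dsum f (p * n) = f p * dsum f n + dsum (twist f p) n.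
Proof.
  intros Hf Hp Hn. assert (Hp1 : (1 < p)%nat) by apply Hp.
  unfold dsum at 1.
  rewrite (rsum_ext _ (fun i =>
    (if Nat.eqb (S i mod p) 0 then (fun k => if divides k (p * n) then f k else 0) (S i) else 0)
    + (if divides (S i) n then twist f p (S i) else 0))).
  - rewrite rsum_plus. f_equal.
    + rewrite Nat.mul_comm, (rsum_multiples (fun k => if divides k (n * p) then f k else 0)) by lia.
      unfold dsum. rewrite <- rsum_scal. apply rsum_ext. intros i _.
      rewrite (cm_mul f Hf).
      assert (E : divides (p * S i) (n * p) = divides (S i) n).
      { apply Bool.eq_iff_eq_true. rewrite !divides_iff. rewrite (Nat.mul_comm n p).
        apply Nat.mul_divide_cancel_l. lia. }
      rewrite E. destruct (divides (S i) n); ring.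
    + apply dsum_len; auto. nia.
  - intros i _. unfold twist. change (Nat.eqb (S i mod p) 0) with (divides p (S i)).
    destruct (divides p (S i)) eqn:E.
    + destruct (divides (S i) n); lra.
    + rewrite Rplus_0_l.
      assert (E2 : divides (S i) (p * n) = divides (S i) n).
      { apply Bool.eq_iff_eq_true. rewrite !divides_iff. split.
        - intros D. apply Nat.gauss with p; auto. rewrite Nat.gcd_comm. apply nprime_gcd; auto.
          rewrite <- divides_iff. congruence.
        - intros D. now apply Nat.divide_mul_r. }
      rewrite E2. reflexivity.
Qed.

Lemma dsum_twist_coprime f p n : (1 <= n)%nat -> ~ Nat.divide p n -> dsum (twist f p) n = dsum f n.
Proof.
  intros Hn Hp. apply rsum_ext. intros i _. unfold twist.
  destruct (divides (S i) n) eqn:E; auto. destruct (divides p (S i)) eqn:E2; auto.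
  apply divides_iff in E. apply divides_iff in E2. exfalso. apply Hp. now apply Nat.divide_trans with (S i).
Qed.

(** Primes are stripped one at a time, with [f] generalised so that it may be replaced by its twist.
    The delicate case is [f p = -1]: if [p] no longer divides the rest, the two contributions
    cancel; otherwise a second factor [p] is stripped and the twisted sums cancel, leaving the sum
    at [k]. *)
Lemma dsum_nonneg n : (1 <= n)%nat -> forall f, cmult f -> 0 <= dsum f n.
Proof.
  induction n as [n IH] using lt_wf_ind. intros Hn f Hf.
  destruct (Nat.eq_dec n 1) as [->|Hn1].
  { unfold dsum. simpl. rewrite (cm_1 f Hf). lra. }
  destruct (nprime_divisor n ltac:(lia)) as [p [Hp [m Hm]]].
  assert (Hp1 : (1 < p)%nat) by apply Hp.
  rewrite Nat.mul_comm in Hm. subst n. assert (Hm1 : (1 <= m)%nat) by nia.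
  pose proof (twist_cmult f p Hp Hf) as Ht.
  rewrite dsum_prime by auto.
  pose proof (IH m ltac:(nia) Hm1 f Hf) as I1.
  pose proof (IH m ltac:(nia) Hm1 _ Ht) as I2.
  destruct (cm_val f Hf p) as [E|[E|E]]; rewrite E; try lra.
  destruct (Classical_Prop.classic (Nat.divide p m)) as [[k Hk]|Hnd].
  - rewrite Nat.mul_comm in Hk. subst m. assert (Hk1 : (1 <= k)%nat) by nia.
    rewrite (dsum_prime f), (dsum_prime (twist f p)) by auto. rewrite E.
    assert (E0 : twist f p p = 0).
    { unfold twist. rewrite (proj2 (divides_iff p p)); auto. apply Nat.divide_refl. }
    rewrite E0.
    assert (E1 : dsum (twist (twist f p) p) k = dsum (twist f p) k).
    { apply rsum_ext. intros i _. unfold twist. destruct (divides (S i) k), (divides p (S i)); auto. }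
    rewrite E1. pose proof (IH k ltac:(nia) Hk1 f Hf). lra.
  - rewrite dsum_twist_coprime by auto. lra.
Qed.

Lemma rsum_multiples_le h p X : (1 <= p)%nat ->
  rsum (fun n => if divides p (S n) then h (S n) else 0) X
  = rsum (fun j => if Nat.leb (p * S j) X then h (p * S j)%nat else 0) X.
Proof.
  intros Hp.
  rewrite <- (rsum_multiples (fun k => if Nat.leb k X then h k else 0) p X Hp).
  rewrite (rsum_ext_len _ X (X * p)) by
    (try nia; intros i Hi; replace (Nat.leb (S i) X) with false by (symmetry; apply Nat.leb_gt; lia);
     destruct (Nat.eqb (S i mod p) 0); auto).
  apply rsum_ext. intros i Hi. unfold divides.
  replace (Nat.leb (S i) X) with true by (symmetry; apply Nat.leb_le; lia). reflexivity.
Qed.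

Lemma hyperbola_sum f g X :
  rsum (fun i => rsum (fun j => if Nat.leb (S i * S j) X then f (S i) * g (S i * S j)%nat else 0) X) X
  = rsum (fun n => dsum f (S n) * g (S n)) X.
Proof.
  transitivity (rsum (fun n => rsum (fun i => if divides (S i) (S n) then f (S i) * g (S n) else 0) X) X).
  - rewrite (rsum_swap (fun n i => if divides (S i) (S n) then f (S i) * g (S n) else 0)).
    apply rsum_ext. intros i _.
    symmetry. apply (rsum_multiples_le (fun k => f (S i) * g k)). lia.
  - apply rsum_ext. intros n Hn. rewrite <- (dsum_len f (S n) X) by lia.
    rewrite <- rsum_scal_r. apply rsum_ext. intros i _.
    destruct (divides (S i) (S n)); ring.
Qed.

(** * Powers [n^(-s)] and lower bounds for double sums *)

Definition npow (s : R) (n : nat) : R := exp (- s * ln (INR n)).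

Lemma npow_pos s n : 0 < npow s n.
Proof. apply exp_pos. Qed.

Lemma npow_mult s m n : (1 <= m)%nat -> (1 <= n)%nat -> npow s (m * n) = npow s m * npow s n.
Proof.
  intros Hm Hn. unfold npow. rewrite mult_INR, ln_mult by (apply lt_0_INR; lia).
  rewrite Rmult_plus_distr_l, exp_plus. reflexivity.
Qed.

Lemma npow_1 s : npow s 1 = 1.
Proof. unfold npow. simpl. rewrite ln_1, Rmult_0_r. apply exp_0. Qed.

Lemma npow_step s n : 1 < s -> (1 <= n)%nat ->
  (s - 1) * npow s (S n) <= npow (s - 1) n - npow (s - 1) (S n).
Proof.
  intros Hs Hn. assert (Hn1 : 1 <= INR n) by (apply (le_INR 1); auto).
  destruct (MVT_gen (fun x => exp (- (s - 1) * ln x)) (INR n) (INR (S n))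
     (fun x => - (s - 1) * exp (- s * ln x))) as [x [Hx E]].
  - rewrite Rmin_left, Rmax_right by (rewrite S_INR; lra). intros x Hx.
    auto_derive; [lra|].
    replace (- s * ln x) with (- (s - 1) * ln x + - ln x) by ring.
    rewrite exp_plus, exp_Ropp, exp_ln by lra. field. lra.
  - rewrite Rmin_left, Rmax_right by (rewrite S_INR; lra). intros x Hx.
    apply continuity_pt_filterlim. apply (ex_derive_continuous (fun x => exp (- (s - 1) * ln x))).
    auto_derive. lra.
  - rewrite Rmin_left, Rmax_right in Hx by (rewrite S_INR; lra).
    assert (D : INR (S n) - INR n = 1) by (rewrite S_INR; ring). rewrite D in E.
    unfold npow.
    assert (exp (- s * ln (INR (S n))) <= exp (- s * ln x)).
    { apply exp_le_mono. assert (ln x <= ln (INR (S n))) by (destruct (proj2 Hx) as [H|H]; [left; apply ln_increasing; lra|rewrite H; lra]). nra. }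
    nra.
Qed.

Lemma ex_series_npow s : 1 < s -> ex_series (fun n => npow s (S n)).
Proof.
  intros Hs. apply ex_series_nonneg_bounded with (1 + / (s - 1)).
  - intros n. left. apply npow_pos.
  - intros n. destruct n as [|n].
    { simpl. assert (0 < / (s - 1)) by (apply Rinv_0_lt_compat; lra). lra. }
    apply Rle_trans with (1 + / (s - 1) * (1 - npow (s - 1) (S n))).
    + induction n as [|n IH].
      * simpl rsum. rewrite !npow_1. lra.
      * change (rsum (fun n => npow s (S n)) (S (S n)))
          with (rsum (fun n => npow s (S n)) (S n) + npow s (S (S n))).
        pose proof (npow_step s (S n) Hs ltac:(lia)) as St.
        assert (npow s (S (S n)) <= / (s - 1) * (npow (s - 1) (S n) - npow (s - 1) (S (S n)))).
        { apply Rmult_le_reg_l with (s - 1); [lra|]. rewrite <- Rmult_assoc, Rinv_r, Rmult_1_l by lra. exact St. }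
        lra.
    + assert (0 < / (s - 1)) by (apply Rinv_0_lt_compat; lra).
      pose proof (npow_pos (s - 1) (S n)). nra.
Qed.

Lemma npow_large s s' n X : s' <= s -> (1 <= X)%nat -> (X <= n)%nat -> npow s n <= npow (s - s') X * npow s' n.
Proof.
  intros Hs HX Hn. unfold npow. rewrite <- exp_plus. apply exp_le_mono.
  assert (0 < INR X) by (apply lt_0_INR; lia).
  assert (ln (INR X) <= ln (INR n)).
  { apply le_INR in Hn. destruct Hn as [Hn|Hn]; [left; apply ln_increasing; auto|rewrite Hn; lra]. }
  nra.
Qed.

Lemma npow_lim s : 0 < s -> is_lim_seq (fun X => npow s (S X)) 0.
Proof.
  intros Hs. apply is_lim_seq_spec. intros [e He]. simpl.
  exists (nat_up (exp (- ln e / s))). intros n Hn.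
  destruct (nat_up_bounds (exp (- ln e / s))) as [H1 _]; [left; apply exp_pos|].
  apply le_INR in Hn. rewrite Rminus_0_r, Rabs_pos_eq by (left; apply npow_pos).
  assert (HL : - ln e / s < ln (INR (S n))).
  { rewrite <- (ln_exp (- ln e / s)). apply ln_increasing; [apply exp_pos|]. rewrite S_INR. lra. }
  rewrite <- (exp_ln e) at 1 by auto. apply exp_increasing.
  apply (Rmult_lt_compat_l s) in HL; auto.
  replace (s * (- ln e / s)) with (- ln e) in HL by (field; lra). lra.
Qed.

(* With [r = 1 * f >= 0] the double sum is [sum r(n) g(n) >= g(1)] up to the part [dm > X]. *)
Lemma double_sum_limit_ge f g C s (l : R) : cmult f -> 1 < s ->
  (forall n, (1 <= n)%nat -> 0 <= g n <= C * npow s n) ->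
  is_lim_seq (fun X => rsum (fun i => rsum (fun j => f (S i) * g (S i * S j)%nat) X) X) l ->
  g 1%nat <= l.
Proof.
  intros Hf Hs Hg Hl.
  (* Midway between 1 and [s]: the exponent [s' > 1] makes the sum over the whole square converge,
     and [s - s' > 0] gives the decay in [X] of the part with [d m > X]. *)
  set (s' := (1 + s) / 2). set (Z := Series (fun n => npow s' (S n))).
  assert (HC : 0 <= C).
  { destruct (Hg 1%nat (le_n _)) as [H1 H2]. rewrite npow_1 in H2. lra. }
  apply is_lim_seq_incr_1 in Hl.
  apply (is_lim_seq_le (fun X => g 1%nat - C * Z ^ 2 * npow (s - s') (S X))
    (fun X => rsum (fun i => rsum (fun j => f (S i) * g (S i * S j)%nat) (S X)) (S X)) (g 1%nat) l); auto.
  2: { eapply is_lim_seq_eq.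
       - apply is_lim_seq_minus'; [apply is_lim_seq_const|]. apply is_lim_seq_scal', npow_lim. unfold s'. lra.
       - ring. }
  intros X0. set (X := S X0).
  assert (Split : rsum (fun i => rsum (fun j => f (S i) * g (S i * S j)%nat) X) X
     = rsum (fun n => dsum f (S n) * g (S n)) X
       + rsum (fun i => rsum (fun j => if Nat.leb (S i * S j) X then 0 else f (S i) * g (S i * S j)%nat) X) X).
  { rewrite <- hyperbola_sum, <- rsum_plus. apply rsum_ext. intros i _. rewrite <- rsum_plus.
    apply rsum_ext. intros j _. destruct (Nat.leb (S i * S j) X); ring. }
  rewrite Split.
  assert (H1 : g 1%nat <= rsum (fun n => dsum f (S n) * g (S n)) X).
  { unfold X. rewrite rsum_S_l. unfold dsum at 1. simpl rsum at 1.
    change (divides 1 1) with true. cbv iota. rewrite (cm_1 f Hf).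
    assert (0 <= rsum (fun i => dsum f (S (S i)) * g (S (S i))) X0).
    { apply rsum_nonneg. intros i _. apply Rmult_le_pos; [apply dsum_nonneg; auto; lia|apply Hg; lia]. }
    lra. }
  assert (H2 : Rabs (rsum (fun i => rsum (fun j => if Nat.leb (S i * S j) X then 0 else f (S i) * g (S i * S j)%nat) X) X)
     <= C * Z ^ 2 * npow (s - s') X).
  { eapply Rle_trans; [apply rsum_abs|].
    apply Rle_trans with (rsum (fun i => rsum (fun j => C * npow (s - s') X * (npow s' (S i) * npow s' (S j))) X) X).
    - apply rsum_le. intros i _. eapply Rle_trans; [apply rsum_abs|]. apply rsum_le. intros j _.
      assert (Hpos : 0 <= C * npow (s - s') X) by (apply Rmult_le_pos; auto; left; apply npow_pos).
      destruct (Nat.leb_spec (S i * S j) X) as [Hle|Hgt].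
      + rewrite Rabs_R0. apply Rmult_le_pos; auto. apply Rmult_le_pos; left; apply npow_pos.
      + destruct (Hg (S i * S j)%nat ltac:(lia)) as [G1 G2].
        rewrite Rabs_mult, (Rabs_pos_eq (g _)) by auto.
        assert (Hfi : Rabs (f (S i)) <= 1).
        { destruct (cm_val f Hf (S i)) as [-> |[-> | ->]]; rewrite ?Rabs_R1, ?Rabs_R0; try lra. rewrite Rabs_left; lra. }
        apply Rle_trans with (1 * (C * npow s (S i * S j))).
        { apply Rmult_le_compat; auto using Rabs_pos. }
        rewrite Rmult_1_l, Rmult_assoc. apply Rmult_le_compat_l; auto.
        rewrite <- npow_mult by lia. apply npow_large; unfold s', X in *; try lra; lia.
    - rewrite (rsum_ext _ (fun i => C * npow (s - s') X * rsum (fun j => npow s' (S j)) X * npow s' (S i))).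
      2: { intros i _. rewrite rsum_scal, rsum_scal. ring. }
      rewrite rsum_scal.
      assert (HZ : 0 <= rsum (fun j => npow s' (S j)) X <= Z).
      { split; [apply rsum_nonneg; intros; left; apply npow_pos|].
        apply rsum_le_Series; [intros; left; apply npow_pos|apply ex_series_npow; unfold s'; lra]. }
      replace (C * Z ^ 2 * npow (s - s') X) with (C * npow (s - s') X * Z * Z) by ring.
      assert (Hpos : 0 <= C * npow (s - s') X) by (apply Rmult_le_pos; auto; left; apply npow_pos).
      apply Rmult_le_compat; try lra; [apply Rmult_le_pos; lra|]. apply Rmult_le_compat_l; lra. }
  apply Rabs_le_between in H2. fold X. lra.
Qed.

(** * Monotonicity of the normalised kernel *)

Definition vdecay (C : R) (v : R -> R) : Prop :=
  forall k x, (2 <= k <= 8)%nat -> Rabs (v x) <= C * exp (- (INR k / 2) * x).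
Definition udecay (K : R) (u : R -> R) : Prop := forall t, Rabs (u t) <= K * exp (- INR 2 * t).

(** Truncated sums obey no reflection formula, so nothing better than growth [e^(-k x / 2)] is known
    at [-oo]. Against the factor [e^(2x)] the choice [k = 8] settles [x >= 0], and [k = 2] leaves
    [e^x] for [x <= 0]. *)
Lemma prod_ibound u v K C L : udecay K u -> vdecay C v ->
  ibound 1 (K * C * exp (- INR 2 * L)) (fun x => u (L - x) * v x).
Proof.
  intros Hu Hv.
  assert (G : forall k x, (2 <= k <= 8)%nat ->
    Rabs (u (L - x) * v x) <= K * C * exp (- INR 2 * L) * exp (INR 2 * x - INR k / 2 * x)).
  { intros k x Hk. rewrite Rabs_mult.
    eapply Rle_trans; [apply Rmult_le_compat; [apply Rabs_pos|apply Rabs_pos|apply Hu|apply (Hv k); auto]|].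
    right. replace (- INR 2 * (L - x)) with (- INR 2 * L + INR 2 * x) by ring.
    replace (INR 2 * x - INR k / 2 * x) with (INR 2 * x + - (INR k / 2) * x) by ring.
    rewrite !exp_plus. ring. }
  assert (H0 : 0 <= K * C * exp (- INR 2 * L)).
  { specialize (G 2%nat 0 ltac:(lia)). replace (INR 2 * 0 - INR 2 / 2 * 0) with 0 in G by ring.
    rewrite exp_0, Rmult_1_r in G. eapply Rle_trans; [apply Rabs_pos|exact G]. }
  apply ibound_of_sides; intros x Hx.
  - eapply Rle_trans; [apply (G 8%nat); lia|]. apply Rmult_le_compat_l; auto.
    apply exp_le_mono. simpl. lra.
  - eapply Rle_trans; [apply (G 2%nat); lia|]. apply Rmult_le_compat_l; auto.
    apply exp_le_mono. simpl. lra.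
Qed.

Lemma prod_igood u v K C L : cont u -> cont v -> udecay K u -> vdecay C v ->
  igood (fun x => u (L - x) * v x).
Proof.
  intros Cu Cv Hu Hv. split.
  - apply cont_mult; auto. now apply cont_shift_arg.
  - exists 1, (K * C * exp (- INR 2 * L)). split; [lra|]. now apply prod_ibound.
Qed.

Lemma uterm_udecay m : exists K, 0 <= K /\ udecay K (uterm m).
Proof.
  exists (INR 2 ^ 2 / PI ^ 2 * / INR (S m) ^ 2). split.
  - apply Rmult_le_pos; [|apply inv_sq_nonneg]. apply Rdiv_le_0_compat; [apply pow2_ge_0|apply pow_lt, PI_RGT_0].
  - intros t. rewrite Rabs_pos_eq by (left; apply uterm_pos).
    eapply Rle_trans; [apply (uterm_bound 2); lia|]. right. ring.
Qed.

Lemma vterm_vdecay c a eta d : (a <= 1)%nat -> 0 < eta -> (forall n, Rabs (c n) <= 1) ->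
  exists C, 0 <= C /\ vdecay C (vterm c a eta d).
Proof.
  intros Ha He Hc. destruct (vterm_bound c a eta Ha He Hc) as [C [HC0 HC]].
  exists (C * / INR (S d) ^ 2). split; [apply Rmult_le_pos; auto; apply inv_sq_nonneg|].
  intros k x Hk. eapply Rle_trans; [apply (HC k d x Hk)|]. apply Req_le. ring.
Qed.

Definition kterm a eta (i j : nat) (L : R) : R :=
  Int (fun x => uterm j (L - x) * phi a eta (INR (S i) * exp (x / 2))).

Lemma kterm_igood a eta i j L : (a <= 1)%nat -> 0 < eta ->
  igood (fun x => uterm j (L - x) * phi a eta (INR (S i) * exp (x / 2))).
Proof.
  intros Ha He. destruct (uterm_udecay j) as [K [_ HK]].
  assert (H1 : forall n : Z, Rabs ((fun _ => 1) n) <= 1) by (intros; rewrite Rabs_R1; lra).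
  destruct (vterm_vdecay (fun _ => 1) a eta i Ha He H1) as [C [_ HC]].
  apply igood_ext with (fun x => uterm j (L - x) * vterm (fun _ => 1) a eta i x).
  - intros x. unfold vterm. ring.
  - apply (prod_igood _ _ K C); auto using cont_uterm, cont_vterm.
Qed.

Lemma uv_cut_Int c a eta L X Y : (a <= 1)%nat -> 0 < eta ->
  igood (fun x => ucut X (L - x) * vcut c a eta Y x) /\
  Int (fun x => ucut X (L - x) * vcut c a eta Y x)
  = rsum (fun i => rsum (fun j => c (Z.of_nat (S i)) * kterm a eta i j L) X) Y.
Proof.
  intros Ha He.
  assert (Z0 : igood (fun _ => 0)).
  { apply igood_ext with (fun x => 0 * (uterm 0 (L - x) * phi a eta (INR 1 * exp (x / 2)))).
    - intros; ring.
    - apply igood_scal. now apply kterm_igood. }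
  assert (I0 : Int (fun _ => 0) = 0).
  { rewrite (Int_ext _ (fun x => 0 * 0)) by (intros; ring). rewrite Int_scal by auto. ring. }
  assert (Row : forall i, igood (fun x => ucut X (L - x) * vterm c a eta i x) /\
     Int (fun x => ucut X (L - x) * vterm c a eta i x) = rsum (fun j => c (Z.of_nat (S i)) * kterm a eta i j L) X).
  { intros i. induction X as [|X [IH1 IH2]].
    - split; [apply igood_ext with (fun _ => 0); auto; intros; unfold ucut; simpl; ring|].
      rewrite (Int_ext _ (fun _ => 0)) by (intros; unfold ucut; simpl; ring). exact I0.
    - assert (E : forall x, ucut X (L - x) * vterm c a eta i x
         + c (Z.of_nat (S i)) * (uterm X (L - x) * phi a eta (INR (S i) * exp (x / 2)))
         = ucut (S X) (L - x) * vterm c a eta i x) by (intros x; unfold ucut, vterm; cbn [rsum]; ring).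
      pose proof (kterm_igood a eta i X L Ha He) as G. split.
      + apply (igood_ext _ _ E). apply igood_plus; auto. now apply igood_scal.
      + rewrite <- (Int_ext _ _ E), Int_plus, Int_scal, IH2 by auto using igood_scal. reflexivity. }
  induction Y as [|Y [IH1 IH2]].
  - split; [apply igood_ext with (fun _ => 0); auto; intros; unfold vcut; simpl; ring|].
    rewrite (Int_ext _ (fun _ => 0)) by (intros; unfold vcut; simpl; ring). exact I0.
  - destruct (Row Y) as [R1 R2].
    assert (E : forall x, ucut X (L - x) * vcut c a eta Y x + ucut X (L - x) * vterm c a eta Y x
       = ucut X (L - x) * vcut c a eta (S Y) x) by (intros x; unfold vcut; cbn [rsum]; ring).
    split.
    + apply (igood_ext _ _ E). now apply igood_plus.
    + rewrite <- (Int_ext _ _ E), Int_plus, IH2, R2 by auto. reflexivity.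
Qed.

(** The error of cutting both theta series is [(u - u_X) v + u_X (v - v_X)], and each part is
    bounded by a constant times the tail [tail2 X]. *)
Lemma Ffun_double_sum c a eta eps L : theta_data c a eta eps ->
  is_lim_seq (fun X => rsum (fun i => rsum (fun j => c (Z.of_nat (S i)) * kterm a eta i j L) X) X)
    (Ffun c a eta L).
Proof.
  intros H. pose proof (td_a _ _ _ _ H) as Ha. pose proof (td_eta _ _ _ _ H) as He. pose proof (td_c _ _ _ _ H) as Hc.
  destruct (vfun_bound c a eta Ha He Hc) as [C [HC0 HC]].
  destruct (vfun_cut_bound c a eta Ha He Hc) as [D [HD0 HD]].
  set (K := INR 2 ^ 2 / PI ^ 2).
  assert (HK0 : 0 <= K) by (apply Rdiv_le_0_compat; [apply pow2_ge_0|apply pow_lt, PI_RGT_0]).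
  pose proof zeta2_nonneg as HZ.
  assert (Hu : forall X, udecay (K * tail2 X) (fun t => ufun t - ucut X t)).
  { intros X t. destruct (ufun_cut_bound 2 X t ltac:(lia)) as [U0 U1]. fold K in U1.
    rewrite Rabs_pos_eq by auto. lra. }
  assert (Hu2 : forall X, udecay (K * zeta2) (ucut X)).
  { intros X t. destruct (ufun_cut_bound 2 X t ltac:(lia)) as [U0 _].
    destruct (ufun_bound 2 t ltac:(lia)) as [_ U1]. fold K in U1.
    rewrite Rabs_pos_eq; [lra|]. apply rsum_nonneg. intros i _. left. apply uterm_pos. }
  assert (Hv : forall X, vdecay (D * tail2 X) (fun x => vfun c a eta x - vcut c a eta X x)).
  { intros X k x Hk. eapply Rle_trans; [apply (HD k X x Hk)|]. right. ring. }
  apply is_lim_seq_ext with (fun X => Ffun c a eta L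
     - (Int (fun x => (ufun (L - x) - ucut X (L - x)) * vfun c a eta x)
        + Int (fun x => ucut X (L - x) * (vfun c a eta x - vcut c a eta X x)))).
  { intros X. destruct (uv_cut_Int c a eta L X X Ha He) as [G <-].
    assert (G1 : igood (fun x => (ufun (L - x) - ucut X (L - x)) * vfun c a eta x)).
    { apply (prod_igood (fun t => ufun t - ucut X t) (vfun c a eta) (K * tail2 X) C); auto.
      - apply cont_minus; [apply cont_ufun|apply cont_ucut].
      - apply (td_cont _ _ _ _ H). }
    assert (G2 : igood (fun x => ucut X (L - x) * (vfun c a eta x - vcut c a eta X x))).
    { apply (prod_igood (ucut X) (fun x => vfun c a eta x - vcut c a eta X x) (K * zeta2) (D * tail2 X)); auto.
      - apply cont_ucut.
      - apply cont_minus; [apply (td_cont _ _ _ _ H)|now apply cont_vcut]. }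
    unfold Ffun. rewrite <- Int_plus, <- Int_minus by (auto using igood_plus; apply (Fint_igood _ _ _ _ _ H)).
    apply Int_ext. intros x. ring. }
  replace (Finite (Ffun c a eta L)) with (Finite (Ffun c a eta L - 0)) by (f_equal; ring).
  apply is_lim_seq_minus'; [apply is_lim_seq_const|].
  apply is_lim_seq_abs_0.
  apply is_lim_seq_le_le with (u := fun _ => 0)
    (w := fun X => (2 * (K * C * exp (- INR 2 * L)) / 1 + 2 * (K * zeta2 * D * exp (- INR 2 * L)) / 1) * tail2 X).
  - intros X. split; [apply Rabs_pos|]. eapply Rle_trans; [apply Rabs_triang|].
    rewrite Rmult_plus_distr_r. apply Rplus_le_compat.
    + eapply Rle_trans; [apply (Int_abs_bound 1 (K * tail2 X * C * exp (- INR 2 * L)))|right; field].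
      * apply cont_mult; [|apply (td_cont _ _ _ _ H)].
        apply (cont_shift_arg (fun t => ufun t - ucut X t)). apply cont_minus; [apply cont_ufun|apply cont_ucut].
      * lra.
      * apply (prod_ibound (fun t => ufun t - ucut X t)); auto.
    + eapply Rle_trans; [apply (Int_abs_bound 1 (K * zeta2 * (D * tail2 X) * exp (- INR 2 * L)))|right; field].
      * apply cont_mult; [apply cont_shift_arg, cont_ucut|].
        apply cont_minus; [apply (td_cont _ _ _ _ H)|now apply cont_vcut].
      * lra.
      * apply (prod_ibound (ucut X) (fun x => vfun c a eta x - vcut c a eta X x)); auto.
  - apply is_lim_seq_const.
  - eapply is_lim_seq_eq; [apply is_lim_seq_scal', tail2_lim|ring].
Qed.

(** Its integral is [2 e^(2b)] times the Bessel function [K] of order [a / 2] at [2 b n], with the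
    parity factor [(n sqrt Q)^(a/2)]. The [-2] removes the smallest exponent, attained at [n = 1],
    [t = 0], so that every integrand with [n >= 1] decreases in [b]. *)
Definition kint (a : nat) (Q b n t : R) : R :=
  (sqrt (n * sqrt Q) * exp (t / 2)) ^ a * exp (- (b * (n * (exp t + exp (- t)) - 2))).
Definition kfun a Q (b : R) (n : nat) : R := Int (kint a Q b (INR n)).

Definition bpar (Q L : R) : R := PI * exp (L / 2) / sqrt Q.
Definition wt (a : nat) (Q L : R) : R := exp (L / 4) ^ a * exp (- (2 * bpar Q L)).

Lemma wt_pos a Q L : 0 < wt a Q L.
Proof. apply Rmult_lt_0_compat; [apply pow_lt, exp_pos|apply exp_pos]. Qed.

Lemma bpar_pos Q L : 0 < Q -> 0 < bpar Q L.
Proof.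
  intros HQ. apply Rdiv_lt_0_compat; [|now apply sqrt_lt_R0].
  apply Rmult_lt_0_compat; [apply PI_RGT_0|apply exp_pos].
Qed.

Lemma cont_kint a Q b n : (a <= 1)%nat -> cont (kint a Q b n).
Proof.
  intros Ha t. apply (ex_derive_continuous (kint a Q b n)).
  destruct a as [|[|a]]; [| |lia]; unfold kint; simpl; auto_derive; auto.
Qed.

Lemma cosh_ge t : 2 <= exp t + exp (- t) /\ exp (Rabs t) <= exp t + exp (- t).
Proof.
  split.
  - pose proof (exp_pos t) as P. rewrite exp_Ropp.
    apply Rmult_le_reg_r with (exp t); auto. rewrite Rmult_plus_distr_r, Rinv_l by lra.
    pose proof (pow2_ge_0 (exp t - 1)). nra.
  - pose proof (exp_pos t). pose proof (exp_pos (- t)).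
    destruct (Rle_lt_dec 0 t); [rewrite Rabs_pos_eq by auto|rewrite Rabs_left by auto]; lra.
Qed.

Lemma kint_pos a Q b n t : 0 < Q -> 0 < n -> 0 < kint a Q b n t.
Proof.
  intros HQ Hn. apply Rmult_lt_0_compat; [|apply exp_pos]. apply pow_lt, Rmult_lt_0_compat; [|apply exp_pos].
  apply sqrt_lt_R0, Rmult_lt_0_compat; auto. now apply sqrt_lt_R0.
Qed.

(** From [exp (- y) <= 27 / y^3] at [y = b n e^|t|]: the parity factor costs at most about
    [n e^(|t|/2)], which leaves [n^(-2)] for the double sum and rate 2 in [t]. *)
Lemma kint_bound a Q b : (a <= 1)%nat -> 0 < Q -> 0 < b -> exists C, 0 <= C /\
  forall n, 1 <= n -> ibound 2 (C * / n ^ 2) (kint a Q b n).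
Proof.
  intros Ha HQ Hb. set (R4 := sqrt (sqrt Q)).
  assert (HR4 : 0 <= R4) by apply sqrt_pos.
  exists ((1 + R4) * (exp (2 * b) * (27 / b ^ 3))). split.
  { apply Rmult_le_pos; [lra|]. apply Rmult_le_pos; [left; apply exp_pos|].
    apply Rdiv_le_0_compat; [lra|apply pow_lt; auto]. }
  intros n Hn t. rewrite Rabs_pos_eq by (left; apply kint_pos; lra). unfold kint.
  assert (P1 : (sqrt (n * sqrt Q) * exp (t / 2)) ^ a <= (1 + R4) * n * exp (/ 2 * Rabs t)).
  { assert (S1 : sqrt (n * sqrt Q) <= n * R4).
    { rewrite sqrt_mult by (try lra; apply sqrt_pos). fold R4. apply Rmult_le_compat_r; auto.
      rewrite <- (sqrt_pow2 n) at 2 by lra. apply sqrt_le_1_alt. nra. }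
    assert (S2 : exp (t / 2) <= exp (/ 2 * Rabs t)) by (apply exp_le_mono; pose proof (Rle_abs t); lra).
    assert (S3 : 1 <= exp (/ 2 * Rabs t)) by (rewrite <- exp_0; apply exp_le_mono; pose proof (Rabs_pos t); lra).
    assert (S4 : 0 <= sqrt (n * sqrt Q)) by apply sqrt_pos.
    pose proof (exp_pos (t / 2)).
    destruct a as [|[|a]]; [| |lia]; simpl; [nra|]. rewrite Rmult_1_r.
    apply Rmult_le_compat; try lra; nra. }
  assert (P2 : exp (- (b * (n * (exp t + exp (- t)) - 2)))
     <= exp (2 * b) * (27 / b ^ 3 * / n ^ 3 * exp (- 3 * Rabs t))).
  { replace (- (b * (n * (exp t + exp (- t)) - 2))) with (2 * b + - (b * n * (exp t + exp (- t)))) by ring.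
    rewrite exp_plus. apply Rmult_le_compat_l; [left; apply exp_pos|].
    pose proof (exp_pos (Rabs t)) as Pt.
    apply Rle_trans with (exp (- (b * n * exp (Rabs t)))).
    - apply exp_le_mono, Ropp_le_contravar. apply Rmult_le_compat_l; [nra|apply cosh_ge].
    - eapply Rle_trans; [apply (exp_neg_le_pow 3); repeat apply Rmult_lt_0_compat; lra|].
      right. replace (-3 * Rabs t) with (- (INR 3 * Rabs t)) by (simpl; ring).
      rewrite exp_Ropp, exp_nat_mult, !Rpow_mult_distr.
      replace (INR 3 ^ 3) with 27 by (simpl; ring). field. repeat split; lra. }
  apply Rle_trans with ((1 + R4) * n * exp (/ 2 * Rabs t) * (exp (2 * b) * (27 / b ^ 3 * / n ^ 3 * exp (-3 * Rabs t)))).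
  - apply Rmult_le_compat; auto; [|left; apply exp_pos].
    apply pow_le. apply Rmult_le_pos; [apply sqrt_pos|left; apply exp_pos].
  - assert (E : exp (/ 2 * Rabs t) * exp (-3 * Rabs t) <= exp (- (2) * Rabs t)).
    { rewrite <- exp_plus. apply exp_le_mono. pose proof (Rabs_pos t). lra. }
    replace ((1 + R4) * n * exp (/ 2 * Rabs t) * (exp (2 * b) * (27 / b ^ 3 * / n ^ 3 * exp (-3 * Rabs t))))
      with ((1 + R4) * (exp (2 * b) * (27 / b ^ 3)) * / n ^ 2 * (exp (/ 2 * Rabs t) * exp (-3 * Rabs t)))
      by (field; lra).
    apply Rmult_le_compat_l; auto.
    repeat apply Rmult_le_pos; try lra; try (left; apply exp_pos).
    + left. apply Rinv_0_lt_compat, pow_lt. auto.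
    + left. apply Rinv_0_lt_compat, pow_lt. lra.
Qed.

Lemma kint_igood a Q b n : (a <= 1)%nat -> 0 < Q -> 0 < b -> 1 <= n -> igood (kint a Q b n).
Proof.
  intros Ha HQ Hb Hn. destruct (kint_bound a Q b Ha HQ Hb) as [C [_ HC]]. split; [now apply cont_kint|].
  exists 2, (C * / n ^ 2). split; [lra|auto].
Qed.

Lemma kfun_bound a Q b : (a <= 1)%nat -> 0 < Q -> 0 < b -> exists C,
  forall n, (1 <= n)%nat -> 0 < kfun a Q b n <= C * npow 2 n.
Proof.
  intros Ha HQ Hb. destruct (kint_bound a Q b Ha HQ Hb) as [C [HC0 HC]]. exists C. intros n Hn.
  assert (Hn1 : 1 <= INR n) by (apply (le_INR 1); auto). split.
  - apply Int_pos; [now apply kint_igood|]. intros t. apply kint_pos; lra.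
  - eapply Rle_trans; [apply Rle_abs|]. eapply Rle_trans; [apply (Int_abs_bound 2 (C * / INR n ^ 2))|].
    + now apply cont_kint.
    + lra.
    + now apply HC.
    + right. unfold npow. replace (- (2) * ln (INR n)) with (- (INR 2 * ln (INR n))) by (simpl; ring).
      rewrite exp_Ropp, exp_nat_mult, exp_ln by lra. field. lra.
Qed.

Lemma kfun_antitone a Q b b' n : (a <= 1)%nat -> 0 < Q -> 0 < b -> b <= b' -> (1 <= n)%nat ->
  kfun a Q b' n <= kfun a Q b n.
Proof.
  intros Ha HQ Hb Hle Hn. assert (Hn1 : 1 <= INR n) by (apply (le_INR 1); auto).
  apply Int_le; try (apply kint_igood; auto; lra).
  intros t. unfold kint. apply Rmult_le_compat_l.
  - apply pow_le. apply Rmult_le_pos; [apply sqrt_pos|left; apply exp_pos].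
  - apply exp_le_mono, Ropp_le_contravar. apply Rmult_le_compat_r; auto.
    destruct (cosh_ge t) as [G _]. nra.
Qed.

Lemma kterm_kfun a Q i j L : (a <= 1)%nat -> 0 < Q ->
  kterm a (PI / Q) i j L = wt a Q L * kfun a Q (bpar Q L) (S i * S j).
Proof.
  intros Ha HQ. pose proof PI_RGT_0 as Hpi.
  assert (Heta : 0 < PI / Q) by (apply Rdiv_lt_0_compat; auto).
  pose proof (INR_S_ge_1 i) as Hi. pose proof (INR_S_ge_1 j) as Hj.
  set (d := INR (S i)) in *. set (m := INR (S j)) in *.
  assert (Hsq : 0 < sqrt Q) by now apply sqrt_lt_R0.
  (* The translation by [ln r] balances the exponents [PI m^2 e^(L - x)] and [PI d^2 e^x / Q].
     Afterwards they depend on [d] and [m] only through [d m], which brings in the coefficients of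
     [1 * chi]. *)
  set (r := exp (L / 2) * sqrt Q * m / d).
  assert (Hr : 0 < r).
  { unfold r. apply Rdiv_lt_0_compat; [|lra]. repeat apply Rmult_lt_0_compat; try lra. apply exp_pos. }
  unfold kterm, kfun. rewrite <- (Int_shift _ (ln r)) by now apply kterm_igood.
  assert (Hn1 : 1 <= INR (S i * S j)) by (apply (le_INR 1); lia).
  rewrite <- Int_scal by (apply kint_igood; auto using bpar_pos).
  apply Int_ext. intros t. unfold uterm, phi, kint, wt, bpar. fold d m.
  rewrite mult_INR. fold d m.
  replace (L - (t + ln r)) with (L / 2 + L / 2 + - t + - ln r) by field.
  rewrite !exp_plus, (exp_Ropp (ln r)), exp_ln by auto.
  replace ((t + ln r) / 2) with (t / 2 + ln r / 2) by field. rewrite exp_plus.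
  rewrite <- (sqrt_exp (ln r)), exp_ln by auto.
  assert (SQ : sqrt Q * sqrt Q = Q) by (apply sqrt_sqrt; lra).
  assert (Hd2 : d * sqrt r = exp (L / 4) * sqrt (d * m * sqrt Q)).
  { rewrite <- (sqrt_pow2 d) at 1 by lra. rewrite <- sqrt_mult by (try apply pow2_ge_0; lra).
    replace (d ^ 2 * r) with (exp (L / 2) * (d * m * sqrt Q)) by (unfold r; field; lra).
    rewrite sqrt_mult, sqrt_exp by (try (left; apply exp_pos); repeat apply Rmult_le_pos; lra).
    do 2 f_equal. field. }
  replace (d * (exp (t / 2) * sqrt r)) with (exp (L / 4) * (sqrt (d * m * sqrt Q) * exp (t / 2)))
    by (rewrite <- Rmult_assoc, <- Hd2; ring).
  rewrite (Rpow_mult_distr (exp (L / 4)) _ a).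
  assert (Hd3 : (exp (L / 4) * (sqrt (d * m * sqrt Q) * exp (t / 2))) ^ 2 = exp (L / 2) * (d * m * sqrt Q) * exp t).
  { rewrite !Rpow_mult_distr. rewrite pow2_sqrt by (repeat apply Rmult_le_pos; lra).
    replace (exp (L / 4) ^ 2) with (exp (L / 2)) by (simpl; rewrite Rmult_1_r, <- exp_plus; f_equal; field).
    replace (exp (t / 2) ^ 2) with (exp t) by (simpl; rewrite Rmult_1_r, <- exp_plus; f_equal; field). ring. }
  rewrite Hd3.
  replace (- (PI * (exp (L / 2) * exp (L / 2) * exp (- t) * / r) * m ^ 2))
    with (- (PI * exp (L / 2) / sqrt Q * (d * m) * exp (- t))).
  2: { unfold r. field. pose proof (exp_pos (L / 2)). repeat split; lra. }
  replace (- (PI / Q * (exp (L / 2) * (d * m * sqrt Q) * exp t)))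
    with (- (PI * exp (L / 2) / sqrt Q * (d * m) * exp t)).
  2: { rewrite <- SQ at 2. field. lra. }
  set (bb := PI * exp (L / 2) / sqrt Q). set (A := exp (L / 4) ^ a).
  set (Bq := (sqrt (d * m * sqrt Q) * exp (t / 2)) ^ a).
  replace (- (bb * (d * m * (exp t + exp (- t)) - 2)))
    with (2 * bb + - (bb * (d * m) * exp (- t)) + - (bb * (d * m) * exp t)) by ring.
  rewrite !exp_plus. rewrite (exp_Ropp (2 * bb)).
  pose proof (exp_pos (2 * bb)). field. lra.
Qed.

Definition Pfun c a Q (L : R) : R := Ffun c a (PI / Q) L / wt a Q L.

Lemma Pfun_double_sum c a Q eps L : 0 < Q -> theta_data c a (PI / Q) eps ->
  is_lim_seq (fun X => rsum (fun i => rsum (fun j =>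
     c (Z.of_nat (S i)) * kfun a Q (bpar Q L) (S i * S j)) X) X) (Pfun c a Q L).
Proof.
  intros HQ H. pose proof (Ffun_double_sum _ _ _ _ L H) as E.
  apply (is_lim_seq_scal' _ (/ wt a Q L)) in E.
  pose proof (wt_pos a Q L) as Hw. unfold Pfun, Rdiv. rewrite Rmult_comm.
  eapply is_lim_seq_ext; [|exact E]. intros X. cbv beta. rewrite <- rsum_scal.
  apply rsum_ext. intros i _. rewrite <- rsum_scal. apply rsum_ext. intros j _.
  rewrite kterm_kfun by (auto; apply H). field. lra.
Qed.

Lemma bpar_mono Q L L' : 0 < Q -> L <= L' -> bpar Q L <= bpar Q L'.
Proof.
  intros HQ HL. unfold bpar, Rdiv. pose proof PI_RGT_0.
  apply Rmult_le_compat_r; [left; apply Rinv_0_lt_compat; now apply sqrt_lt_R0|].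
  apply Rmult_le_compat_l; [lra|]. apply exp_le_mono. lra.
Qed.

(** Grouped by [n = d m] the coefficients are nonnegative, and the term [n = 1] alone is already
    positive. *)
Lemma Pfun_pos c a Q eps L : 0 < Q -> theta_data c a (PI / Q) eps ->
  cmult (fun n => c (Z.of_nat n)) -> 0 < Pfun c a Q L.
Proof.
  intros HQ H Hf. pose proof (td_a _ _ _ _ H) as Ha.
  destruct (kfun_bound a Q (bpar Q L) Ha HQ (bpar_pos Q L HQ)) as [C HC].
  apply Rlt_le_trans with (kfun a Q (bpar Q L) 1); [now apply HC|].
  apply (double_sum_limit_ge (fun n => c (Z.of_nat n)) (kfun a Q (bpar Q L)) C 2); auto; [lra| |].
  - intros n Hn. destruct (HC n Hn). lra.
  - now apply (Pfun_double_sum _ _ _ _ L HQ H).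
Qed.

(** The positivity argument is applied to the difference of the kernels at [L] and [L'], which is
    nonnegative because [bpar] increases with [L]. *)
Lemma Pfun_antitone c a Q eps L L' : 0 < Q -> theta_data c a (PI / Q) eps ->
  cmult (fun n => c (Z.of_nat n)) -> L <= L' -> Pfun c a Q L' <= Pfun c a Q L.
Proof.
  intros HQ H Hf HL. pose proof (td_a _ _ _ _ H) as Ha.
  destruct (kfun_bound a Q (bpar Q L) Ha HQ (bpar_pos Q L HQ)) as [C HC].
  destruct (kfun_bound a Q (bpar Q L') Ha HQ (bpar_pos Q L' HQ)) as [C' HC'].
  assert (Hg : forall n, (1 <= n)%nat -> 0 <= kfun a Q (bpar Q L) n - kfun a Q (bpar Q L') n <= C * npow 2 n).
  { intros n Hn. pose proof (kfun_antitone a Q _ _ n Ha HQ (bpar_pos Q L HQ) (bpar_mono Q L L' HQ HL) Hn).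
    destruct (HC n Hn). destruct (HC' n Hn). lra. }
  assert (G : kfun a Q (bpar Q L) 1 - kfun a Q (bpar Q L') 1 <= Pfun c a Q L - Pfun c a Q L').
  { apply (double_sum_limit_ge (fun n => c (Z.of_nat n))
      (fun n => kfun a Q (bpar Q L) n - kfun a Q (bpar Q L') n) C 2); auto; [lra|].
    eapply is_lim_seq_ext.
    2: { apply is_lim_seq_minus'; [apply (Pfun_double_sum _ _ _ _ L HQ H)|apply (Pfun_double_sum _ _ _ _ L' HQ H)]. }
    intros X. cbv beta. rewrite <- rsum_minus. apply rsum_ext. intros i _. rewrite <- rsum_minus.
    apply rsum_ext. intros j _. ring. }
  destruct (Hg 1%nat (le_n _)). lra.
Qed.

Lemma wt_hbound a Q : (a <= 1)%nat -> 0 < Q -> exists C, 0 <= C /\ hbound 4 C (wt a Q).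
Proof.
  intros Ha HQ. pose proof PI_RGT_0 as Hpi.
  assert (Hsq : 0 < sqrt Q) by now apply sqrt_lt_R0.
  set (c := 2 * PI / sqrt Q). assert (Hc : 0 < c) by (apply Rdiv_lt_0_compat; lra).
  exists (INR 10 ^ 10 / c ^ 10). split.
  { apply Rdiv_le_0_compat; [apply pow_le, pos_INR|now apply pow_lt]. }
  intros L HL. rewrite Rabs_pos_eq by (left; apply wt_pos). unfold wt, bpar.
  replace (2 * (PI * exp (L / 2) / sqrt Q)) with (c * exp (L / 2)) by (unfold c; field; lra).
  pose proof (exp_pos (L / 2)) as P2.
  assert (E1 : exp (L / 4) ^ a <= exp L).
  { destruct a as [|[|a]]; [| |lia]; simpl; rewrite ?Rmult_1_r.
    - rewrite <- exp_0. apply exp_le_mono. lra.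
    - apply exp_le_mono. lra. }
  assert (E2 : exp (- (c * exp (L / 2))) <= INR 10 ^ 10 / c ^ 10 * exp (- (5) * L)).
  { eapply Rle_trans; [apply (exp_neg_le_pow 10); now apply Rmult_lt_0_compat|].
    rewrite Rpow_mult_distr, <- exp_nat_mult.
    replace (- (5) * L) with (- (INR 10 * (L / 2))) by (simpl; field). rewrite exp_Ropp.
    right. field. split; [pose proof (exp_pos (INR 10 * (L / 2))); lra|lra]. }
  eapply Rle_trans; [apply Rmult_le_compat; [apply pow_le; left; apply exp_pos|left; apply exp_pos|exact E1|exact E2]|].
  right. replace (- (4) * L) with (L + - (5) * L) by ring. rewrite exp_plus. ring.
Qed.

Lemma is_derive_wt a Q L : (a <= 1)%nat -> 0 < Q -> is_derive (wt a Q) L (wt a Q L * (INR a / 4 - bpar Q L)).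
Proof.
  intros Ha HQ. assert (Hsq : 0 < sqrt Q) by now apply sqrt_lt_R0.
  destruct a as [|[|a]]; [| |lia]; unfold wt, bpar; simpl; auto_derive; try lra; auto; field; lra.
Qed.

Lemma cont_wt a Q : (a <= 1)%nat -> 0 < Q -> cont (wt a Q).
Proof.
  intros Ha HQ L. apply (ex_derive_continuous (wt a Q)). eexists. now apply is_derive_wt.
Qed.

(** * The weight inequality *)

Definition omega (eps s L : R) : R := halfexp s L + eps * halfexp (1 - s) L.

Lemma halfexp_split s L : halfexp s L = halfexp (1 - s) L * exp ((2 * s - 1) / 2 * L).
Proof. unfold halfexp. rewrite <- exp_plus. f_equal. field. Qed.

Lemma omega_pos eps s L : eps = 1 \/ eps = -1 -> 1 / 2 < s -> 0 < L -> 0 < omega eps s L.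
Proof.
  intros He Hs HL. unfold omega.
  assert (H : halfexp (1 - s) L < halfexp s L) by (apply exp_increasing; nra).
  assert (0 < halfexp (1 - s) L) by apply exp_pos.
  destruct He; subst; lra.
Qed.

Lemma omega_nonneg eps s L : eps = 1 \/ eps = -1 -> 1 / 2 < s -> 0 <= L -> 0 <= omega eps s L.
Proof.
  intros He Hs [HL|<-]; [left; now apply omega_pos|].
  unfold omega, halfexp. rewrite !Rmult_0_r, exp_0. destruct He; subst; lra.
Qed.

Definition domega (eps s L : R) : R := s / 2 * halfexp s L + eps * ((1 - s) / 2 * halfexp (1 - s) L).

Lemma is_derive_omega eps s L : is_derive (omega eps s) L (domega eps s L).
Proof. unfold omega, domega, halfexp. auto_derive; auto. field. Qed.

(** Controls the part of [dPsi] in which [omega] is differentiated. For [eps = -1] the function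
    [omega] vanishes at [L = 0], so plain positivity is too weak; the proof uses
    [z - 1 >= (2s - 1) (1 - i)], a consequence of [1 - e^(-L/2) <= L / 2]. *)
Lemma omega_slope eps s L : eps = 1 \/ eps = -1 -> 1 / 2 < s < 1 -> 0 <= L ->
  (1 - exp (- (L / 2))) * domega eps s L + / 2 * exp (- (L / 2)) * omega eps s L <= omega eps s L.
Proof.
  intros He Hs HL. unfold omega, domega. rewrite (halfexp_split s).
  set (B := halfexp (1 - s) L). assert (HB : 0 < B) by apply exp_pos.
  set (z := exp ((2 * s - 1) / 2 * L)). set (i := exp (- (L / 2))).
  assert (Hi : 0 < i <= 1).
  { split; [apply exp_pos|]. rewrite <- exp_0. apply exp_le_mono. lra. }
  assert (Hi2 : 1 - i <= L / 2) by (pose proof (exp_ge_1_plus (- (L / 2))); unfold i; lra).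
  assert (Hz : 1 + (2 * s - 1) * (1 - i) <= z).
  { pose proof (exp_ge_1_plus ((2 * s - 1) / 2 * L)). unfold z.
    assert ((2 * s - 1) * (1 - i) <= (2 * s - 1) * (L / 2)) by (apply Rmult_le_compat_l; lra). lra. }
  destruct He; subst.
  - assert (G : 0 <= B * (z + 1 - ((1 - i) * (s / 2 * z + (1 - s) / 2) + / 2 * i * (z + 1)))); [|lra].
    assert (Hz1 : 1 <= z) by nra. apply Rmult_le_pos; [lra|].
    assert ((1 - i) * (s / 2 * z + (1 - s) / 2) <= (1 - i) * (/ 2 * (z + 1))) by (apply Rmult_le_compat_l; nra).
    nra.
  - assert (G : 0 <= B * (z - 1 - ((1 - i) * (s / 2 * z - (1 - s) / 2) + / 2 * i * (z - 1)))); [|lra].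
    apply Rmult_le_pos; [lra|].
    set (u := z - 1). replace z with (1 + u) by (unfold u; ring).
    assert (Hu : (2 * s - 1) * (1 - i) <= u) by (unfold u; lra).
    assert (0 <= u) by nra.
    assert (0 <= (1 - i) * (1 - s) * u) by (apply Rmult_le_pos; [apply Rmult_le_pos; lra|lra]).
    nra.
Qed.

Definition Wfun a Q eps s (L : R) : R := wt a Q L * omega eps s L.
(** The value of [y = e^(L/2)] at which the upper bound for [dPsi] changes sign. With
    [c = 2 PI / sqrt Q], the identity [c/2 (Y - y) = 1 + a/4 - c/2 (y - 1)] collects 1 from
    [omega_slope] and the rest from the logarithmic derivative of [wt]. *)
Definition ycut a Q : R := 1 + (2 + INR a / 2) / (2 * PI / sqrt Q).

Lemma hgood_wt_exp a Q r : (a <= 1)%nat -> 0 < Q -> r < 4 -> hgood (fun L => wt a Q L * exp (r * L)).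
Proof.
  intros Ha HQ Hr. destruct (wt_hbound a Q Ha HQ) as [C [_ HC]].
  apply (hgood_moment (wt a Q) 4 C r); auto. now apply cont_wt.
Qed.

Lemma hgood_ext f g : (forall x, f x = g x) -> hgood f -> hgood g.
Proof.
  intros E [Hc [e [C [He HC]]]]. split; [now apply cont_ext with f|].
  exists e, C. split; auto. intros x Hx. rewrite <- E. now apply HC.
Qed.

Lemma Wfun_hgood a Q eps s : (a <= 1)%nat -> 0 < Q -> 0 < s < 1 -> hgood (Wfun a Q eps s).
Proof.
  intros Ha HQ Hs.
  apply hgood_ext with (fun L => wt a Q L * exp (s / 2 * L) + eps * (wt a Q L * exp ((1 - s) / 2 * L))).
  - intros L. unfold Wfun, omega, halfexp. ring.
  - apply hgood_plus; [|apply hgood_scal]; apply hgood_wt_exp; auto; lra.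
Qed.

Lemma Wfun_id_hgood a Q eps s : (a <= 1)%nat -> 0 < Q -> 0 < s < 1 -> hgood (fun L => L * Wfun a Q eps s L).
Proof.
  intros Ha HQ Hs. destruct (wt_hbound a Q Ha HQ) as [C [_ HC]].
  apply hgood_ext with (fun L => L * wt a Q L * exp (s / 2 * L) + eps * (L * wt a Q L * exp ((1 - s) / 2 * L))).
  - intros L. unfold Wfun, omega, halfexp. ring.
  - apply hgood_plus; [|apply hgood_scal]; apply (hgood_moment1 _ 4 C); auto using cont_wt; lra.
Qed.

(** A test function whose derivative has integral zero. The factor [1 - e^(-L/2)] kills the boundary
    term at [L = 0], where [omega] need not vanish, and multiplied by [y] it is just [y - 1]. *)
Definition Psi a Q eps s (L : R) : R := (1 - exp (- (L / 2))) * Wfun a Q eps s L.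
Definition dPsi a Q eps s (L : R) : R :=
  / 2 * exp (- (L / 2)) * Wfun a Q eps s L
  + (1 - exp (- (L / 2))) * (wt a Q L * (INR a / 4 - bpar Q L) * omega eps s L + wt a Q L * domega eps s L).

Lemma is_derive_Psi a Q eps s L : (a <= 1)%nat -> 0 < Q -> is_derive (Psi a Q eps s) L (dPsi a Q eps s L).
Proof.
  intros Ha HQ.
  assert (D1 : is_derive (fun L => 1 - exp (- (L / 2))) L (/ 2 * exp (- (L / 2)))).
  { auto_derive; auto. replace (- (L * / 2)) with (- (L / 2)) by reflexivity. ring. }
  pose proof (is_derive_mult (wt a Q) (omega eps s) L _ _ (is_derive_wt a Q L Ha HQ) (is_derive_omega eps s L)
    Rmult_comm) as D2.
  pose proof (is_derive_mult _ _ L _ _ D1 D2 Rmult_comm) as D3.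
  unfold plus, mult in D3; simpl in D3. exact D3.
Qed.

Lemma Psi_bounds a Q eps s : (a <= 1)%nat -> 0 < Q -> 0 < s < 1 ->
  hgood (dPsi a Q eps s) /\ (exists e C, 0 < e /\ hbound e C (Psi a Q eps s)).
Proof.
  intros Ha HQ Hs. assert (Hsq : 0 < sqrt Q) by now apply sqrt_lt_R0.
  split.
  - set (c := PI / sqrt Q).
    set (e := fun r L => wt a Q L * exp (r * L)).
    apply hgood_ext with (fun L =>
      (/ 2 - s / 2 - INR a / 4 + 0) * e (s / 2 - / 2) L
      + (eps * (/ 2 - (1 - s) / 2 - INR a / 4)) * e ((1 - s) / 2 - / 2) L
      + ((INR a / 4 + s / 2 + c) * e (s / 2) L + (eps * (INR a / 4 + (1 - s) / 2 + c)) * e ((1 - s) / 2) L)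
      + (- c * e (s / 2 + / 2) L + (eps * - c) * e ((1 - s) / 2 + / 2) L)).
    + intros L. unfold dPsi, e, Wfun, omega, domega, halfexp, bpar.
      replace ((s / 2 - / 2) * L) with (- (L / 2) + s / 2 * L) by field.
      replace (((1 - s) / 2 - / 2) * L) with (- (L / 2) + (1 - s) / 2 * L) by field.
      replace ((s / 2 + / 2) * L) with (L / 2 + s / 2 * L) by field.
      replace (((1 - s) / 2 + / 2) * L) with (L / 2 + (1 - s) / 2 * L) by field.
      rewrite !exp_plus. unfold c.
      replace (PI * exp (L / 2) / sqrt Q) with (PI / sqrt Q * exp (L / 2)) by (unfold Rdiv; ring).
      pose proof (exp_half_sq L) as Eh.
      set (i := exp (- (L / 2))) in *. set (y := exp (L / 2)) in *.
      set (AA := exp (s / 2 * L)). set (BB := exp ((1 - s) / 2 * L)).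
      set (w := wt a Q L). set (cc := PI / sqrt Q). set (aa := INR a).
      replace ((1 - i) * (w * (aa / 4 - cc * y) * (AA + eps * BB) + w * (s / 2 * AA + eps * ((1 - s) / 2 * BB))))
       with (w * (AA + eps * BB) * (aa / 4 - aa / 4 * i - cc * y + cc * (i * y)) + (1 - i) * (w * (s / 2 * AA + eps * ((1 - s) / 2 * BB)))) by ring.
      rewrite Eh. field.
    + assert (G : forall k r, r < 4 -> hgood (fun L => k * e r L)).
      { intros k r Hr. apply hgood_scal. now apply hgood_wt_exp. }
      apply hgood_plus; [apply hgood_plus; [apply hgood_plus|apply hgood_plus]|apply hgood_plus]; apply G; lra.
  - assert (GW : hgood (Psi a Q eps s)); [|destruct GW as [_ [e [C [He HC]]]]; eauto].
    apply (hgood_le _ (fun L => wt a Q L * exp (s / 2 * L) + Rabs eps * (wt a Q L * exp ((1 - s) / 2 * L)))).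
    + intros L. apply (ex_derive_continuous (Psi a Q eps s)). eexists. now apply is_derive_Psi.
    + apply hgood_plus; [|apply hgood_scal]; apply hgood_wt_exp; auto; lra.
    + intros L HL. unfold Psi, Wfun.
      assert (Hi : 0 < exp (- (L / 2)) <= 1).
      { split; [apply exp_pos|]. rewrite <- exp_0. apply exp_le_mono. lra. }
      pose proof (wt_pos a Q L) as Hw.
      rewrite Rabs_mult, (Rabs_pos_eq (1 - _)) by lra.
      apply Rle_trans with (1 * Rabs (wt a Q L * omega eps s L)).
      { apply Rmult_le_compat_r; [apply Rabs_pos|lra]. }
      rewrite Rmult_1_l, Rabs_mult, (Rabs_pos_eq (wt a Q L)) by lra.
      replace (wt a Q L * exp (s / 2 * L) + Rabs eps * (wt a Q L * exp ((1 - s) / 2 * L)))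
        with (wt a Q L * (halfexp s L + Rabs eps * halfexp (1 - s) L)) by (unfold halfexp; ring).
      apply Rmult_le_compat_l; [lra|]. unfold omega.
      eapply Rle_trans; [apply Rabs_triang|].
      rewrite Rabs_mult, !(Rabs_pos_eq (halfexp _ _)) by (left; apply exp_pos). lra.
Qed.

(** [dPsi] integrates to 0 and is at most [c/2 W (Y - y)], so the [W]-mean of [y] does not exceed
    [Y]. The tangent of the logarithm at [Y] then bounds the mean of [L / 2 = ln y] by
    [ln Y < rho]. *)
Lemma weight_mean_pos a Q eps s rho : (a <= 1)%nat -> 0 < Q -> eps = 1 \/ eps = -1 -> 1 / 2 < s < 1 ->
  ln (ycut a Q) < rho -> 0 < Hint (fun L => Wfun a Q eps s L * (rho - L / 2)).
Proof.
  intros Ha HQ He Hs Hrho. pose proof PI_RGT_0 as Hpi.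
  assert (Hsq : 0 < sqrt Q) by now apply sqrt_lt_R0.
  set (c := 2 * PI / sqrt Q). assert (Hc : 0 < c) by (apply Rdiv_lt_0_compat; lra).
  set (Y := ycut a Q).
  assert (HY : 1 < Y).
  { unfold Y, ycut. fold c. pose proof (pos_INR a).
    assert (0 < (2 + INR a / 2) / c) by (apply Rdiv_lt_0_compat; lra). lra. }
  destruct (Psi_bounds a Q eps s Ha HQ ltac:(lra)) as [Gd [e [C [He' HC]]]].
  assert (GW : hgood (Wfun a Q eps s)) by (apply Wfun_hgood; auto; lra).
  assert (H0 : Hint (dPsi a Q eps s) = 0).
  { transitivity (- Psi a Q eps s 0).
    - apply (Hint_derive (Psi a Q eps s) (dPsi a Q eps s) e C); auto.
      intros x. now apply is_derive_Psi.
    - unfold Psi. replace (- (0 / 2)) with 0 by field. rewrite exp_0. ring. }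
  assert (HW : 0 < Hint (Wfun a Q eps s)).
  { apply Hint_pos; auto. intros L HL. apply Rmult_lt_0_compat; [apply wt_pos|apply omega_pos; auto; lra]. }
  apply Rlt_le_trans with (Hint (fun L => (rho - ln Y) * Wfun a Q eps s L + 2 / (c * Y) * dPsi a Q eps s L)).
  (* Since [dPsi] integrates to 0, only the strict gap [rho - ln Y] remains. *)
  - rewrite Hint_plus, !Hint_scal, H0 by auto using hgood_scal.
    rewrite Rmult_0_r, Rplus_0_r. apply Rmult_lt_0_compat; auto. fold Y in Hrho. lra.
  - apply Hint_le.
    + apply hgood_plus; now apply hgood_scal.
    + apply hgood_ext with (fun L => rho * Wfun a Q eps s L + - / 2 * (L * Wfun a Q eps s L)).
      * intros L. field.
      * apply hgood_plus; apply hgood_scal; auto. apply Wfun_id_hgood; auto; lra.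
    + intros L HL. set (W := Wfun a Q eps s L).
      assert (HWL : 0 <= W) by (apply Rmult_le_pos; [left; apply wt_pos|apply omega_nonneg; auto; lra]).
      set (y := exp (L / 2)). assert (Hy : 0 < y) by apply exp_pos.
      assert (Hln : L / 2 <= ln Y + (y - Y) / Y).
      { assert (E : ln (y / Y) <= y / Y - 1).
        { pose proof (exp_ge_1_plus (ln (y / Y))) as Ee. rewrite exp_ln in Ee by (apply Rdiv_lt_0_compat; lra). lra. }
        unfold Rdiv at 1 in E. rewrite ln_mult, ln_Rinv in E by (try apply Rinv_0_lt_compat; lra).
        unfold y in E at 1. rewrite ln_exp in E.
        replace ((y - Y) / Y) with (y / Y - 1) by (field; lra). lra. }
      assert (Hd : dPsi a Q eps s L <= c / 2 * (W * (Y - y))).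
      { pose proof (omega_slope eps s L He Hs HL) as Sl.
        pose proof (wt_pos a Q L) as Hw.
        assert (Hi : 0 < exp (- (L / 2)) <= 1).
        { split; [apply exp_pos|]. rewrite <- exp_0. apply exp_le_mono. lra. }
        pose proof (exp_half_sq L) as Eh. fold y in Eh.
        unfold dPsi. set (i := exp (- (L / 2))) in *.
        assert (Eb : bpar Q L = c / 2 * y) by (unfold bpar, c; fold y; field; lra).
        assert (EY : c / 2 * (Y - y) = 1 + INR a / 4 + c / 2 - c / 2 * y).
        { unfold Y, ycut. fold c. field. lra. }
        replace (c / 2 * (W * (Y - y))) with (W * (c / 2 * (Y - y))) by ring. rewrite EY, Eb.
        unfold W, Wfun in *. set (w := wt a Q L) in *. set (om := omega eps s L) in *.
        set (dm := domega eps s L) in *.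
        replace (/ 2 * i * (w * om) + (1 - i) * (w * (INR a / 4 - c / 2 * y) * om + w * dm))
          with (w * ((1 - i) * dm + / 2 * i * om) + w * om * (INR a / 4 - c / 2 * y + c / 2 * (i * y)) - i * (INR a / 4) * (w * om)) by ring.
        rewrite Eh.
        assert (w * ((1 - i) * dm + / 2 * i * om) <= w * om) by (apply Rmult_le_compat_l; lra).
        assert (0 <= i * (INR a / 4) * (w * om)).
        { pose proof (pos_INR a). apply Rmult_le_pos; auto. apply Rmult_le_pos; lra. }
        lra. }
      apply Rle_trans with ((rho - ln Y) * W + (Y - y) / Y * W).
      * apply Rplus_le_compat_l. apply Rle_trans with (2 / (c * Y) * (c / 2 * (W * (Y - y)))).
        -- apply Rmult_le_compat_l; [|exact Hd]. apply Rdiv_le_0_compat; [lra|]. apply Rmult_lt_0_compat; lra.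
        -- right. field. lra.
      * replace ((rho - ln Y) * W + (Y - y) / Y * W) with (W * (rho - (ln Y + (y - Y) / Y))) by (field; lra).
        apply Rmult_le_compat_l; auto. lra.
Qed.

Lemma F_mean_pos c a Q eps s rho : 0 < Q -> theta_data c a (PI / Q) eps ->
  cmult (fun n => c (Z.of_nat n)) -> 1 / 2 < s < 1 -> 0 < rho -> ln (ycut a Q) < rho ->
  0 < Hint (fun L => Ffun c a (PI / Q) L * omega eps s L * (rho - L / 2)).
Proof.
  intros HQ H Hf Hs Hr0 Hrho. pose proof (td_a _ _ _ _ H) as Ha. pose proof (td_eps _ _ _ _ H) as He.
  pose proof (weight_mean_pos a Q eps s rho Ha HQ He Hs Hrho) as HW.
  pose proof (Pfun_pos c a Q eps (2 * rho) HQ H Hf) as HP.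
  destruct (Ffun_hbound _ _ _ _ H) as [C HC]. pose proof (cont_Ffun _ _ _ _ H) as HFc.
  apply Rlt_le_trans with (Hint (fun L => Pfun c a Q (2 * rho) * (Wfun a Q eps s L * (rho - L / 2)))).
  - rewrite Hint_scal; [now apply Rmult_lt_0_compat|].
    apply hgood_ext with (fun L => rho * Wfun a Q eps s L + - / 2 * (L * Wfun a Q eps s L)).
    + intros L. field.
    + apply hgood_plus; apply hgood_scal; [apply Wfun_hgood|apply Wfun_id_hgood]; auto; lra.
  - apply Hint_le.
    + apply hgood_scal.
      apply hgood_ext with (fun L => rho * Wfun a Q eps s L + - / 2 * (L * Wfun a Q eps s L)).
      * intros L. field.
      * apply hgood_plus; apply hgood_scal; [apply Wfun_hgood|apply Wfun_id_hgood]; auto; lra.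
    + set (F := Ffun c a (PI / Q)) in *.
      apply hgood_ext with (fun L => (rho * (F L * exp (s / 2 * L)) + (rho * eps) * (F L * exp ((1 - s) / 2 * L)))
        + (- / 2 * (L * F L * exp (s / 2 * L)) + (- / 2 * eps) * (L * F L * exp ((1 - s) / 2 * L)))).
      * intros L. unfold omega, halfexp. field.
      * apply hgood_plus; apply hgood_plus; apply hgood_scal;
          ((apply (hgood_moment F 2 C); auto; lra) || (apply (hgood_moment1 F 2 C); auto; lra)).
    + intros L HL. pose proof (wt_pos a Q L) as Hw.
      replace (Ffun c a (PI / Q) L) with (Pfun c a Q L * wt a Q L) by (unfold Pfun; field; lra).
      unfold Wfun. set (om := omega eps s L).
      assert (Hom : 0 <= om) by (apply omega_nonneg; auto; lra).
      replace (Pfun c a Q (2 * rho) * (wt a Q L * om * (rho - L / 2)))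
        with (wt a Q L * om * (Pfun c a Q (2 * rho) * (rho - L / 2))) by ring.
      replace (Pfun c a Q L * wt a Q L * om * (rho - L / 2))
        with (wt a Q L * om * (Pfun c a Q L * (rho - L / 2))) by ring.
      apply Rmult_le_compat_l; [apply Rmult_le_pos; lra|].
      destruct (Rle_lt_dec L (2 * rho)) as [Hl|Hl].
      * pose proof (Pfun_antitone c a Q eps L (2 * rho) HQ H Hf Hl).
        apply Rmult_le_compat_r; lra.
      * pose proof (Pfun_antitone c a Q eps (2 * rho) L HQ H Hf ltac:(lra)). nra.
Qed.

(** * Numerical estimates *)

Lemma exp_upper x n : 0 <= x < 1 -> exp (INR n * x) <= / (1 - x) ^ n.
Proof.
  intros Hx. rewrite exp_nat_mult, <- pow_inv. apply pow_incr. split; [left; apply exp_pos|].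
  pose proof (exp_ge_1_plus (- x)) as H. rewrite exp_Ropp in H.
  apply Rle_trans with (/ / exp x); [rewrite Rinv_inv; lra|]. apply Rinv_le_contravar; lra.
Qed.

Lemma pow_lower x y z (n : nat) : 0 <= x <= y -> z <= x ^ n -> z <= y ^ n.
Proof. intros H Hz. eapply Rle_trans; [exact Hz|]. now apply pow_incr. Qed.

(** Gives [ln Q >= 2.6] on the analytic range. The power is reached by repeated squaring with
    rational truncation, which keeps the numerals small. *)
Lemma exp_2_6 : exp (26 / 10) <= 14.
Proof.
  replace (26 / 10) with (INR 130 * (2 / 100)) by (rewrite INR_IZR_INZ; simpl; field).
  eapply Rle_trans; [apply exp_upper; lra|].
  rewrite <- (Rinv_inv 14). apply Rinv_le_contravar; [lra|].
  replace (1 - 2 / 100) with (49 / 50) by field.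
  assert (H4 : 9223 / 10000 <= (49 / 50) ^ 4) by lra.
  assert (H8 : 8506 / 10000 <= (49 / 50) ^ 8).
  { change 8%nat with (4 * 2)%nat. rewrite pow_mult. apply (pow_lower (9223 / 10000)); lra. }
  assert (H16 : 7235 / 10000 <= (49 / 50) ^ 16).
  { change 16%nat with (8 * 2)%nat. rewrite pow_mult. apply (pow_lower (8506 / 10000)); lra. }
  assert (H32 : 5234 / 10000 <= (49 / 50) ^ 32).
  { change 32%nat with (16 * 2)%nat. rewrite pow_mult. apply (pow_lower (7235 / 10000)); lra. }
  assert (H64 : 2739 / 10000 <= (49 / 50) ^ 64).
  { change 64%nat with (32 * 2)%nat. rewrite pow_mult. apply (pow_lower (5234 / 10000)); lra. }
  assert (H128 : 750 / 10000 <= (49 / 50) ^ 128).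
  { change 128%nat with (64 * 2)%nat. rewrite pow_mult. apply (pow_lower (2739 / 10000)); lra. }
  change 130%nat with (128 + 2)%nat. rewrite pow_add. lra.
Qed.

Lemma exp_0_37 : exp (37 / 100) <= 1.4615.
Proof.
  replace (37 / 100) with (INR 37 * (1 / 100)) by (rewrite INR_IZR_INZ; simpl; field).
  eapply Rle_trans; [apply exp_upper; lra|].
  rewrite <- (Rinv_inv 1.4615). apply Rinv_le_contravar; [lra|].
  replace (1 - 1 / 100) with (99 / 100) by field.
  assert (H4 : 96059 / 100000 <= (99 / 100) ^ 4) by lra.
  assert (H8 : 92273 / 100000 <= (99 / 100) ^ 8).
  { change 8%nat with (4 * 2)%nat. rewrite pow_mult. apply (pow_lower (96059 / 100000)); lra. }
  assert (H16 : 85143 / 100000 <= (99 / 100) ^ 16).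
  { change 16%nat with (8 * 2)%nat. rewrite pow_mult. apply (pow_lower (92273 / 100000)); lra. }
  assert (H32 : 72493 / 100000 <= (99 / 100) ^ 32).
  { change 32%nat with (16 * 2)%nat. rewrite pow_mult. apply (pow_lower (85143 / 100000)); lra. }
  change 37%nat with (32 + 5)%nat. rewrite pow_add. lra.
Qed.

(** The one place where the size of [q] and the constant of the theorem meet: it turns the position
    of [s] into the inequality that drives the decrease of [Hfun]. *)
Lemma ycut_numeric a Q s : (a <= 1)%nat -> 14 <= Q -> 1 - 1.011 / ln Q < s < 1 ->
  1 / 2 < s /\ 0 < (2 * s - 1) / (s * (1 - s)) /\ ln (ycut a Q) < (2 * s - 1) / (s * (1 - s)).
Proof.
  intros Ha HQ Hs. set (t := ln Q) in *.
  assert (Ht : 26 / 10 <= t).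
  { unfold t. rewrite <- (ln_exp (26 / 10)). pose proof exp_2_6. pose proof (exp_pos (26 / 10)).
    destruct (Rle_lt_or_eq_dec _ _ (Rle_trans _ _ _ exp_2_6 HQ)) as [H1|H1]; [left; now apply ln_increasing|rewrite H1; lra]. }
  assert (Hx : 0 < 1.011 / t < 0.389).
  { split; [apply Rdiv_lt_0_compat; lra|]. apply Rmult_lt_reg_r with t; [lra|].
    unfold Rdiv. rewrite Rmult_assoc, Rinv_l by lra. lra. }
  assert (Hs2 : 1 / 2 < s) by lra.
  assert (Hsq : sqrt Q = exp (t / 2)).
  { rewrite <- sqrt_exp. unfold t. rewrite exp_ln by lra. reflexivity. }
  assert (Hs14 : 374 / 100 <= sqrt Q).
  { rewrite <- (sqrt_pow2 (374 / 100)) by lra. apply sqrt_le_1_alt. lra. }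
  pose proof PI2_3_2 as Hpi.
  (* From [sqrt Q >= 3.74] and [PI > 3]: [1 / 3.74 + 2.5 / 6] is just below 0.6842, which in turn
     lies below [1 / 1.4615]. *)
  assert (HY : ycut a Q <= 0.6842 * sqrt Q).
  { unfold ycut. assert (INR a <= 1) by (apply (le_INR a 1); auto). pose proof (pos_INR a).
    replace ((2 + INR a / 2) / (2 * PI / sqrt Q)) with ((2 + INR a / 2) / (2 * PI) * sqrt Q) by (field; lra).
    assert (G : (2 + INR a / 2) / (2 * PI) <= 2.5 / 6).
    { unfold Rdiv at 1 3. apply Rmult_le_compat; try lra.
      - left. apply Rinv_0_lt_compat. lra.
      - apply Rinv_le_contravar; lra. }
    nra. }
  assert (HY0 : 0 < ycut a Q).
  { unfold ycut. pose proof (pos_INR a).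
    assert (0 < (2 + INR a / 2) / (2 * PI / sqrt Q)) by (apply Rdiv_lt_0_compat; [lra|apply Rdiv_lt_0_compat; lra]). lra. }
  assert (HlnY : ln (ycut a Q) <= t / 2 - 37 / 100).
  { rewrite <- (ln_exp (t / 2 - 37 / 100)).
    assert (E : ycut a Q <= exp (t / 2 - 37 / 100)).
    { unfold Rminus. rewrite exp_plus, <- Hsq, exp_Ropp. eapply Rle_trans; [exact HY|].
      rewrite (Rmult_comm (sqrt Q)). apply Rmult_le_compat_r; [lra|].
      pose proof exp_0_37. pose proof (exp_pos (37 / 100)).
      apply Rle_trans with (/ 1.4615); [lra|]. apply Rinv_le_contravar; lra. }
    destruct E as [E|E]; [left; now apply ln_increasing|rewrite E; lra]. }
  set (s0 := 1 - 1.011 / t) in *.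
  assert (Hs0 : 0.611 < s0 < 1) by (unfold s0; lra).
  (* Written as [1 / (1 - s) - 1 / s], the right side increases with [s], so the endpoint [s0] is
     the worst case. *)
  assert (Hmono : (2 * s0 - 1) / (s0 * (1 - s0)) < (2 * s - 1) / (s * (1 - s))).
  { replace ((2 * s0 - 1) / (s0 * (1 - s0))) with (/ (1 - s0) - / s0) by (field; lra).
    replace ((2 * s - 1) / (s * (1 - s))) with (/ (1 - s) - / s) by (field; lra).
    assert (/ (1 - s0) < / (1 - s)) by (apply Rinv_lt_contravar; [apply Rmult_lt_0_compat; lra|lra]).
    assert (/ s < / s0) by (apply Rinv_lt_contravar; [apply Rmult_lt_0_compat; lra|lra]). lra. }
  (* Tightest at [t = 2.6], where the two sides are 0.93 and about 0.935; for larger [t] the slope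
     [1 / 1.011 > 1 / 2] wins. *)
  assert (Hmain : t / 2 - 37 / 100 < (2 * s0 - 1) / (s0 * (1 - s0))).
  { replace ((2 * s0 - 1) / (s0 * (1 - s0))) with (t / 1.011 - 1 - 1.011 / (t - 1.011))
      by (unfold s0; field; repeat split; lra).
    assert (G : 1.011 < (t / 1.011 - t / 2 - 63 / 100) * (t - 1.011)) by nra.
    assert (G2 : 1.011 / (t - 1.011) < t / 1.011 - t / 2 - 63 / 100).
    { apply Rmult_lt_reg_r with (t - 1.011); [lra|]. unfold Rdiv at 1. rewrite Rmult_assoc, Rinv_l by lra. lra. }
    lra. }
  split; [auto|]. split; [|lra].
  apply Rdiv_lt_0_compat; [lra|apply Rmult_lt_0_compat; lra].
Qed.

(** * At most one zero *)

(* A double zero is encoded by a quadratic bound, which needs no analyticity. *)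
Definition two_zeros (g : R -> R) (b1 b2 : R) : Prop :=
  g b1 = 0 /\ g b2 = 0 /\
  (b1 <> b2 \/ (b1 = b2 /\ exists K r, 0 < r /\ forall h, Rabs h < r -> Rabs (g (b1 + h)) <= K * h ^ 2)).

Record zeta_setting (c : Z -> R) (a : nat) (Q eps B : R) (g : R -> R) : Prop := {
  zs_Q : 14 <= Q;
  zs_td : theta_data c a (PI / Q) eps;
  zs_mult : cmult (fun n => c (Z.of_nat n));
  zs_B : forall n, Rabs (rsum (fun i => c (Z.of_nat (S i))) n) <= B;
  zs_g : forall s, 0 < s -> is_lim_seq (rsum (dterm c s)) (g s) }.

Definition nfun c a Q eps s : R := Nmom c a (PI / Q) s + eps * Nmom c a (PI / Q) (1 - s).
Definition N1 c a Q s : R := Hint (fun L => L * Ffun c a (PI / Q) L * halfexp s L).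
Definition Dfun eps s : R := s + eps * (1 - s).
(** At a zero, [completed_identity] reads [nfun = Vmel 1 * Dfun / (s (1 - s))], as [1 / (1 - s) +
    eps / s = Dfun / (s (1 - s))]. Solving for [Vmel 1] gives this quotient. *)
Definition Hfun c a Q eps s : R := s * (1 - s) * nfun c a Q eps s / Dfun eps s.

Lemma N1_hgood c a Q eps s : theta_data c a (PI / Q) eps -> s < 4 ->
  hgood (fun L => L * Ffun c a (PI / Q) L * halfexp s L).
Proof.
  intros H Hs. destruct (Ffun_hbound _ _ _ _ H) as [C HC].
  apply (hgood_moment1 _ 2 C); auto; [apply (cont_Ffun _ _ _ _ H)|lra].
Qed.

Lemma is_derive_Nmom c a Q eps s : theta_data c a (PI / Q) eps -> s < 4 ->
  is_derive (Nmom c a (PI / Q)) s (/ 2 * N1 c a Q s).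
Proof.
  intros H Hs. destruct (Ffun_hbound _ _ _ _ H) as [C HC].
  pose proof (is_derive_moment (Ffun c a (PI / Q)) 2 C (s / 2) (cont_Ffun _ _ _ _ H) HC ltac:(lra)) as D.
  assert (D2 : is_derive (fun s => s / 2) s (/ 2)) by (auto_derive; auto; ring).
  exact (is_derive_comp _ (fun s => s / 2) s _ _ D D2).
Qed.

Lemma is_derive_nfun c a Q eps s : theta_data c a (PI / Q) eps -> 0 < s < 1 ->
  is_derive (nfun c a Q eps) s (/ 2 * (N1 c a Q s - eps * N1 c a Q (1 - s))).
Proof.
  intros H Hs.
  pose proof (is_derive_Nmom _ _ _ _ s H ltac:(lra)) as D1.
  pose proof (is_derive_Nmom _ _ _ _ (1 - s) H ltac:(lra)) as D2.
  assert (D3 : is_derive (fun s => 1 - s) s (-1)) by (auto_derive; auto; ring).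
  pose proof (is_derive_comp _ (fun s => 1 - s) s _ _ D2 D3) as D4.
  pose proof (is_derive_plus _ _ s _ _ D1 (is_derive_scal _ s eps _ D4)) as D5.
  unfold plus, scal in D5; simpl in D5. unfold mult in D5; simpl in D5.
  replace (/ 2 * (N1 c a Q s - eps * N1 c a Q (1 - s)))
    with (/ 2 * N1 c a Q s + eps * (-1 * (/ 2 * N1 c a Q (1 - s)))) by ring.
  exact D5.
Qed.

Lemma Ffun_pos c a Q eps B g L : zeta_setting c a Q eps B g -> 0 < Ffun c a (PI / Q) L.
Proof.
  intros H. pose proof (zs_Q _ _ _ _ _ _ H). pose proof (wt_pos a Q L) as Hw.
  pose proof (Pfun_pos c a Q eps L ltac:(lra) (zs_td _ _ _ _ _ _ H) (zs_mult _ _ _ _ _ _ H)) as HP.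
  replace (Ffun c a (PI / Q) L) with (Pfun c a Q L * wt a Q L) by (unfold Pfun; field; lra).
  now apply Rmult_lt_0_compat.
Qed.

Lemma nfun_Hint c a Q eps B g s : zeta_setting c a Q eps B g -> 0 < s < 1 ->
  nfun c a Q eps s = Hint (fun L => Ffun c a (PI / Q) L * omega eps s L) /\
  hgood (fun L => Ffun c a (PI / Q) L * omega eps s L).
Proof.
  intros H Hs. pose proof (zs_td _ _ _ _ _ _ H) as Ht.
  assert (G1 : hgood (fun L => Ffun c a (PI / Q) L * halfexp s L)) by (apply (Nmom_hgood _ _ _ _ _ Ht); lra).
  assert (G2 : hgood (fun L => Ffun c a (PI / Q) L * halfexp (1 - s) L)) by (apply (Nmom_hgood _ _ _ _ _ Ht); lra).
  assert (E : forall L, Ffun c a (PI / Q) L * halfexp s L + eps * (Ffun c a (PI / Q) L * halfexp (1 - s) L)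
     = Ffun c a (PI / Q) L * omega eps s L) by (intros; unfold omega; ring).
  split.
  - unfold nfun, Nmom. rewrite <- Hint_scal, <- Hint_plus by auto using hgood_scal.
    apply Hint_ext. auto.
  - apply (hgood_ext _ _ E). apply hgood_plus; auto. now apply hgood_scal.
Qed.

Lemma nfun_pos c a Q eps B g s : zeta_setting c a Q eps B g -> 1 / 2 < s < 1 -> 0 < nfun c a Q eps s.
Proof.
  intros H Hs. destruct (nfun_Hint _ _ _ _ _ _ s H ltac:(lra)) as [-> G].
  apply Hint_pos; auto. intros L HL. apply Rmult_lt_0_compat.
  - apply (Ffun_pos _ _ _ _ _ _ _ H).
  - apply omega_pos; auto; [apply (zs_td _ _ _ _ _ _ H)|lra].
Qed.

Lemma Dfun_pos eps s : eps = 1 \/ eps = -1 -> 1 / 2 < s -> 2 * s - 1 <= Dfun eps s \/ Dfun eps s = 1.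
Proof. intros [-> | ->] Hs; unfold Dfun; [right; ring|left; lra]. Qed.

(** [F_mean_pos] is the inequality [(2s - 1) n > s (1 - s) (m1 + eps m2) / 2]. It remains to see
    that the derivative of [nfun], corrected by that of [Dfun], is at most [(m1 + eps m2) / 2]. *)
Lemma Hfun_decreasing c a Q eps B g s : zeta_setting c a Q eps B g -> 1 - 1.011 / ln Q < s < 1 ->
  exists d, d < 0 /\ is_derive (Hfun c a Q eps) s d.
Proof.
  intros H Hs0. pose proof (zs_td _ _ _ _ _ _ H) as Ht. pose proof (zs_Q _ _ _ _ _ _ H) as HQ.
  pose proof (td_eps _ _ _ _ Ht) as He.
  destruct (ycut_numeric a Q s (td_a _ _ _ _ Ht) HQ Hs0) as [Hs1 [Hr0 Hr1]].
  assert (Hs : 1 / 2 < s < 1) by lra. clear Hs0 Hs1.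
  set (rho := (2 * s - 1) / (s * (1 - s))) in *.
  pose proof (F_mean_pos c a Q eps s rho ltac:(lra) Ht (zs_mult _ _ _ _ _ _ H) Hs Hr0 Hr1) as HM.
  destruct (nfun_Hint _ _ _ _ _ _ s H ltac:(lra)) as [En Gn].
  pose proof (nfun_pos _ _ _ _ _ _ s H Hs) as Hn.
  pose proof (is_derive_nfun _ _ _ _ s Ht ltac:(lra)) as Dn.
  set (n := nfun c a Q eps s) in *. set (F := Ffun c a (PI / Q)) in *.
  pose proof (N1_hgood _ _ _ _ s Ht ltac:(lra)) as G1.
  pose proof (N1_hgood _ _ _ _ (1 - s) Ht ltac:(lra)) as G2.
  fold F in G1, G2.
  set (m1 := N1 c a Q s) in *. set (m2 := N1 c a Q (1 - s)) in *.
  assert (Hm2 : 0 <= m2).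
  { apply Hint_nonneg; auto. intros L HL. apply Rmult_le_pos; [|left; apply exp_pos].
    apply Rmult_le_pos; auto. left. apply (Ffun_pos _ _ _ _ _ _ _ H). }
  assert (EM : Hint (fun L => F L * omega eps s L * (rho - L / 2)) = rho * n - / 2 * (m1 + eps * m2)).
  { rewrite (Hint_ext _ (fun L => rho * (F L * omega eps s L)
       - / 2 * (L * F L * halfexp s L + eps * (L * F L * halfexp (1 - s) L)))).
    - rewrite Hint_minus, !Hint_scal, Hint_plus, Hint_scal by auto using hgood_scal, hgood_plus.
      rewrite En. reflexivity.
    - intros L _. unfold omega. field. }
  rewrite EM in HM.
  assert (HM2 : 0 < (2 * s - 1) * n - s * (1 - s) * (/ 2 * (m1 + eps * m2))).
  { replace ((2 * s - 1) * n - s * (1 - s) * (/ 2 * (m1 + eps * m2)))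
      with (s * (1 - s) * (rho * n - / 2 * (m1 + eps * m2))) by (unfold rho; field; lra).
    apply Rmult_lt_0_compat; auto. apply Rmult_lt_0_compat; lra. }
  assert (HD : 0 < Dfun eps s) by (destruct (Dfun_pos eps s He ltac:(lra)); lra).
  (* For [eps = 1] this is [m2 >= 0]. For [eps = -1] it amounts to [m2 <= 2 n / (2s - 1)], which
     holds pointwise because [L <= 2 (z - 1) / (2s - 1)] for [z = e^((2s - 1) L / 2)]. *)
  assert (Hm : / 2 * (m1 - eps * m2) - n * (1 - eps) / Dfun eps s <= / 2 * (m1 + eps * m2)).
  { destruct He as [E|E]; unfold Dfun; rewrite E in *.
    - replace (n * (1 - 1) / (s + 1 * (1 - s))) with 0 by (field; lra). lra.
    - replace (n * (1 - -1) / (s + -1 * (1 - s))) with (2 / (2 * s - 1) * n) by (field; lra).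
      assert (K : m2 <= 2 / (2 * s - 1) * n); [|lra].
      rewrite En. unfold m2, N1. fold F. rewrite <- Hint_scal by auto.
      apply Hint_le; auto using hgood_scal.
      intros L HL. unfold omega. rewrite (halfexp_split s).
      set (Bx := halfexp (1 - s) L). assert (HB : 0 < Bx) by apply exp_pos.
      pose proof (exp_ge_1_plus ((2 * s - 1) / 2 * L)) as Ez.
      set (z := exp ((2 * s - 1) / 2 * L)) in *.
      assert (HF : 0 < F L) by apply (Ffun_pos _ _ _ _ _ _ _ H).
      replace (2 / (2 * s - 1) * (F L * (Bx * z + -1 * Bx))) with (F L * Bx * (2 / (2 * s - 1) * (z - 1))) by (field; lra).
      replace (L * F L * Bx) with (F L * Bx * L) by ring.
      apply Rmult_le_compat_l; [apply Rmult_le_pos; lra|].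
      apply Rmult_le_reg_l with ((2 * s - 1) / 2); [lra|].
      replace ((2 * s - 1) / 2 * (2 / (2 * s - 1) * (z - 1))) with (z - 1) by (field; lra). lra. }
  exists (((1 - 2 * s) * n + s * (1 - s) * (/ 2 * (m1 - eps * m2) - n * (1 - eps) / Dfun eps s)) / Dfun eps s).
  split.
  - assert (P : 0 < (2 * s - 1) * n - s * (1 - s) * (/ 2 * (m1 - eps * m2) - n * (1 - eps) / Dfun eps s)).
    { assert (0 < s * (1 - s)) by (apply Rmult_lt_0_compat; lra).
      assert (s * (1 - s) * (/ 2 * (m1 - eps * m2) - n * (1 - eps) / Dfun eps s)
         <= s * (1 - s) * (/ 2 * (m1 + eps * m2))) by (apply Rmult_le_compat_l; lra). lra. }
    apply Rmult_lt_reg_r with (Dfun eps s); auto. unfold Rdiv at 1. rewrite Rmult_assoc, Rinv_l by lra. lra.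
  - assert (Ds : is_derive (fun s => s * (1 - s)) s (1 - 2 * s)) by (auto_derive; auto; ring).
    assert (DD : is_derive (Dfun eps) s (1 - eps)) by (unfold Dfun; auto_derive; auto; ring).
    pose proof (is_derive_mult _ _ s _ _ Ds Dn Rmult_comm) as D1.
    pose proof (is_derive_div _ _ s _ _ D1 DD (Rgt_not_eq _ _ HD)) as D2.
    unfold plus, mult in D2; simpl in D2. fold n in D2.
    match type of D2 with is_derive _ _ ?d => replace (((1 - 2 * s) * n + s * (1 - s) * (/ 2 * (m1 - eps * m2) - n * (1 - eps) / Dfun eps s)) / Dfun eps s) with d by (field; lra) end.
    exact D2.
Qed.

Lemma Vmel_gam c a Q eps B g s : zeta_setting c a Q eps B g -> 0 < s <= 2 ->
  Vmel c a (PI / Q) s = gam a (PI / Q) s * g s.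
Proof.
  intros H Hs. pose proof (zs_td _ _ _ _ _ _ H) as Ht.
  pose proof (mellin_dirichlet c a (PI / Q) B s (td_a _ _ _ _ Ht) (td_eta _ _ _ _ Ht) (td_c _ _ _ _ Ht)
    (zs_B _ _ _ _ _ _ H) Hs (td_igood _ _ _ _ s Ht ltac:(lra))) as L1.
  pose proof (is_lim_seq_scal' _ (gam a (PI / Q) s) _ (zs_g _ _ _ _ _ _ H s ltac:(lra))) as L2.
  apply is_lim_seq_unique in L1. apply is_lim_seq_unique in L2.
  rewrite L1 in L2. now apply Rbar_finite_eq in L2.
Qed.

(** Keeping the error term, and not only its vanishing, shows that [Hfun] approaches [Vmel 1] as
    fast as [g] vanishes; this is needed at double zeros. *)
Lemma Hfun_identity c a Q eps B g s : zeta_setting c a Q eps B g -> 1 / 2 < s < 1 ->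
  Hfun c a Q eps s - Vmel c a (PI / Q) 1
  = s * (1 - s) / Dfun eps s * (Int (ureg_s s) * (gam a (PI / Q) s * g s)).
Proof.
  intros H Hs. pose proof (zs_td _ _ _ _ _ _ H) as Ht.
  pose proof (completed_identity _ _ _ _ s Ht ltac:(lra)) as E.
  rewrite (Vmel_gam _ _ _ _ _ _ s H ltac:(lra)) in E. fold (nfun c a Q eps s) in E.
  assert (HD : 0 < Dfun eps s) by (destruct (Dfun_pos eps s (td_eps _ _ _ _ Ht) ltac:(lra)); lra).
  rewrite E. unfold Hfun, nfun.
  replace (/ (1 - s) + eps / s) with (Dfun eps s / (s * (1 - s))) by (unfold Dfun; field; lra).
  field. repeat split; lra.
Qed.

(** The product [zeta (s) L(s)] is a limit of double sums with nonnegative grouped coefficients,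
    hence at least its first term 1. Zeros beyond 1 are thereby excluded. *)
Lemma g_pos_gt_1 c a Q eps B g s : zeta_setting c a Q eps B g -> 1 < s -> 0 < g s.
Proof.
  intros H Hs. set (Z := Series (fun n => npow s (S n))).
  assert (HZ : 0 <= Z).
  { apply (Rle_trans _ (rsum (fun n => npow s (S n)) 0)); [simpl; lra|].
    apply rsum_le_Series; [intros; left; apply npow_pos|now apply ex_series_npow]. }
  assert (L : is_lim_seq (fun X => rsum (fun i => rsum (fun j => c (Z.of_nat (S i)) * npow s (S i * S j)) X) X) (g s * Z)).
  { apply is_lim_seq_ext with (fun X => rsum (dterm c s) X * rsum (fun n => npow s (S n)) X).
    - intros X. rewrite <- rsum_scal_r. apply rsum_ext. intros i _. rewrite <- rsum_scal.
      apply rsum_ext. intros j _. rewrite npow_mult by lia. unfold dterm. fold (npow s (S i)). ring.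
    - apply is_lim_seq_mult'.
      + apply (zs_g _ _ _ _ _ _ H). lra.
      + apply Series_rsum_lim. now apply ex_series_npow. }
  pose proof (double_sum_limit_ge (fun n => c (Z.of_nat n)) (npow s) 1 s (g s * Z) (zs_mult _ _ _ _ _ _ H) Hs) as G.
  assert (G2 : npow s 1 <= g s * Z).
  { apply G; auto. intros n _. pose proof (npow_pos s n). lra. }
  rewrite npow_1 in G2. destruct (Rle_lt_dec (g s) 0); auto. nra.
Qed.

(** The factor [1 - s] compensates the pole of zeta at 1; the archimedean factor stays bounded. *)
Lemma local_factor_bound c a Q eps B g : zeta_setting c a Q eps B g -> exists K, 0 <= K /\
  forall s, 1 / 2 < s < 1 -> (1 - s) * Rabs (Int (ureg_s s) * gam a (PI / Q) s) <= K.
Proof.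
  intros H. pose proof (zs_td _ _ _ _ _ _ H) as Ht.
  destruct ureg_s_Int_bound as [C [HC0 HC]].
  destruct (gam_bounded a (PI / Q) (td_a _ _ _ _ Ht) (td_eta _ _ _ _ Ht)) as [D [HD0 HD]].
  exists (C * D). split; [now apply Rmult_le_pos|]. intros s Hs.
  specialize (HC s ltac:(lra)). specialize (HD s ltac:(lra)).
  rewrite Rmin_right in HC by lra. rewrite Rabs_mult.
  apply Rle_trans with ((1 - s) * (C / (1 - s) * D)).
  - apply Rmult_le_compat_l; [lra|]. apply Rmult_le_compat; auto using Rabs_pos.
  - right. field. lra.
Qed.

(** The value shared by all zeros below 1 is positive, which also forbids a further zero at 1
    itself, where [Vmel 1] would vanish. *)
Lemma Vmel1_pos_of_zero c a Q eps B g s : zeta_setting c a Q eps B g -> 1 / 2 < s < 1 -> g s = 0 ->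
  Hfun c a Q eps s = Vmel c a (PI / Q) 1 /\ 0 < Vmel c a (PI / Q) 1.
Proof.
  intros H Hs Hz. pose proof (zs_td _ _ _ _ _ _ H) as Ht.
  pose proof (Hfun_identity _ _ _ _ _ _ s H Hs) as E. rewrite Hz, !Rmult_0_r in E.
  assert (E2 : Hfun c a Q eps s = Vmel c a (PI / Q) 1) by lra. split; auto.
  rewrite <- E2. unfold Hfun. pose proof (nfun_pos _ _ _ _ _ _ s H Hs).
  assert (HD : 0 < Dfun eps s) by (destruct (Dfun_pos eps s (td_eps _ _ _ _ Ht) ltac:(lra)); lra).
  apply Rdiv_lt_0_compat; auto. apply Rmult_lt_0_compat; auto. apply Rmult_lt_0_compat; lra.
Qed.

(** A quadratic bound on [g] makes [Hfun - Vmel 1] quadratic at [b], so the derivative of [Hfun] is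
    0 there, against its strict negativity. *)
Lemma no_double_zero_below_1 c a Q eps B g b K r : zeta_setting c a Q eps B g -> 1 - 1.011 / ln Q < b < 1 ->
  0 < r -> (forall h, Rabs h < r -> Rabs (g (b + h)) <= K * h ^ 2) -> False.
Proof.
  intros H Hb Hr Hg. pose proof (zs_td _ _ _ _ _ _ H) as Ht.
  destruct (ycut_numeric a Q b (td_a _ _ _ _ Ht) (zs_Q _ _ _ _ _ _ H) Hb) as [Hb2 _].
  destruct (Hfun_decreasing _ _ _ _ _ _ b H Hb) as [d [Hd Dd]].
  destruct (local_factor_bound _ _ _ _ _ _ H) as [M [HM0 HM]].
  assert (Hg0 : g b = 0).
  { specialize (Hg 0). rewrite Rabs_R0, Rplus_0_r in Hg. specialize (Hg Hr).
    simpl in Hg. rewrite Rmult_0_l, Rmult_0_r in Hg. pose proof (Rabs_pos (g b)).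
    destruct (Req_dec (g b) 0) as [|Hne]; auto. apply Rabs_pos_lt in Hne. lra. }
  destruct (Vmel1_pos_of_zero _ _ _ _ _ _ b H ltac:(lra) Hg0) as [Eb _].
  (* Within this radius [s] stays in [(1/2, 1)] and [2s - 1] stays above [e = b - 1/2], so
     [1 / Dfun] is bounded. *)
  set (r' := Rmin r (Rmin ((b - 1 / 2) / 2) ((1 - b) / 2))).
  assert (Hr' : 0 < r') by (repeat apply Rmin_glb_lt; lra).
  assert (R1 : r' <= r) by apply Rmin_l.
  assert (R2 : r' <= (b - 1 / 2) / 2) by (eapply Rle_trans; [apply Rmin_r|apply Rmin_l]).
  assert (R3 : r' <= (1 - b) / 2) by (eapply Rle_trans; [apply Rmin_r|apply Rmin_r]).
  set (e := b - 1 / 2). assert (He : 0 < e) by (unfold e; lra).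
  assert (D0 : is_derive (Hfun c a Q eps) b 0).
  { apply (is_derive_quadratic _ b 0 ((/ e + 1) * (M * Rabs K)) r' Hr').
    intros h Hh. assert (Hh' : Rabs h < r') by auto. apply Rabs_def2 in Hh'.
    set (s := b + h). assert (Hs : 1 / 2 < s < 1) by (unfold s; lra).
    rewrite Eb, Rmult_0_r, Rminus_0_r, (Hfun_identity _ _ _ _ _ _ s H Hs).
    assert (HD : / Dfun eps s <= / e + 1 /\ 0 < Dfun eps s).
    { assert (0 < / e) by now apply Rinv_0_lt_compat.
      destruct (Dfun_pos eps s (td_eps _ _ _ _ Ht) ltac:(lra)) as [G|G].
      - split; [|lra]. apply Rle_trans with (/ e); [|lra]. apply Rinv_le_contravar; auto. unfold e, s in *. lra.
      - rewrite G, Rinv_1. split; lra. }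
    destruct HD as [HD1 HD2].
    replace (s * (1 - s) / Dfun eps s * (Int (ureg_s s) * (gam a (PI / Q) s * g s)))
      with (/ Dfun eps s * ((s * ((1 - s) * (Int (ureg_s s) * gam a (PI / Q) s))) * g s)) by (unfold Rdiv; ring).
    rewrite !Rabs_mult, (Rabs_pos_eq s), (Rabs_pos_eq (1 - s)), (Rabs_pos_eq (/ _))
      by (try lra; left; now apply Rinv_0_lt_compat).
    rewrite <- (Rabs_mult (Int _)).
    specialize (HM s Hs). specialize (Hg h ltac:(lra)). fold s in Hg.
    set (T := Rabs (Int (ureg_s s) * gam a (PI / Q) s)) in *.
    assert (T0 : 0 <= T) by apply Rabs_pos.
    assert (Hg2 : Rabs (g s) <= Rabs K * h ^ 2).
    { eapply Rle_trans; [exact Hg|]. apply Rmult_le_compat_r; [apply pow2_ge_0|apply Rle_abs]. }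
    rewrite (Rmult_assoc (/ e + 1)). apply Rmult_le_compat; auto.
    - left. now apply Rinv_0_lt_compat.
    - apply Rmult_le_pos; [|apply Rabs_pos]. apply Rmult_le_pos; [lra|]. apply Rmult_le_pos; lra.
    - rewrite (Rmult_assoc M). apply Rmult_le_compat; auto using Rabs_pos.
      + apply Rmult_le_pos; [lra|]. apply Rmult_le_pos; lra.
      + assert (0 <= (1 - s) * T) by (apply Rmult_le_pos; lra). nra. }
  apply is_derive_unique in D0. apply is_derive_unique in Dd. lra.
Qed.

(** For [eps = -1] the weight [omega] is smallest at [s = 3/4], and the case [eps = 1] only exceeds
    it; one bound serves all [s] up to 1. *)
Lemma nfun_lower c a Q eps B g : zeta_setting c a Q eps B g -> exists n0, 0 < n0 /\
  forall s, 3 / 4 <= s < 1 -> n0 <= nfun c a Q eps s.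
Proof.
  intros H. pose proof (zs_td _ _ _ _ _ _ H) as Ht.
  set (F := Ffun c a (PI / Q)).
  assert (G : hgood (fun L => F L * (halfexp (3 / 4) L - halfexp (1 / 4) L))).
  { apply hgood_ext with (fun L => F L * halfexp (3 / 4) L + -1 * (F L * halfexp (1 / 4) L)); [intros; ring|].
    apply hgood_plus; [|apply hgood_scal]; apply (Nmom_hgood _ _ _ _ _ Ht); lra. }
  exists (Hint (fun L => F L * (halfexp (3 / 4) L - halfexp (1 / 4) L))). split.
  - apply Hint_pos; auto. intros L HL. apply Rmult_lt_0_compat; [apply (Ffun_pos _ _ _ _ _ _ _ H)|].
    assert (halfexp (1 / 4) L < halfexp (3 / 4) L) by (apply exp_increasing; lra). lra.
  - intros s Hs. destruct (nfun_Hint _ _ _ _ _ _ s H ltac:(lra)) as [-> G2].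
    apply Hint_le; auto. intros L HL. apply Rmult_le_compat_l; [left; apply (Ffun_pos _ _ _ _ _ _ _ H)|].
    unfold omega.
    assert (halfexp (3 / 4) L <= halfexp s L) by (apply exp_le_mono; nra).
    assert (halfexp (1 - s) L <= halfexp (1 / 4) L) by (apply exp_le_mono; nra).
    assert (0 < halfexp (1 - s) L) by apply exp_pos.
    destruct (td_eps _ _ _ _ Ht) as [-> | ->]; lra.
Qed.

(** Here [Hfun] is of no use, because of its factor [1 - s]. With [Vmel 1 = 0] the completed
    identity makes [nfun s] a product of zeta, of order [1 / (1 - s)], and [g s], of order
    [(1 - s)^2]. It would tend to 0, against [nfun_lower]. *)
Lemma no_double_zero_at_1 c a Q eps B g K r : zeta_setting c a Q eps B g ->
  0 < r -> (forall h, Rabs h < r -> Rabs (g (1 + h)) <= K * h ^ 2) -> False.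
Proof.
  intros H Hr Hg. pose proof (zs_td _ _ _ _ _ _ H) as Ht.
  assert (Hg0 : g 1 = 0).
  { specialize (Hg 0). rewrite Rabs_R0, Rplus_0_r in Hg. specialize (Hg Hr).
    simpl in Hg. rewrite Rmult_0_l, Rmult_0_r in Hg. pose proof (Rabs_pos (g 1)).
    destruct (Req_dec (g 1) 0) as [|Hne]; auto. apply Rabs_pos_lt in Hne. lra. }
  assert (HV : Vmel c a (PI / Q) 1 = 0) by (rewrite (Vmel_gam _ _ _ _ _ _ 1 H); [rewrite Hg0; ring|lra]).
  destruct (nfun_lower _ _ _ _ _ _ H) as [n0 [Hn0 Hn]].
  destruct (local_factor_bound _ _ _ _ _ _ H) as [M [HM0 HM]].
  (* Small enough for the quadratic bound to apply, for [s >= 3/4], and for the resulting bound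
     [M |K| h] on [nfun] to fall below [n0]. *)
  set (h := Rmin (r / 2) (Rmin (1 / 4) (n0 / (2 * (M * Rabs K + 1))))).
  pose proof (Rabs_pos K) as HK.
  assert (HMK : 0 <= M * Rabs K) by now apply Rmult_le_pos.
  assert (Hh : 0 < h) by (repeat apply Rmin_glb_lt; try lra; apply Rdiv_lt_0_compat; lra).
  assert (R1 : h <= r / 2) by apply Rmin_l.
  assert (R2 : h <= 1 / 4) by (eapply Rle_trans; [apply Rmin_r|apply Rmin_l]).
  assert (R3 : h <= n0 / (2 * (M * Rabs K + 1))) by (eapply Rle_trans; [apply Rmin_r|apply Rmin_r]).
  set (s := 1 - h). assert (Hs : 3 / 4 <= s < 1) by (unfold s; lra).
  specialize (Hn s Hs). specialize (HM s ltac:(lra)).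
  pose proof (completed_identity _ _ _ _ s Ht ltac:(lra)) as E.
  rewrite HV, (Vmel_gam _ _ _ _ _ _ s H ltac:(lra)) in E. fold (nfun c a Q eps s) in E.
  specialize (Hg (- h) ltac:(rewrite Rabs_Ropp, Rabs_pos_eq; lra)).
  replace (1 + - h) with s in Hg by (unfold s; ring).
  replace (1 - s) with h in HM by (unfold s; ring).
  replace ((- h) ^ 2) with (h ^ 2) in Hg by ring.
  assert (E2 : nfun c a Q eps s = (Int (ureg_s s) * gam a (PI / Q) s) * g s) by lra.
  assert (Hle : nfun c a Q eps s <= Rabs (Int (ureg_s s) * gam a (PI / Q) s) * Rabs (g s)).
  { rewrite E2, <- Rabs_mult. apply Rle_abs. }
  set (T := Rabs (Int (ureg_s s) * gam a (PI / Q) s)) in *.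
  assert (T0 : 0 <= T) by apply Rabs_pos.
  assert (Hg2 : Rabs (g s) <= Rabs K * h ^ 2).
  { eapply Rle_trans; [exact Hg|]. apply Rmult_le_compat_r; [apply pow2_ge_0|apply Rle_abs]. }
  assert (F1 : T * Rabs (g s) <= T * (Rabs K * h ^ 2)) by (apply Rmult_le_compat_l; auto).
  assert (F2 : T * (Rabs K * h ^ 2) = (h * T) * (Rabs K * h)) by ring.
  assert (F3 : (h * T) * (Rabs K * h) <= M * (Rabs K * h)).
  { apply Rmult_le_compat_r; auto. apply Rmult_le_pos; lra. }
  assert (F4 : h * (2 * (M * Rabs K + 1)) <= n0).
  { apply Rle_trans with (n0 / (2 * (M * Rabs K + 1)) * (2 * (M * Rabs K + 1))).
    - apply Rmult_le_compat_r; lra.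
    - right. field. lra. }
  nra.
Qed.

Theorem at_most_one_zero c a Q eps B g b1 b2 : zeta_setting c a Q eps B g ->
  1 - 1.011 / ln Q < b1 -> 1 - 1.011 / ln Q < b2 -> two_zeros g b1 b2 -> False.
Proof.
  intros H H1 H2 [Z1 [Z2 Hz]]. pose proof (zs_td _ _ _ _ _ _ H) as Ht.
  assert (Hle : forall b, g b = 0 -> b <= 1).
  { intros b Hb. destruct (Rle_lt_dec b 1); auto. pose proof (g_pos_gt_1 _ _ _ _ _ _ b H r). lra. }
  assert (Hhalf : forall b, 1 - 1.011 / ln Q < b -> b < 1 -> 1 / 2 < b < 1).
  { intros b Hb Hb1. destruct (ycut_numeric a Q b (td_a _ _ _ _ Ht) (zs_Q _ _ _ _ _ _ H) (conj Hb Hb1)). lra. }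
  (* A zero at 1 next to a zero below 1: the former gives [Vmel 1 = 0], the latter [Vmel 1 > 0]. *)
  assert (Hone : forall b, 1 - 1.011 / ln Q < b -> b < 1 -> g b = 0 -> g 1 = 0 -> False).
  { intros b Hb Hb1 Hgb Hg1. destruct (Vmel1_pos_of_zero _ _ _ _ _ _ b H (Hhalf b Hb Hb1) Hgb) as [_ P].
    rewrite (Vmel_gam _ _ _ _ _ _ 1 H) in P by lra. rewrite Hg1 in P. lra. }
  pose proof (Hle b1 Z1) as L1. pose proof (Hle b2 Z2) as L2.
  destruct Hz as [Hne|[<- [K [r [Hr Hg]]]]].
  - assert (Hlt : forall x y, 1 - 1.011 / ln Q < x -> x < y -> y <= 1 -> g x = 0 -> g y = 0 -> False).
    { intros x y Hx Hxy Hy Gx Gy. destruct Hy as [Hy|Hy]; [|subst y; now apply (Hone x)].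
      destruct (Vmel1_pos_of_zero _ _ _ _ _ _ x H (Hhalf x Hx ltac:(lra)) Gx) as [Ex _].
      destruct (Vmel1_pos_of_zero _ _ _ _ _ _ y H (Hhalf y ltac:(lra) Hy) Gy) as [Ey _].
      destruct (MVT_gen (Hfun c a Q eps) x y (Derive (Hfun c a Q eps))) as [z [Hz Ez]].
      - rewrite Rmin_left, Rmax_right by lra. intros z Hz. apply Derive_correct.
        destruct (Hfun_decreasing _ _ _ _ _ _ z H ltac:(lra)) as [d [_ Dd]]. now exists d.
      - rewrite Rmin_left, Rmax_right by lra. intros z Hz. apply continuity_pt_filterlim.
        apply (ex_derive_continuous (Hfun c a Q eps)).
        destruct (Hfun_decreasing _ _ _ _ _ _ z H ltac:(lra)) as [d [_ Dd]]. now exists d.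
      - rewrite Rmin_left, Rmax_right in Hz by lra.
        destruct (Hfun_decreasing _ _ _ _ _ _ z H ltac:(lra)) as [d [Hd Dd]].
        apply is_derive_unique in Dd. rewrite Dd, Ex, Ey in Ez. nra. }
    destruct (Rtotal_order b1 b2) as [Hb|[Hb|Hb]]; [now apply (Hlt b1 b2)|contradiction|now apply (Hlt b2 b1)].
  - destruct L1 as [L1|L1].
    + apply (no_double_zero_below_1 _ _ _ _ _ _ b1 K r H (conj H1 L1) Hr Hg).
    + subst b1. apply (no_double_zero_at_1 _ _ _ _ _ _ K r H Hr Hg).
Qed.

(** * Real characters *)

Record real_character (q : nat) (X : Z -> R) : Prop := {
  rc_per : zperiodic q X;
  rc_mul : forall m n, X (m * n)%Z = X m * X n;
  rc_supp : forall n, X n <> 0 <-> Z.gcd n (Z.of_nat q) = 1%Z }.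

Definition nonprincipal (q : nat) (X : Z -> R) : Prop :=
  exists a, Z.gcd a (Z.of_nat q) = 1%Z /\ X a <> 1.

Lemma zperiodic_congr q c m n : (1 <= q)%nat -> zperiodic q c -> (Z.of_nat q | m - n)%Z -> c m = c n.
Proof.
  intros Hq Hc [k Hk]. rewrite <- (zperiodic_mult q c Hc n k). f_equal. lia.
Qed.

Lemma unit_inverse (q : nat) j : Z.gcd j (Z.of_nat q) = 1%Z -> exists i, (Z.of_nat q | i * j - 1)%Z.
Proof.
  intros H. destruct (Z.gcd_bezout _ _ _ H) as [u [v E]]. exists u, (- v)%Z. lia.
Qed.

(** Multiplication by a unit permutes residues. The permutation is encoded by the kernel
    [zind (a - j b) = zind (b - i a)], with [i] inverse to [j], and an exchange of sums. *)
Lemma rsum_reindex q f j : (1 <= q)%nat -> zperiodic q f -> Z.gcd j (Z.of_nat q) = 1%Z ->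
  rsum (fun b => f (j * Z.of_nat b)%Z) q = rsum (fun b => f (Z.of_nat b)) q.
Proof.
  intros Hq Hf Hj. destruct (unit_inverse q j Hj) as [i [k Hk]].
  rewrite (rsum_ext _ (fun b => rsum (fun a => f (Z.of_nat a) * zind q (Z.of_nat a - j * Z.of_nat b)) q)).
  2: { intros b _. symmetry. now apply rsum_residue. }
  rewrite rsum_swap. apply rsum_ext. intros a _. rewrite rsum_scal.
  rewrite (rsum_ext _ (fun b => 1 * zind q (Z.of_nat b - i * Z.of_nat a))).
  - rewrite (rsum_residue q (fun _ => 1)); [ring|auto|intros z; reflexivity].
  - intros b _. rewrite Rmult_1_l. apply zind_ext; auto. split; intros [m Hm].
    + exists (- i * m - k * Z.of_nat b)%Z. nia.
    + exists (- j * m - k * Z.of_nat a)%Z. nia.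
Qed.

Lemma rc_congr q X m n : (1 <= q)%nat -> real_character q X -> (Z.of_nat q | m - n)%Z -> X m = X n.
Proof. intros Hq HX. apply zperiodic_congr; auto. apply HX. Qed.

Lemma rc_prod q X a b c : (1 <= q)%nat -> real_character q X ->
  ((b * c - a) mod Z.of_nat q = 0)%Z -> X a = X b * X c.
Proof.
  intros Hq HX H. rewrite <- (rc_mul _ _ HX). symmetry. apply (rc_congr q); auto.
  apply Z.mod_divide; auto. lia.
Qed.

Lemma rc_1 q X : real_character q X -> X 1%Z = 1.
Proof.
  intros HX. assert (H : X 1%Z <> 0) by (apply (rc_supp _ _ HX); apply Z.gcd_1_l).
  pose proof (rc_mul _ _ HX 1 1) as E. change (1 * 1)%Z with 1%Z in E.
  apply Rmult_eq_reg_l with (X 1%Z); auto. lra.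
Qed.

Lemma rc_zero q X n : real_character q X -> Z.gcd n (Z.of_nat q) <> 1%Z -> X n = 0.
Proof.
  intros HX H. destruct (Req_dec (X n) 0) as [E|E]; auto. apply (rc_supp _ _ HX) in E. contradiction.
Qed.

Lemma rc_pow q X n k : real_character q X -> X (n ^ Z.of_nat k)%Z = X n ^ k.
Proof.
  intros HX. induction k as [|k IH]; [apply (rc_1 q); auto|].
  rewrite Nat2Z.inj_succ, Z.pow_succ_r by lia. rewrite (rc_mul _ _ HX), IH. reflexivity.
Qed.

(** A value of modulus above 1 would have unbounded powers, yet these are again values of a periodic
    function. *)
Lemma rc_abs_le q X n : (1 <= q)%nat -> real_character q X -> Rabs (X n) <= 1.
Proof.
  intros Hq HX. destruct (Rle_lt_dec (Rabs (X n)) 1) as [H|H]; auto. exfalso.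
  set (B := rsum (fun b => Rabs (X (Z.of_nat b))) q).
  destruct (Pow_x_infinity (X n) H (B + 1)) as [N HN]. specialize (HN N (le_n N)).
  rewrite <- (rc_pow q) in HN by auto.
  pose proof (zperiodic_bounded q X Hq (rc_per _ _ HX) (n ^ Z.of_nat N)) as H0. fold B in H0. lra.
Qed.

Lemma rc_unit q X n : (1 <= q)%nat -> real_character q X ->
  Z.gcd n (Z.of_nat q) = 1%Z -> X n = 1 \/ X n = -1.
Proof.
  intros Hq HX H. destruct (unit_inverse q n H) as [i Hi]. pose proof (rc_congr q X _ _ Hq HX Hi) as E.
  rewrite (rc_1 q X HX), (rc_mul _ _ HX) in E.
  pose proof (rc_abs_le q X n Hq HX) as A1. pose proof (rc_abs_le q X i Hq HX) as A2.
  assert (H0 : Rabs (X n) = 1).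
  { assert (P : Rabs (X i) * Rabs (X n) = 1) by (rewrite <- Rabs_mult, E; apply Rabs_R1).
    pose proof (Rabs_pos (X n)). nra. }
  unfold Rabs in H0. destruct (Rcase_abs (X n)); [right|left]; lra.
Qed.

Lemma rc_val q X n : (1 <= q)%nat -> real_character q X -> X n = 1 \/ X n = 0 \/ X n = -1.
Proof.
  intros Hq HX. destruct (Z.eq_dec (Z.gcd n (Z.of_nat q)) 1) as [H|H].
  - destruct (rc_unit q X n Hq HX H); auto.
  - right. left. now apply (rc_zero q).
Qed.

Lemma rc_cmult q X : (1 <= q)%nat -> real_character q X -> cmult (fun n => X (Z.of_nat n)).
Proof.
  intros Hq HX. constructor; [apply (rc_1 q X HX)| |intros; now apply (rc_val q)].
  intros m n. rewrite Nat2Z.inj_mul. apply HX.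
Qed.

Lemma rc_opp q X n : real_character q X -> X (- n)%Z = X (-1)%Z * X n.
Proof. intros HX. rewrite <- (rc_mul _ _ HX). now replace (-1 * n)%Z with (- n)%Z by lia. Qed.

Lemma rc_parity q X : (1 <= q)%nat -> real_character q X -> X (-1)%Z = 1 \/ X (-1)%Z = -1.
Proof.
  intros Hq HX. apply (rc_unit q); auto.
  change (-1)%Z with (- (1))%Z. rewrite Z.gcd_opp_l. apply Z.gcd_1_l.
Qed.

(** Reindexing by a unit [a] multiplies the sum by [X a], and some unit has [X a] different from
    1. *)
Lemma rc_sum_zero q X : (1 <= q)%nat -> real_character q X -> nonprincipal q X ->
  rsum (fun b => X (Z.of_nat b)) q = 0.
Proof.
  intros Hq HX [a [Ha H1]].
  pose proof (rsum_reindex q X a Hq (rc_per _ _ HX) Ha) as E.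
  rewrite (rsum_ext _ (fun b => X a * X (Z.of_nat b))) in E by (intros; apply HX).
  rewrite rsum_scal in E. nra.
Qed.

Lemma rc_partial_periodic q X n : (1 <= q)%nat -> real_character q X -> nonprincipal q X ->
  rsum (fun i => X (Z.of_nat (S i))) (n + q) = rsum (fun i => X (Z.of_nat (S i))) n.
Proof.
  intros Hq HX Hn. induction n as [|n IH].
  - cbn [Nat.add rsum]. rewrite <- (rc_sum_zero q X Hq HX Hn).
    pose proof (rsum_S_l (fun i => X (Z.of_nat i)) q) as E. cbn [rsum] in E.
    assert (X (Z.of_nat q) = X (Z.of_nat 0)) by (apply (rc_congr q); auto; exists 1%Z; lia). lra.
  - cbn [Nat.add rsum]. rewrite IH. f_equal. apply (rc_congr q); auto. exists 1%Z. lia.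
Qed.

Lemma rc_partial_bound q X n : (1 <= q)%nat -> real_character q X -> nonprincipal q X ->
  Rabs (rsum (fun i => X (Z.of_nat (S i))) n) <= INR q.
Proof.
  intros Hq HX Hn. induction n as [n IH] using lt_wf_ind.
  destruct (le_lt_dec q n) as [H|H].
  - replace n with (n - q + q)%nat by lia. rewrite rc_partial_periodic by auto. apply IH. lia.
  - eapply Rle_trans; [apply rsum_abs|].
    apply Rle_trans with (rsum (fun _ => 1) n); [apply rsum_le; intros; now apply (rc_abs_le q)|].
    rewrite rsum_const, Rmult_1_r. apply le_INR. lia.
Qed.

(** Modulo 1 and 2 the only unit class is that of 1. Every modulus met in the reduction to primitive
    characters therefore stays in the range of the threshold lemmas. *)
Lemma nonprincipal_ge_3 q X : (1 <= q)%nat -> real_character q X -> nonprincipal q X -> (3 <= q)%nat.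
Proof.
  intros Hq H [a [Ha H1]].
  assert (C : (q = 1 \/ q = 2 \/ 3 <= q)%nat) by lia. destruct C as [->|[->|C]]; auto.
  - exfalso. apply H1. rewrite <- (rc_1 1 X H). apply (rc_congr 1 X); auto. exists (a - 1)%Z. lia.
  - exfalso. apply H1. rewrite <- (rc_1 2 X H). apply (rc_congr 2 X); auto.
    destruct (Z.Even_or_Odd a) as [[k Hk]|[k Hk]]; [|exists k; lia].
    exfalso. rewrite Hk in Ha.
    assert (D : (2 | Z.gcd (2 * k) (Z.of_nat 2))%Z) by (apply Z.gcd_greatest; [exists k; lia|exists 1%Z; lia]).
    rewrite Ha in D. destruct D as [x Hx]. lia.
Qed.

(** * Dirichlet series on [s > 0] through summation by parts *)

Lemma npow_antitone s m n : 0 < s -> (1 <= m)%nat -> (m <= n)%nat -> npow s n <= npow s m.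
Proof.
  intros Hs Hm Hn. apply exp_le_mono. apply le_INR in Hn.
  assert (0 < INR m) by (apply lt_0_INR; lia).
  assert (ln (INR m) <= ln (INR n)) by (destruct Hn as [Hn|<-]; [left; now apply ln_increasing|lra]). nra.
Qed.

Definition dstep (s : R) (n : nat) : R := npow s (S n) - npow s (S (S n)).

(** The Dirichlet series in its Abel-summed form. With bounded partial sums of [c] it converges
    absolutely on [s > 0], which positivity and analyticity arguments can exploit directly. *)
Definition dirichlet_sum (c : Z -> R) (s : R) : R :=
  Series (fun n => rsum (fun i => c (Z.of_nat (S i))) (S n) * dstep s n).

Lemma dstep_nonneg s n : 0 < s -> 0 <= dstep s n.
Proof. intros Hs. unfold dstep. pose proof (npow_antitone s (S n) (S (S n)) Hs ltac:(lia) ltac:(lia)). lra. Qed.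

Lemma ex_series_dstep s : 0 < s -> ex_series (dstep s).
Proof.
  intros Hs. exists 1. apply is_series_rsum.
  apply is_lim_seq_ext with (fun n => 1 - npow s (S n)).
  - intros n. induction n as [|n IH]; [simpl; rewrite npow_1; ring|].
    cbn [rsum]. rewrite <- IH. unfold dstep. ring.
  - pose proof (is_lim_seq_minus' _ _ 1 0 (is_lim_seq_const 1) (npow_lim s Hs)) as L.
    now rewrite Rminus_0_r in L.
Qed.

Lemma dirichlet_sum_ex c B s : 0 < s -> (forall n, Rabs (rsum (fun i => c (Z.of_nat (S i))) n) <= B) ->
  ex_series (fun n => rsum (fun i => c (Z.of_nat (S i))) (S n) * dstep s n).
Proof.
  intros Hs HB. apply ex_series_Rabs_le with (fun n => B * dstep s n).
  - intros n. rewrite Rabs_mult, (Rabs_pos_eq (dstep s n)) by now apply dstep_nonneg.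
    apply Rmult_le_compat_r; auto. now apply dstep_nonneg.
  - apply ex_series_scal_R. now apply ex_series_dstep.
Qed.

Lemma dirichlet_sum_lim c B s : 0 < s -> (forall n, Rabs (rsum (fun i => c (Z.of_nat (S i))) n) <= B) ->
  is_lim_seq (rsum (dterm c s)) (dirichlet_sum c s).
Proof.
  intros Hs HB.
  set (f := fun i => c (Z.of_nat (S i))) in *.
  apply is_lim_seq_ext with (fun n => rsum f n * npow s (S n) + rsum (fun i => rsum f (S i) * dstep s i) n).
  { intros n. symmetry. apply (abel_sum f (fun i => npow s (S i))). }
  rewrite <- (Rplus_0_l (dirichlet_sum c s)). apply is_lim_seq_plus'.
  - apply is_lim_seq_abs_0. apply is_lim_seq_le_le with (fun _ => 0) (fun n => B * npow s (S n)).
    + intros n. split; [apply Rabs_pos|]. rewrite Rabs_mult, (Rabs_pos_eq (npow _ _)) by (left; apply npow_pos).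
      apply Rmult_le_compat_r; auto. left. apply npow_pos.
    + apply is_lim_seq_const.
    + pose proof (is_lim_seq_scal' _ B 0 (npow_lim s Hs)) as L. now rewrite Rmult_0_r in L.
  - apply Series_rsum_lim. now apply (dirichlet_sum_ex c B).
Qed.

(** [x (x + 2) < (x + 1)^2] makes the middle power smaller than the geometric mean of its
    neighbours, which is at most their arithmetic mean. *)
Lemma dstep_convex s n : 0 < s -> dstep s (S n) < dstep s n.
Proof.
  intros Hs. unfold dstep, npow.
  set (a := ln (INR (S n))). set (b := ln (INR (S (S n)))). set (c := ln (INR (S (S (S n))))).
  assert (Hl : a + c < 2 * b).
  { unfold a, b, c. pose proof (INR_S_ge_1 n) as H1. rewrite !(S_INR (S _)). set (x := INR (S n)) in *.
    rewrite <- ln_mult by lra. replace (2 * ln (x + 1)) with (ln (x + 1) + ln (x + 1)) by ring.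
    rewrite <- ln_mult by lra. apply ln_increasing; nra. }
  assert (E : exp (- s * b) < exp (- s / 2 * a) * exp (- s / 2 * c)).
  { rewrite <- exp_plus. apply exp_increasing. nra. }
  replace (- s * a) with (- s / 2 * a + - s / 2 * a) by field.
  replace (- s * c) with (- s / 2 * c + - s / 2 * c) by field. rewrite !exp_plus.
  pose proof (pow2_ge_0 (exp (- s / 2 * a) - exp (- s / 2 * c))). nra.
Qed.

(* Summing by parts twice against the convex sequence [n^(-s)]. *)
Lemma dirichlet_sum_pos c B s : 0 < s -> (forall n, Rabs (rsum (fun i => c (Z.of_nat (S i))) n) <= B) ->
  c 1%Z = 1 -> (forall n, 0 <= rsum (fun j => rsum (fun i => c (Z.of_nat (S i))) (S j)) n) ->
  0 < dirichlet_sum c s.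
Proof.
  intros Hs HB H1 HP. set (f := fun i => c (Z.of_nat (S i))) in *.
  assert (G : forall n, dstep s 0 - dstep s 1 <= rsum (fun j => rsum f (S j) * dstep s j) (S n)).
  { intros n. rewrite (abel_sum (fun j => rsum f (S j))).
    (* Only the first term is kept: as [c 1 = 1] it equals [dstep s 0 - dstep s 1], a positive bound
       that does not depend on [n]. *)
    apply Rle_trans with (0 + rsum (fun i => rsum (fun j => rsum f (S j)) (S i) * (dstep s i - dstep s (S i))) 1).
    - cbn [rsum]. unfold f at 1. simpl Z.of_nat. rewrite H1. lra.
    - apply Rplus_le_compat.
      + apply Rmult_le_pos; auto. now apply dstep_nonneg.
      + apply rsum_le_len; [lia|]. intros i. apply Rmult_le_pos; auto. pose proof (dstep_convex s i Hs). lra. }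
  pose proof (dstep_convex s 0 Hs).
  assert (Rbar_le (dstep s 0 - dstep s 1) (dirichlet_sum c s)).
  { apply (is_lim_seq_le (fun _ => dstep s 0 - dstep s 1) (fun n => rsum (fun j => rsum f (S j) * dstep s j) (S n))).
    - exact G.
    - apply is_lim_seq_const.
    - apply (is_lim_seq_incr_1 (rsum (fun j => rsum f (S j) * dstep s j))).
      apply Series_rsum_lim. now apply (dirichlet_sum_ex c B). }
  simpl in H0. lra.
Qed.

(** * Gauss sums *)

Lemma exists_prime_divisor n : (1 < n)%Z -> exists p, prime p /\ (p | n)%Z.
Proof.
  intros Hn. assert (H0 : (0 <= n)%Z) by lia. revert Hn. pattern n. apply Z_lt_induction; [|exact H0].
  clear n H0. intros n IH Hn. destruct (prime_dec n) as [H|H].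
  - exists n. split; auto. apply Z.divide_refl.
  - destruct (not_prime_divide n Hn H) as [m [Hm Hd]].
    destruct (IH m) as [p [Hp Hpd]]; try lia. exists p. split; auto. now apply Z.divide_trans with m.
Qed.

(** No proper divisor of [q] induces [X]. It suffices to test the maximal ones [q / p], and
    [q | p (a - 1)] expresses [a = 1] modulo [q / p] without a division. *)
Definition primitive (q : nat) (X : Z -> R) : Prop :=
  forall p, prime p -> (p | Z.of_nat q)%Z ->
    exists a, Z.gcd a (Z.of_nat q) = 1%Z /\ (Z.of_nat q | p * (a - 1))%Z /\ X a <> 1.

Definition trig_sum (w : R -> R) (c : Z -> R) (q : nat) (j : Z) : R :=
  rsum (fun b => c (Z.of_nat b) * w (2 * PI * IZR j * INR b / INR q)) q.

Lemma trig_periodic w c q j : (1 <= q)%nat -> (forall y k, w (y + 2 * IZR k * PI) = w y) -> zperiodic q c ->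
  zperiodic q (fun z => c z * w (2 * PI * IZR j * IZR z / INR q)).
Proof.
  intros Hq Hw Hc z. rewrite Hc. f_equal. rewrite <- (Hw (2 * PI * IZR j * IZR z / INR q) j). f_equal.
  rewrite plus_IZR, <- INR_IZR_INZ. field. apply not_0_INR. lia.
Qed.

Lemma trig_sum_reindex w c q j a : (1 <= q)%nat -> (forall y k, w (y + 2 * IZR k * PI) = w y) ->
  real_character q c -> Z.gcd a (Z.of_nat q) = 1%Z ->
  c a * trig_sum w c q (j * a) = trig_sum w c q j.
Proof.
  intros Hq Hw Hc Ha. unfold trig_sum.
  rewrite (rsum_ext (fun b => c (Z.of_nat b) * w (2 * PI * IZR j * INR b / INR q))
    (fun b => c (Z.of_nat b) * w (2 * PI * IZR j * IZR (Z.of_nat b) / INR q)))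
    by (intros; now rewrite <- INR_IZR_INZ).
  rewrite <- (rsum_reindex q (fun z => c z * w (2 * PI * IZR j * IZR z / INR q)) a Hq);
    [|now apply trig_periodic; auto; apply Hc|auto].
  rewrite <- rsum_scal. apply rsum_ext. intros b _.
  rewrite (rc_mul _ _ Hc), !mult_IZR, <- INR_IZR_INZ, <- Rmult_assoc. f_equal. f_equal.
  unfold Rdiv. ring.
Qed.

(* At [j] sharing a prime [p] with [q], a unit [a = 1 mod q/p] with [c a <> 1] forces the sum to vanish. *)
Lemma trig_sum_primitive w c q j : (1 <= q)%nat -> (forall y k, w (y + 2 * IZR k * PI) = w y) ->
  real_character q c -> primitive q c ->
  trig_sum w c q j = c j * trig_sum w c q 1.
Proof.
  intros Hq Hw Hc Hp. destruct (Z.eq_dec (Z.gcd j (Z.of_nat q)) 1) as [Hj|Hj].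
  - pose proof (trig_sum_reindex w c q 1 j Hq Hw Hc Hj) as E. rewrite Z.mul_1_l in E.
    rewrite <- E, <- Rmult_assoc. destruct (rc_unit q c j Hq Hc Hj) as [-> | ->]; ring.
  - rewrite (rc_zero q c j Hc Hj), Rmult_0_l.
    assert (Hg : (1 < Z.gcd j (Z.of_nat q))%Z).
    { pose proof (Z.gcd_nonneg j (Z.of_nat q)).
      assert (Z.gcd j (Z.of_nat q) <> 0)%Z by (intros E; apply Z.gcd_eq_0_r in E; lia). lia. }
    destruct (exists_prime_divisor _ Hg) as [p [Hpp Hpd]].
    assert (Dj : (p | j)%Z) by (eapply Z.divide_trans; [exact Hpd|apply Z.gcd_divide_l]).
    assert (Dq : (p | Z.of_nat q)%Z) by (eapply Z.divide_trans; [exact Hpd|apply Z.gcd_divide_r]).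
    destruct (Hp p Hpp Dq) as [a [Ha [Hd Hne]]].
    pose proof (trig_sum_reindex w c q j a Hq Hw Hc Ha) as E.
    assert (E2 : trig_sum w c q (j * a) = trig_sum w c q j).
    { apply rsum_ext. intros b _. f_equal.
      destruct Dj as [u Hu]. destruct Hd as [v Hv].
      rewrite <- (Hw (2 * PI * IZR j * INR b / INR q) (u * v * Z.of_nat b)%Z). f_equal.
      assert (Ev : (j * a = j + u * v * Z.of_nat q)%Z).
      { transitivity (j + u * (p * (a - 1)))%Z; [rewrite Hu; ring|rewrite Hv; ring]. }
      rewrite Ev, plus_IZR, !mult_IZR, <- !INR_IZR_INZ. field. apply not_0_INR. lia. }
    rewrite E2 in E. nra.
Qed.

Lemma eps_of_square T (q : nat) : (1 <= q)%nat -> T * T = INR q -> T / sqrt (INR q) = 1 \/ T / sqrt (INR q) = -1.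
Proof.
  intros Hq HT. assert (Hq0 : 0 < INR q) by (apply lt_0_INR; lia).
  assert (Hs : 0 < sqrt (INR q)) by now apply sqrt_lt_R0.
  pose proof (sqrt_sqrt (INR q) ltac:(lra)) as Es. set (r := sqrt (INR q)) in *.
  assert (P : (T - r) * (T + r) = 0) by nra.
  apply Rmult_integral in P. destruct P as [P|P].
  - left. replace T with r by lra. field. lra.
  - right. replace T with (- r) by lra. field. lra.
Qed.

Lemma trig_sum_cosT c q j : trig_sum cos c q (Z.of_nat j) = cosT c q j.
Proof. unfold trig_sum, cosT. now rewrite <- INR_IZR_INZ. Qed.

Lemma trig_sum_sinT c q j : trig_sum sin c q (Z.of_nat j) = sinT c q j.
Proof. unfold trig_sum, sinT. now rewrite <- INR_IZR_INZ. Qed.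

Lemma primitive_theta_data q c : (2 <= q)%nat -> real_character q c -> primitive q c ->
  exists a eps, theta_data c a (PI / INR q) eps.
Proof.
  intros Hq Hc Hp. assert (Hq1 : (1 <= q)%nat) by lia.
  assert (Hq0 : INR q <> 0) by (apply not_0_INR; lia).
  assert (He : 0 < PI / INR q) by (apply Rdiv_lt_0_compat; [apply PI_RGT_0|apply lt_0_INR; lia]).
  assert (Hsp : forall N, spread c 1 N = c (Z.of_nat N)).
  { intros N. unfold spread. rewrite Nat.mod_1_r, Nat.div_1_r. reflexivity. }
  destruct (rc_parity q c Hq1 Hc) as [P|P].
  - assert (Hev : forall n, c (- n)%Z = c n) by (intros; rewrite (rc_opp q c n Hc), P; ring).
    set (T := cosT c q 1).
    assert (HT : forall j, cosT c q j = T * c (Z.of_nat j)).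
    { intros j. rewrite <- trig_sum_cosT, (trig_sum_primitive cos c q (Z.of_nat j)) by auto using cos_period_Z.
      unfold T. rewrite <- trig_sum_cosT. apply Rmult_comm. }
    (* Inversion with [N = 1] at [k = 1]: transforming twice returns [q] times [c 1], and each
       transform multiplies by [T]. So the Gauss sum is known up to sign. *)
    assert (HT2 : T * T = INR q).
    { pose proof (cosT_inversion q 1 c 1 Hq1 (le_n 1) (rc_per _ _ Hc) Hev) as E.
      rewrite Hsp, Nat.mul_1_r in E. change (Z.of_nat 1) with 1%Z in E.
      rewrite (rc_1 q c Hc), (Rmult_1_r (INR q)) in E. rewrite <- E at 1.
      unfold T at 1, cosT at 1. symmetry.
      rewrite (rsum_ext _ (fun b => c (Z.of_nat b) * cos (2 * PI * INR 1 * INR b / INR q) * T)).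
      - rewrite rsum_scal_r. unfold T at 2. reflexivity.
      - intros b _. rewrite HT. simpl INR. replace (2 * 1 * (PI * INR b / INR q)) with (2 * PI * 1 * INR b / INR q) by (unfold Rdiv; ring). ring. }
    exists 0%nat, (T / sqrt (INR q)). constructor; auto; [intros; now apply (rc_abs_le q)|now apply eps_of_square|].
    intros x. apply vfun_reflect_even; auto; [apply Hc|]. apply (rc_zero q); auto.
    rewrite Z.gcd_0_l. lia.
  - assert (Hev : forall n, c (- n)%Z = - c n) by (intros; rewrite (rc_opp q c n Hc), P; ring).
    set (T := sinT c q 1).
    assert (HT : forall j, sinT c q j = T * c (Z.of_nat j)).
    { intros j. rewrite <- trig_sum_sinT, (trig_sum_primitive sin c q (Z.of_nat j)) by auto using sin_period_Z.
      unfold T. rewrite <- trig_sum_sinT. apply Rmult_comm. }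
    assert (HT2 : T * T = INR q).
    { pose proof (sinT_inversion q 1 c 1 Hq1 (le_n 1) (rc_per _ _ Hc) Hev) as E.
      rewrite Hsp, Nat.mul_1_r in E. change (Z.of_nat 1) with 1%Z in E.
      rewrite (rc_1 q c Hc), (Rmult_1_r (INR q)) in E. rewrite <- E at 1.
      unfold T at 1, sinT at 1. symmetry.
      rewrite (rsum_ext _ (fun b => c (Z.of_nat b) * sin (2 * PI * INR 1 * INR b / INR q) * T)).
      - rewrite rsum_scal_r. unfold T at 2. reflexivity.
      - intros b _. rewrite HT. simpl INR. replace (2 * 1 * (PI * INR b / INR q)) with (2 * PI * 1 * INR b / INR q) by (unfold Rdiv; ring). ring. }
    exists 1%nat, (T / sqrt (INR q)). constructor; auto; [intros; now apply (rc_abs_le q)|now apply eps_of_square|].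
    intros x. apply vfun_reflect_odd; auto. apply Hc.
Qed.

Lemma primitive_at_most_one_zero q c b1 b2 : (14 <= q)%nat -> real_character q c -> nonprincipal q c ->
  primitive q c -> 1 - 1.011 / ln (INR q) < b1 -> 1 - 1.011 / ln (INR q) < b2 ->
  two_zeros (dirichlet_sum c) b1 b2 -> False.
Proof.
  intros Hq Hc Hn Hp. destruct (primitive_theta_data q c ltac:(lia) Hc Hp) as [a [eps Ht]].
  apply (at_most_one_zero c a (INR q) eps (INR q)). constructor; auto.
  - replace 14 with (INR 14) by (simpl; ring). now apply le_INR.
  - apply (rc_cmult q); auto; lia.
  - intros n. apply rc_partial_bound; auto; lia.
  - intros s Hs. apply (dirichlet_sum_lim c (INR q)); auto. intros n. apply rc_partial_bound; auto; lia.
Qed.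

(** * Reduction to primitive characters *)

(* A representative of the class of [n] modulo [m] that is prime to [p] whenever [p] does not divide [gcd n m]. *)
Definition lift (p : Z) (m : Z) (n : Z) : Z := if Zdivide_dec p n then (n + m)%Z else n.

Definition reduced (X : Z -> R) (p m : Z) (n : Z) : R := X (lift p m n).

Lemma lift_congr p m n : (m | lift p m n - n)%Z.
Proof.
  unfold lift. destruct (Zdivide_dec p n).
  - exists 1%Z. ring.
  - exists 0%Z. ring.
Qed.

Lemma gcd_1_divide a m k : Z.gcd a m = 1%Z -> (k | a)%Z -> (k | m)%Z -> (k | 1)%Z.
Proof. intros H Ha Hm. rewrite <- H. now apply Z.gcd_greatest. Qed.

Lemma gcd_congr a b m : (m | a - b)%Z -> Z.gcd a m = Z.gcd b m.
Proof.
  intros [k Hk]. replace a with (b + k * m)%Z by lia.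
  rewrite (Z.gcd_comm _ m), (Z.gcd_comm b). apply Z.gcd_add_mult_diag_r.
Qed.

Lemma gcd_mul_1 a m n : Z.gcd a (m * n) = 1%Z <-> Z.gcd a m = 1%Z /\ Z.gcd a n = 1%Z.
Proof.
  split.
  - intros H. split; apply Z.bezout_1_gcd; destruct (Z.gcd_bezout _ _ _ H) as [u [v E]];
      [exists u, (v * n)%Z|exists u, (v * m)%Z]; lia.
  - intros [H1 H2]. apply Zgcd_1_rel_prime. apply rel_prime_mult; now apply Zgcd_1_rel_prime.
Qed.

Lemma prime_gcd_1 p a : prime p -> Z.gcd a p = 1%Z <-> ~ (p | a)%Z.
Proof.
  intros Hp. pose proof (prime_ge_2 _ Hp). split.
  - intros H1 Hd. pose proof (gcd_1_divide a p p H1 Hd (Z.divide_refl p)) as D.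
    apply Z.divide_1_r_nonneg in D; lia.
  - intros Hd. rewrite Z.gcd_comm. apply Zgcd_1_rel_prime. now apply prime_rel_prime.
Qed.

Lemma lift_gcd p m n : prime p -> Z.gcd (lift p m n) (p * m) = 1%Z <-> Z.gcd n m = 1%Z.
Proof.
  intros Hp. pose proof (prime_ge_2 _ Hp) as H2.
  rewrite gcd_mul_1, (gcd_congr _ _ _ (lift_congr p m n)), prime_gcd_1 by auto.
  split; [tauto|]. intros H. split; auto. unfold lift.
  destruct (Zdivide_dec p n) as [D|D]; auto. intros D2.
  assert (D3 : (p | m)%Z) by (apply (Z.divide_add_cancel_r p n m); auto).
  pose proof (gcd_1_divide n m p H D D3) as D4. apply Z.divide_1_r_nonneg in D4; lia.
Qed.

(** If [i] inverts [v] modulo [q], then [u i] is congruent to 1 modulo [m], so [X (u i) = 1], while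
    [X i * X v = 1]. *)
Lemma induced_congr q X p m u v : (1 <= q)%nat -> real_character q X -> Z.of_nat q = (p * m)%Z ->
  (forall a, Z.gcd a (Z.of_nat q) = 1%Z -> (Z.of_nat q | p * (a - 1))%Z -> X a = 1) ->
  Z.gcd u (Z.of_nat q) = 1%Z -> Z.gcd v (Z.of_nat q) = 1%Z -> (m | u - v)%Z -> X u = X v.
Proof.
  intros Hq HX Hpm Ht Hu Hv [k Hk].
  destruct (unit_inverse q v Hv) as [i [j Hij]].
  assert (Hi : Z.gcd i (Z.of_nat q) = 1%Z) by (apply Z.bezout_1_gcd; exists v, (- j)%Z; lia).
  assert (E : X (u * i)%Z = 1).
  { apply Ht.
    - rewrite Z.gcd_comm. apply Zgcd_1_rel_prime. apply rel_prime_mult; apply Zgcd_1_rel_prime; now rewrite Z.gcd_comm.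
    - exists (k * i + p * j)%Z. replace u with (v + k * m)%Z by lia.
      replace (p * ((v + k * m) * i - 1))%Z with (p * (i * v - 1) + k * i * (p * m))%Z by ring.
      rewrite Hij, Hpm. ring. }
  assert (E2 : X (i * v)%Z = 1) by (rewrite <- (rc_1 q X HX); apply (rc_congr q); auto; exists j; lia).
  rewrite (rc_mul _ _ HX) in E, E2.
  transitivity (X u * (X i * X v)); [rewrite E2; ring|].
  rewrite <- Rmult_assoc, E. ring.
Qed.

Lemma reduced_character q X p m : (1 <= m)%nat -> prime p -> real_character q X -> Z.of_nat q = (p * Z.of_nat m)%Z ->
  (forall a, Z.gcd a (Z.of_nat q) = 1%Z -> (Z.of_nat q | p * (a - 1))%Z -> X a = 1) ->
  real_character m (reduced X p (Z.of_nat m)).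
Proof.
  intros Hm Hp HX Hpm Ht. pose proof (prime_ge_2 _ Hp) as H2.
  assert (Hq : (1 <= q)%nat) by nia.
  set (M := Z.of_nat m) in *.
  assert (S : forall n, X (lift p M n) <> 0 <-> Z.gcd n M = 1%Z).
  { intros n. rewrite (rc_supp _ _ HX), Hpm. now apply lift_gcd. }
  assert (U : forall n n', Z.gcd n M = 1%Z -> Z.gcd n' (Z.of_nat q) = 1%Z -> (M | lift p M n - n')%Z -> X (lift p M n) = X n').
  { intros n n' Hn Hn' Hd. apply (induced_congr q X p M); auto. rewrite Hpm. now apply lift_gcd. }
  assert (Z0 : forall n, Z.gcd n M <> 1%Z -> X (lift p M n) = 0).
  { intros n Hn. destruct (Req_dec (X (lift p M n)) 0) as [E|E]; auto. apply S in E. contradiction. }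
  constructor; unfold reduced; [intros n|intros n1 n2|exact S].
  - change (Z.of_nat m) with M. assert (Eg : Z.gcd (n + M) M = Z.gcd n M) by (apply gcd_congr; exists 1%Z; ring).
    destruct (Z.eq_dec (Z.gcd n M) 1) as [Hn|Hn].
    + apply U; [now rewrite Eg|rewrite Hpm; now apply lift_gcd|].
      destruct (lift_congr p M (n + M)) as [a Ha]. destruct (lift_congr p M n) as [b Hb].
      exists (a + 1 - b)%Z. lia.
    + rewrite !Z0; auto. now rewrite Eg.
  - destruct (Z.eq_dec (Z.gcd (n1 * n2) M) 1) as [Hn|Hn].
    + assert (Hs : Z.gcd n1 M = 1%Z /\ Z.gcd n2 M = 1%Z)
        by (rewrite !(Z.gcd_comm _ M) in *; now apply gcd_mul_1).
      rewrite <- (rc_mul _ _ HX). apply U; auto.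
      * rewrite Z.gcd_comm. apply gcd_mul_1. rewrite !(Z.gcd_comm (Z.of_nat q)), Hpm. split; now apply lift_gcd.
      * destruct (lift_congr p M (n1 * n2)) as [a Ha]. destruct (lift_congr p M n1) as [b Hb].
        destruct (lift_congr p M n2) as [c Hc]. exists (a - b * n2 - lift p M n1 * c)%Z.
        replace (lift p M (n1 * n2)) with (a * M + n1 * n2)%Z by lia.
        replace (lift p M n2) with (c * M + n2)%Z by lia.
        replace (lift p M n1) with (b * M + n1)%Z by lia. ring.
    + rewrite Z0 by auto. symmetry.
      destruct (Z.eq_dec (Z.gcd n1 M) 1) as [H1|H1]; [|rewrite (Z0 n1) by auto; ring].
      destruct (Z.eq_dec (Z.gcd n2 M) 1) as [H3|H3]; [|rewrite (Z0 n2) by auto; ring].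
      exfalso. apply Hn. rewrite Z.gcd_comm. apply gcd_mul_1. rewrite !(Z.gcd_comm M). now split.
Qed.

Lemma reduced_nonprincipal q X p m : (1 <= m)%nat -> prime p -> Z.of_nat q = (p * Z.of_nat m)%Z ->
  nonprincipal q X -> nonprincipal m (reduced X p (Z.of_nat m)).
Proof.
  intros Hm Hp Hpm [a [Ha Hne]]. rewrite Hpm in Ha. apply gcd_mul_1 in Ha. destruct Ha as [Ha1 Ha2].
  exists a. split; auto. unfold reduced, lift. destruct (Zdivide_dec p a) as [D|D]; auto.
  now apply prime_gcd_1 in Ha1.
Qed.

Lemma reduced_value q X p m n : prime p -> real_character q X -> Z.of_nat q = (p * Z.of_nat m)%Z ->
  X n = if Zdivide_dec p n then 0 else reduced X p (Z.of_nat m) n.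
Proof.
  intros Hp HX Hpm. unfold reduced, lift. destruct (Zdivide_dec p n) as [D|D]; auto.
  apply (rc_zero q); auto. rewrite Hpm, gcd_mul_1, prime_gcd_1 by auto. tauto.
Qed.

(** Convergence may be conditional, so the Euler factor is removed at the level of partial sums: up
    to [N p], the multiples of [p] account exactly for [Y p * p^(-s)] times the sum up to [N]. If
    [p] still divides [m], then [Y p = 0] and the factor is 1. *)
Lemma reduced_dirichlet_sum q X p m s : (1 <= m)%nat -> prime (Z.of_nat p) -> real_character q X -> nonprincipal q X ->
  Z.of_nat q = (Z.of_nat p * Z.of_nat m)%Z ->
  real_character m (reduced X (Z.of_nat p) (Z.of_nat m)) ->
  0 < s -> dirichlet_sum X s
    = (1 - reduced X (Z.of_nat p) (Z.of_nat m) (Z.of_nat p) * npow s p) * dirichlet_sum (reduced X (Z.of_nat p) (Z.of_nat m)) s.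
Proof.
  intros Hm Hp HX Hn Hpm HY Hs. pose proof (prime_ge_2 _ Hp) as H2.
  assert (Hq : (1 <= q)%nat) by nia.
  pose proof (reduced_nonprincipal q X _ m Hm Hp Hpm Hn) as HnY.
  assert (V : forall n, X n = if Zdivide_dec (Z.of_nat p) n then 0 else reduced X (Z.of_nat p) (Z.of_nat m) n)
    by (intros; now apply (reduced_value q)).
  set (Y := reduced X (Z.of_nat p) (Z.of_nat m)) in *.
  pose proof (dirichlet_sum_lim X (INR q) s Hs (fun n => rc_partial_bound q X n Hq HX Hn)) as LX.
  pose proof (dirichlet_sum_lim Y (INR m) s Hs (fun n => rc_partial_bound m Y n Hm HY HnY)) as LY.
  assert (Hsub : filterlim (fun N => (N * p)%nat) eventually eventually).
  { apply eventually_subseq. intros n. lia. }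
  pose proof (is_lim_seq_subseq _ _ _ Hsub LX) as LX'. pose proof (is_lim_seq_subseq _ _ _ Hsub LY) as LY'.
  pose proof (is_lim_seq_minus' _ _ _ _ LY' (is_lim_seq_scal' _ (Y (Z.of_nat p) * npow s p) _ LY)) as L.
  assert (E : Finite (dirichlet_sum X s) = Finite (dirichlet_sum Y s - Y (Z.of_nat p) * npow s p * dirichlet_sum Y s)).
  { rewrite <- (is_lim_seq_unique _ _ LX'), <- (is_lim_seq_unique _ _ L). apply Lim_seq_ext. intros N.
    rewrite <- rsum_scal.
    rewrite (rsum_ext (fun i => Y (Z.of_nat p) * npow s p * dterm Y s i) (fun k => dterm Y s (p * S k - 1))).
    2: { intros k _. unfold dterm. replace (S (p * S k - 1)) with (p * S k)%nat by nia.
         rewrite Nat2Z.inj_mul, (rc_mul _ _ HY). fold (npow s (p * S k)) (npow s (S k)).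
         rewrite npow_mult by lia. ring. }
    rewrite <- (rsum_multiples (fun k => dterm Y s (k - 1)) p N) by lia.
    rewrite <- rsum_minus. apply rsum_ext. intros k _.
    unfold dterm at 1. rewrite V. replace (S k - 1)%nat with k by lia.
    assert (D : (Z.of_nat p | Z.of_nat (S k))%Z <-> (S k mod p = 0)%nat).
    { rewrite <- Z.mod_divide, <- Nat2Z.inj_mod by lia. lia. }
    destruct (Nat.eqb_spec (S k mod p) 0) as [D1|D1]; destruct (Zdivide_dec (Z.of_nat p) (Z.of_nat (S k))) as [D2|D2];
      try tauto; unfold dterm; ring.
  }
  apply Rbar_finite_eq in E. rewrite E. ring.
Qed.

(** * Small moduli *)

Lemma dirichlet_sum_pos_of_period q X : (1 <= q)%nat -> real_character q X -> nonprincipal q X ->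
  (forall m, (m <= q)%nat -> 0 <= rsum (fun j => rsum (fun i => X (Z.of_nat (S i))) (S j)) m) ->
  forall s, 0 < s -> 0 < dirichlet_sum X s.
Proof.
  intros Hq HX Hn Hm s Hs. apply (dirichlet_sum_pos X (INR q)); auto.
  - intros n. now apply rc_partial_bound.
  - apply (rc_1 q X HX).
  - intros n. induction n as [n IH] using lt_wf_ind.
    destruct (le_lt_dec n q) as [H|H]; [now apply Hm|].
    replace n with (q + (n - q))%nat by lia. rewrite rsum_add.
    rewrite (rsum_ext (fun j => rsum (fun i => X (Z.of_nat (S i))) (S (q + j)))
      (fun j => rsum (fun i => X (Z.of_nat (S i))) (S j))).
    + pose proof (IH (n - q)%nat ltac:(lia)). pose proof (Hm q (le_n q)). lra.
    + intros j _. replace (S (q + j)) with (S j + q)%nat by lia. now apply rc_partial_periodic.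
Qed.

Ltac char_zero q HX X l :=
  match l with
  | nil => idtac
  | cons ?a ?l' => assert (X a%Z = 0) by (apply (rc_zero q X a HX); discriminate); char_zero q HX X l'
  end.

(** A triple [(a, b, c)] means [a = b c] modulo [q]. Each value found becomes available to later
    triples, so a list may walk along the powers of a generator. *)
Ltac char_prod q HX X l :=
  match l with
  | nil => idtac
  | cons (?a, ?b, ?c) ?l' =>
      match goal with Eb : X b = ?u |- _ => match goal with Ec : X c = ?v |- _ =>
        assert (X a = u * v)
          by (rewrite (rc_prod q X a b c ltac:(lia) HX eq_refl); f_equal; assumption) end end;
      char_prod q HX X l'
  end.

Ltac char_gen q Hq HX X g := destruct (rc_unit q X g Hq HX eq_refl).

(** The sign pattern of the principal character is refuted by its nonzero sum over a period. For the
    others the iterated partial sums are computed; fourteen splits cover [0 <= m <= 13]. *)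
Ltac char_finish q Hq HX X HN :=
  first
  [ exfalso; pose proof (rc_sum_zero q X Hq HX HN) as Hsum; cbn in Hsum; lra
  | apply (dirichlet_sum_pos_of_period q X Hq HX HN); intros m Hm;
    do 14 (destruct m as [|m]; [first [lia | clear Hm; cbn; lra]|]); lia ].

Ltac small_case q X HX HN gens zeros prods :=
  let Hq := fresh in assert (Hq : (1 <= q)%nat) by lia;
  let H1 := fresh in pose proof (rc_1 q X HX) as H1;
  char_zero q HX X zeros;
  gens Hq;
  char_prod q HX X prods;
  char_finish q Hq HX X HN.

(** Covers the range below the analytic bound [14 <= Q]. A real character is fixed by its signs on
    generators of the unit group, two for 8 and 12 and one otherwise, so each modulus leaves only a
    few explicit tables. *)
Lemma small_modulus_positive q X : (3 <= q)%nat -> (q <= 13)%nat -> real_character q X -> nonprincipal q X ->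
  forall s, 0 < s -> 0 < dirichlet_sum X s.
Proof.
  intros H3 H13 HX HN.
  assert (C : (q = 3 \/ q = 4 \/ q = 5 \/ q = 6 \/ q = 7 \/ q = 8 \/ q = 9 \/ q = 10 \/ q = 11 \/ q = 12 \/ q = 13)%nat) by lia.
  clear H3 H13.
  destruct C as [->|[->|[->|[->|[->|[->|[->|[->|[->|[->| ->]]]]]]]]]].
  - small_case 3%nat X HX HN ltac:(fun Hq => char_gen 3%nat Hq HX X 2%Z) (0 :: 3 :: nil)%Z (@nil (Z * Z * Z)).
  - small_case 4%nat X HX HN ltac:(fun Hq => char_gen 4%nat Hq HX X 3%Z) (0 :: 2 :: 4 :: nil)%Z (@nil (Z * Z * Z)).
  - small_case 5%nat X HX HN ltac:(fun Hq => char_gen 5%nat Hq HX X 2%Z) (0 :: 5 :: nil)%Z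
      ((4, 2, 2) :: (3, 4, 2) :: nil)%Z.
  - small_case 6%nat X HX HN ltac:(fun Hq => char_gen 6%nat Hq HX X 5%Z) (0 :: 2 :: 3 :: 4 :: 6 :: nil)%Z (@nil (Z * Z * Z)).
  - small_case 7%nat X HX HN ltac:(fun Hq => char_gen 7%nat Hq HX X 3%Z) (0 :: 7 :: nil)%Z
      ((2, 3, 3) :: (6, 2, 3) :: (4, 6, 3) :: (5, 4, 3) :: nil)%Z.
  - small_case 8%nat X HX HN ltac:(fun Hq => char_gen 8%nat Hq HX X 3%Z; char_gen 8%nat Hq HX X 5%Z)
      (0 :: 2 :: 4 :: 6 :: 8 :: nil)%Z ((7, 3, 5) :: nil)%Z.
  - small_case 9%nat X HX HN ltac:(fun Hq => char_gen 9%nat Hq HX X 2%Z) (0 :: 3 :: 6 :: 9 :: nil)%Z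
      ((4, 2, 2) :: (8, 4, 2) :: (7, 8, 2) :: (5, 7, 2) :: nil)%Z.
  - small_case 10%nat X HX HN ltac:(fun Hq => char_gen 10%nat Hq HX X 3%Z) (0 :: 2 :: 4 :: 5 :: 6 :: 8 :: 10 :: nil)%Z
      ((9, 3, 3) :: (7, 9, 3) :: nil)%Z.
  - small_case 11%nat X HX HN ltac:(fun Hq => char_gen 11%nat Hq HX X 2%Z) (0 :: 11 :: nil)%Z
      ((4, 2, 2) :: (8, 4, 2) :: (5, 8, 2) :: (10, 5, 2) :: (9, 10, 2) :: (7, 9, 2) :: (3, 7, 2) :: (6, 3, 2) :: nil)%Z.
  - small_case 12%nat X HX HN ltac:(fun Hq => char_gen 12%nat Hq HX X 5%Z; char_gen 12%nat Hq HX X 7%Z)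
      (0 :: 2 :: 3 :: 4 :: 6 :: 8 :: 9 :: 10 :: 12 :: nil)%Z ((11, 5, 7) :: nil)%Z.
  - small_case 13%nat X HX HN ltac:(fun Hq => char_gen 13%nat Hq HX X 2%Z) (0 :: 13 :: nil)%Z
      ((4, 2, 2) :: (8, 4, 2) :: (3, 8, 2) :: (6, 3, 2) :: (12, 6, 2) :: (11, 12, 2) :: (9, 11, 2)
        :: (5, 9, 2) :: (10, 5, 2) :: (7, 10, 2) :: nil)%Z.
Qed.

(** * Thresholds, Euler factors and induction on the modulus *)

Lemma exp_1_011 : exp 1.011 < 3.
Proof.
  replace 1.011 with (INR 20 * 0.05055) by (simpl; lra).
  eapply Rle_lt_trans; [apply exp_upper; lra|].
  assert (0 < (1 - 0.05055) ^ 20) by (apply pow_lt; lra).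
  apply Rmult_lt_reg_r with ((1 - 0.05055) ^ 20); auto. rewrite Rinv_l by lra.
  lra.
Qed.

(** Amounts to [1.011 < ln 3]. The zeros considered are then positive and lie where [dirichlet_sum]
    represents the L-function. *)
Lemma threshold_pos x : 3 <= x -> 0 < 1 - 1.011 / ln x.
Proof.
  intros H. assert (L : 1.011 < ln x).
  { rewrite <- (ln_exp 1.011). pose proof exp_1_011. apply ln_increasing; [apply exp_pos|lra]. }
  assert (1.011 / ln x < 1); [|lra]. apply Rmult_lt_reg_r with (ln x); [lra|].
  unfold Rdiv. rewrite Rmult_assoc, Rinv_l by lra. lra.
Qed.

(** Passing to a divisor of the modulus only lowers the threshold, so zeros above the old one are
    above the new one. *)
Lemma threshold_mono x y : 3 <= x -> x <= y -> 1 - 1.011 / ln x <= 1 - 1.011 / ln y.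
Proof.
  intros H Hxy. assert (L : 0 < ln x) by (rewrite <- ln_1; apply ln_increasing; lra).
  assert (L2 : ln x <= ln y) by (destruct Hxy as [Hxy|<-]; [left; apply ln_increasing; lra|lra]).
  assert (1.011 / ln y <= 1.011 / ln x); [|lra].
  apply Rmult_le_compat_l; [lra|]. now apply Rinv_le_contravar.
Qed.

(** A factor bounded away from 0 can be divided out of the values and of the quadratic bound alike,
    so multiplicity is preserved. *)
Lemma two_zeros_factor g g' (e : R -> R) (t b1 b2 : R) : 0 < t -> t <= b1 -> t <= b2 ->
  (forall s, 0 < s -> g s = e s * g' s) -> (forall s, 0 < s -> 0 < e s) ->
  (exists e0, 0 < e0 /\ forall s, t / 2 <= s -> e0 <= e s) ->
  two_zeros g b1 b2 -> two_zeros g' b1 b2.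
Proof.
  intros Ht H1 H2 Hg He [e0 [He0 Hl]] [Z1 [Z2 Hz]].
  assert (Z : forall b, t <= b -> g b = 0 -> g' b = 0).
  { intros b Hb Hb0. rewrite Hg in Hb0 by lra. pose proof (He b ltac:(lra)).
    apply Rmult_integral in Hb0. destruct Hb0; lra. }
  split; [now apply Z|]. split; [now apply Z|].
  destruct Hz as [Hz|[Hb [K [r [Hr Hk]]]]]; [now left|right]. split; auto.
  (* The radius [t / 2] around [b1 >= t] keeps the argument above [t / 2], where [e0] bounds the
     factor from below. *)
  exists (K / e0), (Rmin r (t / 2)). split; [apply Rmin_glb_lt; lra|]. intros h Hh.
  assert (Hh1 : Rabs h < r) by (eapply Rlt_le_trans; [exact Hh|apply Rmin_l]).
  assert (Hh2 : Rabs h < t / 2) by (eapply Rlt_le_trans; [exact Hh|apply Rmin_r]).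
  apply Rabs_def2 in Hh2. specialize (Hk h Hh1). rewrite Hg in Hk by lra.
  specialize (Hl (b1 + h) ltac:(lra)).
  rewrite Rabs_mult, (Rabs_pos_eq (e _)) in Hk by lra.
  apply Rmult_le_reg_l with e0; auto. replace (e0 * (K / e0 * h ^ 2)) with (K * h ^ 2) by (field; lra).
  eapply Rle_trans; [|exact Hk]. apply Rmult_le_compat_r; auto using Rabs_pos.
Qed.

Lemma euler_factor_bound y p s t : (2 <= p)%nat -> Rabs y <= 1 -> 0 < t -> t <= s ->
  0 < 1 - npow t 2 <= 1 - y * npow s p.
Proof.
  intros Hp Hy Ht Hs.
  assert (E2 : npow t 2 < 1).
  { unfold npow. rewrite <- exp_0. apply exp_increasing.
    assert (0 < ln (INR 2)) by (rewrite <- ln_1; apply ln_increasing; simpl; lra). nra. }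
  assert (Ep : npow s p <= npow t 2).
  { apply Rle_trans with (npow s 2); [apply npow_antitone; lia || lra|].
    apply exp_le_mono. assert (0 < ln (INR 2)) by (rewrite <- ln_1; apply ln_increasing; simpl; lra). nra. }
  pose proof (npow_pos s p). apply Rabs_le_between in Hy. split; [lra|]. nra.
Qed.

(** Strong induction on the modulus: an imprimitive character loses one prime per step, and the
    descent ends at a primitive character with [q >= 14] or at a small modulus without positive
    zeros. *)
Lemma character_at_most_one_zero q X b1 b2 : (1 <= q)%nat -> real_character q X -> nonprincipal q X ->
  1 - 1.011 / ln (INR q) < b1 -> 1 - 1.011 / ln (INR q) < b2 -> two_zeros (dirichlet_sum X) b1 b2 -> False.
Proof.
  revert X. induction q as [q IH] using lt_wf_ind. intros X Hq HX HN H1 H2 HZ.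
  pose proof (nonprincipal_ge_3 q X Hq HX HN) as H3.
  assert (H3' : 3 <= INR q) by (replace 3 with (INR 3) by (simpl; ring); now apply le_INR).
  pose proof (threshold_pos _ H3') as HT.
  destruct (le_lt_dec q 13) as [H13|H14].
  { destruct HZ as [Z1 _]. pose proof (small_modulus_positive q X H3 H13 HX HN b1 ltac:(lra)). lra. }
  destruct (classic (primitive q X)) as [HP|HP].
  { apply (primitive_at_most_one_zero q X b1 b2); auto. }
  apply not_all_ex_not in HP. destruct HP as [p HP].
  apply imply_to_and in HP. destruct HP as [Hp HP]. apply imply_to_and in HP. destruct HP as [[m Hm] HP].
  pose proof (prime_ge_2 _ Hp) as Hp2.
  assert (Hm1 : (1 <= Z.to_nat m)%nat) by nia. 
  assert (Hpm : Z.of_nat q = (p * Z.of_nat (Z.to_nat m))%Z) by nia.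
  assert (Ht : forall a, Z.gcd a (Z.of_nat q) = 1%Z -> (Z.of_nat q | p * (a - 1))%Z -> X a = 1).
  { intros a Ha Hd. destruct (Req_dec (X a) 1); auto. exfalso. apply HP. now exists a. }
  pose proof (reduced_character q X p (Z.to_nat m) Hm1 Hp HX Hpm Ht) as HY.
  pose proof (reduced_nonprincipal q X p (Z.to_nat m) Hm1 Hp Hpm HN) as HYN.
  set (Y := reduced X p (Z.of_nat (Z.to_nat m))) in *.
  assert (Hm3 : 3 <= INR (Z.to_nat m)).
  { replace 3 with (INR 3) by (simpl; ring). apply le_INR. now apply (nonprincipal_ge_3 _ Y). }
  assert (Hlt : (Z.to_nat m < q)%nat) by nia.
  pose proof (threshold_mono _ (INR q) Hm3 ltac:(apply le_INR; lia)) as HTm.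
  apply (IH (Z.to_nat m) Hlt Y); auto; try lra.
  assert (HYb : forall n, Rabs (Y n) <= 1) by (intros; now apply (rc_abs_le (Z.to_nat m))).
  set (P := Z.to_nat p). assert (EP : p = Z.of_nat P) by (unfold P; lia).
  apply (two_zeros_factor (dirichlet_sum X) (dirichlet_sum Y) (fun s => 1 - Y p * npow s P) (1 - 1.011 / ln (INR q))); auto; try lra.
  - intros s Hs. unfold Y. rewrite EP. apply (reduced_dirichlet_sum q); auto; rewrite <- EP; auto.
  - intros s Hs. destruct (euler_factor_bound (Y p) P s s ltac:(lia) (HYb p) Hs ltac:(lra)). lra.
  - exists (1 - npow ((1 - 1.011 / ln (INR q)) / 2) 2). split.
    + apply (euler_factor_bound (Y p) P ((1 - 1.011 / ln (INR q)) / 2) ((1 - 1.011 / ln (INR q)) / 2) ltac:(lia) (HYb p) ltac:(lra) (Rle_refl _)).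
    + intros s Hs. apply (euler_factor_bound (Y p) P s ((1 - 1.011 / ln (INR q)) / 2) ltac:(lia) (HYb p) ltac:(lra) Hs).
Qed.

(** * The identity principle on the half line *)

Definition expansion (F : R -> R) (s r : R) (d : nat -> R) : Prop :=
  forall h, Rabs h < r -> is_lim_seq (rsum (fun k => d k * h ^ k)) (F (s + h)).

Definition analytic_at (F : R -> R) (s : R) : Prop := exists r d, 0 < r /\ expansion F s r d.

Lemma analytic_minus F G s : analytic_at F s -> analytic_at G s -> analytic_at (fun x => F x - G x) s.
Proof.
  intros [r1 [d1 [H1 E1]]] [r2 [d2 [H2 E2]]].
  exists (Rmin r1 r2), (fun k => d1 k - d2 k). split; [now apply Rmin_glb_lt|]. intros h Hh.
  assert (Rabs h < r1) by (eapply Rlt_le_trans; [exact Hh|apply Rmin_l]).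
  assert (Rabs h < r2) by (eapply Rlt_le_trans; [exact Hh|apply Rmin_r]).
  apply is_lim_seq_ext with (fun n => rsum (fun k => d1 k * h ^ k) n - rsum (fun k => d2 k * h ^ k) n).
  - intros n. rewrite <- rsum_minus. apply rsum_ext. intros k _. ring.
  - apply is_lim_seq_minus'; auto.
Qed.

(** Convergence at [p = r / 2] bounds the numbers [d_j p^j]; for [|h| < p / 2] the tail from [k] on
    is dominated by a geometric series of ratio below 1/2, whence the factor 2. *)
Lemma expansion_remainder F s r d k : 0 < r -> expansion F s r d ->
  exists C rho, 0 < rho /\ rho <= r /\ 0 <= C /\
    forall h, Rabs h < rho -> Rabs (F (s + h) - rsum (fun j => d j * h ^ j) k) <= C * Rabs h ^ k.
Proof.
  intros Hr H. set (p := r / 2). assert (Hp : 0 < p < r) by (unfold p; lra).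
  pose proof (H p ltac:(rewrite Rabs_pos_eq; lra)) as Lp.
  apply is_series_rsum in Lp.
  assert (Hb : exists C, forall j, Rabs (d j * p ^ j) <= C).
  { assert (L0 : is_lim_seq (fun j => d j * p ^ j) 0) by (apply ex_series_lim_0; eexists; exact Lp).
    destruct (filterlim_bounded (fun j => d j * p ^ j)) as [C HC]; [now exists 0|]. exists C. exact HC. }
  destruct Hb as [C0 HC0].
  assert (HC0p : 0 <= C0) by (eapply Rle_trans; [apply Rabs_pos|apply (HC0 0%nat)]).
  exists (2 * C0 / p ^ k), (p / 2). split; [lra|]. split; [lra|].
  assert (Hpk : 0 < p ^ k) by (apply pow_lt; lra).
  split; [apply Rle_mult_inv_pos; lra|].
  intros h Hh. pose proof (H h ltac:(lra)) as Lh. apply is_series_rsum in Lh.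
  set (y := Rabs h / p). assert (Hy : 0 <= y < 1 / 2).
  { unfold y. split; [apply Rle_mult_inv_pos; [apply Rabs_pos|lra]|].
    apply Rmult_lt_reg_r with p; [lra|]. unfold Rdiv at 1. rewrite Rmult_assoc, Rinv_l by lra. lra. }
  assert (Eh : forall j, Rabs (d j * h ^ j) <= C0 * y ^ j).
  { intros j. replace (Rabs (d j * h ^ j)) with (Rabs (d j * p ^ j) * y ^ j).
    - apply Rmult_le_compat_r; auto. apply pow_le. lra.
    - rewrite !Rabs_mult, <- !RPow_abs, (Rabs_pos_eq p), Rmult_assoc, <- Rpow_mult_distr by lra.
      unfold y. do 2 f_equal. field. lra. }
  assert (Ex : ex_series (fun j => d j * h ^ j)) by (eexists; exact Lh).
  apply is_series_unique in Lh. rewrite <- Lh, (Series_split _ k Ex).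
  replace (rsum (fun j => d j * h ^ j) k + Series (fun j => d (k + j)%nat * h ^ (k + j)) - rsum (fun j => d j * h ^ j) k)
    with (Series (fun j => d (k + j)%nat * h ^ (k + j))) by ring.
  assert (Eg : is_series (fun j => C0 * y ^ k * y ^ j) (C0 * y ^ k * / (1 - y))).
  { apply (is_series_scal (V := R_NormedModule) (C0 * y ^ k) (fun j => y ^ j) (/ (1 - y))).
    apply is_series_geom. rewrite Rabs_pos_eq; lra. }
  eapply Rle_trans; [apply (Series_abs_le _ (fun j => C0 * y ^ k * y ^ j))|].
  - intros j. eapply Rle_trans; [apply Eh|]. rewrite pow_add. lra.
  - eexists. exact Eg.
  - rewrite (is_series_unique _ _ Eg).
    replace (2 * C0 / p ^ k * Rabs h ^ k) with (C0 * y ^ k * 2).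
    + assert (0 <= y ^ k) by (apply pow_le; lra).
      apply Rmult_le_compat_l; [now apply Rmult_le_pos|].
      replace 2 with (/ (1 / 2)) by field. apply Rinv_le_contravar; lra.
    + unfold y, Rdiv. rewrite Rpow_mult_distr, pow_inv. ring.
Qed.

(** If all earlier coefficients vanish, the remainder bound of order [k + 1] gives [|d_k| <= C h]
    for arbitrarily small [h > 0]. *)
Lemma expansion_zero F s r d : 0 < r -> expansion F s r d -> (forall h, 0 < h < r -> F (s + h) = 0) ->
  forall k, d k = 0.
Proof.
  intros Hr H H0 k. induction k as [k IH] using lt_wf_ind.
  destruct (expansion_remainder F s r d (S k) Hr H) as [C [rho [Hrho [Hle [HC Hb]]]]].
  destruct (Req_dec (d k) 0) as [E|E]; auto. exfalso. apply Rabs_pos_lt in E.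
  set (h := Rmin (rho / 2) (Rabs (d k) / (2 * (C + 1)))).
  assert (Hh : 0 < h) by (apply Rmin_glb_lt; [lra|apply Rdiv_lt_0_compat; lra]).
  assert (Hh1 : h <= rho / 2) by apply Rmin_l.
  assert (Hh2 : h <= Rabs (d k) / (2 * (C + 1))) by apply Rmin_r.
  specialize (Hb h ltac:(rewrite Rabs_pos_eq; lra)). rewrite (Rabs_pos_eq h) in Hb by lra.
  rewrite H0 in Hb by lra. cbn [rsum] in Hb. rewrite rsum_zero in Hb by (intros i Hi; rewrite IH by auto; ring).
  replace (0 - (0 + d k * h ^ k)) with (- (d k * h ^ k)) in Hb by ring.
  assert (Hk : 0 < h ^ k) by now apply pow_lt.
  rewrite Rabs_Ropp, Rabs_mult, (Rabs_pos_eq (h ^ k)) in Hb by lra. simpl in Hb.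
  assert (B : Rabs (d k) <= C * h).
  { apply Rmult_le_reg_r with (h ^ k); auto. lra. }
  assert (B2 : h * (2 * (C + 1)) <= Rabs (d k)).
  { apply Rle_trans with (Rabs (d k) / (2 * (C + 1)) * (2 * (C + 1))); [apply Rmult_le_compat_r; lra|].
    right. field. lra. }
  nra.
Qed.

(** Let [m] be the supremum of the points where [F] is nonzero. To the right of [m] it vanishes, so
    its expansion at [m] is zero, and [F] vanishes to the left as well, which contradicts the choice
    of [m]. *)
Lemma identity_principle F : (forall s, 0 < s -> analytic_at F s) -> (forall s, 1 < s -> F s = 0) ->
  forall s, 0 < s -> F s = 0.
Proof.
  intros HF H1 s Hs. destruct (Req_dec (F s) 0) as [E|E]; auto. exfalso.
  set (S := fun t => 0 < t /\ F t <> 0).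
  assert (Hb : bound S).
  { exists 1. intros t [Ht Hne]. destruct (Rle_lt_dec t 1); auto. contradict Hne. now apply H1. }
  destruct (completeness S Hb (ex_intro _ s (conj Hs E))) as [m [Hup Hlub]].
  assert (Hm : 0 < m) by (apply Rlt_le_trans with s; auto; apply Hup; now split).
  destruct (HF m Hm) as [r [d [Hr Hd]]].
  assert (Hz : forall h, 0 < h -> F (m + h) = 0).
  { intros h Hh. destruct (Req_dec (F (m + h)) 0) as [G|G]; auto. exfalso.
    assert (m + h <= m); [|lra]. apply Hup. split; auto. lra. }
  assert (D0 : forall k, d k = 0) by (apply (expansion_zero F m r d Hr Hd); intros; apply Hz; lra).
  assert (m <= m - r / 2); [|lra]. apply Hlub. intros t [Ht Hne].
  destruct (Rle_lt_dec t (m - r / 2)) as [G|G]; auto. exfalso. apply Hne.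
  destruct (Rle_lt_dec t m) as [G2|G2].
  - pose proof (Hd (t - m) ltac:(rewrite Rabs_left1; lra)) as L. replace (m + (t - m)) with t in L by ring.
    apply is_lim_seq_unique in L.
    rewrite (Lim_seq_ext _ (fun _ => 0)) in L by (intros n; apply rsum_zero; intros; rewrite D0; ring).
    rewrite Lim_seq_const in L. apply Rbar_finite_eq in L. now symmetry.
  - replace t with (m + (t - m)) by ring. apply Hz. lra.
Qed.

(** * Analyticity of the Dirichlet series on [s > 0] *)

Lemma is_series_exp x : is_series (fun k => x ^ k / INR (fact k)) (exp x).
Proof.
  pose proof (is_exp_Reals x) as H. unfold is_pseries in H.
  eapply is_series_ext; [|exact H]. intros k.
  rewrite pow_n_pow. unfold scal; simpl. unfold mult; simpl. unfold Rdiv. reflexivity.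
Qed.

Lemma rsum_exp_le x n : 0 <= x -> rsum (fun k => x ^ k / INR (fact k)) n <= exp x.
Proof.
  intros Hx. rewrite <- (is_series_unique _ _ (is_series_exp x)). apply rsum_le_Series.
  - intros k. apply Rle_mult_inv_pos; [now apply pow_le|apply INR_fact_lt_0].
  - eexists. apply is_series_exp.
Qed.

(* Taylor coefficients at [s] of [s => x^(-s)], up to the sign [(-1)^k]. *)
Definition tcoef (s : R) (k : nat) (x : R) : R := ln x ^ k / INR (fact k) * exp (- s * ln x).

(** The mean value theorem gains a factor [1 / x] in the difference of consecutive coefficients.
    This is what carries convergence from [s > 1] to [s > 0]. *)
Lemma tcoef_step s k x : 0 < s -> 1 <= x ->
  Rabs (tcoef s k (x + 1) - tcoef s k x)
  <= exp (- (s + 1) * ln x) * (INR k * ln (x + 1) ^ pred k + s * ln (x + 1) ^ k) / INR (fact k).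
Proof.
  intros Hs Hx. pose proof (INR_fact_lt_0 k) as Hf.
  destruct (MVT_gen (tcoef s k) x (x + 1)
    (fun y => exp (- s * ln y) * / y * (INR k * ln y ^ pred k - s * ln y ^ k) / INR (fact k))) as [y [Hy E]].
  - rewrite Rmin_left, Rmax_right by lra. intros y Hy. unfold tcoef. auto_derive; [lra|]. field. split; lra.
  - rewrite Rmin_left, Rmax_right by lra. intros y Hy.
    apply continuity_pt_filterlim. apply (ex_derive_continuous (tcoef s k)).
    unfold tcoef. auto_derive. lra.
  - rewrite Rmin_left, Rmax_right in Hy by lra. rewrite E.
    replace (x + 1 - x) with 1 by ring. rewrite Rmult_1_r.
    assert (Hl0 : 0 <= ln x) by (rewrite <- ln_1; destruct Hx as [Hx|<-]; [left; apply ln_increasing; lra|lra]).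
    assert (Hl1 : ln x <= ln y) by (destruct (proj1 Hy) as [G|<-]; [left; apply ln_increasing; lra|lra]).
    assert (Hl2 : ln y <= ln (x + 1)) by (destruct (proj2 Hy) as [G| ->]; [left; apply ln_increasing; lra|lra]).
    unfold Rdiv. rewrite !Rabs_mult, (Rabs_pos_eq (/ INR (fact k))) by (left; now apply Rinv_0_lt_compat).
    apply Rmult_le_compat_r; [left; now apply Rinv_0_lt_compat|].
    rewrite <- Rabs_mult. apply Rmult_le_compat; auto using Rabs_pos.
    + rewrite Rabs_pos_eq by (left; apply Rmult_lt_0_compat; [apply exp_pos|apply Rinv_0_lt_compat; lra]).
      replace (/ y) with (exp (- ln y)) by (rewrite exp_Ropp, exp_ln by lra; reflexivity).
      rewrite <- exp_plus. apply exp_le_mono. nra.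
    + pose proof (pos_INR k).
      assert (P1 : 0 <= ln y ^ pred k <= ln (x + 1) ^ pred k) by (split; [apply pow_le; lra|apply pow_incr; lra]).
      assert (P2 : 0 <= ln y ^ k <= ln (x + 1) ^ k) by (split; [apply pow_le; lra|apply pow_incr; lra]).
      assert (INR k * ln y ^ pred k <= INR k * ln (x + 1) ^ pred k) by (apply Rmult_le_compat_l; lra).
      assert (0 <= INR k * ln y ^ pred k) by (apply Rmult_le_pos; lra).
      assert (s * ln y ^ k <= s * ln (x + 1) ^ k) by (apply Rmult_le_compat_l; lra).
      assert (0 <= s * ln y ^ k) by (apply Rmult_le_pos; lra).
      apply Rabs_le. lra.
Qed.

Definition ecoef (s : R) (n k : nat) : R :=
  (-1) ^ k * (tcoef s k (INR (S n)) - tcoef s k (INR (S (S n)))).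

Lemma tcoef_sum s h x : is_series (fun k => (-1) ^ k * tcoef s k x * h ^ k) (exp (- (s + h) * ln x)).
Proof.
  replace (exp (- (s + h) * ln x)) with (exp (- s * ln x) * exp (- h * ln x)) by (rewrite <- exp_plus; f_equal; ring).
  eapply is_series_ext; [|apply (is_series_scal (V := R_NormedModule) (exp (- s * ln x)) _ _ (is_series_exp (- h * ln x)))].
  intros k. unfold scal; simpl. unfold mult; simpl. unfold tcoef.
  rewrite Rpow_mult_distr. replace (- h) with (-1 * h) by ring. rewrite Rpow_mult_distr. unfold Rdiv. ring.
Qed.

Lemma ecoef_sum s h n : is_lim_seq (rsum (fun k => ecoef s n k * h ^ k)) (dstep (s + h) n).
Proof.
  apply is_lim_seq_ext with (fun K => rsum (fun k => (-1) ^ k * tcoef s k (INR (S n)) * h ^ k) K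
     - rsum (fun k => (-1) ^ k * tcoef s k (INR (S (S n))) * h ^ k) K).
  - intros K. rewrite <- rsum_minus. apply rsum_ext. intros k _. unfold ecoef. ring.
  - apply is_lim_seq_minus'; apply is_series_rsum; apply tcoef_sum.
Qed.

(** Summed over [k] the two parts of [tcoef_step] are exponential series with sum about [x^r]. The
    result is of order [x^(- (s + 1 - r))], summable over [n] as soon as [r < s]. *)
Lemma ecoef_bound s r n K : 0 < s -> 0 < r ->
  rsum (fun k => Rabs (ecoef s n k) * r ^ k) K <= (r + s) * exp (r * ln 2) * npow (s + 1 - r) (S n).
Proof.
  intros Hs Hr. pose proof (INR_S_ge_1 n) as Hn. set (x := INR (S n)) in *.
  set (l := ln (x + 1)).
  assert (Hl : 0 <= l) by (unfold l; rewrite <- ln_1; left; apply ln_increasing; lra).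
  apply Rle_trans with (rsum (fun k => exp (- (s + 1) * ln x) *
     (INR k * l ^ pred k / INR (fact k) * r ^ k + s * ((r * l) ^ k / INR (fact k)))) K).
  { apply rsum_le. intros k _. unfold ecoef. rewrite Rabs_mult, pow_1_abs, Rmult_1_l, Rabs_minus_sym.
    rewrite (S_INR (S n)). fold x.
    eapply Rle_trans; [apply Rmult_le_compat_r; [apply pow_le; lra|apply tcoef_step; auto]|].
    fold l. right. rewrite Rpow_mult_distr. unfold Rdiv. ring. }
  rewrite rsum_scal, rsum_plus, rsum_scal.
  assert (E1 : rsum (fun k => INR k * l ^ pred k / INR (fact k) * r ^ k) K <= r * exp (r * l)).
  { destruct K as [|K]; [simpl; apply Rmult_le_pos; [lra|left; apply exp_pos]|].
    rewrite rsum_S_l. replace (INR 0 * _ / _ * _) with 0 by (simpl INR; unfold Rdiv; ring). rewrite Rplus_0_l.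
    rewrite (rsum_ext _ (fun k => r * ((r * l) ^ k / INR (fact k)))).
    - rewrite rsum_scal. apply Rmult_le_compat_l; [lra|]. apply rsum_exp_le. apply Rmult_le_pos; lra.
    - intros k _. pose proof (INR_fact_lt_0 k). rewrite fact_simpl, mult_INR, Rpow_mult_distr. simpl pred.
      rewrite <- tech_pow_Rmult. field. split; [lra|]. pose proof (INR_S_ge_1 k). lra. }
  assert (E2 : rsum (fun k => (r * l) ^ k / INR (fact k)) K <= exp (r * l)) by (apply rsum_exp_le; apply Rmult_le_pos; lra).
  assert (E3 : exp (- (s + 1) * ln x) * exp (r * l) <= exp (r * ln 2) * npow (s + 1 - r) (S n)).
  { unfold npow. fold x. rewrite <- !exp_plus. apply exp_le_mono.
    assert (l <= ln 2 + ln x).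
    { rewrite <- ln_mult by lra. unfold l. destruct (Req_dec x 1) as [->|]; [right; f_equal; ring|].
      left. apply ln_increasing; lra. }
    nra. }
  pose proof (exp_pos (- (s + 1) * ln x)).
  apply Rle_trans with (exp (- (s + 1) * ln x) * ((r + s) * exp (r * l))).
  - apply Rmult_le_compat_l; [lra|]. nra.
  - replace (exp (- (s + 1) * ln x) * ((r + s) * exp (r * l))) with ((r + s) * (exp (- (s + 1) * ln x) * exp (r * l))) by ring.
    rewrite (Rmult_assoc (r + s)). apply Rmult_le_compat_l; lra.
Qed.

(** An exchange of the sums over [n] and [k]: for finite [K] it is linearity, and [tannery] with the
    majorant [M] lets [K] tend to infinity. *)
Lemma expansion_of_sum (e : nat -> nat -> R) (M : nat -> R) (F : nat -> R) (r h : R) :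
  Rabs h <= r -> ex_series M ->
  (forall n K, rsum (fun k => Rabs (e n k) * r ^ k) K <= M n) ->
  (forall n, is_lim_seq (rsum (fun k => e n k * h ^ k)) (F n)) ->
  (forall k, ex_series (fun n => e n k)) ->
  is_lim_seq (rsum (fun k => Series (fun n => e n k) * h ^ k)) (Series F).
Proof.
  intros Hh HM He HF Hex.
  assert (S1 : forall K, ex_series (fun n => rsum (fun k => e n k * h ^ k) K)
     /\ Series (fun n => rsum (fun k => e n k * h ^ k) K) = rsum (fun k => Series (fun n => e n k) * h ^ k) K).
  { induction K as [|K [IH1 IH2]]; cbn [rsum].
    - assert (Z : is_series (fun _ : nat => 0) 0).
      { apply is_series_rsum. apply is_lim_seq_ext with (fun _ => 0); [|apply is_lim_seq_const].
        intros n. now rewrite rsum_zero. }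
      split; [now exists 0|now apply is_series_unique].
    - assert (X1 : ex_series (fun n => e n K * h ^ K)) by now apply ex_series_scal_r.
      split.
      + exact (ex_series_plus (V := R_NormedModule) _ _ IH1 X1).
      + rewrite Series_plus, IH2, Series_scal_r; auto. }
  apply is_lim_seq_ext with (fun K => Series (fun n => rsum (fun k => e n k * h ^ k) K)).
  - intros K. apply S1.
  - apply (tannery (fun K n => rsum (fun k => e n k * h ^ k) K) F M HM); auto.
    exists 0%nat. intros K _ n. eapply Rle_trans; [apply rsum_abs|].
    eapply Rle_trans; [|apply (He n K)]. apply rsum_le. intros k _.
    rewrite Rabs_mult. apply Rmult_le_compat_l; [apply Rabs_pos|].
    rewrite <- RPow_abs. apply pow_incr. split; [apply Rabs_pos|auto].
Qed.

Lemma dirichlet_sum_analytic c B s : 0 < s -> (forall n, Rabs (rsum (fun i => c (Z.of_nat (S i))) n) <= B) ->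
  analytic_at (dirichlet_sum c) s.
Proof.
  intros Hs HB. set (A n := rsum (fun i => c (Z.of_nat (S i))) (S n)).
  assert (HA : forall n, Rabs (A n) <= B) by (intros; apply HB).
  assert (HB0 : 0 <= B) by (eapply Rle_trans; [apply Rabs_pos|apply (HB 0%nat)]).
  (* Any radius below [s] would serve; it makes the exponent [s + 1 - r] exceed 1. *)
  set (r := s / 2). assert (Hr : 0 < r < s) by (unfold r; lra).
  set (M n := B * ((r + s) * exp (r * ln 2)) * npow (s + 1 - r) (S n)).
  assert (HM : ex_series M) by (apply ex_series_scal_R, ex_series_npow; lra).
  assert (He : forall n K, rsum (fun k => Rabs (A n * ecoef s n k) * r ^ k) K <= M n).
  { intros n K. rewrite (rsum_ext _ (fun k => Rabs (A n) * (Rabs (ecoef s n k) * r ^ k))).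
    - rewrite rsum_scal. unfold M. rewrite (Rmult_assoc B). apply Rmult_le_compat; auto using Rabs_pos.
      + apply rsum_nonneg. intros k _. apply Rmult_le_pos; [apply Rabs_pos|apply pow_le; lra].
      + apply ecoef_bound; lra.
    - intros k _. rewrite Rabs_mult. ring. }
  exists r, (fun k => Series (fun n => A n * ecoef s n k)). split; [lra|]. intros h Hh.
  apply (expansion_of_sum (fun n k => A n * ecoef s n k) M (fun n => A n * dstep (s + h) n) r h); auto; [lra| |].
  - intros n. apply is_lim_seq_ext with (fun K => A n * rsum (fun k => ecoef s n k * h ^ k) K).
    + intros K. rewrite <- rsum_scal. apply rsum_ext. intros k _. ring.
    + apply (is_lim_seq_scal' _ (A n)). apply ecoef_sum.
  - intros k. apply ex_series_Rabs_le with (fun n => / r ^ k * M n); [|now apply ex_series_scal_R].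
    assert (Hk : 0 < r ^ k) by (apply pow_lt; lra).
    intros n. apply Rmult_le_reg_r with (r ^ k); auto.
    replace (/ r ^ k * M n * r ^ k) with (M n) by (field; lra).
    eapply Rle_trans; [|apply (He n (S k))]. cbn [rsum].
    assert (0 <= rsum (fun k0 => Rabs (A n * ecoef s n k0) * r ^ k0) k); [|lra].
    apply rsum_nonneg. intros i _. apply Rmult_le_pos; [apply Rabs_pos|apply pow_le; lra].
Qed.

(** * From the complex L-function to its values on the real axis *)

Lemma Re_sum_n (a : nat -> C) n : Re (sum_n a n) = rsum (fun k => Re (a k)) (S n).
Proof.
  induction n as [|n IH]; [rewrite sum_O; simpl; ring|].
  rewrite sum_Sn. change (rsum (fun k => Re (a k)) (S (S n))) with (rsum (fun k => Re (a k)) (S n) + Re (a (S n))).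
  rewrite <- IH. reflexivity.
Qed.

Lemma is_series_Re (a : nat -> C) (l : C) : @is_series C_AbsRing C_NormedModule a l ->
  is_lim_seq (rsum (fun k => Re (a k))) (Re l).
Proof.
  intros H. apply is_lim_seq_incr_1. apply is_lim_seq_ext with (fun n => Re (sum_n a n)); [intros; apply Re_sum_n|].
  intros P [e He]. apply (H (fun z => P (Re z))). exists e. intros z Hz. apply He. exact (proj1 Hz).
Qed.

Lemma pow_n_RtoC (h : R) k : pow_n (RtoC h : C_AbsRing) k = RtoC (h ^ k).
Proof.
  induction k as [|k IH]; [reflexivity|]. simpl pow_n. rewrite IH.
  change (Cmult (RtoC h) (RtoC (h ^ k)) = RtoC (h * h ^ k)). now rewrite RtoC_mult.
Qed.

(** At a real centre and real [h] the powers of [h] are real, so taking real parts acts on the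
    coefficients alone. *)
Lemma power_series_expansion (L : C -> C) (s : R) a : power_series_at L (RtoC s) a ->
  exists r, 0 < r /\ expansion (fun x => Re (L (RtoC x))) s r (fun k => Re (a k)).
Proof.
  intros [e He]. exists e. split; [apply cond_pos|]. intros h Hh.
  assert (Hb : @ball C_UniformSpace (RtoC s) e (RtoC (s + h))).
  { split; simpl.
    - change (Rabs (s + h - s) < e). now replace (s + h - s) with h by ring.
    - change (Rabs (0 - 0) < e). rewrite Rminus_0_r, Rabs_R0. apply cond_pos. }
  specialize (He _ Hb). unfold is_pseries in He.
  apply is_series_Re in He. eapply is_lim_seq_ext; [|exact He].
  intros n. apply rsum_ext. intros k _.
  replace (RtoC (s + h) - RtoC s)%C with (RtoC h) by (rewrite <- RtoC_minus; f_equal; ring).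
  rewrite pow_n_RtoC. change (Re (Cmult (RtoC (h ^ k)) (a k)) = Re (a k) * h ^ k).
  destruct (a k) as [x y]. simpl. eqR. ring.
Qed.

Lemma nat_Cpower_real n (s : R) : nat_Cpower n (- RtoC s)%C = RtoC (npow s n).
Proof.
  unfold nat_Cpower, Cexp, npow, RtoC. simpl.
  replace (- s * ln (INR n) - -0 * 0) with (- s * ln (INR n)) by ring.
  replace (- s * 0 + - 0 * ln (INR n)) with 0 by ring.
  rewrite cos_0, sin_0. f_equal; ring.
Qed.

Lemma real_part_character (q : Z) chi : (1 <= q)%Z -> dirichlet_character q chi -> real_valued chi ->
  real_character (Z.to_nat q) (fun n => Re (chi n)).
Proof.
  intros Hq [Hp Hm Hs] Hr.
  assert (E : forall n, chi n = RtoC (Re (chi n))).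
  { intros n. specialize (Hr n). destruct (chi n) as [x y]. simpl in *. now rewrite Hr. }
  constructor.
  - intros n. rewrite Z2Nat.id by lia. now rewrite Hp.
  - intros m n. rewrite Hm. rewrite (E m), (E n). simpl. ring.
  - intros n. rewrite Z2Nat.id by lia. rewrite <- Hs. rewrite (E n) at 2.
    split; intros H G; apply H; [now apply RtoC_inj|now rewrite G].
Qed.

Lemma real_part_nonprincipal (q : Z) chi : (1 <= q)%Z -> real_valued chi -> ~ principal q chi ->
  nonprincipal (Z.to_nat q) (fun n => Re (chi n)).
Proof.
  intros Hq Hr Hn. apply not_all_ex_not in Hn. destruct Hn as [a Ha]. apply imply_to_and in Ha.
  destruct Ha as [H1 H2]. exists a. rewrite Z2Nat.id by lia. split; auto.
  intros E. apply H2. specialize (Hr a). destruct (chi a) as [x y]. simpl in *. now subst.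
Qed.

(** The definition of [L] gives the series only for [Re s > 1]. Both functions are analytic on the
    half line [s > 0], and the identity principle carries the equality down to 0. *)
Lemma L_eq_dirichlet_sum (q : Z) chi L s : (3 <= q)%Z -> dirichlet_character q chi -> real_valued chi ->
  ~ principal q chi -> is_dirichlet_L chi L -> 0 < s ->
  Re (L (RtoC s)) = dirichlet_sum (fun n => Re (chi n)) s.
Proof.
  intros Hq Hc Hr Hn [Hent Hser] Hs.
  pose proof (real_part_character q chi ltac:(lia) Hc Hr) as HX.
  pose proof (real_part_nonprincipal q chi ltac:(lia) Hr Hn) as HN.
  pose proof (fun n => rc_partial_bound (Z.to_nat q) _ n ltac:(lia) HX HN) as HB.
  apply Rminus_diag_uniq.
  apply (identity_principle (fun s => Re (L (RtoC s)) - dirichlet_sum (fun n => Re (chi n)) s)); auto.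
  - intros t Ht. apply analytic_minus; [|now apply (dirichlet_sum_analytic _ _ _ Ht HB)].
    destruct (Hent (RtoC t)) as [a Ha]. apply power_series_expansion in Ha. destruct Ha as [r [Hr0 Ha]].
    now exists r, (fun k => Re (a k)).
  - intros t Ht. apply Rminus_diag_eq.
    pose proof (is_series_Re _ _ (Hser (RtoC t) Ht)) as L1.
    pose proof (dirichlet_sum_lim _ _ t ltac:(lra) HB) as L2.
    apply is_lim_seq_unique in L1. apply is_lim_seq_unique in L2.
    rewrite (Lim_seq_ext _ (rsum (dterm (fun n => Re (chi n)) t))) in L1.
    + rewrite L1 in L2. now apply Rbar_finite_eq in L2.
    + intros n. apply rsum_ext. intros k _. rewrite nat_Cpower_real. unfold dterm, npow.
      destruct (chi (Z.of_nat (S k))) as [x y]. simpl. ring.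
Qed.

(** Multiplicity at least 2 means that the first two coefficients vanish, so the remainder bound of
    order 2 is the quadratic bound required by [two_zeros]. *)
Lemma two_real_zeros_dirichlet_sum (q : Z) chi L b1 b2 : (3 <= q)%Z -> dirichlet_character q chi -> real_valued chi ->
  ~ principal q chi -> is_dirichlet_L chi L -> 0 < b1 -> 0 < b2 ->
  two_real_zeros L b1 b2 -> two_zeros (dirichlet_sum (fun n => Re (chi n))) b1 b2.
Proof.
  intros Hq Hc Hr Hn HL H1 H2 [Z1 [Z2 HZ]].
  pose proof (fun s => L_eq_dirichlet_sum q chi L s Hq Hc Hr Hn HL) as E.
  split; [rewrite <- E, Z1 by auto; reflexivity|]. split; [rewrite <- E, Z2 by auto; reflexivity|].
  destruct HZ as [HZ|[Hb [a [Ha Ha0]]]]; [now left|right]. split; auto.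
  apply power_series_expansion in Ha. destruct Ha as [r [Hr0 Ha]].
  destruct (expansion_remainder _ _ _ _ 2 Hr0 Ha) as [C [rho [Hrho [_ [_ HC]]]]].
  (* The cap [b1] keeps [b1 + h] positive, where [L] and [dirichlet_sum] agree. *)
  exists C, (Rmin rho b1). split; [now apply Rmin_glb_lt|]. intros h Hh.
  assert (Hh1 : Rabs h < rho) by (eapply Rlt_le_trans; [exact Hh|apply Rmin_l]).
  assert (Hh2 : Rabs h < b1) by (eapply Rlt_le_trans; [exact Hh|apply Rmin_r]).
  specialize (HC h Hh1). apply Rabs_def2 in Hh2. rewrite E in HC by lra.
  cbn [rsum] in HC. rewrite !Ha0 in HC by lia. simpl Re in HC. rewrite !Rmult_0_l, !Rplus_0_r, Rminus_0_r in HC.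
  rewrite RPow_abs, (Rabs_pos_eq (h ^ 2)) in HC by apply pow2_ge_0. exact HC.
Qed.

Theorem theorem2 (q : Z) (hq : (3 <= q)%Z)
    (chi : Z -> C) (hchi : dirichlet_character q chi)
    (hreal : real_valued chi) (hnonprincipal : ~ principal q chi)
    (L : C -> C) (hL : is_dirichlet_L chi L) :
  (forall b1 b2 : R, two_real_zeros L b1 b2 ->
     Rmin b1 b2 <= 1 - 1.011 / ln (IZR q))
  /\
  (forall b1 b2 : R,
     1 - 1.011 / ln (IZR q) < b1 < 1 ->
     1 - 1.011 / ln (IZR q) < b2 < 1 ->
     ~ two_real_zeros L b1 b2).
Proof.
  (* Stated without [< 1], because the first claim of the theorem puts no upper bound on the
     zeros. *)
  assert (main : forall b1 b2, 1 - 1.011 / ln (IZR q) < b1 -> 1 - 1.011 / ln (IZR q) < b2 ->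
    ~ two_real_zeros L b1 b2).
  { intros b1 b2 H1 H2 HZ. pose proof (threshold_pos (IZR q) (IZR_le 3 q hq)) as HT.
    apply (two_real_zeros_dirichlet_sum q chi) in HZ; auto; try lra.
    assert (Eq : IZR q = INR (Z.to_nat q)) by (rewrite INR_IZR_INZ, Z2Nat.id by lia; reflexivity).
    rewrite Eq in H1, H2.
    apply (character_at_most_one_zero (Z.to_nat q) (fun n => Re (chi n)) b1 b2); auto; try lia.
    - apply real_part_character; auto; lia.
    - apply real_part_nonprincipal; auto; lia. }
  split.
  - intros b1 b2 HZ. destruct (Rle_lt_dec (Rmin b1 b2) (1 - 1.011 / ln (IZR q))) as [H|H]; auto. exfalso.
    apply (main b1 b2); auto; eapply Rlt_le_trans; [exact H|apply Rmin_l|exact H|apply Rmin_r].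
  - intros b1 b2 H1 H2. now apply main.
Qed.
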